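(* Let $X$ be a complex Banach space, let $d\ge1$, let $\big((T^1_t)_{t\ge0},\ldots,(T^d_t)_{t\ge0}\big)$ be a $d$-tuple of commuting bounded analytic semigroups on $X$, and let $A_1,\ldots,A_d$ denote their negative generators. Assume that each $A_k$ is $R$-sectorial of $R$-type $\omega_k<\frac\pi2$. Assume further that there exist a Banach space $Y$, two bounded operators $J:X\to Y$ and $Q:Y\to X$, as well as a $d$-tuple $\big((U^1_t)_{t\in\mathbb R},\ldots,(U^d_t)_{t\in\mathbb R}\big)$ of commuting bounded $C_0$-groups on $Y$ such that: (a) The $d$-tuple $(B_1,\ldots,B_d)$, where $B_k$ is the negative generator of $(U^k_t)_t$ for all $k=1,\ldots,d$, admits an $H^\infty(\Sigma_{\theta_1}\times\cdots\times\Sigma_{\theta_d})$ joint functional calculus, for some $\theta_k\in[\frac\pi2,\pi)$; (b) For any $t_1,\ldots,t_d$ in $\mathbb R_+$, we have $T^1_{t_1}\cdots T^d_{t_d}=Q\,U^1_{t_1}\cdots U^d_{t_d}\,J$. Then $(A_1,\ldots,A_d)$ admits an $H^\infty(\Sigma_{\theta'_1}\times\cdots\times\Sigma_{\theta'_d})$ joint functional calculus, for all $\theta'_k\in(\omega_k,\frac\pi2)$, $k=1,\ldots,d$.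
   Context: The negative generator of a $C_0$-semigroup is $A$ where $-A$ is its generator. Sectors and sectorial operators. For $\theta\in(0,\pi)$, $\Sigma_\theta=\{z\in\mathbb{C}\setminus\{0\}: |\mathrm{Arg}(z)|<\theta\}$. $R(z,A)=(zI-A)^{-1}$. A closed densely defined operator $A$ is sectorial of type $\omega\in(0,\pi)$ if $\sigma(A)\subset\overline{\Sigma_\omega}$ and for every $\theta\in(\omega,\pi)$ there is $C_\theta$ with $\|zR(z,A)\|\le C_\theta$ for all $z\in\mathbb{C}\setminus\overline{\Sigma_\theta}$. The negative generator of a bounded $C_0$-semigroup is sectorial of type $\frac\pi2$; it is sectorial of type $<\frac\pi2$ if and only if the semigroup is bounded analytic. Sectorial operators commute if their resolvents commute (equivalently, for negative generators, the semigroups commute). $R$-sectoriality. Let $(r_j)_{j\ge1}$ be independent Rademacher variables on a probability space $(\mathcal S,\mathbb P)$ and $\|\sum_j r_j\otimes x_j\|_{\mathrm{Rad}(X)}=(\int_{\mathcal S}\|\sum_j r_j(t)x_j\|_X^2\,d\mathbb P(t))^{1/2}$. A set $\mathcal F\subset B(X)$ is $R$-bounded if there is $K\ge0$ such that $\|\sum_j r_j\otimes T_jx_j\|_{\mathrm{Rad}(X)}\le K\|\sum_j r_j\otimes x_j\|_{\mathrm{Rad}(X)}$ for all finitely supported sequences $(T_j)$ in $\mathcal F$ and $(x_j)$ in $X$. A sectorial operator $A$ is $R$-sectorial of $R$-type $\omega\in(0,\pi)$ if $\sigma(A)\subset\overline{\Sigma_\omega}$ and for every $\theta\in(\omega,\pi)$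 the set $\{zR(z,A): z\in\mathbb{C}\setminus\overline{\Sigma_\theta}\}$ is $R$-bounded. Joint functional calculus. Let $(A_1,\ldots,A_d)$ be commuting sectorial operators of types $\omega_1,\ldots,\omega_d$ on a Banach space, and let $\theta_k\in(\omega_k,\pi)$. For $\Lambda\subset\{1,\ldots,d\}$, $H_0^\infty(\prod_{k\in\Lambda}\Sigma_{\theta_k})$ is the algebra of bounded holomorphic $f:\Sigma_{\theta_1}\times\cdots\times\Sigma_{\theta_d}\to\mathbb C$ depending only on the variables $(z_k)_{k\in\Lambda}$ such that there are $C\ge0$ and $s_k>0$ ($k\in\Lambda$) with $|f(z_1,\ldots,z_d)|\le C\prod_{k\in\Lambda}\frac{|z_k|^{s_k}}{(1+|z_k|)^{2s_k}}$ (for $\Lambda=\emptyset$: constant functions). For $\Lambda\neq\emptyset$ and such $f$, with $\nu_k\in(\omega_k,\theta_k)$, $$f(A_1,\ldots,A_d)=\Big(\frac1{2\pi i}\Big)^{|\Lambda|}\int_{\prod_{k\in\Lambda}\partial\Sigma_{\nu_k}}f(z_1,\ldots,z_d)\prod_{k\in\Lambda}R(z_k,A_k)\prod_{k\in\Lambda}dz_k,$$ the boundaries being oriented counterclockwise (independent of the $\nu_k$); for $f\equiv a$ constant, $f(A_1,\ldots,A_d)=aI$. Set $H_{0,1}^\infty(\Sigma_{\theta_1}\times\cdots\times\Sigma_{\theta_d})=\bigoplus_{\Lambda}H_0^\infty(\prod_{k\in\Lambda}\Sigma_{\theta_k})$ (the sum is direct) and extend $f\mapsto f(A_1,\ldots,A_d)$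 linearly. $(A_1,\ldots,A_d)$ admits an $H^\infty(\Sigma_{\theta_1}\times\cdots\times\Sigma_{\theta_d})$ joint functional calculus if there is $K>0$ with $$( * )\quad\|f(A_1,\ldots,A_d)\|\le K\sup_{\Sigma_{\theta_1}\times\cdots\times\Sigma_{\theta_d}}|f|\quad\text{for all } f\in H_{0,1}^\infty(\Sigma_{\theta_1}\times\cdots\times\Sigma_{\theta_d}).$$ Limit case: $(A_1,\ldots,A_d)$ admits an $H^\infty(\Sigma_{\omega_1}\times\cdots\times\Sigma_{\omega_d})$ joint functional calculus if it admits an $H^\infty(\Sigma_{\theta_1}\times\cdots\times\Sigma_{\theta_d})$ joint functional calculus for all $\theta_k\in(\omega_k,\pi)$, with one constant $K$ for which $( * )$ holds for all $\theta_k\in(\omega_k,\pi)$. The $B_k$ are regarded as sectorial of type $\frac\pi2$; if in (a) some (not necessarily all) $\theta_k$ equal $\frac\pi2$, the property is understood in the same way: those $\theta_k$ may be replaced by arbitrary angles in $(\frac\pi2,\pi)$, with a constant $K$ uniform in these angles. *)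

(* Defs.v *)
(* R : realType is the field of real numbers, R[i] that of complex numbers. *)
From HB Require Import structures.
From mathcomp Require Import all_boot all_order all_algebra.
From mathcomp Require Import all_classical all_reals all_analysis.
From mathcomp Require Import complex.

Set Implicit Arguments.
Unset Strict Implicit.
Unset Printing Implicit Defensive.

Import Order.TTheory GRing.Theory Num.Theory.
Import numFieldNormedType.Exports.

Local Open Scope classical_set_scope.
Local Open Scope ring_scope.
Local Open Scope complex_scope.

Section Sectors.
Context {R : realType}.

(* The norm of a normed module over R[i] takes its values in R[i]; rnorm is the
   same norm, with values in R. *)
Definition rnorm {V : normedZmodType R[i]} (x : V) : R := complex.Re `|x|.

Definition Arg (z : R[i]) : R :=
  let a := acos (complex.Re z / rnorm z) in
  if 0 <= complex.Im z then a else - a.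

Definition sector (theta : R) : set R[i]^o :=
  [set z | z != 0 /\ `|Arg z| < theta].

Definition cis (a : R) : R[i] := cos a +i* sin a.

(* The boundary of the sector of half-angle nu, oriented counterclockwise: t
   runs over the real line, t < 0 comes in from infinity along the upper ray and
   t >= 0 goes out along the lower ray. *)
Definition bdpath (nu t : R) : R[i] :=
  `|t|%:C * cis (if t < 0 then nu else - nu).

Definition bdpath' (nu t : R) : R[i] :=
  if t < 0 then - cis nu else cis (- nu).

End Sectors.

Section BochnerIntegral.
Context {R : realType} {d : measure_display} {T : measurableType d}.
Context {V : normedModType R[i]}.
Variable mu : {measure set T -> \bar R}.

Definition integrable_simple (s : T -> V) :=
  [/\ finite_set (range s),
      forall v, measurable (s @^-1` [set v]) &
      forall v, v != 0 -> (mu (s @^-1` [set v]) < +oo)%E].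

Definition simple_integral (s : T -> V) : V :=
  \sum_(v \in range s) (fine (mu (s @^-1` [set v])))%:C *: v.

Definition is_bochner_integral (F : T -> V) (y : V) :=
  exists s : nat -> T -> V,
    [/\ forall n, integrable_simple (s n),
        {ae mu, forall t, s n t @[n --> \oo] --> F t},
        (\int[mu]_t (rnorm (F t - s n t))%:E)%E @[n --> \oo] --> 0%E &
        simple_integral (s n) @[n --> \oo] --> y].

Definition bochner_integral (F : T -> V) : V :=
  xget 0 [set y | is_bochner_integral F y].

End BochnerIntegral.

Section Operators.
Context {R : realType} {X : normedModType R[i]}.

(* Unbounded operators are represented by their graphs. *)
Definition closed_densely_defined (A : set (X * X)) :=
  [/\ A 0 /\ (forall (a : R[i]) p q, A p -> A q -> A (a *: p + q)),
      forall y, A (0, y) -> y = 0,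
      closed A &
      dense [set x | exists y, A (x, y)]].

Definition resolvent_set (A : set (X * X)) : set R[i]^o :=
  [set z | exists S : {linear X -> X},
    [/\ continuous S,
        forall v, A (S v, z *: S v - v) &
        forall x y, A (x, y) -> S (z *: x - y) = x]].

Definition spectrum (A : set (X * X)) : set R[i]^o := ~` resolvent_set A.

(* R(z, A) v is the x in the domain of A with z x - A x = v. *)
Definition resolvent (A : set (X * X)) (z : R[i]) (v : X) : X :=
  xget 0 [set x | A (x, z *: x - v)].

Definition sectorial_of_type (omega : R) (A : set (X * X)) :=
  [/\ 0 < omega < pi,
      closed_densely_defined A,
      spectrum A `<=` closure (sector omega) &
      forall theta, omega < theta < pi ->
        exists C : R, forall z, ~ closure (sector theta) z ->
          forall x, rnorm (z *: resolvent A z x) <= C * rnorm x].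

Definition sectorial (A : set (X * X)) :=
  exists omega, sectorial_of_type omega A.

End Operators.

Section RSectorial.
Context {R : realType} {dS : measure_display} {S : measurableType dS}.
Variable P : probability S R.

Definition independent_rademacher (r : nat -> {RV P >-> R}) :=
  (forall j, P (r j @^-1` [set 1]) = (2^-1)%:E /\
             P (r j @^-1` [set -1]) = (2^-1)%:E) /\
  (forall (J : seq nat) (B : nat -> set R), uniq J ->
     (forall j, measurable (B j)) ->
     P (\bigcap_(j in [set` J]) (r j @^-1` B j)) =
     (\prod_(j <- J) P (r j @^-1` B j))%E).

Context {X : normedModType R[i]}.
Variable r : nat -> {RV P >-> R}.

Definition rad_norm (n : nat) (x : nat -> X) : R :=
  Num.sqrt (fine
    (\int[P]_t ((rnorm (\sum_(j < n) (r j t)%:C *: x j)) ^+ 2)%:E)%E).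

Definition R_bounded (F : set (X -> X)) :=
  exists K : R, 0 <= K /\
    forall (n : nat) (T : nat -> X -> X) (x : nat -> X),
      (forall j, (j < n)%N -> F (T j)) ->
      rad_norm n (fun j => T j (x j)) <= K * rad_norm n x.

Definition R_sectorial_of_type (omega : R) (A : set (X * X)) :=
  [/\ 0 < omega < pi,
      sectorial A,
      spectrum A `<=` closure (sector omega) &
      forall theta, omega < theta < pi ->
        R_bounded [set T | exists2 z, ~ closure (sector theta) z &
                                      T = fun x => z *: resolvent A z x]].

End RSectorial.

Section Semigroups.
Context {R : realType} {X : normedModType R[i]}.

(* Only the values at nonnegative times matter for a semigroup. *)
Definition C0_semigroup (T : R -> {linear X -> X}) :=
  [/\ forall t, 0 <= t -> continuous (T t),
      forall x, T 0 x = x,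
      forall s t x, 0 <= s -> 0 <= t -> T (s + t) x = T s (T t x) &
      forall x, T t x @[t --> 0^'+] --> x].

Definition bounded_C0_semigroup (T : R -> {linear X -> X}) :=
  C0_semigroup T /\
  exists M : R, forall t x, 0 <= t -> rnorm (T t x) <= M * rnorm x.

(* Holomorphy of an operator-valued function is stated pointwise (strongly),
   which for locally bounded families agrees with norm holomorphy. *)
Definition bounded_analytic_semigroup (T : R -> {linear X -> X}) :=
  bounded_C0_semigroup T /\
  exists (alpha : R) (S : R[i]^o -> {linear X -> X}),
    [/\ 0 < alpha < pi / 2,
        forall t x, 0 < t -> S t%:C x = T t x,
        forall x z, sector alpha z -> derivable (fun w => S w x) z 1 &
        exists M : R, forall z x, sector alpha z ->
          rnorm (S z x) <= M * rnorm x].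

Definition bounded_C0_group (U : R -> {linear X -> X}) :=
  [/\ forall t, continuous (U t),
      forall x, U 0 x = x,
      forall s t x, U (s + t) x = U s (U t x),
      forall x, U t x @[t --> 0] --> x &
      exists M : R, forall t x, rnorm (U t x) <= M * rnorm x].

Definition neg_generator (T : R -> {linear X -> X}) : set (X * X) :=
  [set p | (t^-1)%:C *: (p.1 - T t p.1) @[t --> 0^'+] --> p.2].

Definition commuting_semigroups d (T : 'I_d -> R -> {linear X -> X}) :=
  forall i j s t x, 0 <= s -> 0 <= t -> T i s (T j t x) = T j t (T i s x).

Definition commuting_groups d (U : 'I_d -> R -> {linear X -> X}) :=
  forall i j s t x, U i s (U j t x) = U j t (U i s x).

End Semigroups.

Section JointFunctionalCalculus.
Context {R : realType} {d : nat}.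

Definition polysector (theta : 'I_d -> R) : set 'rV[R[i]^o]_d :=
  [set z | forall k, sector (theta k) (z 0 k)].

(* f is a total function, only its values on the polysector matter. For
   Lambda = set0 this is the space of constant functions. *)
Definition Hinf0 (theta : 'I_d -> R) (Lambda : {set 'I_d})
    (f : 'rV[R[i]^o]_d -> R[i]^o) :=
  [/\ forall z, polysector theta z -> differentiable f z,
      exists M : R, forall z, polysector theta z -> rnorm (f z) <= M,
      forall z w, polysector theta z -> polysector theta w ->
        (forall k, k \in Lambda -> z 0 k = w 0 k) -> f z = f w &
      exists (C : R) (s : 'I_d -> R),
        [/\ 0 <= C,
            forall k, k \in Lambda -> 0 < s k &
            forall z, polysector theta z ->
              rnorm (f z) <= C * \prod_(k in Lambda)
                (rnorm (z 0 k) `^ s k / (1 + rnorm (z 0 k)) `^ (2 * s k))]].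

(* f is in the direct sum of the Hinf0 spaces, with components F. *)
Definition Hinf01 (theta : 'I_d -> R) (f : 'rV[R[i]^o]_d -> R[i]^o)
    (F : {set 'I_d} -> 'rV[R[i]^o]_d -> R[i]^o) :=
  (forall Lambda, Hinf0 theta Lambda (F Lambda)) /\
  (forall z, polysector theta z -> f z = \sum_(Lambda : {set 'I_d}) F Lambda z).

Definition supnorm (theta : 'I_d -> R) (f : 'rV[R[i]^o]_d -> R[i]^o) : R :=
  sup [set rnorm (f z) | z in polysector theta].

Context {X : normedModType R[i]}.

Definition compose_all (P : pred 'I_d) (F : 'I_d -> X -> X) : X -> X :=
  \big[comp/id]_(k < d | P k) F k.

Definition contour_integral (nu : R) (F : R[i]^o -> X) : X :=
  bochner_integral lebesgue_measure
    (fun t : R => bdpath' nu t *: F (bdpath nu t)).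

Definition set_coord (z : 'rV[R[i]^o]_d) (k : 'I_d) (w : R[i]^o) :
    'rV[R[i]^o]_d := \row_j (if j == k then w else z 0 j).

(* The integral over the product of the sector boundaries indexed by ks, as an
   iterated integral; the coordinates outside ks are those of z. *)
Fixpoint multi_contour_integral (nu : 'I_d -> R) (ks : seq 'I_d)
    (F : 'rV[R[i]^o]_d -> X) (z : 'rV[R[i]^o]_d) : X :=
  if ks is k :: ks' then
    contour_integral (nu k)
      (fun w => multi_contour_integral nu ks' F (set_coord z k w))
  else F z.

(* The value at x of f(A_1, ..., A_d), for f in Hinf0 theta Lambda. Since f
   does not depend on the coordinates outside Lambda, these are set to 1. For
   Lambda = set0 and f constant equal to a, this is a x. *)
Definition fcalc (A : 'I_d -> set (X * X)) (nu : 'I_d -> R)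
    (Lambda : {set 'I_d}) (f : 'rV[R[i]^o]_d -> R[i]^o) (x : X) : X :=
  ((2 * pi)%:C * 'i)^-1 ^+ #|Lambda| *:
  multi_contour_integral nu (enum Lambda)
    (fun z => f z *:
       compose_all (mem Lambda) (fun k => resolvent (A k) (z 0 k)) x)
    (const_mx 1).

(* The estimate ||f(A_1, ..., A_d)|| <= K sup |f|, for operators A_k of types
   omega k. *)
Definition Hinf_estimate (A : 'I_d -> set (X * X)) (omega theta : 'I_d -> R)
    (K : R) :=
  forall f F nu, Hinf01 theta f F -> (forall k, omega k < nu k < theta k) ->
    forall x,
      rnorm (\sum_(Lambda : {set 'I_d}) fcalc A nu Lambda (F Lambda) x)
        <= K * supnorm theta f * rnorm x.

Definition admits_Hinf (A : 'I_d -> set (X * X)) (omega theta : 'I_d -> R) :=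
  exists K : R, 0 < K /\ Hinf_estimate A omega theta K.

(* The limit case: each angle theta k equal to omega k is replaced by an
   arbitrary angle in ]omega k, pi[, with a constant K uniform in these angles;
   the angles theta k > omega k are kept. *)
Definition admits_Hinf_limit (A : 'I_d -> set (X * X))
    (omega theta : 'I_d -> R) :=
  exists K : R, 0 < K /\
    forall eta : 'I_d -> R,
      (forall k, theta k = omega k -> omega k < eta k < pi) ->
      (forall k, omega k < theta k -> eta k = theta k) ->
      Hinf_estimate A omega eta K.

End JointFunctionalCalculus.

(* Main.v *)
Require Import Defs.
From HB Require Import structures.
From mathcomp Require Import all_boot all_order all_algebra finmap.
From mathcomp Require Import all_classical all_reals all_analysis measurable_realfun.
From mathcomp Require Import complex.
From mathcomp Require Import ring lra.

Set Implicit Arguments.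
Unset Strict Implicit.
Unset Printing Implicit Defensive.

Import Order.TTheory GRing.Theory Num.Theory.
Import numFieldNormedType.Exports.
Local Open Scope classical_set_scope.
Local Open Scope ring_scope.
Local Open Scope complex_scope.

(* Write q = - z R(- z, A_k) for the scaled resolvent at the opposite point.  Along a contour
   close to the boundary of the sector, the resolvent z R(z, A_k) may be replaced by
   16 z R(z, A_k) (q - q^2)^2, because the difference is a polynomial in q, holomorphic on the
   sector; and this kernel factors as S_u M_u S_u with u = ln |z|, where S_u = p - p^2 for
   p = - e^u R(- e^u, A_k) and the operators M_u form an R-bounded family.  Replacing the integral
   with respect to dz / z by sums over the shells ln |z| = t + j, j an integer, gives sums
   sum_j f(z_j) S_j M_j S_j x, which by averaging over signs are controlled by the R-bound of
   (M_j) as soon as |sum_j c_j S_j x| <= K sup |c_j| |x|.  The operators S_j are compressions by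
   Q and J of the corresponding operators for the groups (through Laplace transforms), and these
   are phi(B_1, ..., B_d) for products phi of the functions z / r / (1 + z / r)^2; the sums
   sum_j |phi(z / e^j)| are bounded on sectors, so that the joint functional calculus of
   (B_1, ..., B_d) yields the estimate. *)

(** The contours for the [A_k] lie in the right half-plane, those for the generators [B_k] of the
    groups in the left half-plane. No contour is common to both, and the dilation transfers only
    operators built from the semigroups at nonnegative times, such as resolvents in the left
    half-plane, never the resolvents met along the contours of the [A_k]. This is why the outer
    factors [S_u] are built from resolvents at negative real points. On scalars, with q = z / (z +
    a), the function z R(z, a) = z / (z - a) is singular only at a = z, where q = 1/2 and 16 (q -
    q^2)^2 = 1: hence the factor 16 and the holomorphy of the difference. What depends on the angle
    of z is left in [M_u], and R-sectoriality is used for this factor. The sums over shells have to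
    be estimated as a whole, as the norms of the single terms need not be summable uniformly in f.
    The calculus is estimated on each space [Hinf0] separately, which requires bounding the
    components of f by sup |f|. Vector integrals are reduced to real ones by norming real-linear
    functionals. *)

(** * Real-valued norms and convergence *)

Section RNorm.
Context {R : realType}.

Lemma real_complexD (a b : R) : (a + b)%:C = a%:C + b%:C :> R[i].
Proof. exact: (rmorphD (real_complex R)). Qed.

Lemma real_complexM (a b : R) : (a * b)%:C = a%:C * b%:C :> R[i].
Proof. exact: (rmorphM (real_complex R)). Qed.

Lemma real_complex1 : 1%:C = 1 :> R[i]. Proof. by []. Qed.

Lemma real_complexN (a : R) : (- a)%:C = - a%:C :> R[i].
Proof. exact: (rmorphN (real_complex R)). Qed.

Lemma real_complexB (a b : R) : (a - b)%:C = a%:C - b%:C :> R[i].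
Proof. exact: (rmorphB (real_complex R)). Qed.

Lemma real_complexV (a : R) : (a^-1)%:C = (a%:C)^-1 :> R[i].
Proof. exact: (fmorphV (real_complex R)). Qed.

Lemma real_complexX (a : R) n : (a ^+ n)%:C = a%:C ^+ n :> R[i].
Proof. exact: (rmorphXn (real_complex R)). Qed.

Lemma normE_rnorm (V : normedZmodType R[i]) (x : V) : `|x| = (rnorm x)%:C.
Proof.
have : 0 <= `|x| by [].
by rewrite lecE => /andP[/eqP im _]; rewrite /rnorm; case: (`|x|) im => a b /= ->.
Qed.

Lemma rnorm_ge0 (V : normedZmodType R[i]) (x : V) : 0 <= rnorm x.
Proof. by rewrite -ler0c -normE_rnorm. Qed.

Lemma ler_rnormD (V : normedZmodType R[i]) (x y : V) :
  rnorm (x + y) <= rnorm x + rnorm y.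
Proof. by rewrite -lecR real_complexD -!normE_rnorm ler_normD. Qed.

Lemma rnorm0 (V : normedZmodType R[i]) : rnorm (0 : V) = 0.
Proof. by rewrite /rnorm normr0. Qed.

Lemma rnormN (V : normedZmodType R[i]) (x : V) : rnorm (- x) = rnorm x.
Proof. by rewrite /rnorm normrN. Qed.

Lemma rnormC (V : normedZmodType R[i]) (x y : V) : rnorm (x - y) = rnorm (y - x).
Proof. by rewrite -rnormN opprB. Qed.

Lemma ler_rnormB (V : normedZmodType R[i]) (x y : V) :
  rnorm (x - y) <= rnorm x + rnorm y.
Proof. by rewrite -(rnormN y) ler_rnormD. Qed.

Lemma ler_rnorm_sub (V : normedZmodType R[i]) (x y : V) :
  rnorm x - rnorm y <= rnorm (x - y).
Proof. by rewrite lerBlDr -{1}(subrK y x) ler_rnormD. Qed.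

Lemma ler_dist_rnorm (V : normedZmodType R[i]) (x y : V) :
  `|rnorm x - rnorm y| <= rnorm (x - y).
Proof.
rewrite ler_norml ler_rnorm_sub andbT lerNl opprB (le_trans (ler_rnorm_sub _ _))//.
by rewrite rnormC.
Qed.

Lemma rnorm_eq0 (V : normedZmodType R[i]) (x : V) : (rnorm x == 0) = (x == 0).
Proof. by rewrite -(normr_eq0 x) normE_rnorm -(inj_eq (@complexI R)). Qed.

Lemma ler_rnorm_sum (V : normedZmodType R[i]) (I : Type) (r : seq I) (P : pred I)
    (F : I -> V) :
  rnorm (\sum_(i <- r | P i) F i) <= \sum_(i <- r | P i) rnorm (F i).
Proof.
elim/big_ind2: _ => [|x a y b xa yb|//]; first by rewrite rnorm0.
by rewrite (le_trans (ler_rnormD _ _))// lerD.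
Qed.

Lemma rnormZ (V : normedModType R[i]) (a : R[i]) (x : V) :
  rnorm (a *: x) = rnorm a * rnorm x.
Proof.
by apply: complexI; rewrite real_complexM -!normE_rnorm normrZ.
Qed.

Lemma rnormM (a b : R[i]) : rnorm (a * b) = rnorm a * rnorm b.
Proof. by apply: complexI; rewrite real_complexM -!normE_rnorm normrM. Qed.

Lemma rnormV (a : R[i]) : rnorm a^-1 = (rnorm a)^-1.
Proof. by apply: complexI; rewrite real_complexV -!normE_rnorm normfV. Qed.

Lemma rnormX (a : R[i]) n : rnorm (a ^+ n) = rnorm a ^+ n.
Proof. by apply: complexI; rewrite real_complexX -!normE_rnorm normrX. Qed.

Lemma rnorm_real (a : R) : rnorm (a%:C) = `|a|.
Proof. by rewrite /rnorm normc_def /= expr0n addr0 sqrtr_sqr. Qed.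

Lemma rnorm1 : rnorm (1 : R[i]) = 1.
Proof. by rewrite (rnorm_real 1) normr1. Qed.

Lemma rnormi : rnorm ('i : R[i]) = 1.
Proof. by rewrite /rnorm normc_def /= expr0n add0r expr1n sqrtr1. Qed.

Lemma rnormZr (V : normedModType R[i]) (a : R) (x : V) :
  rnorm (a%:C *: x) = `|a| * rnorm x.
Proof. by rewrite rnormZ rnorm_real. Qed.

Lemma ler_Re_rnorm (z : R[i]) : `|complex.Re z| <= rnorm z.
Proof. by rewrite -lecR -normE_rnorm normc_ge_Re. Qed.

Lemma rnorm_le_ReIm (z : R[i]) : rnorm z <= `|complex.Re z| + `|complex.Im z|.
Proof.
rewrite {1}(complexE z) (le_trans (ler_rnormD _ _))// rnormM rnormi mul1r.
by rewrite !rnorm_real.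
Qed.

Lemma scale_realD (V : lmodType R[i]) (a b : R) (x : V) :
  (a + b)%:C *: x = a%:C *: x + b%:C *: x.
Proof. by rewrite real_complexD scalerDl. Qed.

Lemma scale_realN1 (V : lmodType R[i]) (x : V) : (-1)%:C *: x = - x.
Proof. by rewrite real_complexN scaleNr scale1r. Qed.

Lemma scale_realM (V : lmodType R[i]) (a b : R) (x : V) :
  (a * b)%:C *: x = a%:C *: (b%:C *: x).
Proof. by rewrite real_complexM scalerA. Qed.

(** A positive element of [R[i]] is a positive real number, so balls with radius in [R[i]] are balls
    with radius in [R]. This is the bridge from the library notion of convergence to real
    epsilons. *)
Lemma cvg_rnormP (V : normedModType R[i]) (T : Type) (F : set_system T)
    {FF : Filter F} (f : T -> V) (l : V) :
  f x @[x --> F] --> l <->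
  forall e : R, 0 < e -> \forall x \near F, rnorm (f x - l) < e.
Proof.
split => [/cvgrPdist_lt fl e e0|fl].
  have e0' : 0 < e%:C :> R[i] by rewrite ltcR.
  have := fl _ e0'; apply: filterS => x.
  by rewrite normE_rnorm ltcR rnormC.
apply/cvgrPdist_lt => e e0.
have ee : e = (complex.Re e)%:C.
  by move: e0; rewrite ltcE => /andP[/eqP/= e0 _]; case: e e0 => a b /= ->.
have e0' : 0 < complex.Re e by rewrite -ltcR -ee.
have := fl _ e0'; apply: filterS => x.
by rewrite normE_rnorm ee ltcR rnormC.
Qed.

Lemma rnorm_cvg0P (V : normedModType R[i]) (T : Type) (F : set_system T)
    {FF : Filter F} (f : T -> V) (l : V) :
  f x @[x --> F] --> l <-> rnorm (f x - l) @[x --> F] --> 0.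
Proof.
rewrite cvg_rnormP; split => [fl|/cvgrPdist_lt fl e e0].
  apply/cvgrPdist_lt => e e0; have := fl e e0; apply: filterS => x.
  by rewrite sub0r normrN ger0_norm ?rnorm_ge0.
have := fl e e0; apply: filterS => x.
by rewrite sub0r normrN ger0_norm ?rnorm_ge0.
Qed.

Lemma cvg_rnorm (V : normedModType R[i]) (T : Type) (F : set_system T)
    {FF : Filter F} (f : T -> V) (l : V) :
  f x @[x --> F] --> l -> rnorm (f x) @[x --> F] --> rnorm l.
Proof.
move=> /cvg_rnormP fl; apply/cvgrPdist_lt => e e0.
have := fl e e0; apply: filterS => x; apply: le_lt_trans.
by rewrite rnormC ler_dist_rnorm.
Qed.

Lemma cvg_rnorm_le (V : normedModType R[i]) (T : Type) (F : set_system T)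
    {FF : Filter F} (f : T -> V) (l : V) (g : T -> R) :
  (\forall x \near F, rnorm (f x - l) <= g x) -> g x @[x --> F] --> 0 ->
  f x @[x --> F] --> l.
Proof.
move=> fg g0; apply/rnorm_cvg0P; apply: (@squeeze_cvgr _ _ _ _ (cst 0) g).
- by apply: filterS fg => x ->; rewrite rnorm_ge0.
- exact: cvg_cst.
- exact: g0.
Qed.

Lemma bounded_linear_cvg (V W : normedModType R[i]) (L : {linear V -> W}) c
    (T : Type) (F : set_system T) {FF : Filter F} (f : T -> V) (l : V) :
  (forall x, rnorm (L x) <= c * rnorm x) ->
  f x @[x --> F] --> l -> L (f x) @[x --> F] --> L l.
Proof.
move=> Lc /rnorm_cvg0P fl; apply: (@cvg_rnorm_le _ _ _ _ _ _ (fun x => c * rnorm (f x - l))).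
  by apply: nearW => x; rewrite -raddfB; exact: Lc.
by rewrite -(mulr0 c); exact: cvgMr.
Qed.

(** Continuity at 0 gives a ball of radius [r] mapped into the unit ball. A vector is rescaled to
    norm [r / 2], strictly inside this ball, whence the constant [2 / r]. *)
Lemma continuous_linear_bounded (V W : normedModType R[i]) (L : {linear V -> W}) :
  continuous L -> exists2 c, 0 < c & forall x, rnorm (L x) <= c * rnorm x.
Proof.
move=> /(_ 0) /cvg_rnormP /(_ 1 ltr01) /nbhs_ballP[d /= d0 dL].
have dd : d = (complex.Re d)%:C.
  by move: d0; rewrite ltcE => /andP[/eqP/= d0 _]; case: d d0 {dL} => a b /= ->.
have {}d0 : 0 < complex.Re d by rewrite -ltcR -dd.
set r := complex.Re d in dd d0.
exists (2 / r) => [|x]; first by rewrite divr_gt0.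
have [->|x0] := eqVneq x 0; first by rewrite linear0 !rnorm0 mulr0.
have nx : 0 < rnorm x by rewrite lt_def rnorm_eq0 x0 rnorm_ge0.
pose y := (r / 2 / rnorm x)%:C *: x.
have : rnorm (L y - L 0) < 1.
  apply: dL; rewrite -ball_normE /ball_ /= sub0r normrN normE_rnorm dd ltcR.
  rewrite rnormZr gtr0_norm ?divr_gt0// divfK ?gt_eqF//.
  by rewrite ltr_pdivrMr// ltr_pMr// ltr1n.
rewrite linear0 subr0 linearZ /= rnormZr gtr0_norm ?divr_gt0// mulrC -ltr_pdivlMr ?divr_gt0//.
rewrite div1r => /ltW; congr (_ <= _); rewrite !invf_div.
by field; rewrite !gt_eqF.
Qed.

Lemma rnorm_complete (V : completeNormedModType R[i]) (x : nat -> V) :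
  (forall e : R, 0 < e -> exists N, forall m n, (N <= m)%N -> (N <= n)%N ->
     rnorm (x m - x n) < e) ->
  exists l : V, x n @[n --> \oo] --> l.
Proof.
move=> cx; apply/cvg_ex/cauchy_cvgP/cauchy_exP => e e0.
have ee : e = (complex.Re e)%:C.
  by move: e0; rewrite ltcE => /andP[/eqP/= e0 _]; case: e e0 => a b /= ->.
have e0' : 0 < complex.Re e by rewrite -ltcR -ee.
have [N NP] := cx _ e0'.
exists (x N); exists N => // n /= Nn.
by rewrite -ball_normE /ball_ /= normE_rnorm ee ltcR; apply: NP.
Qed.

End RNorm.

(** * Norming real-linear functionals *)

Section Functionals.
Context {R : realType}.

(* Only real linearity is required, although V is a complex space. *)
Definition rfunctional (V : normedModType R[i]) (l : V -> R) :=
  [/\ forall x y, l (x + y) = l x + l y,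
      forall a x, l (a%:C *: x) = a * l x &
      exists c, forall x, `|l x| <= c * rnorm x].

Section RFunctionalTheory.
Context {V : normedModType R[i]} (l : V -> R) (lP : rfunctional l).

Lemma rfunctionalD x y : l (x + y) = l x + l y. Proof. by case: lP. Qed.

Lemma rfunctionalZ a x : l (a%:C *: x) = a * l x. Proof. by case: lP. Qed.

Lemma rfunctional0 : l 0 = 0.
Proof. by rewrite -(scale0r 0) (rfunctionalZ 0) mul0r. Qed.

Lemma rfunctionalN x : l (- x) = - l x.
Proof.
by rewrite -scale_realN1 rfunctionalZ mulN1r.
Qed.

Lemma rfunctionalB x y : l (x - y) = l x - l y.
Proof. by rewrite rfunctionalD rfunctionalN. Qed.

Lemma rfunctional_sum (I : Type) (r : seq I) (P : pred I) (F : I -> V) :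
  l (\sum_(i <- r | P i) F i) = \sum_(i <- r | P i) l (F i).
Proof. exact: (big_morph l rfunctionalD rfunctional0). Qed.

Lemma rfunctional_bounded : exists2 c, 0 < c & forall x, `|l x| <= c * rnorm x.
Proof.
have [_ _ [c cl]] := lP; exists (`|c| + 1) => [|x]; first by rewrite ltr_wpDl.
rewrite (le_trans (cl x))// ler_wpM2r ?rnorm_ge0//.
by rewrite (le_trans (ler_norm _))// lerDl.
Qed.

Lemma rfunctional_cvg (T : Type) (F : set_system T) {FF : Filter F} (f : T -> V)
    (y : V) : f x @[x --> F] --> y -> l (f x) @[x --> F] --> l y.
Proof.
have [c c0 cl] := rfunctional_bounded => /cvg_rnormP fy.
apply/cvgrPdist_lt => e e0; have /fy : 0 < e / c by rewrite divr_gt0.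
apply: filterS => x; rewrite ltr_pdivlMr// mulrC; apply: le_lt_trans.
by rewrite distrC -rfunctionalB.
Qed.

End RFunctionalTheory.

Lemma rfunctional_comp (V W : normedModType R[i]) (L : {linear V -> W}) (l : W -> R) c :
  (forall x, rnorm (L x) <= c * rnorm x) -> rfunctional l -> rfunctional (l \o L).
Proof.
move=> cL lP; have [k k0 kl] := rfunctional_bounded lP.
split => [x y|a x|] /=; first by rewrite linearD rfunctionalD.
  by rewrite linearZ rfunctionalZ.
exists (k * c) => x; rewrite (le_trans (kl _))// -mulrA ler_wpM2l//; exact: ltW.
Qed.

Lemma rfunctional_scale (V : normedModType R[i]) (l : V -> R) (a : R[i]) :
  rfunctional l -> rfunctional (fun x => l (a *: x)).
Proof.
move=> lP; have [k k0 kl] := rfunctional_bounded lP.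
split => [x y|b x|]; first by rewrite scalerDr rfunctionalD.
  by rewrite scalerA mulrC -scalerA rfunctionalZ.
by exists (k * rnorm a) => x; rewrite (le_trans (kl _))// rnormZ mulrA.
Qed.

Section HahnBanach.
Variables (V : normedModType R[i]) (x0 : V).

Let linear_graph (G : set (V * R)) :=
  forall a p q, G p -> G q -> G (a%:C *: p.1 + q.1, a * p.2 + q.2).

(** Partial functionals are represented by graphs; linearity and domination by the norm force them
    to be single-valued. The condition on [x0] concerns nonempty graphs only, so that the union of
    the empty chain is admissible in Zorn's lemma. *)
Let admissible (G : set (V * R)) :=
  [/\ linear_graph G, forall p, G p -> p.2 <= rnorm p.1 &
      forall p, G p -> G (x0, rnorm x0)].

Let maximal_graph : exists G, admissible G /\
  forall H, G `<` H -> ~ admissible H.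
Proof.
apply: Zorn_bigcup => F FP Ftot; split.
- move=> a p q [G FG Gp] [H FH Hq].
  have [GH|HG] := Ftot _ _ FG FH.
    by exists H => //; have [+ _ _] := FP _ FH; apply => //; exact: GH.
  by exists G => //; have [+ _ _] := FP _ FG; apply => //; exact: HG.
- by move=> p [G FG Gp]; have [_ + _] := FP _ FG; apply.
- by move=> p [G FG Gp]; exists G => //; have [_ _ +] := FP _ FG; apply; exact: Gp.
Qed.

Lemma hahn_banach_norming :
  exists l : V -> R, [/\ rfunctional l, forall x, `|l x| <= rnorm x & l x0 = rnorm x0].
Proof.
have [G [[Glin Gle G0] Gmax]] := maximal_graph.
have {}G0 : G (x0, rnorm x0).
  apply: contrapT => nG; have Gempty p : ~ G p by move=> /G0.
  (* An empty maximal graph would be extended by the functional on the real line through [x0] that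
     takes the value [rnorm x0] at [x0]. *)
  apply: (Gmax [set p | exists a, p = (a%:C *: x0, a * rnorm x0)]).
    split; first by move=> p /Gempty.
    move=> /(_ (x0, rnorm x0)); case/(_ _)/Gempty.
    by exists 1; rewrite scale1r mul1r.
  split => [a _ _ [b ->] [c ->]|_ [b ->]|_ _] /=.
  - by exists (a * b + c); rewrite scale_realD scale_realM mulrDl mulrA.
  - by rewrite rnormZr ler_wpM2r ?rnorm_ge0// ler_norm.
  - by exists 1; rewrite scale1r mul1r.
have G00 : G (0, 0).
  have := Glin (-1) _ _ G0 G0.
  by rewrite /= scale_realN1 addNr mulN1r addNr.
have GZ a p : G p -> G (a%:C *: p.1, a * p.2).
  by move=> Gp; have := Glin a _ _ Gp G00; rewrite /= !addr0.
have GD p q : G p -> G q -> G (p.1 + q.1, p.2 + q.2).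
  by move=> Gp Gq; have := Glin 1 _ _ Gp Gq; rewrite /= scale1r mul1r.
have Gtotal y : exists r, G (y, r).
  apply: contrapT => nGy.
  (* A value at [y] keeps the domination when it lies above all elements of [S] and below all
     [rnorm (q.1 + y) - q.2]. By [Sub] the two families are ordered, so the supremum of [S] is such
     a value. *)
  pose S := [set p.2 - rnorm (p.1 - y) | p in G].
  have Sub q : G q -> ubound S (rnorm (q.1 + y) - q.2).
    move=> Gq _ [p Gp <-]; rewrite lerBlDr addrAC lerBrDr.
    rewrite (le_trans (Gle _ (GD _ _ Gp Gq)))//= addrC -{1}(subrK y p.1).
    by rewrite -addrA (addrC y) (le_trans (ler_rnormD _ _))// addrC.
  have supS : has_sup S.
    split; first by exists (0 - rnorm (0 - y)), (0, 0).
    by exists (rnorm (0 + y) - 0); exact: (Sub _ G00).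
  pose g := sup S.
  have gl p : G p -> p.2 - rnorm (p.1 - y) <= g.
    by move=> Gp; apply: ub_le_sup; [case: supS|exists p].
  have gu p : G p -> g <= rnorm (p.1 + y) - p.2.
    by move=> Gp; apply: ge_sup; [case: supS|exact: Sub].
  apply: (Gmax [set q | exists p t, G p /\ q = (p.1 + t%:C *: y, p.2 + t * g)]).
    split.
      by move=> [p r] Gp; exists (p, r), 0; rewrite scale0r mul0r !addr0.
    move=> /(_ (y, g)) Gy; apply: nGy; exists g; apply: Gy.
    by exists (0, 0), 1; rewrite scale1r mul1r !add0r.
  split.
  - move=> a _ _ [p [t [Gp ->]]] [q [s [Gq ->]]] /=.
    exists (a%:C *: p.1 + q.1, a * p.2 + q.2), (a * t + s); split; first exact: Glin.
    congr (_, _) => /=; last by ring.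
    by rewrite scalerDr scale_realD scale_realM addrACA.
  - move=> _ [p [t [Gp ->]]] /=; have [t0|t0|->] := ltgtP t 0.
    + have := gl _ (GZ (- t^-1) _ Gp); rewrite /=.
      have -> : (- t^-1)%:C *: p.1 - y = (- t^-1)%:C *: (p.1 + t%:C *: y).
        rewrite scalerDr scalerA -real_complexM mulNr mulVf ?lt_eqF//.
        by rewrite scale_realN1.
      rewrite rnormZr normrN normfV ltr0_norm// => H.
      have nt0 : 0 < - t by rewrite oppr_gt0.
      have : (- t) * (- t^-1 * p.2 - (- t)^-1 * rnorm (p.1 + t%:C *: y)) <= - t * g.
        by rewrite ler_pM2l.
      rewrite (_ : - t * _ = p.2 - rnorm (p.1 + t%:C *: y)).
        by rewrite mulNr lerBlDr addrC -lerBrDr.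
      by field; rewrite lt_eqF.
    + have := gu _ (GZ t^-1 _ Gp); rewrite /=.
      have -> : (t^-1)%:C *: p.1 + y = (t^-1)%:C *: (p.1 + t%:C *: y).
        by rewrite scalerDr scalerA -real_complexM mulVf ?gt_eqF// scale1r.
      rewrite rnormZr gtr0_norm ?invr_gt0// => H.
      have : t * g <= t * (t^-1 * rnorm (p.1 + t%:C *: y) - t^-1 * p.2).
        by rewrite ler_pM2l.
      rewrite (_ : t * (_ - _) = rnorm (p.1 + t%:C *: y) - p.2).
        by rewrite lerBrDl.
      by field; rewrite gt_eqF.
    + by rewrite scale0r mul0r !addr0 Gle.
  - move=> _ _; exists (x0, rnorm x0), 0; split => //.
    by rewrite scale0r mul0r !addr0.
have Guniq x r s : G (x, r) -> G (x, s) -> r = s.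
  move=> Gr Gs; apply/eqP; rewrite eq_le -[r <= s]subr_le0 -[s <= r]subr_le0.
  have H (p q : R) : G (x, p) -> G (x, q) -> p - q <= 0.
    move=> Gp Gq; have := Gle _ (Glin (-1) _ _ Gq Gp).
    by rewrite /= scale_realN1 addNr rnorm0 mulN1r addrC.
  by rewrite !H.
pose l x := projT1 (cid (Gtotal x)).
have lG x : G (x, l x) by rewrite /l; case: cid.
have lE x r : G (x, r) -> l x = r by move/(Guniq _ _ _ (lG x)).
have lle x : l x <= rnorm x by exact: (Gle _ (lG x)).
have lZ a x : l (a%:C *: x) = a * l x by apply: lE; exact: (GZ a _ (lG x)).
have lnorm x : `|l x| <= rnorm x.
  rewrite ler_norml lle andbT lerNl -rnormN (le_trans _ (lle (- x)))//.
  by rewrite -scale_realN1 lZ mulN1r.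
exists l; split => //; last exact: lE.
split => // [x y|]; first by apply: lE; exact: (GD _ _ (lG x) (lG y)).
by exists 1 => x; rewrite mul1r.
Qed.

End HahnBanach.

Lemma rfunctional_inj (V : normedModType R[i]) (x y : V) :
  (forall l, rfunctional l -> l x = l y) -> x = y.
Proof.
move=> lxy; have [l [lP _ lE]] := hahn_banach_norming (x - y).
apply/eqP; rewrite -subr_eq0 -rnorm_eq0 -lE (rfunctionalB lP) (lxy l)//.
by rewrite subrr.
Qed.

(* The complexification l x - i l (i x) of a real functional is complex linear; hence
   identities between vectors reduce to identities between complex numbers. *)
Lemma cfunctional_inj (V : normedModType R[i]) (x y : V) :
  (forall c : V -> R[i], (forall u v, c (u + v) = c u + c v) ->
     (forall u, c (- u) = - c u) -> (forall a u, c (a *: u) = a * c u) -> c x = c y) ->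
  x = y.
Proof.
move=> cxy; apply: rfunctional_inj => l lP.
pose c u := (l u)%:C - 'i%C * (l ('i%C *: u))%:C.
have cD u v : c (u + v) = c u + c v.
  by rewrite /c scalerDr !(rfunctionalD lP) !real_complexD; ring.
have cZr (a : R) u : c (a%:C *: u) = a%:C * c u.
  rewrite /c (scalerA 'i%C a%:C) (mulrC 'i%C a%:C) -(scalerA a%:C).
  by rewrite !(rfunctionalZ lP) !real_complexM; ring.
have ci u : c ('i%C *: u) = 'i%C * c u.
  rewrite /c scalerA -expr2 sqr_i scaleN1r (rfunctionalN lP) real_complexN.
  by rewrite mulrBr mulrA -expr2 sqr_i; ring.
have cZ a u : c (a *: u) = a * c u.
  rewrite {1}(complexE a) scalerDl cD cZr -scalerA ci cZr mulrA -mulrDl.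
  by rewrite -complexE.
have cN u : c (- u) = - c u by rewrite -scaleN1r cZ mulN1r.
have := cxy c cD cN cZ; rewrite /c => /(congr1 (@complex.Re R)).
by rewrite /= !(mul0r, mulr0, mul1r, subrr, oppr0, addr0, subr0).
Qed.

Lemma rnorm_le_functional (V : normedModType R[i]) (x : V) (M : R) :
  (forall l, rfunctional l -> (forall y, `|l y| <= rnorm y) -> l x <= M) ->
  rnorm x <= M.
Proof. by move=> lM; have [l [lP ll <-]] := hahn_banach_norming x; exact: lM. Qed.

End Functionals.

(** * Bochner integrals over the real line *)

Section Bochner.
Context {R : realType}.
Notation mu := (@lebesgue_measure R).

Lemma open_neq0 : open (~` [set (0 : R)]).
Proof.
apply/closed_openC; apply: accessible_closed_set1; apply: hausdorff_accessible.
exact: Rhausdorff.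
Qed.

Lemma measurable_continuous_off0 (f : R -> R) :
  (forall t, t != 0 -> {for t, continuous f}) -> measurable_fun setT f.
Proof.
move=> cf; rewrite -(setUv [set (0 : R)]).
apply/measurable_funU; [exact: measurable_set1|exact: measurableC|split].
  exact: measurable_fun_set1.
apply: measurable_realfun.open_continuous_measurable_fun; first exact: open_neq0.
by move=> t; rewrite inE => /= t0; apply: cf; exact/eqP.
Qed.

Lemma measurable_finite_range (W : Type) (s : R -> W) (B : W -> set R) :
  finite_set (range s) -> (forall v, measurable (s @^-1` [set v])) ->
  (forall v, measurable (B v)) -> measurable [set t | B (s t) t].
Proof.
move=> fs ms mB.
rewrite (_ : mkset _ = \bigcup_(v in range s) (s @^-1` [set v] `&` B v)).
  by apply: fin_bigcup_measurable => // v _; exact: measurableI.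
by apply/seteqP; split => [t Bt|t [_ _ [<-]]//]; exists (s t).
Qed.

Context {V : normedModType R[i]}.

Section SimpleIntegral.
Variables (s : R -> V) (sP : integrable_simple mu s).
Variables (l : V -> R) (lP : rfunctional l).

Let level v t := l v * \1_(s @^-1` [set v]) t.

Let functional_simpleE t : l (s t) = \sum_(v <- fset_set (range s)) level v t.
Proof.
have [fs _ _] := sP.
rewrite (bigD1_seq (s t)) ?fset_uniq//=; last first.
  by rewrite in_fset_set// inE; exists t.
rewrite /level indicE mem_set// mulr1 big1 ?addr0// => v vst.
by rewrite indicE memNset ?mulr0//= => /esym /eqP; rewrite (negbTE vst).
Qed.

Let level_indic_integrable v : v != 0 ->
  mu.-integrable setT (EFin \o \1_(s @^-1` [set v])).
Proof.
move=> v0; have [_ ms fs] := sP.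
apply/integrableP; split.
  exact/measurable_EFinP/measurable_indic.
under eq_integral do rewrite abse_EFin ger0_norm ?indicE//.
by rewrite -/(\1_(s @^-1` [set v])) integral_indic// setIT; exact: fs.
Qed.

Let level_integrable v : mu.-integrable setT (EFin \o level v).
Proof.
have [_ ms fs] := sP; have [->|v0] := eqVneq v 0.
  rewrite (_ : _ \o _ = cst 0%E); first exact: integrable0.
  by apply/funext => t /=; rewrite /level (rfunctional0 lP) mul0r.
rewrite (_ : _ \o _ = (fun t => (l v)%:E * (\1_(s @^-1` [set v]) t)%:E)%E)//.
apply: integrableZl => //; exact: level_indic_integrable.
Qed.

Let level_integral v :
  (\int[mu]_t (level v t)%:E)%E = (fine (mu (s @^-1` [set v])) * l v)%:E.
Proof.
have [_ ms fs] := sP; have [->|v0] := eqVneq v 0.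
  rewrite (rfunctional0 lP) mulr0; under eq_integral do rewrite /level (rfunctional0 lP) mul0r.
  by rewrite integral0.
under eq_integral do rewrite EFinM.
rewrite integralZl ?integral_indic ?setIT//; last first.
  by apply: level_indic_integrable => //.
by rewrite mulrC EFinM fineK// ge0_fin_numE//; exact: fs.
Qed.

Lemma integrable_functional_simple : mu.-integrable setT (EFin \o (l \o s)).
Proof.
rewrite (_ : _ \o _ = fun t => (\sum_(v <- fset_set (range s)) (level v t)%:E)%E).
  by apply: integrable_sum => // v _; exact: level_integrable.
by apply/funext => t /=; rewrite functional_simpleE sumEFin.
Qed.

Lemma functional_simple_integral :
  l (simple_integral mu s) = \int[mu]_t l (s t).
Proof.
have [fs ms _] := sP.
rewrite /simple_integral fsbig_finite// (rfunctional_sum lP).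
under eq_bigr do rewrite (rfunctionalZ lP).
under eq_Rintegral do rewrite functional_simpleE.
rewrite /Rintegral.
under eq_integral do rewrite -sumEFin.
rewrite integral_sum//.
under [in RHS]eq_bigr do rewrite level_integral.
by rewrite sumEFin.
Qed.
End SimpleIntegral.

(** Continuity and the bound are required off 0 only: the parametrisation of the boundary of a
    sector jumps at its vertex, and the Laplace integrands jump at time 0. *)
Definition dominated_continuous (F : R -> V) :=
  (forall t, t != 0 -> {for t, continuous F}) /\
  exists g : R -> R, [/\ measurable_fun setT g, forall t, 0 <= g t,
    mu.-integrable setT (EFin \o g) & forall t, t != 0 -> rnorm (F t) <= g t].

Section DominatedContinuous.
Variables (F : R -> V) (FP : dominated_continuous F).

Lemma dominated_continuous_bound : exists g : R -> R,
  [/\ measurable_fun setT g, forall t, 0 <= g t,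
    mu.-integrable setT (EFin \o g) & forall t, rnorm (F t) <= g t].
Proof.
have [_ [g [mg g0 ig Fg]]] := FP.
pose h t := rnorm (F 0) * \1_[set (0 : R)] t.
have mh : measurable_fun setT h by exact/measurable_funM/measurable_indic.
have h0 t : 0 <= h t by rewrite mulr_ge0 ?rnorm_ge0.
have ih : mu.-integrable setT (EFin \o h).
  rewrite (_ : _ \o _ = fun t => ((rnorm (F 0))%:E * (\1_[set (0 : R)] t)%:E)%E)//.
  by apply: integrableZl => //; rewrite -set_itv1; exact: integrable_indic_itv.
exists (fun t => g t + h t); split.
- exact: measurable_funD.
- by move=> t; rewrite addr_ge0.
- rewrite (_ : _ \o _ = fun t => ((g t)%:E + (h t)%:E)%E)//; exact: integrableD.
- move=> t; have [->|t0] := eqVneq t 0.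
    by rewrite /h indicE mem_set// mulr1 lerDr.
  by rewrite (le_trans (Fg _ t0))// lerDl.
Qed.

Lemma measurable_functional l : rfunctional l -> measurable_fun setT (l \o F).
Proof.
move=> lP; apply: measurable_continuous_off0 => t t0.
by apply: (rfunctional_cvg lP); exact: FP.1.
Qed.

Lemma measurable_rnorm : measurable_fun setT (fun t => rnorm (F t)).
Proof.
by apply: measurable_continuous_off0 => t t0; apply: cvg_rnorm; exact: FP.1.
Qed.

Lemma integrable_rnorm : mu.-integrable setT (fun t => (rnorm (F t))%:E).
Proof.
have [g [mg g0 ig Fg]] := dominated_continuous_bound.
apply: le_integrable ig => //; first by apply/measurable_EFinP; exact: measurable_rnorm.
by move=> t _ /=; rewrite lee_fin !ger0_norm// rnorm_ge0.
Qed.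

Lemma integrable_functional l : rfunctional l -> mu.-integrable setT (EFin \o (l \o F)).
Proof.
move=> lP; have [c c0 cl] := rfunctional_bounded lP.
have := integrableZl measurableT c integrable_rnorm; apply: le_integrable => //.
  by apply/measurable_EFinP; exact: measurable_functional.
by move=> t _ /=; rewrite lee_fin (le_trans (cl _))// ler_norm.
Qed.

Lemma measurable_rnorm_sub_simple s : integrable_simple mu s ->
  measurable_fun setT (fun t => rnorm (F t - s t)).
Proof.
move=> [fs ms _] _ B mB; rewrite setTI.
apply: (@measurable_finite_range V s (fun v => [set t | B (rnorm (F t - v))])) => // v.
rewrite (_ : mkset _ = setT `&` (fun t => rnorm (F t - v)) @^-1` B) ?setTI//.
rewrite -[X in measurable X]setTI.
apply: (@measurable_continuous_off0 (fun t => rnorm (F t - v))) => // t t0.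
by apply: cvg_rnorm; apply: cvgB; [exact: FP.1|exact: cvg_cst].
Qed.

(** The bound involves the functional only through [c]. Applied to functionals of norm at most 1 it
    is uniform, which gives the Cauchy property of the approximating integrals; applied to a fixed
    functional it identifies the limit. *)
Lemma functional_simple_approx s l c : integrable_simple mu s -> rfunctional l ->
  0 <= c -> (forall x, `|l x| <= c * rnorm x) ->
  (`|l (simple_integral mu s) - \int[mu]_t l (F t)|%:E <=
   c%:E * \int[mu]_t (rnorm (F t - s t))%:E)%E.
Proof.
move=> sP lP c0 cl.
have is_ := integrable_functional_simple sP lP.
have iF := integrable_functional lP.
rewrite functional_simple_integral// -RintegralB//.
have iB : mu.-integrable setT (EFin \o (fun t => l (s t) - l (F t))).
  exact: (integrableB measurableT is_ iF).
have mB := measurable_int _ iB.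
rewrite EFin_normr_Rintegral// (le_trans (le_abse_integral _ _ _))//.
have mN := measurable_rnorm_sub_simple sP.
rewrite -ge0_integralZl//; last 2 first.
- exact/measurable_EFinP.
- by move=> t _; rewrite lee_fin rnorm_ge0.
apply: ge0_le_integral => //.
- exact: measurableT_comp.
- exact/measurable_EFinP/measurable_funM.
- move=> t _; rewrite abse_EFin lee_fin -(rfunctionalB lP).
  by rewrite (le_trans (cl _))// rnormC.
Qed.

(** The real integral on the right does not involve the approximating simple functions. As
    functionals separate points, this makes the Bochner integral unique and reduces its properties
    to those of real integrals. *)
Lemma bochner_functional l y : rfunctional l -> is_bochner_integral mu F y ->
  l y = \int[mu]_t l (F t).
Proof.
move=> lP [s [sP _ sF sy]].
have [c c0 cl] := rfunctional_bounded lP.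
have ly : l (simple_integral mu (s n)) @[n --> \oo] --> l y.
  exact: (rfunctional_cvg lP).
apply/eqP; rewrite -subr_eq0 -normr_eq0; apply/eqP.
have : (`|l (simple_integral mu (s n)) - \int[mu]_t l (F t)|%:E @[n --> \oo]
    --> 0%E).
  apply: (@squeeze_cvge _ _ _ _ (cst 0%E) _
    (fun n => c%:E * \int[mu]_t (rnorm (F t - s n t))%:E)%E).
  - apply: nearW => n; rewrite lee_fin normr_ge0/=.
    by apply: functional_simple_approx => //; exact: ltW.
  - exact: cvg_cst.
  - by rewrite -(mule0 c%:E); exact: cvgeZl.
move=> /fine_cvg /=; rewrite /comp /= => H.
have L : `|l (simple_integral mu (s n)) - \int[mu]_t l (F t)| @[n --> \oo] -->
    `|l y - \int[mu]_t l (F t)|.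
  by apply: cvg_norm; exact: (cvgB ly (cvg_cst _)).
exact: (cvg_unique (@Rhausdorff R) L H).
Qed.

End DominatedContinuous.

End Bochner.

Section BochnerExistence.
Import HBSimple.

Lemma sfun_cvg_id (R : realType) : exists i_ : {sfun (measurableTypeR R) >-> R}^nat,
  forall t, i_ n t @[n --> \oo] --> t.
Proof.
have [|i_ iP] := @approximation_sfun _ (measurableTypeR R) R EFin setT measurableT.
  exact/measurable_EFinP/measurable_id.
exists i_ => t; have /fine_cvg := iP t I; exact.
Qed.

Context {R : realType} {V : completeNormedModType R[i]}.
Notation mu := (@lebesgue_measure R).
Variables (F : R -> V) (FP : dominated_continuous F).

(** Simple approximations [i_] of the identity of the line are composed with [F]: the values
    [F (i_ n t)] are finite in number and converge by continuity. Truncation to |t| <= n gives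
    levels of finite measure, and the comparison with [2 * g] makes the convergence dominated. *)
Lemma bochner_exists : exists y, is_bochner_integral mu F y.
Proof.
have [g [mg g0 ig Fg]] := dominated_continuous_bound FP.
have [i_ i_cvg] := @sfun_cvg_id R.
have fi n : finite_set (range (i_ n)) := fimfunP (i_ n).
have mi n a : measurable (i_ n @^-1` [set a]) := measurable_funPTI (i_ n) (measurable_set1 a).
pose s n t := if t == 0 then F 0 else
  if (rnorm (F (i_ n t)) <= 2 * g t) && (`|t| <= n%:R) then F (i_ n t) else 0.
have sle n t : rnorm (s n t) <= 2 * g t.
  rewrite /s; case: eqP => [->|_].
    by rewrite (le_trans (Fg _))// ler_peMl// ler1n.
  by case: ifP => [/andP[]//|_]; rewrite rnorm0 mulr_ge0.
have s_cvg t : s n t @[n --> \oo] --> F t.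
  rewrite /s; case: eqP => [->|/eqP t0]; first exact: cvg_cst.
  have Fi : F (i_ n t) @[n --> \oo] --> F t.
    by apply: continuous_cvg; [exact: FP.1|exact: i_cvg].
  (* Where [g t = 0] there is no such room, but then the condition on the norm forces [F (i_ n t)]
     to vanish, as does [F t]. *)
  have [gt0|gt0] := eqVneq (g t) 0.
    have Ft : F t = 0.
      by apply/eqP; rewrite -rnorm_eq0 eq_le rnorm_ge0 andbT -gt0.
    rewrite Ft; apply: cvg_near_cst; apply: nearW => n.
    rewrite gt0 mulr0; case: ifP => // /andP[+ _].
    by move=> Fi0; apply/eqP; rewrite -rnorm_eq0 eq_le Fi0 rnorm_ge0.
  apply: (cvg_trans _ Fi); apply: near_eq_cvg.
  have gt1 : 0 < g t by rewrite lt_def gt0 g0.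
  have Fi' : \forall n \near \oo, rnorm (F (i_ n t) - F t) < g t.
    by move/cvg_rnormP : Fi; exact.
  near=> n; rewrite ifT//; apply/andP; split.
    have : rnorm (F (i_ n t) - F t) < g t by near: n.
    move=> Fn; rewrite -(subrK (F t) (F (i_ n t))) (le_trans (ler_rnormD _ _))//.
    by rewrite (_ : 2 * g t = g t + g t) ?lerD// ?ltW//; ring.
  by near: n; exact: nbhs_infty_ger.
have fs n : finite_set (range (s n)).
  apply: (@sub_finite_set _ _ ([set F 0; 0] `|` F @` range (i_ n))).
    move=> _ [t _ <-]; rewrite /s; case: ifP => _; first by left; left.
    by case: ifP => _; [right; exists (i_ n t) => //; exists t|left; right].
  rewrite finite_setU; split; first exact: finite_set2.
  exact/finite_image/fi.
have ms n v : measurable (s n @^-1` [set v]).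
  pose b a t := if t == 0 then F 0 == v else
    if (rnorm (F a) <= 2 * g t) && (`|t| <= n%:R) then F a == v else 0 == v.
  rewrite (_ : _ @^-1` _ = [set t | [set t' | b (i_ n t) t'] t]); last first.
    apply/seteqP; split => t /=; rewrite /s /b; case: ifP => _.
    - by move/eqP.
    - by case: ifP => _ /eqP.
    - by move/eqP.
    - by case: ifP => _ /eqP.
  apply: (@measurable_finite_range R R (i_ n) (fun a => [set t' | b a t'])).
  - exact: fi.
  - by move=> a; exact: mi.
  move=> a; rewrite (_ : mkset _ = setT `&` b a @^-1` [set true]); last first.
    by rewrite setTI; apply/seteqP; split => t /=; case: (b a t).
  suff : measurable_fun setT (b a) by apply.
  apply: measurable_fun_ifT => //.
    by apply: measurable_fun_eqr => //; exact: measurable_cst.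
  apply: measurable_fun_ifT => //.
  apply: measurable_and; apply: measurable_fun_ler => //.
    exact: measurable_funM.
have sP n : integrable_simple mu (s n).
  split; [exact: fs|exact: ms|] => v v0; rewrite (@le_lt_trans _ _ (mu `[- n%:R, n%:R]))//; last first.
    by rewrite lebesgue_measure_itv/=; case: ifP => _; rewrite ?ltry.
  apply: le_measure; rewrite ?inE; [exact: ms|exact: measurable_itv|].
  move=> t /= sv; rewrite in_itv/= -ler_norml.
  have [->|t0] := eqVneq t 0; first by rewrite normr0.
  move: v0; rewrite -sv /s (negbTE t0).
  by case: ifP => [/andP[]//|_]; rewrite eqxx.
have sF : (\int[mu]_t (rnorm (F t - s n t))%:E)%E @[n --> \oo] --> 0%E.
  rewrite -(@integral0 _ _ R mu setT).
  apply: (@dominated_cvg _ _ _ mu setT measurableT _ (cst 0%E) (EFin \o (fun t => 3 * g t))) => //.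
  - by move=> n; apply/measurable_EFinP; exact: measurable_rnorm_sub_simple.
  - move=> t _; apply/fine_cvgP; split; first exact: nearW.
    have /rnorm_cvg0P := s_cvg t.
    by apply: cvg_trans; apply: near_eq_cvg; apply: nearW => n /=; rewrite rnormC.
  - exact: (integrableZl measurableT 3 ig).
  - move=> n t _ /=; rewrite lee_fin ger0_norm ?rnorm_ge0//.
    rewrite (le_trans (ler_rnormB _ _))// (_ : 3 * g t = g t + 2 * g t); last by ring.
    by rewrite lerD.
have [|y sy] := @rnorm_complete _ V (fun n => simple_integral mu (s n)).
  move=> e e0; have e2 : 0 < e / 2 by rewrite divr_gt0.
  have [N _ NP] : \forall n \near \oo,
      (\int[mu]_t (rnorm (F t - s n t))%:E < (e / 2)%:E)%E.
    have [fn /cvgrPdist_lt f0] := (fine_cvgP _ _).1 sF.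
    near=> n; rewrite -(@fineK _ (\int[mu]_t _)%E) ?lte_fin; last by near: n.
    rewrite (le_lt_trans (ler_norm _))// -normrN -sub0r.
    by near: n; exact: f0.
  exists N => m n Nm Nn.
  (* A functional norming the difference compares both simple integrals with the same real integral,
     each up to [e / 2]. *)
  have [l [lP l1 <-]] :=
    hahn_banach_norming (simple_integral mu (s m) - simple_integral mu (s n)).
  have approx k : (N <= k)%N ->
      `|l (simple_integral mu (s k)) - \int[mu]_t l (F t)| < e / 2.
    move=> Nk; rewrite -lte_fin; apply: le_lt_trans (NP _ Nk).
    rewrite -[leRHS]mul1e; apply: functional_simple_approx => // x.
    by rewrite mul1r.
  rewrite (rfunctionalB lP) -(subrKA (\int[mu]_t l (F t))).
  rewrite (le_lt_trans (ler_norm _))// (le_lt_trans (ler_normD _ _))//.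
  rewrite [ltRHS](splitr e) ltrD ?approx// distrC approx//.
exists y, s; split => //; exact: aeW.
Unshelve. all: by end_near.
Qed.

End BochnerExistence.

Section BochnerTheory.
Context {R : realType}.
Notation mu := (@lebesgue_measure R).
Notation bint F := (bochner_integral mu F).

Section DominatedContinuousTheory.
Context {V W : normedModType R[i]}.

Lemma dominated_continuousD (F G : R -> V) : dominated_continuous F ->
  dominated_continuous G -> dominated_continuous (fun t => F t + G t).
Proof.
move=> [cF [f [mf f0 if_ Ff]]] [cG [g [mg g0 ig Gg]]]; split.
  by move=> t t0; apply: cvgD; [exact: cF|exact: cG].
exists (fun t => f t + g t); split.
- exact: measurable_funD.
- by move=> t; rewrite addr_ge0.
- exact: (integrableD measurableT if_ ig).
- by move=> t t0; rewrite (le_trans (ler_rnormD _ _))// lerD ?Ff ?Gg.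
Qed.

Lemma dominated_continuous_map (F : R -> V) (L : {linear V -> W}) c :
  dominated_continuous F ->
  (forall x, rnorm (L x) <= c * rnorm x) ->
  dominated_continuous (fun t => L (F t)).
Proof.
move=> [cF [f [mf f0 if_ Ff]]] Lc; split.
  by move=> t t0; apply: (bounded_linear_cvg Lc); exact: cF.
exists (fun t => `|c| * f t); split.
- exact: measurable_funM.
- by move=> t; rewrite mulr_ge0.
- exact: (integrableZl measurableT `|c| if_).
- move=> t t0; rewrite (le_trans (Lc _))// (@le_trans _ _ (`|c| * rnorm (F t)))//.
    by rewrite ler_wpM2r ?rnorm_ge0// ler_norm.
  by rewrite ler_wpM2l// Ff.
Qed.

Lemma dominated_continuousZ (F : R -> V) (a : R[i]) : dominated_continuous F ->
  dominated_continuous (fun t => a *: F t).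
Proof.
move=> [cF [f [mf f0 if_ Ff]]]; split.
  by move=> t t0; apply: cvgZr; exact: cF.
exists (fun t => rnorm a * f t); split.
- exact: measurable_funM.
- by move=> t; rewrite mulr_ge0// rnorm_ge0.
- exact: (integrableZl measurableT (rnorm a) if_).
- by move=> t t0; rewrite rnormZ ler_wpM2l ?rnorm_ge0// Ff.
Qed.

Lemma dominated_continuous0 : dominated_continuous (fun=> 0 : V).
Proof.
split; first by move=> t _; exact: cvg_cst.
exists (cst 0); split => //; last by move=> t _; rewrite rnorm0.
exact: integrable0.
Qed.

Lemma dominated_continuousB (F G : R -> V) : dominated_continuous F ->
  dominated_continuous G -> dominated_continuous (fun t => F t - G t).
Proof.
move=> dF dG; under eq_fun do rewrite -scaleN1r.
exact/dominated_continuousD/dominated_continuousZ.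
Qed.

Lemma dominated_continuous_sum (I : Type) (r : seq I) (F : I -> R -> V) :
  (forall i, dominated_continuous (F i)) ->
  dominated_continuous (fun t => \sum_(i <- r) F i t).
Proof.
move=> dF; elim: r => [|i r IH].
  by under eq_fun do rewrite big_nil; exact: dominated_continuous0.
by under eq_fun do rewrite big_cons; exact: dominated_continuousD.
Qed.

End DominatedContinuousTheory.

Section BochnerIntegralTheory.
Context {V : completeNormedModType R[i]}.

Lemma bochner_integralP (F : R -> V) :
  dominated_continuous F -> is_bochner_integral mu F (bint F).
Proof.
move=> dF; rewrite /bochner_integral.
by have [y Fy] := bochner_exists dF; apply: xgetPex; exists y.
Qed.

Lemma bint_functional (F : R -> V) l : dominated_continuous F -> rfunctional l ->
  l (bint F) = \int[mu]_t l (F t).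
Proof. by move=> dF lP; exact: bochner_functional (bochner_integralP dF). Qed.

Lemma bint_eqP (F : R -> V) y : dominated_continuous F ->
  (forall l, rfunctional l -> l y = \int[mu]_t l (F t)) -> bint F = y.
Proof.
move=> dF ly; apply: rfunctional_inj => l lP.
by rewrite (bint_functional dF lP) ly.
Qed.

Lemma bintD (F G : R -> V) : dominated_continuous F -> dominated_continuous G ->
  bint (fun t => F t + G t) = bint F + bint G.
Proof.
move=> dF dG; apply: bint_eqP => [|l lP]; first exact: dominated_continuousD.
apply: etrans (rfunctionalD lP _ _) _.
apply: etrans (congr2 +%R (bint_functional dF lP) (bint_functional dG lP)) _.
under [RHS]eq_Rintegral do rewrite (rfunctionalD lP).
rewrite RintegralD//; [exact: integrable_functional dF _ lP|].
exact: integrable_functional dG _ lP.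
Qed.

Lemma bintZ (F : R -> V) a : dominated_continuous F ->
  bint (fun t => a *: F t) = a *: bint F.
Proof.
move=> dF; apply: bint_eqP => [|l lP]; first exact: dominated_continuousZ.
by rewrite -(bint_functional dF (rfunctional_scale a lP)).
Qed.

Lemma bintB (F G : R -> V) : dominated_continuous F -> dominated_continuous G ->
  bint (fun t => F t - G t) = bint F - bint G.
Proof.
move=> dF dG; under eq_fun do rewrite -scaleN1r.
by rewrite bintD ?bintZ ?scaleN1r//; exact: dominated_continuousZ.
Qed.

Lemma bint0 : bint (fun=> 0 : V) = 0.
Proof.
apply: bint_eqP => [|l lP]; first exact: dominated_continuous0.
by rewrite (rfunctional0 lP) /Rintegral integral0.
Qed.

Lemma bint_sum (I : Type) (r : seq I) (F : I -> R -> V) :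
  (forall i, dominated_continuous (F i)) ->
  bint (fun t => \sum_(i <- r) F i t) = \sum_(i <- r) bint (F i).
Proof.
move=> dF; elim: r => [|i r IH].
  by rewrite big_nil; under eq_fun do rewrite big_nil; rewrite bint0.
rewrite big_cons -IH.
transitivity (bint (fun t => F i t + \sum_(j <- r) F j t)).
  by congr bochner_integral; apply/funext => t; rewrite big_cons.
by apply: bintD; [exact: dF|exact: dominated_continuous_sum].
Qed.

Lemma rnorm_bint (F : R -> V) (g : R -> R) : dominated_continuous F ->
  (forall t, 0 <= g t) -> mu.-integrable setT (EFin \o g) ->
  (forall t, t != 0 -> rnorm (F t) <= g t) ->
  rnorm (bint F) <= \int[mu]_t g t.
Proof.
move=> dF g0 ig Fg; apply: rnorm_le_functional => l lP l1.
rewrite bint_functional//.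
have ilF := integrable_functional dF lP.
have iF := integrable_rnorm dF.
rewrite (le_trans (ler_norm _))// (le_trans (le_normr_Rintegral _ ilF))//.
have inlF : mu.-integrable setT (EFin \o (fun t => `|l (F t)|)).
  apply: (le_integrable measurableT _ _ ilF).
    apply/measurable_EFinP; apply: measurableT_comp => //.
    exact: measurable_functional.
  by move=> t _; rewrite /= lee_fin normr_id.
apply: (@le_trans _ _ (\int[mu]_t rnorm (F t))).
  by apply: le_Rintegral => // t _; exact: l1.
rewrite /Rintegral fine_le//; [exact: integrable_fin_num|exact: integrable_fin_num|].
apply: ae_ge0_le_integral => //.
- by move=> t _; rewrite lee_fin rnorm_ge0.
- exact: measurable_int iF.
- by move=> t _; rewrite lee_fin.
- exact: measurable_int ig.
exists [set 0]; split => //; first exact: lebesgue_measure_set1.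
by move=> t /=; apply: contra_notP => /eqP t0 _; rewrite lee_fin Fg.
Qed.

(** The norm of the increment is at most the integral of the real function [rnorm (F a t - F a0 t)],
    whose continuity in [a] follows from the majorant [2 * g]. *)
Lemma continuous_bint (F : R -> R -> V) (g : R -> R) (a0 : R) :
  (forall a, dominated_continuous (F a)) ->
  (forall t, t != 0 -> continuous (F ^~ t)) ->
  (forall t, 0 <= g t) -> mu.-integrable setT (EFin \o g) ->
  (forall a t, t != 0 -> rnorm (F a t) <= g t) ->
  {for a0, continuous (fun a => bint (F a))}.
Proof.
move=> dF cF g0 ig Fg.
pose h a t := rnorm (F a t - F a0 t).
have dB a := dominated_continuousB (dF a) (dF a0).
apply: (@cvg_rnorm_le _ _ _ _ _ _ _ (fun a => \int[mu]_t h a t)).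
  apply: nearW => a; rewrite -bintB//; apply: rnorm_bint => //.
  - by move=> t; exact: rnorm_ge0.
  - exact: integrable_rnorm.
have h0 : \int[mu]_t h a0 t = 0.
  rewrite /h; under eq_Rintegral do rewrite subrr rnorm0.
  by rewrite /Rintegral integral0.
suff H : {in `](a0 - 1), (a0 + 1)[%classic, continuous (fun a => \int[mu]_t h a t)}.
  have := H a0; rewrite /continuous_at h0; apply.
  by rewrite inE /= in_itv/= ltrBlDr !ltrDl ltr01.
apply: (@continuity_under_integral _ _ _ mu h setT measurableT (a0 - 1) (a0 + 1)
  _ _ (fun t => 2 * g t)).
- by move=> a _; exact: integrable_rnorm.
- exists [set 0]; split => //; first exact: lebesgue_measure_set1.
  move=> t /=; apply: contra_notP => /eqP t0 _ a _.
  by apply: cvg_rnorm; apply: cvgB; [exact: (cF t t0 a)|exact: cvg_cst].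
- exact: (integrableZl measurableT 2 ig).
- move=> a _; exists [set 0]; split => //; first exact: lebesgue_measure_set1.
  move=> t /=; apply: contra_notP => /eqP t0 _.
  rewrite ger0_norm ?rnorm_ge0// (le_trans (ler_rnormB _ _))//.
  by rewrite (_ : 2 * g t = g t + g t) ?lerD ?Fg//; ring.
Qed.

End BochnerIntegralTheory.

Lemma bint_linear (V W : completeNormedModType R[i]) (F : R -> V) (L : {linear V -> W}) c :
  dominated_continuous F ->
  (forall x, rnorm (L x) <= c * rnorm x) ->
  bint (fun t => L (F t)) = L (bint F).
Proof.
move=> dF Lc; apply: bint_eqP => [|l lP].
  exact: dominated_continuous_map Lc.
exact: bint_functional dF (rfunctional_comp Lc lP).
Qed.

Section ExponentialDecay.

(** In the coordinate u = ln |z| the weight |z|^s / (1 + |z|)^(2 s) of the functional calculus is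
    comparable to this function. *)
Definition edecay (s t : R) : R := expR (- s * `|t|).

Lemma edecay_ge0 s t : 0 <= edecay s t. Proof. exact: expR_ge0. Qed.

Lemma continuous_edecay s : continuous (edecay s).
Proof.
move=> t; apply: continuous_comp; last exact: continuous_expR.
by apply: cvgMr; exact: norm_continuous.
Qed.

Lemma integral_edecay s : 0 < s -> (\int[mu]_t (edecay s t)%:E)%E = (2 / s)%:E.
Proof.
move=> s0.
rewrite ge0_symfun_integralT; [|exact: edecay_ge0|exact: continuous_edecay|]; last first.
  by move=> t; rewrite /= /edecay normrN.
(* By symmetry the integral is twice the one over the positive half-line, where [s * edecay s] is
   the density of the exponential law. *)
have := @integral_exponential_pdf R s s0.
rewrite /exponential_pdf (_ : (fun x => _) = (EFin \o (fun x => s * expR (- s * x))) \_ `[0, +oo[); last first.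
  by apply/funext => x; rewrite restrict_EFin.
rewrite -integral_mkcond => H.
suff -> : (\int[mu]_(x in [set x | (0 <= x)%R]) (edecay s x)%:E)%E = (s^-1)%:E by rewrite -EFinM.
transitivity (s^-1%:E * \int[mu]_(x in `[0%R, +oo[) (s * expR (- s * x))%:E)%E; last first.
  by rewrite [X in (_ * X)%E]H mule1.
rewrite -ge0_integralZl//=; last 3 first.
- apply/measurable_EFinP; apply: measurable_funTS; apply: continuous_measurable_fun.
  move=> t; apply: cvgMr; apply: continuous_comp; last exact: continuous_expR.
  by apply: cvgMr; exact: cvg_id.
- by move=> t _; rewrite lee_fin mulr_ge0// ?expR_ge0// ltW.
- by rewrite lee_fin invr_ge0 ltW.
rewrite set_itvcy; apply: eq_integral => t; rewrite inE /= => t0.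
by rewrite -EFinM mulrA mulVf ?mul1r ?gt_eqF// /edecay ger0_norm.
Qed.

Lemma integrable_edecay s : 0 < s -> mu.-integrable setT (EFin \o edecay s).
Proof.
move=> s0; apply/integrableP; split.
  by apply/measurable_EFinP; apply: continuous_measurable_fun; exact: continuous_edecay.
under eq_integral do rewrite /= ger0_norm ?edecay_ge0//.
by rewrite integral_edecay// ltry.
Qed.

End ExponentialDecay.
End BochnerTheory.

(** * The substitutions t = exp u and t = - exp u on the half-lines *)

Section LogarithmicSubstitution.
Context {R : realType}.
Notation mu := (@lebesgue_measure R).

Let shell n : set R := `[expR (- n%:R), expR n%:R]%classic.

Let sym n : set R := `[- n%:R, n%:R]%classic.

Let bigcup_shell : \bigcup_n shell n = `]0, +oo[%classic.
Proof.
apply/seteqP; split => [t [n _]|t].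
  by rewrite /shell /= !in_itv/= andbT => /andP[+ _]; apply: lt_le_trans; exact: expR_gt0.
rewrite /= in_itv/= andbT => t0.
have [n nt] : exists n : nat, `|ln t| < n%:R.
  by exists (Num.truncn `|ln t|).+1; exact: truncnS_gt.
exists n => //; rewrite /shell /= in_itv/=.
move: nt; rewrite ltr_norml => /andP[/ltW n1 /ltW n2].
by rewrite -(lnK t0) !ler_expR n1 n2.
Qed.

Let bigcup_Nshell : \bigcup_n (-%R @^-1` shell n) = `]-oo, 0[%classic.
Proof.
rewrite -preimage_bigcup bigcup_shell; apply/seteqP; split => t /=;
  by rewrite !in_itv/= andbT oppr_gt0.
Qed.

Let shell_homo : {homo shell : n m / (n <= m)%N >-> (n <= m)%O}.
Proof.
move=> n m nm; apply/subsetPset => t; rewrite /shell /= !in_itv/= => /andP[t1 t2].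
by rewrite (le_trans _ t1) ?(le_trans t2)// ler_expR ?lerN2 ler_nat.
Qed.

Let continuous_log (psi : R -> R) : continuous psi ->
  forall t, 0 < t -> {for t, continuous (fun t : R => t^-1 * psi (ln t))}.
Proof.
move=> cpsi t t0; apply: cvgM; first by apply: cvgV; rewrite ?gt_eqF//; exact: cvg_id.
by apply: (continuous_comp (continuous_ln t0)); exact: cpsi.
Qed.

Let integral_shell (psi : R -> R) n : continuous psi ->
  (\int[mu]_(t in shell n) (t^-1 * psi (ln t))%:E =
   \int[mu]_(u in sym n) (psi u)%:E)%E.
Proof.
move=> cpsi; rewrite /shell /sym.
have expE : (expR : R -> R)^`()%classic = expR by apply/funext => x; rewrite derive1E derive_val.
rewrite (@integration_by_substitution_increasing _ expR (fun t : R => t^-1 * psi (ln t))).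
- apply: eq_integral => u _; congr EFin; rewrite expE !fctE /= expRK.
  by rewrite mulrAC mulVf ?mul1r// gt_eqF// expR_gt0.
- by rewrite -subr_ge0 opprK addr_ge0.
- by move=> x y _ _; rewrite ltr_expR.
- by move=> x _; rewrite expE; exact: continuous_expR.
- by rewrite expE; apply/cvg_ex; exists (expR (- n%:R)); apply: cvg_at_right_filter; exact: continuous_expR.
- by rewrite expE; apply/cvg_ex; exists (expR n%:R); apply: cvg_at_left_filter; exact: continuous_expR.
- split; first by move=> x _; exact: derivable_expR.
    by apply: cvg_at_right_filter; exact: continuous_expR.
  by apply: cvg_at_left_filter; exact: continuous_expR.
- apply: continuous_in_subspaceT => t; rewrite inE /= in_itv/= => /andP[t1 _].
  by apply: continuous_log => //; exact: lt_le_trans (expR_gt0 _) t1.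
Qed.

Let cvg_integral_sym (psi : R -> R) : continuous psi -> (forall u, 0 <= psi u) ->
  (\int[mu]_(u in sym n) (psi u)%:E)%E @[n --> \oo] --> (\int[mu]_u (psi u)%:E)%E.
Proof.
move=> cpsi psi0.
have -> : [set: R] = \bigcup_n sym n.
  apply/seteqP; split => // u _; exists (Num.truncn `|u|).+1 => //=.
  by rewrite /sym /= in_itv/= -ler_norml ltW// truncnS_gt.
apply: ge0_nondecreasing_set_cvg_integral => //.
- move=> n m nm; apply/subsetPset => t; rewrite /sym /= !in_itv/= -!ler_norml => /le_trans; apply.
  by rewrite ler_nat.
- by move=> n; exact: measurable_itv.
- move=> n; apply: measurable_funTS; apply/measurable_EFinP; exact: continuous_measurable_fun.
- by move=> n u _; rewrite lee_fin.
Qed.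

Let measurable_log (psi : R -> R) : continuous psi ->
  measurable_fun (`]0, +oo[%classic : set R) (fun t : R => (t^-1 * psi (ln t))%:E).
Proof.
move=> cpsi; apply/measurable_EFinP; apply: open_continuous_measurable_fun.
  exact: interval_open.
by move=> t; rewrite inE /= in_itv/= andbT; exact: continuous_log.
Qed.

Let ge0_integral_log (psi : R -> R) : continuous psi -> (forall u, 0 <= psi u) ->
  (\int[mu]_(t in `]0%R, +oo[) (t^-1 * psi (ln t))%:E = \int[mu]_u (psi u)%:E)%E.
Proof.
move=> cpsi psi0; have H := cvg_integral_sym cpsi psi0.
apply: (cvg_unique (@ereal_hausdorff R) _ H).
rewrite (_ : (fun n => _) =
    fun n => (\int[mu]_(t in shell n) (t^-1 * psi (ln t))%:E)%E); last first.
  by apply/funext => n; rewrite integral_shell.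
rewrite -bigcup_shell; apply: ge0_nondecreasing_set_cvg_integral => //.
- by move=> n; exact: measurable_itv.
- move=> n; apply: measurable_funS (measurable_log cpsi) => //.
  by rewrite -bigcup_shell; exact: bigcup_sup.
- move=> n t; rewrite /shell /= in_itv/= => /andP[t1 _]; rewrite lee_fin mulr_ge0// invr_ge0.
  by rewrite (le_trans _ t1)// expR_ge0.
Qed.

Let measurable_logN (psi : R -> R) : continuous psi ->
  measurable_fun (`]-oo, 0[%classic : set R) (fun t : R => ((- t)^-1 * psi (ln (- t)))%:E).
Proof.
move=> cpsi; apply/measurable_EFinP; apply: open_continuous_measurable_fun.
  exact: interval_open.
move=> t; rewrite inE /= in_itv/= => t0.
apply: (@continuous_comp _ _ _ (-%R : R -> R) (fun t : R => t^-1 * psi (ln t))).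
  exact: opp_continuous.
by apply: continuous_log; rewrite ?oppr_gt0.
Qed.

Let ge0_integral_logN (psi : R -> R) : continuous psi -> (forall u, 0 <= psi u) ->
  (\int[mu]_(t in `]-oo, 0%R[) ((- t)^-1 * psi (ln (- t)))%:E = \int[mu]_u (psi u)%:E)%E.
Proof.
move=> cpsi psi0; have H := cvg_integral_sym cpsi psi0.
apply: (cvg_unique (@ereal_hausdorff R) _ H).
have shellN n : (\int[mu]_(t in -%R @^-1` shell n) ((- t)^-1 * psi (ln (- t)))%:E =
    \int[mu]_(u in sym n) (psi u)%:E)%E.
  rewrite -integral_shell// (_ : _ @^-1` _ = `[- expR n%:R, - expR (- n%:R)]%classic).
    rewrite (@integration_by_substitution_oppr _ (fun t : R => (- t)^-1 * psi (ln (- t)))).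
    - by apply: eq_integral => t _; rewrite /= opprK.
    - by rewrite ler_expR -subr_ge0 opprK addr_ge0.
    - apply: continuous_in_subspaceT => t; rewrite inE /= in_itv/= => /andP[_ t1].
      apply: (@continuous_comp _ _ _ (-%R : R -> R) (fun t : R => t^-1 * psi (ln t))).
        exact: opp_continuous.
      by apply: continuous_log => //; rewrite oppr_gt0 (le_lt_trans t1)// oppr_lt0 expR_gt0.
  apply/seteqP; split => t; rewrite /shell /= !in_itv/= => /andP[t1 t2].
    by rewrite lerNl t2 lerNr.
  by rewrite lerNr t2 lerNl.
rewrite (_ : (fun n => _) = fun n =>
    (\int[mu]_(t in -%R @^-1` shell n) ((- t)^-1 * psi (ln (- t)))%:E)%E); last first.
  by apply/funext => n; rewrite shellN.
rewrite -bigcup_Nshell; apply: ge0_nondecreasing_set_cvg_integral => //.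
- by move=> n m /shell_homo /subsetPset nm; apply/subsetPset => t /nm.
- move=> n; rewrite -[X in measurable X]setTI; apply: (@oppr_measurable R setT) => //; exact: measurable_itv.
- move=> n; apply: measurable_funS (measurable_logN cpsi) => //.
  by rewrite -bigcup_Nshell; exact: (@bigcup_sup _ _ n setT (fun n => -%R @^-1` shell n)).
- move=> n t; rewrite /shell /= in_itv/= => /andP[t1 _]; rewrite lee_fin mulr_ge0// invr_ge0.
  by rewrite (le_trans _ t1)// expR_ge0.
Qed.

Lemma continuous_funrpos (psi : R -> R) : continuous psi -> continuous (psi^\+)%R.
Proof.
move=> cpsi u.
by apply: (@continuous_max R R psi (cst 0) u); [exact: cpsi|exact: cvg_cst].
Qed.

Lemma continuous_funrneg (psi : R -> R) : continuous psi -> continuous (psi^\-)%R.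
Proof.
move=> cpsi u; apply: (@continuous_max R R (fun u => - psi u) (cst 0) u).
  by apply: cvgN; exact: cpsi.
exact: cvg_cst.
Qed.

(** The substitution is made on the compact sets [exp (-n), exp n], extended by monotone convergence
    to nonnegative integrands, and then applied to the positive and negative parts. *)
Lemma integral_log (psi : R -> R) : continuous psi ->
  (\int[mu]_(t in `]0%R, +oo[) (t^-1 * psi (ln t))%:E = \int[mu]_u (psi u)%:E)%E.
Proof.
move=> cpsi; rewrite [LHS]integralE [RHS]integralE; congr (_ - _)%E.
  rewrite [RHS](_ : _ = \int[mu]_u ((psi^\+)%R u)%:E)%E; last first.
    by apply: eq_integral => u _; rewrite funeposE /funrpos EFin_max.
  rewrite -ge0_integral_log; [|exact: continuous_funrpos|exact: funrpos_ge0].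
  apply: eq_integral => t; rewrite inE /= in_itv/= andbT => t0.
  by rewrite funeposE -EFin_max /funrpos maxr_pMr ?mulr0 ?invr_ge0 ?ltW.
rewrite [RHS](_ : _ = \int[mu]_u ((psi^\-)%R u)%:E)%E; last first.
  by apply: eq_integral => u _; rewrite funenegE /funrneg EFin_max.
rewrite -ge0_integral_log; [|exact: continuous_funrneg|exact: funrneg_ge0].
apply: eq_integral => t; rewrite inE /= in_itv/= andbT => t0.
by rewrite funenegE -EFinN -EFin_max /funrneg maxr_pMr ?mulr0 ?mulrN ?invr_ge0 ?ltW.
Qed.

Lemma integral_logN (psi : R -> R) : continuous psi ->
  (\int[mu]_(t in `]-oo, 0%R[) ((- t)^-1 * psi (ln (- t)))%:E = \int[mu]_u (psi u)%:E)%E.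
Proof.
move=> cpsi; rewrite [LHS]integralE [RHS]integralE; congr (_ - _)%E.
  rewrite [RHS](_ : _ = \int[mu]_u ((psi^\+)%R u)%:E)%E; last first.
    by apply: eq_integral => u _; rewrite funeposE /funrpos EFin_max.
  rewrite -ge0_integral_logN; [|exact: continuous_funrpos|exact: funrpos_ge0].
  apply: eq_integral => t; rewrite inE /= in_itv/= => t0.
  by rewrite funeposE -EFin_max /funrpos maxr_pMr ?mulr0 ?invr_ge0 ?oppr_ge0 ?ltW.
rewrite [RHS](_ : _ = \int[mu]_u ((psi^\-)%R u)%:E)%E; last first.
  by apply: eq_integral => u _; rewrite funenegE /funrneg EFin_max.
rewrite -ge0_integral_logN; [|exact: continuous_funrneg|exact: funrneg_ge0].
apply: eq_integral => t; rewrite inE /= in_itv/= => t0.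
by rewrite funenegE -EFinN -EFin_max /funrneg maxr_pMr ?mulr0 ?mulrN ?invr_ge0 ?oppr_ge0 ?ltW.
Qed.

End LogarithmicSubstitution.

(** * Polar coordinates and contour integrals *)

Section Polar.
Context {R : realType}.

Lemma is_derive_approx (f : R -> R) (x df : R) : is_derive x 1 f df ->
  forall e : R, 0 < e -> exists2 d : R, 0 < d &
    forall h, `|h| < d -> `|f (x + h) - f x - h * df| <= e * `|h|.
Proof.
move=> [fx dfx] e e0; move: fx; rewrite /derivable -/(derive f x 1) => fx.
have : h^-1 *: (f (h *: 1 + x) - f x) @[h --> 0^'] --> df.
  by rewrite -dfx; exact: fx.
move=> /cvgrPdist_le /(_ e e0) [d /= d0 dP]; exists d => // h hd.
have [->|h0] := eqVneq h 0; first by rewrite addr0 subrr mul0r subr0 normr0 mulr0.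
have := dP h; rewrite /= sub0r normrN => /(_ hd h0).
rewrite /GRing.scale /= mulr1 => H.
rewrite (_ : _ - _ - _ = - (h * (df - h^-1 * (f (h + x) - f x)))); last first.
  by rewrite (addrC x); field.
by rewrite normrN normrM mulrC ler_wpM2r.
Qed.

(** The exponential of [u +i* a]. In these coordinates sectors become horizontal strips, rays become
    lines, and dz / z becomes du along a ray. *)
Definition polar (u a : R) : R[i] := (expR u)%:C * cis a.

Lemma cisD (a b : R) : cis (a + b) = cis a * cis b.
Proof. by rewrite /cis cosD sinD; simpc; congr (_ +i* _); rewrite addrC mulrC (mulrC (sin b)). Qed.

Lemma cis0 : cis 0 = 1 :> R[i]. Proof. by rewrite /cis cos0 sin0. Qed.

Lemma rnorm_cis (a : R) : rnorm (cis a) = 1.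
Proof. by rewrite /rnorm normc_def /= cos2Dsin2 sqrtr1. Qed.

Lemma rnorm_polar (u a : R) : rnorm (polar u a) = expR u.
Proof. by rewrite rnormM rnorm_cis mulr1 rnorm_real gtr0_norm ?expR_gt0. Qed.

Lemma polar_neq0 (u a : R) : polar u a != 0.
Proof. by rewrite -rnorm_eq0 rnorm_polar gt_eqF ?expR_gt0. Qed.

Lemma polarD (u v a b : R) : polar (u + v) (a + b) = polar u a * polar v b.
Proof. by rewrite /polar expRD real_complexM cisD; ring. Qed.

Lemma polar00 : polar 0 0 = 1. Proof. by rewrite /polar expR0 cis0 mulr1. Qed.

Lemma Re_polar (u a : R) : complex.Re (polar u a) = expR u * cos a.
Proof. by rewrite /polar /cis; simpc. Qed.

Lemma Im_polar (u a : R) : complex.Im (polar u a) = expR u * sin a.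
Proof. by rewrite /polar /cis; simpc. Qed.

Lemma cis_approx (e : R) : 0 < e -> exists2 d : R, 0 < d &
  forall t : R, `|t| < d -> rnorm (cis t - 1 - 'i%C * t%:C) <= e * `|t|.
Proof.
move=> e0; have e2 : 0 < e / 2 by rewrite divr_gt0.
have [d1 d10 H1] := is_derive_approx (is_derive_cos 0) e2.
have [d2 d20 H2] := is_derive_approx (is_derive_sin 0) e2.
exists (Num.min d1 d2) => [|t]; first by rewrite lt_min d10.
rewrite lt_min => /andP[/H1 + /H2]; rewrite !add0r cos0 sin0 oppr0 mulr0 mulr1 !(subr0, addr0) => {}H1 {}H2.
rewrite (le_trans (rnorm_le_ReIm _))//.
have -> : cis t - 1 - 'i%C * t%:C = (cos t - 1) +i* (sin t - t).
  rewrite [RHS]complexE (complexE (cis t)) /= !real_complexB real_complex1. ring.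
by rewrite /= (le_trans (lerD H1 H2))// -mulrDl -splitr.
Qed.

(** This is the first-order expansion of the exponential. The factor 3 in [k] leaves room for the
    three remainders, two proportional to [s] and one to [t], into which the error factors after
    [polar u a] is taken out. *)
Lemma polar_approx (u a e : R) : 0 < e -> exists2 d : R, 0 < d &
  forall s t : R, `|s| < d -> `|t| < d ->
    rnorm (polar (u + s) (a + t) - polar u a - (s +i* t) * polar u a)
      <= e * (`|s| + `|t|).
Proof.
move=> e0; pose k := e / (3 * expR u).
have k0 : 0 < k by rewrite divr_gt0// mulr_gt0// expR_gt0.
have [d1 d10 H1] := is_derive_approx (is_derive_expR 0) k0.
have [d2 d20 H2] := cis_approx k0.
have [d3 d30 H3] := cis_approx (ltr01 : 0 < 1 :> R).
exists (Num.min (Num.min d1 d2) (Num.min d3 (k / 2))) => [|s t].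
  by rewrite !lt_min d10 d20 d30 divr_gt0.
rewrite !lt_min => /andP[/andP[s1 _] _] /andP[/andP[_ t2] /andP[t3 tk]].
have {}H1 := H1 _ s1; rewrite add0r expR0 mulr1 in H1.
have {}H2 := H2 _ t2; have {}H3 := H3 _ t3.
have cis1 : rnorm (cis t - 1) <= k.
  rewrite -(subrK ('i%C * t%:C) (cis t - 1)) (le_trans (ler_rnormD _ _))//.
  rewrite rnormM rnormi mul1r rnorm_real (le_trans (lerD H3 (lexx _)))//.
  by rewrite mul1r -mulr2n -mulr_natr -ler_pdivlMr// ltW.
have -> : polar (u + s) (a + t) - polar u a - (s +i* t) * polar u a =
    polar u a * ((expR s - 1 - s)%:C * cis t + s%:C * (cis t - 1) +
                 (cis t - 1 - 'i%C * t%:C)).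
  rewrite polarD {2}/polar !real_complexB real_complex1.
  have -> : s +i* t = s%:C + 'i%C * t%:C by rewrite [LHS]complexE.
  by ring.
rewrite rnormM rnorm_polar.
apply: (@le_trans _ _ (expR u * (k * `|s| + k * `|s| + k * `|t|))).
  rewrite ler_pM2l ?expR_gt0//.
  rewrite (le_trans (ler_rnormD _ _))// lerD// (le_trans (ler_rnormD _ _))// lerD//.
    by rewrite rnormM rnorm_cis mulr1 rnorm_real.
  by rewrite rnormM rnorm_real mulrC ler_wpM2r.
have -> : expR u * (k * `|s| + k * `|s| + k * `|t|) =
    e * ((2 * `|s| + `|t|) / 3).
  by rewrite /k; field; rewrite gt_eqF ?expR_gt0.
rewrite ler_pM2l// ler_pdivrMr//.
by have := normr_ge0 s; have := normr_ge0 t; lra.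
Qed.

End Polar.

Section ContourIntegral.
Context {R : realType} {V : completeNormedModType R[i]}.
Notation mu := (@lebesgue_measure R).
Notation bint F := (bochner_integral mu F).

Definition decaying (C s : R) (F : R -> V) :=
  [/\ 0 < s, continuous F & forall u, rnorm (F u) <= C * edecay s u].

Lemma decaying_ge0 C s F : decaying C s F -> 0 <= C.
Proof.
move=> [_ _ /(_ 0)]; rewrite /edecay normr0 mulr0 expR0 mulr1.
by apply: le_trans; exact: rnorm_ge0.
Qed.

Lemma decaying_dominated C s F : decaying C s F -> dominated_continuous F.
Proof.
move=> dF; have C0 := decaying_ge0 dF; have [s0 cF Fle] := dF.
split; first by move=> t _; exact: cF.
exists (fun u => C * edecay s u); split => //.
- apply: measurable_funM => //; apply: continuous_measurable_fun.
  exact: continuous_edecay.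
- by move=> t; rewrite mulr_ge0// edecay_ge0.
- exact: (integrableZl measurableT C (integrable_edecay s0)).
Qed.

Lemma decayingD C1 C2 s F G : decaying C1 s F -> decaying C2 s G ->
  decaying (C1 + C2) s (fun u => F u + G u).
Proof.
move=> [s0 cF Fle] [_ cG Gle]; split => // [u|u].
  by apply: cvgD; [exact: cF|exact: cG].
by rewrite mulrDl (le_trans (ler_rnormD _ _))// lerD.
Qed.

Lemma decayingN C s F : decaying C s F -> decaying C s (fun u => - F u).
Proof.
by move=> [s0 cF Fle]; split => // u; [apply: cvgN; exact: cF|rewrite rnormN].
Qed.

Lemma decayingB C1 C2 s F G : decaying C1 s F -> decaying C2 s G ->
  decaying (C1 + C2) s (fun u => F u - G u).
Proof. by move=> dF /decayingN; exact: decayingD. Qed.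

Definition edecay_mass (s : R) := \int[mu]_u edecay s u.

Lemma rnorm_bint_decaying C s F : decaying C s F ->
  rnorm (bint F) <= C * edecay_mass s.
Proof.
move=> dF; have C0 := decaying_ge0 dF; have [s0 cF Fle] := dF.
rewrite /edecay_mass -RintegralZl//; last exact: integrable_edecay.
apply: rnorm_bint => //.
- exact: decaying_dominated dF.
- by move=> t; rewrite mulr_ge0// edecay_ge0.
- exact: (integrableZl measurableT C (integrable_edecay s0)).
Qed.

Section LogBochner.
Variables (C s : R) (fm fp : R -> V) (dm : decaying C s fm) (dp : decaying C s fp).
Variable G : R -> V.
Hypothesis Gpos : forall t, 0 < t -> G t = (t^-1)%:C *: fm (ln t).
Hypothesis Gneg : forall t, t < 0 -> G t = - ((- t)^-1)%:C *: fp (ln (- t)).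

Let continuous_scale_log (f : R -> V) t : continuous f -> 0 < t ->
  {for t, continuous (fun t : R => (t^-1)%:C *: f (ln t))}.
Proof.
move=> cf t0; apply: cvgZ; last first.
  by apply: (@continuous_comp _ _ _ (@ln R) f); [exact: continuous_ln|exact: cf].
apply/(@cvg_rnormP R R[i]^o) => e e0.
have /cvgrPdist_lt /(_ e e0) : x^-1 @[x --> t] --> t^-1.
  by apply: cvgV; [rewrite gt_eqF|exact: cvg_id].
apply: filterS => x; rewrite /= -real_complexB rnorm_real distrC; exact.
Qed.

Let continuousG t : t != 0 -> {for t, continuous G}.
Proof.
have [_ cm _] := dm; have [_ cp _] := dp.
move=> t0; have [tneg|tpos] := ltP t 0.
  have : {for t, continuous (fun t : R => - (((- t)^-1)%:C *: fp (ln (- t))))}.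
    apply: cvgN.
    apply: (@continuous_comp _ _ _ (-%R : R -> R) (fun t : R => (t^-1)%:C *: fp (ln t))).
      exact: opp_continuous.
    by apply: continuous_scale_log => //; rewrite oppr_gt0.
  rewrite /prop_for /continuous_at -[in X in _ --> X -> _]scaleNr -Gneg//; apply: cvg_trans; apply: near_eq_cvg.
  by near=> x; rewrite Gneg ?scaleNr//; near: x; exact: lt_nbhsl.
have {}tpos : 0 < t by rewrite lt_def t0.
have : {for t, continuous (fun t : R => (t^-1)%:C *: fm (ln t))}.
  exact: continuous_scale_log.
rewrite /prop_for /continuous_at -Gpos//; apply: cvg_trans; apply: near_eq_cvg.
by near=> x; rewrite Gpos//; near: x; exact: lt_nbhsr.
Unshelve. all: by end_near.
Qed.

Let bound (t : R) := C * (`|t|^-1 * edecay s (ln `|t|)).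

Let C0 : 0 <= C. Proof. exact: decaying_ge0 dm. Qed.

Let bound_ge0 t : 0 <= bound t.
Proof. by rewrite !mulr_ge0// ?invr_ge0// edecay_ge0. Qed.

Let rnormG t : t != 0 -> rnorm (G t) <= bound t.
Proof.
have [_ _ lem] := dm; have [_ _ lep] := dp.
move=> t0; rewrite /bound mulrCA; have [tneg|tpos] := ltP t 0.
  have nt : 0 < - t by rewrite oppr_gt0.
  rewrite Gneg// scaleNr rnormN rnormZr gtr0_norm ?invr_gt0//.
  by rewrite ltr0_norm// ler_wpM2l ?invr_ge0// ltW.
have {}tpos : 0 < t by rewrite lt_def t0.
rewrite Gpos// rnormZr gtr0_norm ?invr_gt0//.
by rewrite gtr0_norm// ler_wpM2l ?invr_ge0// ltW.
Qed.

Let setT_split : [set: R] = [set 0] `|` (`]-oo, 0[ `|` `]0, +oo[).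
Proof.
apply/seteqP; split => // t _; have [t0|t0|->] := ltgtP t 0; [right; left|right; right|by left];
  by rewrite /= in_itv/= ?andbT.
Qed.

Let integral_split (f : R -> R) : measurable_fun setT f ->
  (\int[mu]_t (f t)%:E = \int[mu]_(t in `]-oo, 0%R[) (f t)%:E +
    \int[mu]_(t in `]0%R, +oo[) (f t)%:E)%E.
Proof.
move=> mf; have mEf : measurable_fun setT (EFin \o f) by exact/measurable_EFinP.
have mU : measurable (`]-oo, 0[%classic `|` `]0, +oo[%classic : set R).
  by apply: measurableU; exact: measurable_itv.
rewrite setT_split (integral_setU mu (measurable_set1 0) mU).
- rewrite integral_set1 add0e integral_setU//.
  + exact: measurable_funS mEf.
  + rewrite disj_set2E; apply/eqP/seteqP; split => // t [].
    by rewrite /= !in_itv/= andbT => t1 /(lt_trans t1); rewrite ltxx.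
- by rewrite -setT_split.
- rewrite disj_set2E; apply/eqP/seteqP; split => // t [-> []];
    by rewrite /= in_itv/= ?ltxx.
Qed.

Let measurable_bound : measurable_fun setT bound.
Proof.
apply: measurable_continuous_off0 => t t0; apply: cvgMr.
have nt : 0 < `|t| by rewrite normr_gt0.
apply: (@continuous_comp _ _ _ (fun t : R => `|t|) (fun x : R => x^-1 * edecay s (ln x))).
  exact: norm_continuous.
apply: cvgM; first by apply: cvgV; [rewrite gt_eqF|exact: cvg_id].
by apply: (continuous_comp (continuous_ln nt)); exact: continuous_edecay.
Qed.

Lemma dominated_continuous_log : dominated_continuous G.
Proof.
have [s0 _ _] := dm.
split; first exact: continuousG.
exists bound; split => //.
apply/integrableP; split; first exact/measurable_EFinP.
under eq_integral do rewrite /= ger0_norm//.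
rewrite integral_split//.
have ce : continuous (fun u => C * edecay s u).
  by move=> u; apply: cvgMr; exact: continuous_edecay.
have fin : (\int[mu]_u (C * edecay s u)%:E < +oo)%E.
  have /integrableP[_] := integrableZl measurableT C (integrable_edecay s0).
  by under eq_integral do rewrite /= ger0_norm ?mulr_ge0 ?edecay_ge0//.
rewrite lte_add_pinfty//.
  rewrite (_ : (\int[mu]_(x in _) _)%E = (\int[mu]_u (C * edecay s u)%:E)%E)//.
  rewrite -(integral_logN ce); apply: eq_integral => t; rewrite inE /= in_itv/= => t0.
  by rewrite /bound ltr0_norm// mulrCA.
rewrite (_ : (\int[mu]_(x in _) _)%E = (\int[mu]_u (C * edecay s u)%:E)%E)//.
rewrite -(integral_log ce); apply: eq_integral => t; rewrite inE /= in_itv/= andbT => t0.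
by rewrite /bound gtr0_norm// mulrCA.
Qed.

(** The factors 1 / |t| in [Gpos] and [Gneg] compensate the Jacobians of t = exp u and t = - exp u;
    the minus sign of [Gneg] is the one of the incoming ray. *)
Lemma bint_log : bint G = bint (fun u => fm u - fp u).
Proof.
have [_ cm _] := dm; have [_ cp _] := dp.
have dG := dominated_continuous_log.
have dB := decaying_dominated (decayingB dm dp).
apply: bint_eqP => // l lP; rewrite bint_functional//.
have lm := integrable_functional (decaying_dominated dm) lP.
have lp := integrable_functional (decaying_dominated dp) lP.
under eq_Rintegral do rewrite (rfunctionalB lP).
rewrite RintegralB// /Rintegral [in RHS]integral_split; last exact: measurable_functional.
have -> : (\int[mu]_(t in `]0%R, +oo[) (l (G t))%:E = \int[mu]_u (l (fm u))%:E)%E.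
  have clm : continuous (fun u => l (fm u)).
    by move=> u; apply: (rfunctional_cvg lP); exact: cm.
  rewrite -(integral_log clm).
  apply: eq_integral => t; rewrite inE /= in_itv/= andbT => t0.
  by rewrite Gpos// (rfunctionalZ lP).
have -> : (\int[mu]_(t in `]-oo, 0%R[) (l (G t))%:E = \int[mu]_u (- l (fp u))%:E)%E.
  have clp : continuous (fun u => - l (fp u)).
    by move=> u; apply: cvgN; apply: (rfunctional_cvg lP); exact: cp.
  rewrite -(integral_logN clp).
  apply: eq_integral => t; rewrite inE /= in_itv/= => t0.
  by rewrite Gneg// scaleNr -scalerN (rfunctionalZ lP) (rfunctionalN lP).
have f1 : (\int[mu]_u (l (fm u))%:E)%E \is a fin_num.
  exact: (integrable_fin_num measurableT lm).
have f2 : (\int[mu]_u (l (fp u))%:E)%E \is a fin_num.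
  exact: (integrable_fin_num measurableT lp).
have -> : (\int[mu]_u (- l (fp u))%:E = - \int[mu]_u (l (fp u))%:E)%E.
  by rewrite -integralN//; exact: integrable_add_def.
have aux (a b : \bar R) : a \is a fin_num -> b \is a fin_num ->
    fine a - fine b = fine (- b + a)%E.
  by move=> /fineK <- /fineK <-; rewrite /= addrC.
exact: aux.
Qed.

End LogBochner.

(** Along a ray dz = z du, whence the weights [polar u nu] and [polar u (- nu)]. The lower ray is
    traversed outwards and counts positively, the upper one inwards and counts negatively. *)
Lemma contour_integralE (nu C s : R) (F : R[i]^o -> V) :
  decaying C s (fun u => polar u nu *: F (polar u nu)) ->
  decaying C s (fun u => polar u (- nu) *: F (polar u (- nu))) ->
  contour_integral nu F =
  bint (fun u => polar u (- nu) *: F (polar u (- nu)) - polar u nu *: F (polar u nu)).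
Proof.
move=> dp dm; apply: (bint_log dm dp) => t t0.
  rewrite /bdpath /bdpath' ltNge ltW//= gtr0_norm//.
  by rewrite /polar lnK// scalerA mulrA -real_complexM mulVf ?gt_eqF// mul1r.
rewrite /bdpath /bdpath' t0 ltr0_norm// /polar lnK ?posrE ?oppr_gt0//.
rewrite scalerA mulNr mulrA -real_complexM mulVf ?mul1r// gt_eqF// oppr_gt0//.
Qed.

End ContourIntegral.

(** * Goursat's theorem *)

Section Goursat.
Context {R : realType}.
Notation mu := (@lebesgue_measure R).
Notation integ f a b := (\int[mu]_(x in `[a, b]) f x).

Definition continuous_on_itv (f : R -> R) a b :=
  forall x, a <= x <= b -> {for x, continuous f}.

Notation cont := continuous_on_itv.

Lemma continuous_itv_integrable f a b : cont f a b -> mu.-integrable `[a, b] (EFin \o f).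
Proof.
move=> cf; apply: continuous_compact_integrable; first exact: segment_compact.
apply: continuous_in_subspaceT => x; rewrite inE /= in_itv/=; exact: cf.
Qed.

Lemma Rintegral_itv_split f a c b : cont f a b -> a <= c <= b ->
  integ f a b = integ f a c + integ f c b.
Proof.
move=> cf /andP[ac cb].
have ifab := continuous_itv_integrable cf.
have := @Rintegral_itvB _ f (BLeft a) (BRight b) c ifab ac cb.
rewrite Rintegral_itv_obnd_cbnd; last first.
  apply: integrableS ifab => //; apply: subset_itvr; exact: ac.
by move=> <-; rewrite addrC subrK.
Qed.

Let integB f g a b : cont f a b -> cont g a b ->
  integ (fun x => f x - g x) a b = integ f a b - integ g a b.
Proof. by move=> cf cg; rewrite RintegralB//; exact: continuous_itv_integrable. Qed.

Lemma Rintegral_itv_near_cst f c k a b : a <= b -> cont f a b ->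
  (forall x, a <= x <= b -> `|f x - c| <= k) ->
  `|integ f a b - c * (b - a)| <= k * (b - a).
Proof.
move=> ab cf fk.
have mab : fine (mu `[a, b]) = b - a.
  rewrite lebesgue_measure_itv/= lte_fin; case: ltgtP ab => // -> _.
  by rewrite subrr.
have cstE d : integ (fun=> d) a b = d * (b - a) by rewrite Rintegral_cst// mab.
have ccst d : cont (fun=> d) a b by move=> x _; exact: cvg_cst.
have cB : cont (fun x => f x - c) a b by move=> x xab; apply: cvgB; [exact: cf|exact: cvg_cst].
rewrite -!cstE -integB// (le_trans (le_normr_Rintegral _ (continuous_itv_integrable cB)))//.
apply: le_Rintegral => //.
- apply: (@continuous_itv_integrable (fun x => `|f x - c|)) => x xab.
  by apply: cvg_norm; exact: cB.
- exact: continuous_itv_integrable.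
Qed.

Let itv_sub (a b c d x : R) : a <= c -> d <= b -> c <= x -> x <= d -> a <= x <= b.
Proof. by move=> ac db cx xd; rewrite (le_trans ac)// (le_trans xd). Qed.

Let dist_itv (a d x y : R) : a <= x <= a + d -> a <= y <= a + d -> `|x - y| <= d.
Proof. by move=> /andP[x1 x2] /andP[y1 y2]; rewrite ler_norml; lra. Qed.

Let itv_end (x d : R) : 0 <= d -> x <= x <= x + d /\ x <= x + d <= x + d.
Proof. by move=> d0; rewrite !lexx lerDl d0. Qed.

Let norm4_lt (a b c d k : R) : `|a| < k -> `|b| < k -> `|c| < k -> `|d| < k ->
  `|a + b + c + d| < k + k + k + k.
Proof. by rewrite !ltr_norml; lra. Qed.

Variables P Q : R -> R -> R.

(* The form P du + Q da is closed at (u, a), and its coefficients are differentiable there. *)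
Definition closed_form_at (u a : R) := exists p q r : R, forall e, 0 < e ->
  exists2 d, 0 < d & forall s t, `|s| < d -> `|t| < d ->
    `|P (u + s) (a + t) - P u a - (p * s + q * t)| <= e * (`|s| + `|t|) /\
    `|Q (u + s) (a + t) - Q u a - (q * s + r * t)| <= e * (`|s| + `|t|).

Lemma closed_form_continuous u a : closed_form_at u a ->
  [/\ {for u, continuous (fun u => P u a)} & {for a, continuous (Q u)}].
Proof.
move=> [p [q [r H]]].
have [d d0 dP] := H 1 ltr01.
have lin (f : R -> R) x k : (forall s, `|s| < d -> `|f (x + s) - f x - k * s| <= `|s|) ->
    {for x, continuous f}.
  move=> fk; apply/cvgrPdist_lt => e e0.
  exists (Num.min d (e / (1 + `|k|))) => [|y /=]; first by rewrite /= lt_min d0 divr_gt0// ltr_pwDl.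
  rewrite lt_min ltr_pdivlMr ?ltr_pwDl// distrC => /andP[yd ye].
  have := fk _ yd; rewrite (_ : x + (y - x) = y) => [fy|]; last by ring.
  apply: le_lt_trans ye.
  rewrite (distrC (f x)) -(subrK (k * (y - x)) (f y - f x)) (le_trans (ler_normD _ _))//.
  by rewrite [leRHS]mulrDr mulr1 lerD// normrM mulrC.
split.
  apply: (lin (P^~ a) u p) => s sd; have := dP s 0 sd; rewrite normr0 d0 => /(_ isT)[+ _].
  by rewrite !addr0 mulr0 addr0 mul1r.
apply: (lin (Q u) a r) => s sd; have := dP 0 s; rewrite normr0 d0 => /(_ isT sd)[_].
by rewrite !addr0 mulr0 !add0r mul1r.
Qed.

(** The circulation of the form P du + Q da around the rectangle with lower left corner (x, y),
    width [w] and height [h]. *)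
Let circ x y w h :=
  integ (P^~ y) x (x + w) - integ (P^~ (y + h)) x (x + w) +
  integ (Q (x + w)) y (y + h) - integ (Q x) y (y + h).

Variables x0 y0 w0 h0 : R.
Hypotheses (w0_gt0 : 0 < w0) (h0_gt0 : 0 < h0).
Hypothesis PQ : forall u a, x0 <= u <= x0 + w0 -> y0 <= a <= y0 + h0 -> closed_form_at u a.

Let inside x y w h := [/\ x0 <= x, x + w <= x0 + w0, y0 <= y & y + h <= y0 + h0].

Let circ_split x y w h : inside x y w h -> 0 <= w -> 0 <= h ->
  circ x y w h = circ x y (w / 2) (h / 2) + circ (x + w / 2) y (w / 2) (h / 2) +
    circ x (y + h / 2) (w / 2) (h / 2) + circ (x + w / 2) (y + h / 2) (w / 2) (h / 2).
Proof.
move=> [x1 x2 y1 y2] w1 h1.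
have cP a : y <= a <= y + h -> cont (P^~ a) x (x + w).
  move=> /andP[a1 a2] u /andP[u1 u2]; have [] // := @closed_form_continuous u a.
  by apply: PQ; [apply: (itv_sub x1 x2)|apply: (itv_sub y1 y2)].
have cQ u : x <= u <= x + w -> cont (Q u) y (y + h).
  move=> /andP[u1 u2] a /andP[a1 a2]; have [] // := @closed_form_continuous u a.
  by apply: PQ; [apply: (itv_sub x1 x2)|apply: (itv_sub y1 y2)].
have xw : x + w = x + w / 2 + w / 2 by rewrite -addrA -splitr.
have yh : y + h = y + h / 2 + h / 2 by rewrite -addrA -splitr.
have mx : x <= x + w / 2 <= x + w by apply/andP; split; lra.
have my : y <= y + h / 2 <= y + h by apply/andP; split; lra.
rewrite /circ -xw -yh.
rewrite (@Rintegral_itv_split (P^~ y) x (x + w / 2) (x + w))//; last by apply: cP; lra.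
rewrite (@Rintegral_itv_split (P^~ (y + h)) x (x + w / 2) (x + w))//; last by apply: cP; lra.
rewrite (@Rintegral_itv_split (Q (x + w)) y (y + h / 2) (y + h))//; last by apply: cQ; lra.
rewrite (@Rintegral_itv_split (Q x) y (y + h / 2) (y + h))//; last by apply: cQ; lra.
by lra.
Qed.

(** The affine parts of [P] and [Q] at (u, a) contribute - q h w and q w h, which cancel because the
    cross derivative is common to both. What remains is at most e / 2 (w + h) on each side of the
    rectangle, hence e (w + h) w + e (w + h) h in total. *)
Let circ_small u a e : closed_form_at u a -> 0 < e -> exists2 d, 0 < d &
  forall x y w h, inside x y w h -> 0 < w < d -> 0 < h < d ->
    x <= u <= x + w -> y <= a <= y + h -> `|circ x y w h| <= e * (w + h) ^+ 2.
Proof.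
move=> [p [q [r H]]] e0; have e2 : 0 < e / 2 by rewrite divr_gt0.
have [d d0 dPQ] := H _ e2; exists d => // x y w h [x1 x2 y1 y2] /andP[w1 w2] /andP[h1 h2].
move=> /andP[u1 u2] /andP[a1 a2].
have dist v b : x <= v <= x + w -> y <= b <= y + h ->
    `|P v b - P u a - (p * (v - u) + q * (b - a))| <= e / 2 * (w + h) /\
    `|Q v b - Q u a - (q * (v - u) + r * (b - a))| <= e / 2 * (w + h).
  move=> /andP[v1 v2] /andP[b1 b2].
  have vw : `|v - u| <= w by apply: (@dist_itv x); rewrite ?v1 ?v2 ?u1 ?u2.
  have bh : `|b - a| <= h by apply: (@dist_itv y); rewrite ?b1 ?b2 ?a1 ?a2.
  have := dPQ (v - u) (b - a) (le_lt_trans vw w2) (le_lt_trans bh h2).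
  rewrite !(addrC _ (_ - _)) !subrK => -[Hp Hq].
  have le : e / 2 * (`|v - u| + `|b - a|) <= e / 2 * (w + h).
    by rewrite ler_pM2l// lerD.
  by split; [exact: le_trans Hp le|exact: le_trans Hq le].
have cP b : y <= b <= y + h -> cont (P^~ b) x (x + w).
  move=> /andP[b1 b2] v /andP[v1 v2]; have [] // := @closed_form_continuous v b.
  by apply: PQ; [apply: (itv_sub x1 x2)|apply: (itv_sub y1 y2)].
have cQ v : x <= v <= x + w -> cont (Q v) y (y + h).
  move=> /andP[v1 v2] b /andP[b1 b2]; have [] // := @closed_form_continuous v b.
  by apply: PQ; [apply: (itv_sub x1 x2)|apply: (itv_sub y1 y2)].
have [y0h y1h] := itv_end y (ltW h1); have [x0w x1w] := itv_end x (ltW w1).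
have HP : `|integ (fun v => P v y - P v (y + h)) x (x + w) - - (q * h) * (x + w - x)|
    <= e * (w + h) * (x + w - x).
  apply: Rintegral_itv_near_cst => [|v xv|v xv]; first by rewrite lerDl ltW.
    by apply: cvgB; exact: cP.
  have [A _] := dist v _ xv y0h; have [B _] := dist v _ xv y1h.
  rewrite (_ : _ - _ = (P v y - P u a - (p * (v - u) + q * (y - a))) -
    (P v (y + h) - P u a - (p * (v - u) + q * (y + h - a)))); last by ring.
  by rewrite (le_trans (ler_normB _ _))// (le_trans (lerD A B))// -mulrDl -splitr.
have HQ : `|integ (fun b => Q (x + w) b - Q x b) y (y + h) - (q * w) * (y + h - y)|
    <= e * (w + h) * (y + h - y).
  apply: Rintegral_itv_near_cst => [|b yb|b yb]; first by rewrite lerDl ltW.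
    by apply: cvgB; exact: cQ.
  have [_ A] := dist _ b x1w yb; have [_ B] := dist _ b x0w yb.
  rewrite (_ : _ - _ = (Q (x + w) b - Q u a - (q * (x + w - u) + r * (b - a))) -
    (Q x b - Q u a - (q * (x - u) + r * (b - a)))); last by ring.
  by rewrite (le_trans (ler_normB _ _))// (le_trans (lerD A B))// -mulrDl -splitr.
rewrite integB in HP; [|exact: cP|exact: cP].
rewrite integB in HQ; [|exact: cQ|exact: cQ].
rewrite /circ; move: HP HQ; 
set A := integ (P^~ y) x (x + w); set B := integ (P^~ (y + h)) x (x + w).
set C := integ (Q (x + w)) y (y + h); set D := integ (Q x) y (y + h) => HP HQ.
rewrite (_ : A - B + C - D = (A - B - - (q * h) * (x + w - x)) +
  (C - D - q * w * (y + h - y))); last by ring.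
rewrite (le_trans (ler_normD _ _))// (le_trans (lerD HP HQ))//.
by rewrite le_eqVlt; apply/orP; left; apply/eqP; ring.
Qed.

Let w n : R := w0 / 2 ^+ n.
Let h n : R := h0 / 2 ^+ n.

Let wS n : w n.+1 = w n / 2.
Proof. by rewrite /w exprS invfM mulrA mulrAC. Qed.
Let hS n : h n.+1 = h n / 2.
Proof. by rewrite /h exprS invfM mulrA mulrAC. Qed.
Let w_gt0 n : 0 < w n. Proof. by rewrite divr_gt0// exprn_gt0. Qed.
Let h_gt0 n : 0 < h n. Proof. by rewrite divr_gt0// exprn_gt0. Qed.

Let c := `|circ x0 y0 w0 h0|.

Let big n (z : R * R) :=
  inside z.1 z.2 (w n) (h n) /\ c / 4 ^+ n <= `|circ z.1 z.2 (w n) (h n)|.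

(** The circulation is the sum of those around the four quarters, so one quarter carries at least a
    fourth of it. *)
Let big_step n z : big n z -> exists z', [/\ big n.+1 z', z.1 <= z'.1,
  z'.1 + w n.+1 <= z.1 + w n, z.2 <= z'.2 & z'.2 + h n.+1 <= z.2 + h n].
Proof.
case: z => x y [/= I cz]; have [x1 x2 y1 y2] := I.
have wn := w_gt0 n; have hn := h_gt0 n.
apply: contrapT => nex.
have H x' y' : x <= x' -> x' + w n.+1 <= x + w n -> y <= y' -> y' + h n.+1 <= y + h n ->
    `|circ x' y' (w n.+1) (h n.+1)| < c / 4 ^+ n.+1.
  move=> a1 a2 b1 b2; rewrite ltNge; apply/negP => H; apply: nex.
  exists (x', y'); split => //; split => //; split => //=; lra.
move: cz; apply/negP; rewrite -ltNge circ_split ?ltW// -wS -hS.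
have -> : c / 4 ^+ n = c / 4 ^+ n.+1 + c / 4 ^+ n.+1 + c / 4 ^+ n.+1 + c / 4 ^+ n.+1.
  by rewrite exprS; field; rewrite expf_neq0.
have wS' := wS n; have hS' := hS n.
by apply: norm4_lt; apply: H; lra.
Qed.

(** Goursat's bisection: a nonzero circulation c would survive as at least c / 4^n on nested
    rectangles shrinking to a point, against the quadratic bound of [circ_small] at that point. *)
Lemma goursat :
  \int[mu]_(u in `[x0, x0 + w0]) P u y0 - \int[mu]_(u in `[x0, x0 + w0]) P u (y0 + h0) +
  \int[mu]_(a in `[y0, y0 + h0]) Q (x0 + w0) a - \int[mu]_(a in `[y0, y0 + h0]) Q x0 a = 0.
Proof.
change (circ x0 y0 w0 h0 = 0).
apply/eqP; rewrite -normr_eq0 -/c; apply/eqP; apply: contrapT => /eqP c_neq0.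
have c0 : 0 < c by rewrite lt_def c_neq0 normr_ge0.
(* The choice function is total: on rectangles that are not [big] it returns the rectangle itself, a
   value never met in the sequence [z]. *)
have /choice[next nextP] : forall nz : nat * (R * R), exists z', big nz.1 nz.2 ->
    [/\ big nz.1.+1 z', nz.2.1 <= z'.1, z'.1 + w nz.1.+1 <= nz.2.1 + w nz.1,
      nz.2.2 <= z'.2 & z'.2 + h nz.1.+1 <= nz.2.2 + h nz.1].
  move=> [n z] /=.
  have [/big_step[z' z'P]|nb] := pselect (big n z); first by exists z'.
  by exists z.
pose z := fix z n := if n is m.+1 then next (m, z m) else (x0, y0).
have zbig n : big n (z n).
  elim: n => [|n /(nextP (n, _))[]//].
  by rewrite /big /w /h /= !expr0 !divr1.
have step n := nextP (n, z n) (zbig n).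
have mono1 : {homo (fun n => (z n).1) : m n / (m <= n)%N >-> m <= n}.
  by apply: homo_leq => [x //|x y t|n]; [exact: le_trans|have [] := step n].
have mono2 : {homo (fun n => (z n).2) : m n / (m <= n)%N >-> m <= n}.
  by apply: homo_leq => [x //|x y t|n]; [exact: le_trans|have [] := step n].
have anti1 : {homo (fun n => (z n).1 + w n) : m n / (m <= n)%N >-> n <= m}.
  by apply: homo_leq => [x //|x y t xy yt|n]; [exact: le_trans yt xy|have [] := step n].
have anti2 : {homo (fun n => (z n).2 + h n) : m n / (m <= n)%N >-> n <= m}.
  by apply: homo_leq => [x //|x y t xy yt|n]; [exact: le_trans yt xy|have [] := step n].
have cross1 m n : (z m).1 <= (z n).1 + w n.
  have [mn|/ltnW nm] := leqP m n.
    by rewrite (le_trans (mono1 _ _ mn))// lerDl ltW.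
  by rewrite (le_trans _ (anti1 _ _ nm))// lerDl ltW.
have cross2 m n : (z m).2 <= (z n).2 + h n.
  have [mn|/ltnW nm] := leqP m n.
    by rewrite (le_trans (mono2 _ _ mn))// lerDl ltW.
  by rewrite (le_trans _ (anti2 _ _ nm))// lerDl ltW.
pose u := sup (range (fun n => (z n).1)); pose a := sup (range (fun n => (z n).2)).
have uP n : (z n).1 <= u <= (z n).1 + w n.
  apply/andP; split.
    apply: ub_le_sup; last by exists n.
    by exists ((z 0%N).1 + w 0%N) => _ [m _ <-]; exact: cross1.
  by apply: ge_sup; [exists (z 0%N).1, 0%N|move=> _ [m _ <-]; exact: cross1].
have aP n : (z n).2 <= a <= (z n).2 + h n.
  apply/andP; split.
    apply: ub_le_sup; last by exists n.
    by exists ((z 0%N).2 + h 0%N) => _ [m _ <-]; exact: cross2.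
  by apply: ge_sup; [exists (z 0%N).2, 0%N|move=> _ [m _ <-]; exact: cross2].
have ua : closed_form_at u a.
  by have := uP 0%N; have := aP 0%N; rewrite /w /h /= expr0 !divr1 => a1 u1; exact: PQ.
(* With this [e] the bound e (w n + h n)^2 equals (c / 2) / 4^n, half of the lower bound kept by the
   bisection. *)
pose e := c / (2 * (w0 + h0) ^+ 2).
have wh0 : 0 < w0 + h0 by rewrite addr_gt0.
have e0 : 0 < e by rewrite divr_gt0// mulr_gt0// exprn_gt0.
have [d d0 dP] := circ_small ua e0.
have [n nd] : exists n, w n < d /\ h n < d.
  pose n := (Num.truncn ((w0 + h0) / d)).+1.
  have n1 : (w0 + h0) / d < 2 ^+ n.
    rewrite (lt_le_trans (truncnS_gt _))// -natrX ler_nat.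
    exact: ltnW (ltn_expl _ _).
  have n2 : (w0 + h0) / 2 ^+ n < d.
    by rewrite ltr_pdivrMr ?exprn_gt0// mulrC -ltr_pdivrMr.
  exists n; split; apply: le_lt_trans n2; rewrite ler_pM2r ?invr_gt0 ?exprn_gt0//.
    by rewrite lerDl ltW.
  by rewrite lerDr ltW.
have [In cn] := zbig n.
have : `|circ (z n).1 (z n).2 (w n) (h n)| <= e * (w n + h n) ^+ 2.
  by apply: dP => //; rewrite ?w_gt0 ?h_gt0; case: nd.
move=> /(le_trans cn); apply/negP; rewrite -ltNge.
rewrite (_ : e * _ = (c / 2) / 4 ^+ n).
  by rewrite ltr_pM2r ?invr_gt0 ?exprn_gt0// ltr_pdivrMr// ltr_pMr// ltr1n.
rewrite /e /w /h -mulrDl exprMn exprVn -exprM mulnC exprM (_ : 2 ^+ 2 = 4); last by ring.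
by field; rewrite expf_neq0// gt_eqF.
Qed.

End Goursat.

(** * Deformation of the contour *)

Section ComplexDerivative.
Context {R : realType} {V : normedModType R[i]}.

Definition cderiv (h : R[i] -> V) (z : R[i]) (dh : V) := forall e : R, 0 < e ->
  exists2 d, 0 < d & forall w : R[i], rnorm w < d ->
    rnorm (h (z + w) - h z - w *: dh) <= e * rnorm w.

Definition cdiff (h : R[i] -> V) z := exists dh, cderiv h z dh.

(** The chain rule for [h] composed with the exponential: the increments [s] and [t] enter only
    through the complex number [s +i* t]. *)
Lemma polar_cderiv h u a dh : cderiv h (polar u a) dh -> forall e : R, 0 < e ->
  exists2 d : R, 0 < d & forall s t : R, `|s| < d -> `|t| < d ->
    rnorm (h (polar (u + s) (a + t)) - h (polar u a) - (s +i* t) *: (polar u a *: dh))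
      <= e * (`|s| + `|t|).
Proof.
move=> hD e e0; set z := polar u a.
pose m := expR u + 1 + rnorm dh.
have m0 : 0 < m by rewrite !ltr_pwDl ?expR_gt0// ?addr_ge0 ?rnorm_ge0.
(* [m] bounds the increment of the exponential per unit of |s| + |t| (here [k <= 1] is used) and
   also the norm of [dh]. The remainder of [h] and that of the exponential then cost k m each, at
   most [e / 2]. *)
pose k := Num.min 1 (e / (2 * m)).
have k0 : 0 < k by rewrite lt_min ltr01 divr_gt0// mulr_gt0.
have ke : k * m <= e / 2.
  have ke : k <= e / (2 * m) by rewrite ge_min lexx orbT.
  by rewrite (le_trans (ler_wpM2r (ltW m0) ke))// invfM mulrA divfK ?gt_eqF.
have k1 : k <= 1 by rewrite ge_min lexx.
have [d1 d10 H1] := hD _ k0.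
have [d2 d20 H2] := polar_approx u a k0.
exists (Num.min d2 (d1 / (2 * m))) => [|s t]; first by rewrite lt_min d20 divr_gt0// mulr_gt0.
rewrite !lt_min => /andP[s2 s1] /andP[t2 t1].
have {}H2 := H2 _ _ s2 t2.
pose w := polar (u + s) (a + t) - z; pose r := w - (s +i* t) * z.
have rle : rnorm r <= k * (`|s| + `|t|) by exact: H2.
have st0 : 0 <= `|s| + `|t| by rewrite addr_ge0.
have wle : rnorm w <= m * (`|s| + `|t|).
  rewrite -(subrK ((s +i* t) * z) w) (le_trans (ler_rnormD _ _))//.
  rewrite rnormM rnorm_polar (@le_trans _ _ (k * (`|s| + `|t|) + (`|s| + `|t|) * expR u))//.
    by rewrite lerD// ler_wpM2r ?expR_ge0//; exact: (rnorm_le_ReIm (s +i* t)).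
  rewrite (mulrC _ (expR u)) -mulrDl ler_wpM2r// /m.
  by have := rnorm_ge0 dh; lra.
have wd : rnorm w < d1.
  rewrite (le_lt_trans wle)//.
  rewrite (@lt_le_trans _ _ (m * (d1 / (2 * m) + d1 / (2 * m))))//.
    by rewrite ltr_pM2l// ltrD.
  by rewrite le_eqVlt; apply/orP; left; apply/eqP; field; rewrite gt_eqF.
have zw : polar u a + w = polar (u + s) (a + t) by rewrite /w addrC subrK.
have {}H1 := H1 _ wd; rewrite zw in H1.
have -> : h (polar (u + s) (a + t)) - h z - (s +i* t) *: (z *: dh) =
    (h (polar (u + s) (a + t)) - h z - w *: dh) + r *: dh.
  have -> : r *: dh = w *: dh - ((s +i* t) * z) *: dh by exact: scalerBl.
  by rewrite scalerA addrA subrK.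
rewrite (le_trans (ler_rnormD _ _))// rnormZ.
apply: (@le_trans _ _ (k * (m * (`|s| + `|t|)) + k * (`|s| + `|t|) * m)).
  rewrite lerD//; first by rewrite (le_trans H1)// ler_pM2l.
  rewrite ler_pM ?rnorm_ge0// /m lerDr addr_ge0// expR_ge0.
rewrite (_ : _ + _ = (k * m + k * m) * (`|s| + `|t|)); last by ring.
by rewrite ler_wpM2r// (splitr e) lerD.
Qed.

Lemma cdiff_continuous_polar h u a : cdiff h (polar u a) ->
  {for u, continuous (fun u => h (polar u a))}.
Proof.
move=> [dh hD]; apply/cvg_rnormP => e e0.
have [d d0 H] := polar_cderiv hD ltr01.
pose m := 1 + rnorm (polar u a *: dh).
have m0 : 0 < m by rewrite ltr_pwDl ?rnorm_ge0.
exists (Num.min d (e / m)) => [|x /=]; first by rewrite /= lt_min d0 divr_gt0.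
rewrite lt_min distrC ltr_pdivlMr// => /andP[xd xe].
have := H (x - u) 0 xd; rewrite normr0 d0 addr0 mul1r => /(_ isT).
rewrite addr0 (_ : u + (x - u) = x); last by ring.
move=> H1; apply: le_lt_trans xe.
rewrite -(subrK (((x - u) +i* 0) *: (polar u a *: dh)) (_ - _)).
rewrite (le_trans (ler_rnormD _ _))// [leRHS]mulrDr mulr1 lerD//.
by rewrite [leLHS]rnormZ complexr0 rnorm_real.
Qed.

End ComplexDerivative.

Section Strip.
Context {R : realType} {V : completeNormedModType R[i]}.
Notation mu := (@lebesgue_measure R).
Notation bint F := (bochner_integral mu F).

Lemma cvg_Rintegral_sym (f : R -> R) : mu.-integrable setT (EFin \o f) ->
  \int[mu]_(u in `[- n%:R, n%:R]) f u @[n --> \oo] --> \int[mu]_u f u.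
Proof.
move=> if_; have fin := integrable_fin_num measurableT if_.
pose J n : set R := `[- n%:R, n%:R]%classic.
have mf : measurable_fun setT (EFin \o f) by exact: measurable_int if_.
have -> : (fun n => \int[mu]_(u in `[- n%:R, n%:R]) f u) =
    (fun n => fine (\int[mu]_u ((EFin \o f) \_ (J n)) u)%E).
  by apply/funext => n; rewrite /Rintegral integral_mkcond.
apply: fine_cvg; rewrite fineK//.
apply: (@dominated_cvg _ _ _ mu setT measurableT _ _ (fun u => `|(f u)%:E|%E)) => //.
- move=> n; apply/(measurable_restrictT _ _).1 => //; first exact: measurable_itv.
  exact: measurable_funTS.
- move=> u _; apply: cvg_near_cst; near=> n.
  rewrite patchE ifT// inE /J /= in_itv/= -ler_norml.
  by near: n; exact: nbhs_infty_ger.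
- exact: integrable_abse.
- by move=> n u _; rewrite patchE; case: ifPn => //= _; rewrite normr0 lee_fin.
Unshelve. all: by end_near.
Qed.

Lemma cvg_edecay (s : R) : 0 < s -> edecay s n%:R @[n --> \oo] --> 0.
Proof.
move=> s0; have e1 : `|expR (- s)| < 1 by rewrite gtr0_norm ?expR_gt0// expR_lt1 oppr_lt0.
have := cvg_expr e1; apply: cvg_trans; apply: near_eq_cvg; apply: nearW => n.
by rewrite /edecay normr_nat -expRM_natr.
Qed.

Let scale_complex (x y : R) (D : V) : (x +i* y) *: D = x%:C *: D + y%:C *: ('i%C *: D).
Proof. by rewrite [X in X *: _]complexE scalerDl scalerA mulrC. Qed.

Let scale_i_complex (x y : R) (D : V) :
  'i%C *: ((x +i* y) *: D) = x%:C *: ('i%C *: D) - y%:C *: D.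
Proof.
rewrite scale_complex scalerDr !scalerA -scaleNr; congr (_ *: _ + _ *: _).
  by rewrite mulrC.
by rewrite mulrAC -expr2 sqr_i mulN1r.
Qed.

(** Tested with a functional [l], holomorphy says that l(h) du + l(i h) da is a closed form on the
    strip. Its circulation around [-n, n] x [a1, a2] vanishes, and the vertical sides tend to 0 by
    the exponential decay. *)
Lemma strip_invariance (h : R[i] -> V) (a1 a2 C s : R) : 0 < s -> a1 < a2 ->
  (forall u a, a1 <= a <= a2 -> cdiff h (polar u a)) ->
  (forall u a, a1 <= a <= a2 -> rnorm (h (polar u a)) <= C * edecay s u) ->
  bint (fun u => h (polar u a1)) = bint (fun u => h (polar u a2)).
Proof.
move=> s0 a12 hd hC.
have dec a : a1 <= a <= a2 -> decaying C s (fun u => h (polar u a)).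
  by move=> a12'; split => // u; [apply: cdiff_continuous_polar; exact: hd|exact: hC].
have a1P : a1 <= a1 <= a2 by rewrite lexx ltW.
have a2P : a1 <= a2 <= a2 by rewrite lexx ltW.
have C0 := decaying_ge0 (dec _ a1P).
have dom a aP := decaying_dominated (dec a aP).
apply: rfunctional_inj => l lP.
apply: etrans (bint_functional (dom _ a1P) lP) _.
apply: etrans _ (esym (bint_functional (dom _ a2P) lP)).
have [c c0 cl] := rfunctional_bounded lP.
pose P u a := l (h (polar u a)); pose Q u a := l ('i%C *: h (polar u a)).
have PQ u a : a1 <= a <= a2 -> closed_form_at P Q u a.
  move=> aP; have [dh hD] := hd u a aP.
  set D := polar u a *: dh.
  (* The Cauchy-Riemann equations: [D] is the derivative of [h] in the direction u and i D in the
     direction a, so the second coefficient has derivatives l(i D) and l(i i D) = - l(D). *)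
  exists (l D), (l ('i%C *: D)), (- l D) => e e0.
  have ec : 0 < e / c by rewrite divr_gt0.
  have [d d0 H] := polar_cderiv hD ec; exists d => // x y xd yd.
  have {}H := H _ _ xd yd.
  have E : c * rnorm (h (polar (u + x) (a + y)) - h (polar u a) - (x +i* y) *: D)
      <= e * (`|x| + `|y|).
    rewrite (le_trans (ler_wpM2l (ltW c0) H))// mulrA mulrCA divff ?mulr1//.
    by rewrite gt_eqF.
  have xyE : (x +i* y) *: D = x%:C *: D + y%:C *: ('i%C *: D).
    exact: scale_complex.
  have iE : 'i%C *: ((x +i* y) *: D) = x%:C *: ('i%C *: D) - y%:C *: D.
    exact: scale_i_complex.
  split; apply: le_trans E; rewrite /P /Q -!(rfunctionalB lP).
    rewrite (_ : _ - _ = l (h (polar (u + x) (a + y)) - h (polar u a) - (x +i* y) *: D)) ?cl//.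
    by rewrite xyE !(rfunctionalB lP) (rfunctionalD lP) !(rfunctionalZ lP); ring.
  rewrite (_ : _ - _ = l ('i%C *: (h (polar (u + x) (a + y)) - h (polar u a) - (x +i* y) *: D))).
    by rewrite (le_trans (cl _))// rnormZ rnormi mul1r.
  rewrite !scalerBr iE !(rfunctionalB lP) !(rfunctionalZ lP); ring.
have iP a : a1 <= a <= a2 -> mu.-integrable setT (EFin \o (P^~ a)).
  by move=> aP; exact: (integrable_functional (dom a aP) lP).
have cvgP a (aP : a1 <= a <= a2) := cvg_Rintegral_sym (iP a aP).
pose side u := \int[mu]_(a in `[a1, a2]) Q u a.
have side_le u : `|side u| <= c * (C * edecay s u) * (a2 - a1).
  have := @Rintegral_itv_near_cst R (Q u) 0 (c * (C * edecay s u)) a1 a2.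
  rewrite mul0r subr0; apply; first exact: ltW.
  - by move=> a aP; have [] := closed_form_continuous (PQ u a aP).
  - move=> a aP; rewrite subr0 (le_trans (cl _))// ler_pM2l// rnormZ rnormi mul1r.
    exact: hC.
have edge : (fun n : nat => c * (C * edecay s n%:R) * (a2 - a1)) @ \oo --> 0.
  rewrite -(mulr0 (c * C * (a2 - a1))).
  rewrite (_ : (fun n => _) = fun n : nat => c * C * (a2 - a1) * edecay s n%:R); last first.
    by apply/funext => n; ring.
  apply: cvgMr; exact: cvg_edecay.
have side0 (sg : R) : `|sg| = 1 -> side (sg * n%:R) @[n --> \oo] --> 0.
  move=> sg1; apply/norm_cvg0P; apply: (@squeeze_cvgr _ _ _ _ (cst 0)
    (fun n : nat => c * (C * edecay s n%:R) * (a2 - a1))).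
  - apply: nearW => n; rewrite normr_ge0/= (le_trans (side_le _))//.
    by rewrite /edecay !normrM sg1 mul1r.
  - exact: cvg_cst.
  - exact: edge.
have rect n : \int[mu]_(u in `[- n%:R, n%:R]) P u a1 - \int[mu]_(u in `[- n%:R, n%:R]) P u a2
    = side (- n%:R) - side n%:R.
  case: n => [|n].
    by rewrite oppr0 subrr set_itv1 !Rintegral_set1 subrr.
  have n0 : 0 < n.+1%:R + n.+1%:R :> R by rewrite addr_gt0.
  have a0 : 0 < a2 - a1 by rewrite subr_gt0.
  have := @goursat R P Q (- n.+1%:R) a1 _ _ n0 a0.
  rewrite (addrC a1) subrK addKr => G; rewrite -[LHS]subr0 -[X in _ - X]G; last first.
    by move=> u a _; exact: PQ.
  rewrite -/(side _) -/(side (- n.+1%:R)); move: (side _) (side _) => s1 s2.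
  by set i1 := Rintegral _ _ _; set i2 := Rintegral _ _ _; move: i1 i2 => i1 i2; ring.
have lim : side (- n%:R) - side n%:R @[n --> \oo] --> 0.
  rewrite -(subrr 0); apply: cvgB.
    rewrite (_ : (fun n : nat => _) = fun n : nat => side (-1 * n%:R)).
      exact (side0 (-1) (normrN1 R)).
    by apply/funext => n; rewrite mulN1r.
  rewrite (_ : (fun n : nat => _) = fun n : nat => side (1 * n%:R)).
    exact (side0 1 (normr1 R)).
  by apply/funext => n; rewrite mul1r.
have lim2 : \int[mu]_(u in `[- n%:R, n%:R]) P u a1 -
    \int[mu]_(u in `[- n%:R, n%:R]) P u a2 @[n --> \oo] -->
    \int[mu]_u P u a1 - \int[mu]_u P u a2.
  by apply: cvgB; exact: cvgP.
apply/eqP; rewrite -subr_eq0; apply/eqP.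
have lim3 : \int[mu]_(u in `[- n%:R, n%:R]) P u a1 -
    \int[mu]_(u in `[- n%:R, n%:R]) P u a2 @[n --> \oo] --> 0.
  by apply: cvg_trans lim; apply: near_eq_cvg; apply: nearW => n; rewrite -rect.
exact: (cvg_unique (@Rhausdorff R) lim2 lim3).
Qed.

End Strip.

(** * Fubini's theorem for Bochner integrals *)

Section Fubini.
Import HBSimple.
Context {R : realType}.
Notation mu := (@lebesgue_measure R).
Notation bint F := (bochner_integral mu F).

(** When the first variable is replaced by a simple approximation of itself, the function becomes
    measurable on finitely many strips; continuity in the first variable gives convergence. *)
Lemma measurable_separately_continuous (phi : R -> R -> R) :
  (forall v, continuous (phi^~ v)) -> (forall u, continuous (phi u)) ->
  measurable_fun [set: R * R] (fun z => phi z.1 z.2).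
Proof.
move=> c1 c2.
have [i_ i_cvg] := @sfun_cvg_id R.
apply: (@measurable_fun_cvg _ _ _ _ (fun n z => phi (i_ n z.1) z.2)).
  move=> n _ B mB; rewrite setTI.
  have fi : finite_set (range (i_ n)) := fimfunP (i_ n).
  rewrite (_ : _ @^-1` _ =
      \bigcup_(a in range (i_ n)) ((i_ n @^-1` [set a]) `*` (phi a @^-1` B))).
    apply: fin_bigcup_measurable => // a _; apply: measurableX.
      exact: (measurable_funPTI (i_ n) (measurable_set1 a)).
    rewrite -[X in measurable X]setTI.
    exact: (continuous_measurable_fun (c2 a)).
  apply/seteqP; split => [[u v] /= Buv|[u v] [_ _ [<-]]//].
  by exists (i_ n u) => //; exists u.
move=> [u v] _ /=.
exact: (cvg_comp _ _ (i_cvg u) (c1 v u)).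
Qed.

Context {V : completeNormedModType R[i]}.

Section Swap.
Variables (Phi : R -> R -> V) (C s : R).
Hypotheses (s0 : 0 < s) (C0 : 0 <= C).
Hypothesis Phi1 : forall v, continuous (Phi^~ v).
Hypothesis Phi2 : forall u, continuous (Phi u).
Hypothesis PhiC : forall u v, rnorm (Phi u v) <= C * edecay s u * edecay s v.

Let edecay_le1 u : edecay s u <= 1.
Proof. by rewrite -expR0 ler_expR mulNr oppr_le0 mulr_ge0// ltW. Qed.

Let dec1 v : decaying (C * edecay s v) s (Phi^~ v).
Proof. by split => // u; rewrite mulrAC. Qed.

Let dec2 u : decaying (C * edecay s u) s (Phi u).
Proof. by split. Qed.

Lemma decaying_bint : decaying (C * edecay_mass s) s (fun u => bint (Phi u)).
Proof.
split => // [u|u]; last by rewrite mulrAC; exact: rnorm_bint_decaying.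
apply: (continuous_bint (g := fun v => C * edecay s v)).
- by move=> u'; exact: decaying_dominated (dec2 u').
- by move=> v _; exact: Phi1.
- by move=> v; rewrite mulr_ge0// edecay_ge0.
- exact: (integrableZl measurableT C (integrable_edecay s0)).
- move=> u' v _; rewrite (le_trans (PhiC _ _))// -mulrA ler_wpM2l//.
  by rewrite ler_piMl// edecay_ge0.
Qed.

End Swap.

(** Each iterated integral is tested with a functional, and the product of the two exponentials is
    the integrable majorant for Fubini's theorem on the plane. *)
Lemma bint_swap (Phi : R -> R -> V) (C s : R) : 0 < s -> 0 <= C ->
  (forall v, continuous (Phi^~ v)) -> (forall u, continuous (Phi u)) ->
  (forall u v, rnorm (Phi u v) <= C * edecay s u * edecay s v) ->
  bint (fun u => bint (Phi u)) = bint (fun v => bint (Phi^~ v)).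
Proof.
move=> s0 C0 c1 c2 PhiC.
have PhiC' v u : rnorm (Phi u v) <= C * edecay s v * edecay s u by rewrite mulrAC.
have d1 := decaying_bint s0 C0 c1 c2 PhiC.
have d2 := @decaying_bint (fun v u => Phi u v) _ _ s0 C0 c2 c1 PhiC'.
apply: rfunctional_inj => l lP.
apply: (etrans (bint_functional (decaying_dominated d1) lP)).
apply: (etrans _ (esym (bint_functional (decaying_dominated d2) lP))).
have dPhi u : decaying (C * edecay s u) s (Phi u) by [].
have dPhi' v : decaying (C * edecay s v) s (Phi^~ v) by split => // u; exact: PhiC'.
have [c c_gt0 cl] := rfunctional_bounded lP.
pose phi u v := l (Phi u v).
have mphi : measurable_fun [set: R * R] (fun z => (phi z.1 z.2)%:E).
  apply/measurable_EFinP; apply: measurable_separately_continuous.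
    by move=> v u; apply: (rfunctional_cvg lP); exact: c1.
  by move=> u v; apply: (rfunctional_cvg lP); exact: c2.
have iphi u : mu.-integrable setT (EFin \o phi u).
  exact: (integrable_functional (decaying_dominated (dPhi u)) lP).
have iphi' v : mu.-integrable setT (EFin \o phi^~ v).
  exact: (integrable_functional (decaying_dominated (dPhi' v)) lP).
have E1 u : (\int[mu]_v (phi u v)%:E)%E = (l (bint (Phi u)))%:E.
  rewrite [in RHS](bint_functional (decaying_dominated (dPhi u)) lP) /Rintegral fineK//.
  exact: (integrable_fin_num measurableT (iphi u)).
have E2 v : (\int[mu]_u (phi u v)%:E)%E = (l (bint (Phi^~ v)))%:E.
  rewrite [in RHS](bint_functional (decaying_dominated (dPhi' v)) lP) /Rintegral fineK//.
  exact: (integrable_fin_num measurableT (iphi' v)).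
have iprod : (mu \x mu)%E.-integrable setT (fun z => (phi z.1 z.2)%:E).
  pose g u v : R := c * C * edecay s u * edecay s v.
  have g0 u v : 0 <= g u v by rewrite !mulr_ge0 ?edecay_ge0// ltW.
  have mg : measurable_fun [set: R * R] (fun z => (g z.1 z.2)%:E).
    apply/measurable_EFinP; apply: measurable_separately_continuous.
      by move=> v u; apply: cvgMl; apply: cvgMr; exact: continuous_edecay.
    by move=> u v; apply: cvgMr; exact: continuous_edecay.
  have ie := integrable_edecay s0.
  have ig : (mu \x mu)%E.-integrable setT (fun z => (g z.1 z.2)%:E).
    apply/(integrable12ltyP mu mu mg).
    rewrite (_ : (fun u => _) = fun u => (c * C * edecay_mass s * edecay s u)%:E).
      have /integrableP[_] := integrableZl measurableT (c * C * edecay_mass s) ie.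
      apply: le_lt_trans; apply: ge0_le_integral => //.
      - move=> u _; rewrite lee_fin !mulr_ge0 ?edecay_ge0//; first exact: ltW.
        by apply: Rintegral_ge0 => v _; exact: edecay_ge0.
      - apply/measurable_EFinP; apply: measurable_funM => //.
        by apply: continuous_measurable_fun; exact: continuous_edecay.
      - apply: measurableT_comp => //; apply/measurable_EFinP; apply: measurable_funM => //.
        by apply: continuous_measurable_fun; exact: continuous_edecay.
      - by move=> u _ /=; rewrite lee_fin ler_norm.
    apply/funext => u.
    under eq_integral do rewrite /= ger0_norm//.
    have -> : (c * C * edecay_mass s * edecay s u)%:E =
        (\int[mu]_v (c * C * edecay s u * edecay s v))%:E.
      by rewrite RintegralZl// mulrAC.
    rewrite /Rintegral fineK//; apply: integrable_fin_num => //.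
    exact: (integrableZl measurableT (c * C * edecay s u) ie).
  apply: le_integrable ig => //.
  move=> [u v] _ /=; rewrite lee_fin [leRHS]ger0_norm// (le_trans (cl _))//.
  by rewrite /g -!mulrA ler_pM2l// !mulrA.
have := Fubini iprod.
under eq_integral do rewrite /= E1.
under [X in _ = X -> _]eq_integral do rewrite /= E2.
by move=> H; exact (congr1 fine H).
Qed.

End Fubini.

(** * Iterated contour integrals in logarithmic coordinates *)

Section LogIntegral.
Context {R : realType} {d : nat}.
Notation mu := (@lebesgue_measure R).
Notation bint F := (bochner_integral mu F).
Notation point := 'rV[R[i]^o]_d.
Implicit Types (nu : 'I_d -> R) (A : {set 'I_d}) (z : point).

Lemma set_coordE z k w j : set_coord z k w 0 j = if j == k then w else z 0 j.
Proof. by rewrite mxE. Qed.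

Lemma set_coord_id z k w v : set_coord (set_coord z k w) k v = set_coord z k v.
Proof. by apply/rowP => j; rewrite !set_coordE; case: (j == k). Qed.

Lemma set_coordC z k j w v : j != k ->
  set_coord (set_coord z k w) j v = set_coord (set_coord z j v) k w.
Proof.
move=> jk; apply/rowP => i; rewrite !set_coordE; case: eqP => // ->.
by rewrite (negbTE jk).
Qed.

(** [true] denotes the lower ray, [false] the upper one. *)
Definition ray (nu : R) (b : bool) : R := if b then - nu else nu.

Definition on_contour nu A z0 z := forall k,
  if k \in A then exists u b, z 0 k = polar u (ray (nu k) b) else z 0 k = z0 0 k.

Lemma on_contour_set_coord nu A z0 z k u b : on_contour nu A z0 z ->
  on_contour nu (k |: A) z0 (set_coord z k (polar u (ray (nu k) b))).
Proof.
move=> zA j; rewrite in_setU1 set_coordE; case: eqP => [->|_] /=; first by exists u, b.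
exact: zA.
Qed.

Lemma on_contour_base nu A z0 k u b z : k \notin A ->
  on_contour nu A (set_coord z0 k (polar u (ray (nu k) b))) z -> on_contour nu (k |: A) z0 z.
Proof.
move=> kA zA j; have := zA j; rewrite in_setU1 set_coordE.
by case: eqP => [->|_] //=; rewrite (negbTE kA) => ->; exists u, b.
Qed.

Context {V : completeNormedModType R[i]}.
Implicit Types (H : point -> V).

(** A contour integral with respect to dz / z in the coordinate [k], written in logarithmic
    coordinates. *)
Definition ray_difference (nu : R) (k : 'I_d) H z : V := bint (fun u =>
  H (set_coord z k (polar u (ray nu true))) - H (set_coord z k (polar u (ray nu false)))).

Fixpoint log_integral nu (ks : seq 'I_d) H z : V :=
  if ks is k :: ks' then ray_difference (nu k) k (log_integral nu ks' H) z else H z.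

(** Continuity along the rays in each coordinate separately, together with product decay: this class
    is stable under integration of one coordinate, and on it the order of integrations may be
    changed. *)
Definition nice nu A H z0 C s := [/\ 0 < s, 0 <= C,
  forall z k b, on_contour nu A z0 z -> k \in A ->
    continuous (fun u => H (set_coord z k (polar u (ray (nu k) b)))) &
  forall z, on_contour nu A z0 z ->
    rnorm (H z) <= C * \prod_(k in A) edecay s (ln (rnorm (z 0 k)))].

Lemma edecay_le1 (s u : R) : 0 <= s -> edecay s u <= 1.
Proof. by move=> s0; rewrite -expR0 ler_expR mulNr oppr_le0 mulr_ge0. Qed.

Lemma nice_le nu k A H z0 C s z u b : k \notin A -> nice nu (k |: A) H z0 C s ->
  on_contour nu A z0 z ->
  rnorm (H (set_coord z k (polar u (ray (nu k) b)))) <=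
    C * (\prod_(j in A) edecay s (ln (rnorm (z 0 j)))) * edecay s u.
Proof.
move=> kA [_ _ _ Hle] zA.
rewrite (le_trans (Hle _ (on_contour_set_coord k u b zA)))// big_setU1//=.
rewrite set_coordE eqxx rnorm_polar expRK -mulrA (mulrC (edecay s u)) le_eqVlt.
apply/orP; left; apply/eqP; congr (_ * (_ * _)); apply: eq_bigr => j jA.
by rewrite set_coordE ifN//; apply: (contraNneq _ kA) => <-.
Qed.

Lemma nice_decaying nu k A H z0 C s z b : k \notin A -> nice nu (k |: A) H z0 C s ->
  on_contour nu A z0 z ->
  decaying (C * \prod_(j in A) edecay s (ln (rnorm (z 0 j)))) s
    (fun u => H (set_coord z k (polar u (ray (nu k) b)))).
Proof.
move=> kA nH zA; have [s0 _ Hc _] := nH; split => // [u|u]; last exact: (nice_le _ _ kA nH zA).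
have -> : (fun u => H (set_coord z k (polar u (ray (nu k) b)))) =
    (fun u => H (set_coord (set_coord z k (polar 0 (ray (nu k) b))) k (polar u (ray (nu k) b)))).
  by apply/funext => v; rewrite set_coord_id.
by apply: Hc; [exact: on_contour_set_coord|exact: finset.setU11].
Qed.

(** Integrating out [k] costs the mass of the exponential, and [C + C] accounts for the two rays.
    Continuity in the other coordinates is continuity under the integral, with the decay in [k] as
    majorant. *)
Lemma nice_ray_difference nu k A H z0 C s : k \notin A -> nice nu (k |: A) H z0 C s ->
  nice nu A (ray_difference (nu k) k H) z0 ((C + C) * edecay_mass s) s.
Proof.
move=> kA nH; have [s0 C0 Hc Hle] := nH.
have m0 : 0 <= edecay_mass s by apply: Rintegral_ge0 => u _; exact: edecay_ge0.
have CC0 : 0 <= C + C by rewrite addr_ge0.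
have dB z (zA : on_contour nu A z0 z) :=
  decayingB (nice_decaying true kA nH zA) (nice_decaying false kA nH zA).
split => //; first by rewrite mulr_ge0.
- move=> z j b zA jA.
  have jk : j != k by apply: (contraNneq _ kA) => <-.
  have zj u : on_contour nu A z0 (set_coord z j (polar u (ray (nu j) b))).
    by have := on_contour_set_coord j u b zA; rewrite (finset.setUidPr _)// finset.sub1set.
  move=> u; apply: (continuous_bint (g := fun t => (C + C) * edecay s t)).
  + by move=> v; exact: decaying_dominated (dB _ (zj v)).
  + move=> t _ v.
    have cb b' : {for v, continuous (fun u =>
        H (set_coord (set_coord z j (polar u (ray (nu j) b))) k (polar t (ray (nu k) b'))))}.
      have -> : (fun u =>
          H (set_coord (set_coord z j (polar u (ray (nu j) b))) k (polar t (ray (nu k) b')))) =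
        (fun u =>
          H (set_coord (set_coord z k (polar t (ray (nu k) b'))) j (polar u (ray (nu j) b)))).
        by apply/funext => u'; rewrite [in RHS]set_coordC.
      by apply: Hc; [exact: on_contour_set_coord|rewrite finset.in_setU1 jA orbT].
    by apply: cvgB; exact: cb.
  + by move=> t; rewrite mulr_ge0// edecay_ge0.
  + exact: (integrableZl measurableT (C + C) (integrable_edecay s0)).
  + move=> v t _; have [_ _ Dle] := dB _ (zj v); rewrite (le_trans (Dle t))//.
    rewrite ler_wpM2r ?edecay_ge0// lerD// -[leRHS]mulr1 ler_wpM2l//;
      by apply: prodr_ile1 => i; rewrite edecay_ge0 edecay_le1// ltW.
- move=> z zA; rewrite (le_trans (rnorm_bint_decaying (dB _ zA)))//.
  by rewrite -mulrDl mulrAC.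
Qed.

Lemma nice_base nu k A H z0 C s u b : k \notin A -> nice nu (k |: A) H z0 C s ->
  nice nu A H (set_coord z0 k (polar u (ray (nu k) b))) (C * edecay s u) s.
Proof.
move=> kA [s0 C0 Hc Hle]; split => //; first by rewrite mulr_ge0// edecay_ge0.
- move=> z j b' zA jA; apply: Hc; first exact: on_contour_base zA.
  by rewrite finset.in_setU1 jA orbT.
- move=> z zA; rewrite (le_trans (Hle _ (on_contour_base kA zA)))// big_setU1//=.
  have := zA k; rewrite (negbTE kA) => ->.
  by rewrite set_coordE eqxx rnorm_polar expRK mulrA.
Qed.

Lemma nice_log_integral nu ks A H z0 C s : uniq ks -> (forall k, k \in ks -> k \notin A) ->
  nice nu (A :|: [set k in ks]) H z0 C s ->
  exists C', nice nu A (log_integral nu ks H) z0 C' s.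
Proof.
elim: ks A => [A _ _|k ks IH A /= /andP[kks uks] dA nH].
  rewrite (_ : [set k in [::]] = finset.set0) ?finset.setU0; first by exists C.
  by apply/finset.setP => k; rewrite !inE.
have kA : k \notin A by apply: dA; rewrite inE eqxx.
have [||C' nC'] := IH (k |: A) uks.
- move=> j jks; rewrite in_setU1 negb_or dA ?andbT; last by rewrite inE jks orbT.
  by apply: (contraNneq _ kks) => <-.
- rewrite (_ : (k |: A) :|: [set j in ks] = A :|: [set j in k :: ks])//.
  by apply/finset.setP => j; rewrite !inE -orbA orbCA.
- by exists ((C' + C') * edecay_mass s); exact: nice_ray_difference.
Qed.

Lemma set_in_cons k (ks : seq 'I_d) : [set j in k :: ks] = k |: [set j in ks].
Proof. by apply/finset.setP => j; rewrite !inE. Qed.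

Lemma log_integral_decaying nu k ks H z C s b : uniq (k :: ks) ->
  nice nu [set j in k :: ks] H z C s ->
  exists C', decaying C' s
    (fun u => log_integral nu ks H (set_coord z k (polar u (ray (nu k) b)))).
Proof.
move=> /= /andP[kks uks] nH.
have [||C' nC'] := @nice_log_integral nu ks [set k] H z C s uks.
- by move=> j jks; rewrite inE; apply: (contraNneq _ kks) => <-.
- by rewrite -set_in_cons.
- have zz : on_contour nu finset.set0 z z by move=> j; rewrite inE.
  exists (C' * \prod_(j in finset.set0) edecay s (ln (rnorm (z 0 j)))).
  by apply: (@nice_decaying nu k finset.set0 _ z); rewrite ?inE ?finset.setU0.
Qed.

Lemma eq_log_integral nu nu' ks H H' z : uniq ks -> {in ks, nu =1 nu'} ->
  (forall z', on_contour nu [set k in ks] z z' -> H z' = H' z') ->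
  log_integral nu ks H z = log_integral nu' ks H' z.
Proof.
elim: ks z => [z _ _ HH'|k ks IH z /= /andP[kks uks] nn HH'].
  by apply: HH' => k; rewrite inE.
have kS : k \notin [set j in ks] by rewrite inE.
have nk : nu k = nu' k by apply: nn; rewrite inE eqxx.
rewrite /ray_difference nk; congr bochner_integral; apply/funext => u.
have E b : log_integral nu ks H (set_coord z k (polar u (ray (nu' k) b))) =
           log_integral nu' ks H' (set_coord z k (polar u (ray (nu' k) b))).
  apply: IH => // [j jks|z' z'P]; first by apply: nn; rewrite inE jks orbT.
  apply: HH'; rewrite set_in_cons; apply: (on_contour_base kS).
  by rewrite nk; exact: z'P.
by rewrite !E.
Qed.

Lemma log_integralZ nu ks H z C s (a : R[i]) : uniq ks -> nice nu [set k in ks] H z C s ->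
  log_integral nu ks (fun z => a *: H z) z = a *: log_integral nu ks H z.
Proof.
elim: ks z C => [//|k ks IH z C ukks nH].
have /= /andP[kks uks] := ukks.
have kS : k \notin [set j in ks] by rewrite inE.
have [C1 d1] := log_integral_decaying true ukks nH.
have [C2 d2] := log_integral_decaying false ukks nH.
rewrite /= /ray_difference -bintZ; last exact: decaying_dominated (decayingB d1 d2).
congr bochner_integral; apply/funext => u; rewrite scalerBr.
by congr (_ - _); apply: IH => //; apply: (nice_base _ _ kS); rewrite -set_in_cons; exact: nH.
Qed.

Lemma log_integral_sum nu ks (I : Type) (r : seq I) (H : I -> point -> V) z C s :
  uniq ks -> (forall i, nice nu [set k in ks] (H i) z (C i) (s i)) ->
  log_integral nu ks (fun z => \sum_(i <- r) H i z) z =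
  \sum_(i <- r) log_integral nu ks (H i) z.
Proof.
elim: ks z C => [//|k ks IH z C ukks nH].
have /= /andP[kks uks] := ukks.
have kS : k \notin [set j in ks] by rewrite inE.
rewrite /= /ray_difference -bint_sum; last first.
  move=> i; have [C1 d1] := log_integral_decaying true ukks (nH i).
  have [C2 d2] := log_integral_decaying false ukks (nH i).
  exact: decaying_dominated (decayingB d1 d2).
congr bochner_integral; apply/funext => u; rewrite sumrB.
congr (_ - _); apply: (IH _ (fun i => C i * edecay (s i) u)) => // i.
  by apply: (nice_base _ _ kS); rewrite -set_in_cons; exact: nH.
by apply: (nice_base _ _ kS); rewrite -set_in_cons; exact: nH.
Qed.

End LogIntegral.

Section LogIntegralSwap.
Context {R : realType} {d : nat} {V : completeNormedModType R[i]}.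
Notation mu := (@lebesgue_measure R).
Notation bint F := (bochner_integral mu F).
Notation point := 'rV[R[i]^o]_d.
Implicit Types (nu : 'I_d -> R) (A : {set 'I_d}) (z : point) (H : point -> V).

(** Both sides integrate the same combination [Phi] of the four pairs of rays, to which the exchange
    of integrals applies at once. *)
Lemma ray_difference_swap nu j k H z C s : j != k -> nice nu [set j; k] H z C s ->
  ray_difference (nu k) k (ray_difference (nu j) j H) z =
  ray_difference (nu j) j (ray_difference (nu k) k H) z.
Proof.
move=> jk nH; have [s0 C0 Hc Hle] := nH.
pose r b u := polar u (ray (nu k) b); pose q b v := polar v (ray (nu j) b).
pose g b b' u v := H (set_coord (set_coord z k (r b u)) j (q b' v)).
have onc b b' u v : on_contour nu [set j; k] z
    (set_coord (set_coord z k (r b u)) j (q b' v)).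
  move=> i; rewrite !inE !set_coordE; case: (i =P j) => [->|_] /=; first by exists v, b'.
  by case: (i =P k) => [->|//]; exists u, b.
have g2 b b' u : continuous (g b b' u).
  rewrite (_ : g b b' u =
      fun v => H (set_coord (set_coord (set_coord z k (r b u)) j (q b' 0)) j (q b' v))).
    by apply: Hc; [exact: onc|rewrite !inE eqxx].
  by apply/funext => v; rewrite /g set_coord_id.
have g1 b b' v : continuous ((g b b')^~ v).
  rewrite (_ : (g b b')^~ v =
      fun u => H (set_coord (set_coord (set_coord z k (r b 0)) j (q b' v)) k (r b u))).
    by apply: Hc; [exact: onc|rewrite !inE eqxx orbT].
  by apply/funext => u; rewrite /g !(set_coordC _ _ _ jk) set_coord_id.
have gle b b' u v : rnorm (g b b' u v) <= C * edecay s u * edecay s v.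
  rewrite (le_trans (Hle _ (onc b b' u v)))// (eq_bigl (mem (j |: [set k]))); last first.
    by move=> i; rewrite !inE.
  rewrite big_setU1 ?inE//= big_set1 !set_coordE eqxx eq_sym (negbTE jk) eqxx.
  by rewrite !rnorm_polar !expRK mulrA mulrAC.
have d2 b b' u : decaying (C * edecay s u) s (g b b' u) by split.
have d1 b b' v : decaying (C * edecay s v) s ((g b b')^~ v).
  by split => // u; rewrite mulrAC.
pose Phi u v := (g true true u v - g true false u v) - (g false true u v - g false false u v).
have dom C1 C2 F G (dF : decaying C1 s F) (dG : decaying C2 s G) :
    dominated_continuous (fun v => F v - G v).
  exact: decaying_dominated (decayingB dF dG).
transitivity (bint (fun u => bint (Phi u))).
  rewrite /ray_difference; congr bochner_integral; apply/funext => u.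
  by rewrite -bintB; [|exact: dom (d2 _ _ _) (d2 _ _ _)..].
transitivity (bint (fun v => bint (Phi^~ v))).
  apply: (@bint_swap _ _ Phi (C + C + (C + C)) s) => //.
  - by rewrite !addr_ge0.
  - by move=> v u; apply: cvgB; apply: cvgB; exact: g1.
  - by move=> u v; apply: cvgB; apply: cvgB; exact: g2.
  - move=> u v; rewrite !mulrDl (le_trans (ler_rnormB _ _))// lerD//;
      by rewrite (le_trans (ler_rnormB _ _))// lerD.
rewrite /ray_difference; congr bochner_integral; apply/funext => v.
have E b' : bint (fun u => g true b' u v - g false b' u v) = bint (fun u =>
    H (set_coord (set_coord z j (q b' v)) k (r true u)) -
    H (set_coord (set_coord z j (q b' v)) k (r false u))).
  congr bochner_integral; apply/funext => u.
  by rewrite /g !(set_coordC _ _ _ jk).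
rewrite -!E -bintB; [|exact: dom (d1 _ _ _) (d1 _ _ _)..].
congr bochner_integral; apply/funext => u; rewrite /Phi.
by rewrite !opprB addrACA [RHS]addrACA; congr (_ + _); exact: addrC.
Qed.

(** The outermost variable is moved to the innermost place, where all other coordinates are fixed
    and a one-variable change of contour or of kernel can be performed. *)
Lemma log_integral_inner nu k ks H z C s : uniq (k :: ks) ->
  nice nu [set j in k :: ks] H z C s ->
  log_integral nu (k :: ks) H z = log_integral nu ks (ray_difference (nu k) k H) z.
Proof.
elim: ks z C => [//|j ks IH z C /= /andP[kjks /andP[jks uks]] nH].
have kj : k != j by move: kjks; rewrite inE negb_or => /andP[].
have kks : k \notin ks by move: kjks; rewrite inE negb_or => /andP[].
have [||C' nI] := @nice_log_integral R d V nu ks [set j; k] H z C s uks.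
- move=> i iks; rewrite !inE negb_or; apply/andP; split.
    by apply: (contraNneq _ jks) => <-.
  by apply: (contraNneq _ kks) => <-.
- rewrite (_ : [set j; k] :|: [set i in ks] = [set i in k :: j :: ks])//.
  by apply/finset.setP => i; rewrite !inE -orbA orbCA.
apply: (etrans (@ray_difference_swap nu j k _ _ C' s _ nI)); first by rewrite eq_sym.
rewrite /ray_difference; congr bochner_integral; apply/funext => v.
have E b : ray_difference (nu k) k (log_integral nu ks H)
      (set_coord z j (polar v (ray (nu j) b))) =
    log_integral nu ks (ray_difference (nu k) k H) (set_coord z j (polar v (ray (nu j) b))).
  apply: (IH _ (C * edecay s v)); first by rewrite /= kks.
  apply: (@nice_base _ _ _ nu j [set i in k :: ks]); first by rewrite !inE negb_or eq_sym kj.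
  rewrite (_ : j |: [set i in k :: ks] = [set i in k :: j :: ks])//.
  by apply/finset.setP => i; rewrite !inE orbCA.
by rewrite -!E.
Qed.

Lemma log_integral_change nu nu' k ks H H' z C C' s s' : uniq (k :: ks) ->
  {in ks, nu =1 nu'} ->
  nice nu [set j in k :: ks] H z C s -> nice nu' [set j in k :: ks] H' z C' s' ->
  (forall z', on_contour nu [set j in ks] z z' ->
     ray_difference (nu k) k H z' = ray_difference (nu' k) k H' z') ->
  log_integral nu (k :: ks) H z = log_integral nu' (k :: ks) H' z.
Proof.
move=> ukks nn nH nH' HH'.
rewrite (log_integral_inner ukks nH) (log_integral_inner ukks nH').
by apply: eq_log_integral => //; have /andP[] := ukks.
Qed.

Lemma nice_eq nu A H H' z C s : nice nu A H z C s ->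
  (forall z', on_contour nu A z z' -> H' z' = H z') -> nice nu A H' z C s.
Proof.
move=> [s0 C0 Hc Hle] HH'; split => // [z' k b z'A kA|z' z'A]; last by rewrite HH'// Hle.
have -> : (fun u => H' (set_coord z' k (polar u (ray (nu k) b)))) =
    (fun u => H (set_coord z' k (polar u (ray (nu k) b)))).
  apply/funext => u; apply: HH'.
  by have := on_contour_set_coord k u b z'A; rewrite (finset.setUidPr _)// finset.sub1set.
exact: Hc.
Qed.

Lemma niceZ nu A H z C s (a : R[i]) : nice nu A H z C s ->
  nice nu A (fun z => a *: H z) z (rnorm a * C) s.
Proof.
move=> [s0 C0 Hc Hle]; split => // [|z' k b z'A kA u|z' z'A].
- by rewrite mulr_ge0// rnorm_ge0.
- by apply: cvgZr; exact: Hc.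
- by rewrite rnormZ -mulrA ler_wpM2l ?rnorm_ge0// Hle.
Qed.

Lemma decaying_le C C' s (F : R -> V) : C <= C' -> decaying C s F -> decaying C' s F.
Proof.
move=> CC' [s0 cF Fle]; split => // u; rewrite (le_trans (Fle u))//.
by rewrite ler_wpM2r// edecay_ge0.
Qed.

(** The product of the coordinates comes from dz = z du in each variable. *)
Lemma multi_contour_integralE nu ks (F : point -> V) z C s : uniq ks ->
  nice nu [set k in ks] (fun z => (\prod_(k <- ks) z 0 k) *: F z) z C s ->
  multi_contour_integral nu ks F z =
  log_integral nu ks (fun z => (\prod_(k <- ks) z 0 k) *: F z) z.
Proof.
elim: ks z C => [z C _ _|k ks IH z C ukks nH]; first by rewrite /= big_nil scale1r.
have /= /andP[kks uks] := ukks.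
have kS : k \notin [set j in ks] by rewrite inE.
set H0 := (fun z : point => (\prod_(k <- k :: ks) z 0 k) *: F z) in nH *.
pose H1 := fun z : point => (\prod_(k <- ks) z 0 k) *: F z.
have M u b : polar u (ray (nu k) b) *:
      multi_contour_integral nu ks F (set_coord z k (polar u (ray (nu k) b))) =
    log_integral nu ks H0 (set_coord z k (polar u (ray (nu k) b))).
  set w := polar u _.
  have nH0 : nice nu [set j in ks] H0 (set_coord z k w) (C * edecay s u) s.
    by apply: (nice_base _ _ kS); rewrite -set_in_cons.
  have H10 z' : on_contour nu [set j in ks] (set_coord z k w) z' -> H1 z' = w^-1 *: H0 z'.
    move=> /(_ k); rewrite (negbTE kS) set_coordE eqxx /H1 /H0 big_cons => ->.
    by rewrite scalerA mulKf// polar_neq0.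
  have nH1 := nice_eq (niceZ w^-1 nH0) H10.
  rewrite (IH _ _ uks nH1) -(log_integralZ _ uks nH1).
  apply: eq_log_integral => // z' /H10 ->.
  by rewrite scalerA mulfV ?scale1r// polar_neq0.
have [C1 d1] := log_integral_decaying true ukks nH.
have [C2 d2] := log_integral_decaying false ukks nH.
have E (b : bool) C3 :
    decaying C3 s (fun u => log_integral nu ks H0 (set_coord z k (polar u (ray (nu k) b)))) ->
    decaying C3 s (fun u => polar u (ray (nu k) b) *:
      multi_contour_integral nu ks F (set_coord z k (polar u (ray (nu k) b)))).
  by under eq_fun do rewrite -M.
have C12 : C1 <= C1 + C2 by rewrite lerDl (decaying_ge0 d2).
have C21 : C2 <= C1 + C2 by rewrite lerDr (decaying_ge0 d1).
rewrite [LHS](contour_integralE (E false _ (decaying_le C21 d2)) (E true _ (decaying_le C12 d1))).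
rewrite /= /ray_difference; congr bochner_integral; apply/funext => u.
by rewrite -!M.
Qed.

End LogIntegralSwap.

Section LogIntegralMap.
Context {R : realType} {d : nat} {V W : completeNormedModType R[i]}.
Notation point := 'rV[R[i]^o]_d.

Lemma log_integral_map (nu : 'I_d -> R) (ks : seq 'I_d) (H : point -> V) (z : point) C s
    (L : {linear V -> W}) c : uniq ks -> (forall x, rnorm (L x) <= c * rnorm x) ->
  nice nu [set k in ks] H z C s ->
  log_integral nu ks (fun z => L (H z)) z = L (log_integral nu ks H z).
Proof.
move=> + Lc; elim: ks z C => [//|k ks IH z C ukks nH].
have /= /andP[kks uks] := ukks.
have kS : k \notin [set j in ks] by rewrite inE.
have [C1 d1] := log_integral_decaying true ukks nH.
have [C2 d2] := log_integral_decaying false ukks nH.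
rewrite /= /ray_difference -(bint_linear (decaying_dominated (decayingB d1 d2)) Lc).
congr bochner_integral; apply/funext => u; rewrite linearB.
by congr (_ - _); apply: (IH _ (C * edecay s u)) => //;
  apply: (nice_base _ _ kS); rewrite -set_in_cons.
Qed.

End LogIntegralMap.

(** * Decomposition of a contour integral into shells *)

Section Shells.
Context {R : realType}.
Notation mu := (@lebesgue_measure R).
Notation bint F := (bochner_integral mu F).

Lemma Rintegral_shift (f : R -> R) (a : R) : continuous f ->
  \int[mu]_(u in `[a, a + 1]) f u = \int[mu]_(u in `[0, 1]) f (a + u).
Proof.
move=> cf; rewrite /Rintegral; congr fine.
have dE : ((fun x : R => a + x)^`())%classic = cst 1.
  by apply/funext => x; rewrite derive1E deriveD// derive_cst add0r derive_id.
have := @integration_by_substitution_increasing R (fun x => a + x) f 0 1 ler01.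
rewrite addr0 => ->.
- by apply: eq_integral => u _; rewrite dE fctE /= mulr1.
- by move=> x y _ _; rewrite ltrD2l.
- by move=> x _; rewrite dE; exact: cst_continuous.
- by rewrite dE; exact: is_cvg_cst.
- by rewrite dE; exact: is_cvg_cst.
- have cc x : {for x, continuous (fun y : R => a + y)}.
    by apply: cvgD; [exact: cvg_cst|exact: cvg_id].
  split; first by move=> x _; apply: derivableD => //; exact: derivable_id.
    by apply: cvg_at_right_filter; exact: cc.
  by apply: cvg_at_left_filter; exact: cc.
- exact: continuous_subspaceT.
Qed.

Lemma Rintegral_unit_split (f : R -> R) (a : R) (n : nat) : continuous f ->
  \int[mu]_(u in `[a, a + n%:R]) f u =
  \sum_(i <- iota 0 n) \int[mu]_(u in `[0, 1]) f (a + i%:R + u).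
Proof.
move=> cf; elim: n => [|n IH]; first by rewrite addr0 set_itv1 Rintegral_set1 big_nil.
rewrite (@Rintegral_itv_split _ f a (a + n%:R)); last first.
- by rewrite lerDl ler0n/= lerD2l ler_nat.
- by move=> x _; exact: cf.
rewrite -addn1 iotaD big_cat big_seq1 IH add0n; congr (_ + _).
by rewrite natrD addrA Rintegral_shift.
Qed.

Lemma continuous_sum (I : Type) (r : seq I) (f : I -> R -> R) :
  (forall i, continuous (f i)) -> continuous (fun u => \sum_(i <- r) f i u).
Proof.
move=> cf; elim: r => [|i r IH] u.
  by under eq_fun do rewrite big_nil; exact: cvg_cst.
by under eq_fun do rewrite big_cons; apply: cvgD; [exact: cf|exact: IH].
Qed.

Lemma Rintegral_itv_sum (I : Type) (r : seq I) (f : I -> R -> R) (a b : R) :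
  (forall i, continuous (f i)) ->
  \int[mu]_(u in `[a, b]) (\sum_(i <- r) f i u) =
  \sum_(i <- r) \int[mu]_(u in `[a, b]) f i u.
Proof.
move=> cf; elim: r => [|i r IH].
  rewrite big_nil; under eq_Rintegral do rewrite big_nil.
  by rewrite /Rintegral integral0.
rewrite big_cons -IH -RintegralD//.
- by under eq_Rintegral do rewrite big_cons.
- by apply: continuous_itv_integrable => u _; exact: cf.
- by apply: continuous_itv_integrable => u _; exact: continuous_sum.
Qed.

Context {V : completeNormedModType R[i]}.

(** The integral over [-N, N] is the integral over t in [0, 1] of the sum of the values at the 2 N
    points - N + i + t. A bound of these sums, uniform in [N] and [t], passes to the integral since
    [0, 1] has length 1. *)
Lemma rnorm_bint_shells (F : R -> V) C s M : decaying C s F ->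
  (forall (N : nat) (t : R), 0 <= t <= 1 ->
     rnorm (\sum_(i <- iota 0 N.*2) F (- N%:R + i%:R + t)) <= M) ->
  rnorm (bint F) <= M.
Proof.
move=> dF FM; have [_ cF _] := dF; have domF := decaying_dominated dF.
apply: rnorm_le_functional => l lP l1.
rewrite (bint_functional domF lP).
have clF : continuous (fun u => l (F u)).
  by move=> u; apply: (rfunctional_cvg lP); exact: cF.
have H := cvg_Rintegral_sym (integrable_functional domF lP).
rewrite -(cvg_lim (@Rhausdorff R) H); apply: limr_le; first exact: cvgP H.
apply: nearW => n.
have -> : `[- n%:R, n%:R]%classic = `[- n%:R, - n%:R + n.*2%:R]%classic :> set R.
  by rewrite -addnn natrD addKr.
rewrite Rintegral_unit_split// -Rintegral_itv_sum; last first.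
  move=> i x; apply: (@continuous_comp _ _ _ (fun u : R => - n%:R + i%:R + u) (fun u => l (F u))).
    by apply: cvgD; [exact: cvg_cst|exact: cvg_id].
  exact: clF.
have cS : continuous (fun u : R => \sum_(i <- iota 0 n.*2) l (F (- n%:R + i%:R + u))).
  apply: continuous_sum => i; move=> x.
  apply: (@continuous_comp _ _ _ (fun u : R => - n%:R + i%:R + u) (fun u => l (F u))).
    by apply: cvgD; [exact: cvg_cst|exact: cvg_id].
  exact: clF.
have -> : M = \int[mu]_(u in `[0, 1]) M.
  have m1 : fine (mu `[0, 1]) = 1.
    by rewrite lebesgue_measure_itv/= lte_fin ltr01 -EFinB subr0.
  by rewrite Rintegral_cst// m1 mulr1.
apply: le_Rintegral => //.
- by apply: continuous_itv_integrable => x _; exact: cS.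
- by apply: continuous_itv_integrable => x _; exact: cvg_cst.
- move=> u; rewrite /= in_itv/= => u01; rewrite -(rfunctional_sum lP).
  by rewrite (le_trans (ler_norm _))// (le_trans (l1 _))// FM.
Qed.

End Shells.

Section ShellPoints.
Context {R : realType} {d : nat} {V : completeNormedModType R[i]}.
Notation mu := (@lebesgue_measure R).
Notation bint F := (bochner_integral mu F).
Notation point := 'rV[R[i]^o]_d.
Variable nu : 'I_d -> R.

(** The grid of points whose coordinates in [ks] lie on the rays chosen by [b], with logarithms of
    the moduli in - N + t plus integers. *)
Fixpoint shell_points (N : 'I_d -> nat) (t : 'I_d -> R) (b : 'I_d -> bool)
    (ks : seq 'I_d) (z : point) : seq point :=
  if ks is k :: ks' then
    flatten [seq shell_points N t b ks'
      (set_coord z k (polar (- (N k)%:R + i%:R + t k) (ray (nu k) (b k))))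
      | i <- iota 0 (N k).*2]
  else [:: z].

Lemma shell_points_set_coord N t b ks (z : point) k w : k \notin ks ->
  shell_points N t b ks (set_coord z k w) =
  [seq set_coord p k w | p <- shell_points N t b ks z].
Proof.
elim: ks z => [//|j ks IH] z; rewrite inE negb_or => /andP[kj kks] /=.
rewrite map_flatten -map_comp; congr flatten; apply: eq_map => i /=.
by rewrite -IH// set_coordC// eq_sym.
Qed.

Lemma eq_shell_points N t b N' t' b' ks (z : point) :
  {in ks, N =1 N'} -> {in ks, t =1 t'} -> {in ks, b =1 b'} ->
  shell_points N t b ks z = shell_points N' t' b' ks z.
Proof.
elim: ks z => [//|k ks IH] z NN tt bb /=.
rewrite NN ?tt ?bb ?inE ?eqxx//; congr flatten; apply: eq_map => i.
by apply: IH => j jks; rewrite ?NN ?tt ?bb// inE jks orbT.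
Qed.

Lemma log_integral_set_coord ks (H : point -> V) z k w : k \notin ks ->
  log_integral nu ks H (set_coord z k w) =
  log_integral nu ks (fun z => H (set_coord z k w)) z.
Proof.
elim: ks z => [//|j ks IH] z; rewrite inE negb_or => /andP[kj kks] /=.
rewrite /ray_difference; congr bochner_integral; apply/funext => u.
by rewrite !(set_coordC _ _ _ (_ : j != k)) ?IH// eq_sym.
Qed.

Lemma nice_set_coord (A : {set 'I_d}) (H : point -> V) z k w C s : k \notin A ->
  nice nu A H (set_coord z k w) C s -> nice nu A (fun z => H (set_coord z k w)) z C s.
Proof.
move=> kA [s0 C0 Hc Hle].
have G z' : on_contour nu A z z' -> on_contour nu A (set_coord z k w) (set_coord z' k w).
  move=> z'A j; have := z'A j; rewrite !set_coordE.
  by case: eqP => [->|//]; rewrite (negbTE kA).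
split => // [z' j b z'A jA|z' z'A].
  have kj : k != j by apply: (contraNneq _ kA) => ->.
  under eq_fun do rewrite set_coordC//.
  by apply: Hc => //; exact: G.
rewrite (le_trans (Hle _ (G _ z'A)))// le_eqVlt; apply/orP; left; apply/eqP.
congr (_ * _); apply: eq_bigr => j jA; rewrite set_coordE ifN//.
by apply: (contraNneq _ kA) => <-.
Qed.

Lemma nice_sum (A : {set 'I_d}) (I : Type) (r : seq I) (H : I -> point -> V) z C s : 0 < s ->
  (forall i, nice nu A (H i) z (C i) s) ->
  nice nu A (fun z => \sum_(i <- r) H i z) z (\sum_(i <- r) C i) s.
Proof.
move=> s0 nH; split => // [|z' k b z'A kA|z' z'A].
- by apply: sumr_ge0 => i _; have [] := nH i.
- elim: r => [|i r IH] u.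
    by under eq_fun do rewrite big_nil; exact: cvg_cst.
  under eq_fun do rewrite big_cons.
  by apply: cvgD; [have [_ _ Hc _] := nH i; exact: Hc|exact: IH].
- rewrite mulr_suml (le_trans (ler_rnorm_sum _ _ _))// ler_sum// => i _.
  by have [_ _ _] := nH i; apply.
Qed.

(** The power of 2 counts the choices of a ray in each coordinate. The sum over the shells of the
    first variable is taken inside the remaining integral, so that the hypothesis concerns the norm
    of the sum over the whole grid. *)
Lemma rnorm_log_integral_shells ks (H : point -> V) z C s M : uniq ks ->
  nice nu [set k in ks] H z C s ->
  (forall N t b, (forall k, 0 <= t k <= 1) ->
     rnorm (\sum_(p <- shell_points N t b ks z) H p) <= M) ->
  rnorm (log_integral nu ks H z) <= 2 ^+ size ks * M.
Proof.
elim: ks H z C => [H z C _ _ HM|k ks IH H z C ukks nH HM].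
  have := HM (fun=> 0%N) (fun=> 0) (fun=> true).
  by rewrite /= big_seq1 expr0 mul1r; apply => _; rewrite lexx ler01.
have /= /andP[kks uks] := ukks.
have kS : k \notin [set j in ks] by rewrite inE.
have [C1 d1] := log_integral_decaying true ukks nH.
have [C2 d2] := log_integral_decaying false ukks nH.
have Hb b C3 : decaying C3 s
    (fun u => log_integral nu ks H (set_coord z k (polar u (ray (nu k) b)))) ->
    rnorm (bint (fun u => log_integral nu ks H (set_coord z k (polar u (ray (nu k) b)))))
      <= 2 ^+ size ks * M.
  move=> d3; apply: (rnorm_bint_shells d3) => n x x01.
  pose w i := polar (- n%:R + i%:R + x) (ray (nu k) b).
  under eq_bigr do rewrite log_integral_set_coord//.
  have nHi (i : nat) : nice nu [set j in ks] (fun z => H (set_coord z k (w i))) z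
      (C * edecay s (- n%:R + i%:R + x)) s.
    apply: nice_set_coord => //; apply: nice_base => //.
    by rewrite -set_in_cons.
  rewrite -(log_integral_sum _ uks nHi).
  apply: (IH _ _ (\sum_(i <- iota 0 n.*2) C * edecay s (- n%:R + i%:R + x))) => //.
    by apply: nice_sum => //; have [] := nH.
  move=> N t b' t01.
  (* The data at [k] are those of the current shell; the grid over [ks], which does not contain [k],
     is unaffected by the change. *)
  pose N' j := if j == k then n else N j; pose t' j := if j == k then x else t j.
  pose b'' j := if j == k then b else b' j.
  have := HM N' t' b''; rewrite /= /N' /t' /b'' eqxx big_flatten big_map => HM'.
  rewrite exchange_big/=; apply: le_trans (HM' _); last first.
    by move=> j; case: ifP => // _; exact: t01.
  rewrite le_eqVlt; apply/orP; left; apply/eqP; congr rnorm.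
  apply: eq_bigr => i _; rewrite -/(w i) shell_points_set_coord// big_map.
  rewrite (@eq_shell_points _ _ _ N t b') => // j jks;
    by rewrite ifN//; apply: (contraNneq _ kks) => <-.
rewrite /= /ray_difference bintB ?[leRHS]mulrDl; [|exact: decaying_dominated d1|exact: decaying_dominated d2].
rewrite (le_trans (ler_rnormB _ _))// exprS -mulrA mulr2n mulrDl !mul1r.
by apply: lerD; [exact: Hb d1|exact: Hb d2].
Qed.

End ShellPoints.

(** * Operators depending holomorphically on a parameter *)

Section LinearMaps.
Context {R : realType}.

Lemma linear_packP (V W : lmodType R[i]) (f : V -> W) : linear f ->
  exists L : {linear V -> W}, L =1 f.
Proof.
move=> lf; pose m := GRing.isLinear.Build R[i] V W *:%R f lf.
by exists (HB.pack f m : {linear V -> W}).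
Qed.

Lemma linear_comp (U V W : lmodType R[i]) (f : V -> W) (g : U -> V) :
  linear f -> linear g -> linear (f \o g).
Proof. by move=> lf lg a x y /=; rewrite lg lf. Qed.

Section LinearTheory.
Context (V W : lmodType R[i]) (f : V -> W) (lf : linear f).

(** Operator families are plain functions, linear only for parameters in a part of the plane. These
    are the rules of linear maps for a linearity predicate. *)
Lemma linear_predD x y : f (x + y) = f x + f y.
Proof. by have := lf 1 x y; rewrite !scale1r. Qed.

Lemma linear_pred0 : f 0 = 0.
Proof. by apply: (@addrI _ (f 0)); rewrite -linear_predD !addr0. Qed.

Lemma linear_predZ a x : f (a *: x) = a *: f x.
Proof. by have := lf a x 0; rewrite linear_pred0 !addr0. Qed.

Lemma linear_predN x : f (- x) = - f x.
Proof. by rewrite -scaleN1r linear_predZ scaleN1r. Qed.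

Lemma linear_predB x y : f (x - y) = f x - f y.
Proof. by rewrite linear_predD linear_predN. Qed.

Lemma linear_pred_sum (I : Type) (r : seq I) (P : pred I) (F : I -> V) :
  f (\sum_(i <- r | P i) F i) = \sum_(i <- r | P i) f (F i).
Proof. exact: (big_morph f linear_predD linear_pred0). Qed.

End LinearTheory.
End LinearMaps.

Section Holomorphic.
Context {R : realType} {V : normedModType R[i]}.
Implicit Types (D : set R[i]) (W : R[i] -> V -> V).

Lemma cderivD (f g : R[i] -> V) z df dg : cderiv f z df -> cderiv g z dg ->
  cderiv (fun z => f z + g z) z (df + dg).
Proof.
move=> fd gd e e0; have e2 : 0 < e / 2 by rewrite divr_gt0.
have [d1 d10 H1] := fd _ e2; have [d2 d20 H2] := gd _ e2.
exists (Num.min d1 d2) => [|w]; first by rewrite lt_min d10.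
rewrite lt_min => /andP[/H1 {}H1 /H2 {}H2].
have -> : f (z + w) + g (z + w) - (f z + g z) - w *: (df + dg) =
    (f (z + w) - f z - w *: df) + (g (z + w) - g z - w *: dg).
  by apply: cfunctional_inj => c cD cN cZ; rewrite !(cD, cN, cZ); ring.
by rewrite (le_trans (ler_rnormD _ _))// (le_trans (lerD H1 H2))// -mulrDl -splitr.
Qed.

Lemma cderiv_cst (v : V) z : cderiv (fun=> v) z 0.
Proof.
move=> e e0; exists 1 => // w _.
by rewrite scaler0 !subrr rnorm0 mulr_ge0 ?rnorm_ge0// ltW.
Qed.

Lemma cdiff_near (f : R[i] -> V) z : cdiff f z -> forall e : R, 0 < e ->
  exists2 d : R, 0 < d & forall w : R[i], rnorm w < d -> rnorm (f (z + w) - f z) <= e.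
Proof.
move=> [df fd] e e0; have [d d0 H] := fd 1 ltr01.
have m0 : 0 < 1 + rnorm df by rewrite ltr_pwDl ?rnorm_ge0.
exists (Num.min d (e / (1 + rnorm df))) => [|w]; first by rewrite lt_min d0 divr_gt0.
rewrite lt_min ltr_pdivlMr// => /andP[/H Hw we].
rewrite -(subrK (w *: df) (f (z + w) - f z)) (le_trans (ler_rnormD _ _))//.
by rewrite (le_trans _ (ltW we))// mulrDr mulr1 rnormZ lerD// (le_trans Hw)// mul1r.
Qed.

Lemma cdiffD (f g : R[i] -> V) z : cdiff f z -> cdiff g z ->
  cdiff (fun z => f z + g z) z.
Proof. by move=> [df fd] [dg gd]; exists (df + dg); exact: cderivD. Qed.

Lemma cdiff_cst (v : V) z : cdiff (fun=> v) z.
Proof. by exists 0; exact: cderiv_cst. Qed.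

End Holomorphic.

Section OperatorFamilies.
Context {R : realType}.
Implicit Types (D : set R[i]).

(** The product rule for strongly holomorphic, locally bounded families. The increment splits into
    [L (z + w)] applied to the remainder of [g], the variation of [L] on the fixed vector [dg], and
    the remainder of [L] on the fixed vector [g z]. *)
Lemma cdiff_apply (V U : normedModType R[i]) (L : R[i] -> V -> U) (g : R[i] -> V) z d C :
  0 < d -> 0 <= C -> (forall w : R[i], rnorm w < d -> linear (L (z + w))) ->
  (forall (w : R[i]) x, rnorm w < d -> rnorm (L (z + w) x) <= C * rnorm x) ->
  (forall x, cdiff (L^~ x) z) -> cdiff g z ->
  cdiff (fun z => L z (g z)) z.
Proof.
move=> d0 C0 Ll LC Ld [dg gd]; have [dL Lgd] := Ld (g z).
exists (L z dg + dL) => e e0.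
have e3 : 0 < e / 3 by rewrite divr_gt0.
(* [1 + C] instead of [C], which may vanish. *)
have k0 : 0 < e / (3 * (1 + C)) by rewrite divr_gt0// mulr_gt0// ltr_pwDl.
have [d1 d10 H1] := gd _ k0.
have [d2 d20 H2] := Lgd _ e3.
have [d3 d30 H3] := cdiff_near (Ld dg) e3.
exists (Num.min (Num.min d d1) (Num.min d2 d3)) => [|w]; first by rewrite !lt_min d0 d10 d20.
rewrite !lt_min => /andP[/andP[wd /H1 {}H1] /andP[/H2 {}H2 /H3 {}H3]].
have lw := Ll _ wd.
have -> : L (z + w) (g (z + w)) - L z (g z) - w *: (L z dg + dL) =
    L (z + w) (g (z + w) - g z - w *: dg) + w *: (L (z + w) dg - L z dg) +
    (L (z + w) (g z) - L z (g z) - w *: dL).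
  rewrite !(linear_predB lw) (linear_predZ lw).
  by apply: cfunctional_inj => c cD cN cZ; rewrite !(cD, cN, cZ); ring.
rewrite (le_trans (ler_rnormD _ _))//.
have -> : e * rnorm w = (e / 3 * rnorm w + e / 3 * rnorm w) + e / 3 * rnorm w by field.
rewrite lerD// (le_trans (ler_rnormD _ _))// lerD//.
  rewrite (le_trans (LC _ _ wd))// (le_trans (ler_wpM2l C0 H1))// mulrA ler_wpM2r ?rnorm_ge0//.
  rewrite (_ : C * _ = e / 3 * (C / (1 + C))); last by field; rewrite gt_eqF// ltr_pwDl.
  rewrite ler_piMr//; first exact: ltW.
  by rewrite ler_pdivrMr ?ltr_pwDl// mul1r lerDr ler01.
by rewrite rnormZ mulrC ler_wpM2r ?rnorm_ge0.
Qed.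

Lemma cdiff_scale (V : normedModType R[i]) (f : R[i] -> R[i]^o) (g : R[i] -> V) z :
  cdiff f z -> cdiff g z -> cdiff (fun z => f z *: g z) z.
Proof.
move=> fd; have [d d0 H] := cdiff_near fd ltr01.
apply: (@cdiff_apply V V (fun z x => f z *: x) g z d (rnorm (f z) + 1)) => //.
- by rewrite addr_ge0 ?rnorm_ge0.
- by move=> w _ a x y; rewrite scalerDr !scalerA mulrC.
- move=> w x wd; rewrite rnormZ ler_wpM2r ?rnorm_ge0//.
  rewrite -(subrK (f z) (f (z + w))) addrC (le_trans (ler_rnormD _ _))// lerD//.
  exact: H.
- move=> x; have [df dfP] := fd; exists (df *: x) => e e0.
  have m0 : 0 < 1 + rnorm x by rewrite ltr_pwDl ?rnorm_ge0.
  have [d' d'0 H'] := dfP _ (divr_gt0 e0 m0); exists d' => // w wd.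
  rewrite scalerA -!scalerBl rnormZ (le_trans (ler_wpM2r (rnorm_ge0 _) (H' _ wd)))//.
  rewrite mulrAC ler_wpM2r ?rnorm_ge0// mulrAC ler_pdivrMr// ler_pM2l//.
  by rewrite lerDr ler01.
Qed.

Lemma cdiff_id z : cdiff (fun z : R[i] => z : R[i]^o) z.
Proof.
exists 1 => e e0; exists 1 => // w _.
rewrite (_ : _ - _ - _ = 0); last by rewrite /GRing.scale /=; ring.
by rewrite rnorm0 mulr_ge0 ?rnorm_ge0// ltW.
Qed.

Lemma cdiff_inv (c z : R[i]) : z + c != 0 ->
  cdiff (fun z : R[i] => (z + c)^-1 : R[i]^o) z.
Proof.
move=> zc; exists (- (z + c)^-1 ^+ 2) => e e0.
have m0 : 0 < rnorm (z + c) by rewrite lt_def rnorm_eq0 zc rnorm_ge0.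
set m := rnorm (z + c) in m0.
exists (Num.min (m / 2) (e * m ^+ 3 / 2)) => [|w].
  by rewrite lt_min !divr_gt0// mulr_gt0// exprn_gt0.
rewrite lt_min => /andP[wm we].
have mw : m / 2 <= rnorm (z + w + c).
  rewrite (_ : z + w + c = (z + c) - (- w)); last by ring.
  rewrite (le_trans _ (ler_rnorm_sub _ _))// rnormN -/m.
  lra.
have mw0 : 0 < rnorm (z + w + c) by rewrite (lt_le_trans _ mw)// divr_gt0.
have zwc : z + w + c != 0 by rewrite -rnorm_eq0 gt_eqF.
rewrite (_ : _ - _ - _ = w ^+ 2 * ((z + c)^-1 ^+ 2 * (z + w + c)^-1)); last first.
  by rewrite /GRing.scale /=; field; rewrite zc zwc.
rewrite rnormM rnormX rnormM rnormX !rnormV -/m expr2 -mulrA mulrC ler_wpM2r ?rnorm_ge0//.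
rewrite (@le_trans _ _ (rnorm w * (m^-1 ^+ 2 * (m / 2)^-1)))//.
  rewrite ler_wpM2l ?rnorm_ge0// ler_wpM2l ?exprn_ge0 ?invr_ge0 ?(ltW m0)//.
  by rewrite lef_pV2 ?posrE// divr_gt0.
rewrite (@le_trans _ _ (e * m ^+ 3 / 2 * (m^-1 ^+ 2 * (m / 2)^-1)))//.
  by rewrite ler_wpM2r ?(ltW we)// mulr_ge0// ?exprn_ge0 ?invr_ge0 ?divr_ge0 ?(ltW m0).
by rewrite le_eqVlt; apply/orP; left; apply/eqP; field; rewrite gt_eqF.
Qed.

Definition copen D := forall z, D z ->
  exists2 d : R, 0 < d & forall w : R[i], rnorm w < d -> D (z + w).

Context {V : normedModType R[i]}.
Implicit Types (W : R[i] -> V -> V).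

Definition op_holo D W (C : R) := [/\ 0 <= C, forall z, D z -> linear (W z),
  forall z x, D z -> rnorm (W z x) <= C * rnorm x &
  forall z x, D z -> cdiff (W^~ x) z].

Lemma op_holo_cdiff D W C g z : copen D -> op_holo D W C -> D z -> cdiff g z ->
  cdiff (fun z => W z (g z)) z.
Proof.
move=> oD [C0 Wl WC Wd] Dz; have [d d0 dD] := oD _ Dz.
apply: (@cdiff_apply V V W g z d C) => //.
- by move=> w /dD; exact: Wl.
- by move=> w x /dD; exact: WC.
- by move=> x; exact: Wd.
Qed.

Lemma op_holo_comp D W W' C C' : copen D -> op_holo D W C -> op_holo D W' C' ->
  op_holo D (fun z x => W z (W' z x)) (C * C').
Proof.
move=> oD oW oW'; have [C0 Wl WC Wd] := oW; have [C'0 W'l W'C W'd] := oW'.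
split; first by rewrite mulr_ge0.
- by move=> z Dz; apply: linear_comp; [exact: Wl|exact: W'l].
- move=> z x Dz; rewrite (le_trans (WC _ _ Dz))// -mulrA ler_wpM2l//; exact: W'C.
- by move=> z x Dz; apply: (op_holo_cdiff oD oW Dz); exact: W'd.
Qed.

Lemma op_holoD D W W' C C' : op_holo D W C -> op_holo D W' C' ->
  op_holo D (fun z x => W z x + W' z x) (C + C').
Proof.
move=> [C0 Wl WC Wd] [C'0 W'l W'C W'd].
split; first by rewrite addr_ge0.
- by move=> z Dz a x y; rewrite Wl// W'l// scalerDr addrACA.
- move=> z x Dz; rewrite (le_trans (ler_rnormD _ _))// mulrDl lerD//; [exact: WC|exact: W'C].
- by move=> z x Dz; apply: cdiffD; [exact: Wd|exact: W'd].
Qed.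

Lemma op_holo_id D : op_holo D (fun _ x => x) 1.
Proof.
by split => // [z x Dz|z x Dz]; [rewrite mul1r|exact: cdiff_cst].
Qed.

Lemma op_holo_map D W C (L : V -> V) c : copen D -> 0 <= c -> linear L ->
  (forall x, rnorm (L x) <= c * rnorm x) ->
  op_holo D W C -> op_holo D (fun z x => L (W z x)) (c * C).
Proof.
move=> oD c0 lL Lc; apply: (@op_holo_comp D (fun _ x => L x)) => //.
by split => // z x Dz; exact: cdiff_cst.
Qed.

Lemma op_holoZ D W C (a : R[i]) : copen D -> op_holo D W C ->
  op_holo D (fun z x => a *: W z x) (rnorm a * C).
Proof.
move=> oD; apply: op_holo_map => //; first exact: rnorm_ge0.
  by move=> b x y; rewrite scalerDr !scalerA mulrC.
by move=> x; rewrite rnormZ.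
Qed.

Lemma op_holoB D W W' C C' : copen D -> op_holo D W C -> op_holo D W' C' ->
  op_holo D (fun z x => W z x - W' z x) (C + C').
Proof.
move=> oD oW oW'.
have := op_holoD oW (op_holoZ (-1) oD oW'); rewrite rnormN rnorm1 mul1r.
rewrite (_ : (fun z x => _ + _) = (fun z x => W z x - W' z x))//.
by apply/funext => z; apply/funext => x; rewrite scaleN1r.
Qed.

Section Resolvent.
Variable A : set (V * V).

Lemma resolventP z : resolvent_set A z ->
  [/\ forall v, A (resolvent A z v, z *: resolvent A z v - v),
      forall x y, A (x, y) -> resolvent A z (z *: x - y) = x &
      linear (resolvent A z)].
Proof.
move=> [S [_ AS SA]].
have RS v : resolvent A z v = S v.
  have /= H : A (resolvent A z v, z *: resolvent A z v - v).
    by apply: (@xgetPex _ 0 [set x | A (x, z *: x - v)]); exists (S v) => /=.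
  by have := SA _ _ H; rewrite opprB addrC subrK.
split => [v|x y Axy|a x y]; first by rewrite RS.
  by rewrite RS SA.
by rewrite !RS linearP.
Qed.

Lemma resolvent_identity z w v : resolvent_set A z -> resolvent_set A w ->
  resolvent A z v - resolvent A w v = (w - z) *: resolvent A z (resolvent A w v).
Proof.
move=> /resolventP[_ zl zL] /resolventP[wA _ _].
have := zl _ _ (wA v); set x := resolvent A w v.
rewrite (_ : z *: x - (w *: x - v) = v - (w - z) *: x); last first.
  by apply: cfunctional_inj => c cD cN cZ; rewrite !(cD, cN, cZ); ring.
rewrite (linear_predB zL) (linear_predZ zL) => H.
by rewrite -[X in _ - X]H opprB addrC subrK.
Qed.

Lemma resolvent_commute (S : V -> V) z v : resolvent_set A z -> linear S ->
  (forall x y, A (x, y) -> A (S x, S y)) ->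
  resolvent A z (S v) = S (resolvent A z v).
Proof.
move=> /resolventP[zA zl _] lS SA; have := zl _ _ (SA _ _ (zA v)).
rewrite (linear_predB lS) (linear_predZ lS) => <-.
by rewrite opprB addrC subrK.
Qed.

(** By the resolvent identity the derivative of R(z) x is - R(z)^2 x, with remainder exactly w^2 R(z
    + w) R(z)^2 x. As 0 is not in [D], the bound on z R(z) controls R(z + w) for small w. *)
Lemma op_holo_resolvent D C : copen D -> 0 <= C -> D `<=` resolvent_set A -> ~ D 0 ->
  (forall z x, D z -> rnorm (z *: resolvent A z x) <= C * rnorm x) ->
  op_holo D (fun z x => z *: resolvent A z x) C.
Proof.
move=> oD C0 Dr D0 DC; split => // z.
  by move=> /Dr/resolventP[_ _ lr] a x y; rewrite lr scalerDr !scalerA mulrC.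
move=> x Dz; apply: (@cdiff_scale V (fun z => z) (fun z => resolvent A z x)).
  exact: cdiff_id.
have z0 : z != 0 by apply/eqP => z0; apply: D0; rewrite -z0.
have m0 : 0 < rnorm z by rewrite lt_def rnorm_eq0 z0 rnorm_ge0.
have [d d0 dD] := oD _ Dz.
pose y := resolvent A z (resolvent A z x).
have [_ _ zL] := resolventP (Dr _ Dz).
exists (- y) => e e0.
(* The bound of R(z + w) y obtained from |z + w| >= |z| / 2. *)
pose k := 2 * C / rnorm z * rnorm y.
have k0 : 0 <= k by rewrite !mulr_ge0 ?invr_ge0 ?rnorm_ge0.
have k1 : 0 < 1 + k by rewrite ltr_pwDl.
exists (Num.min d (Num.min (rnorm z / 2) (e / (1 + k)))) => [|w].
  by rewrite !lt_min d0 !divr_gt0.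
rewrite !lt_min (ltr_pdivlMr _ _ k1) => /and3P[wd wz we].
have Dw := dD _ wd; have [_ _ wL] := resolventP (Dr _ Dw).
have E : resolvent A (z + w) x - resolvent A z x - w *: - y =
    w ^+ 2 *: resolvent A (z + w) y.
  have H1 := resolvent_identity x (Dr _ Dw) (Dr _ Dz).
  have H2 := resolvent_identity (resolvent A z x) (Dr _ Dw) (Dr _ Dz).
  rewrite H1 -(subrK y (resolvent A (z + w) (resolvent A z x))) H2.
  by apply: cfunctional_inj => c cD cN cZ; rewrite !(cD, cN, cZ) -/y; ring.
rewrite E rnormZ rnormX expr2 mulrAC ler_wpM2r ?rnorm_ge0//.
have zw : rnorm z / 2 <= rnorm (z + w).
  rewrite -(opprK w) (le_trans _ (ler_rnorm_sub _ _))// rnormN.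
  lra.
have zw0 : 0 < rnorm (z + w) by rewrite (lt_le_trans _ zw)// divr_gt0.
have Rk : rnorm (resolvent A (z + w) y) <= k.
  rewrite -(ler_pM2l zw0) -rnormZ (le_trans (DC _ _ Dw))//.
  rewrite (@le_trans _ _ (rnorm z / 2 * k))//; last by rewrite ler_wpM2r.
  by rewrite le_eqVlt; apply/orP; left; apply/eqP; rewrite /k; field; rewrite gt_eqF.
rewrite (le_trans _ (ltW we))// ler_wpM2l ?rnorm_ge0// (le_trans Rk)//.
by rewrite lerDr ler01.
Qed.

End Resolvent.
End OperatorFamilies.

Section RayShift.
Context {R : realType} {V : completeNormedModType R[i]}.
Notation mu := (@lebesgue_measure R).
Notation bint F := (bochner_integral mu F).

Lemma op_ray_shift (D : set R[i]) (W : R[i] -> V -> V) (C c s a1 a2 : R)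
    (f : R[i] -> R[i]^o) (x : V) : copen D -> op_holo D W C -> 0 < s -> a1 <= a2 ->
  (forall u a, a1 <= a <= a2 -> D (polar u a)) ->
  (forall u a, a1 <= a <= a2 -> cdiff f (polar u a)) ->
  (forall u a, a1 <= a <= a2 -> rnorm (f (polar u a)) <= c * edecay s u) ->
  bint (fun u => f (polar u a1) *: W (polar u a1) x) =
  bint (fun u => f (polar u a2) *: W (polar u a2) x).
Proof.
move=> oD oW s0; rewrite le_eqVlt => /predU1P[->//|a12] Da fd fc.
have [C0 _ WC Wd] := oW.
apply: (@strip_invariance _ _ (fun z => f z *: W z x) a1 a2 (c * (C * rnorm x)) s) => //.
  by move=> u a aP; apply: cdiff_scale; [exact: fd|apply: Wd; exact: Da].
move=> u a aP; rewrite rnormZ mulrAC.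
apply: ler_pM; rewrite ?rnorm_ge0//; [exact: fc|by apply: WC; exact: Da].
Qed.

End RayShift.

(** * Laplace transform of a bounded semigroup *)

Section ShiftHalfLine.
Context {R : realType}.
Notation mu := (@lebesgue_measure R).

Let ge0_shift (f : R -> R) (a : R) : continuous f -> (forall x, 0 <= f x) ->
  (\int[mu]_(x in `[a, +oo[) (f x)%:E = \int[mu]_(x in `[0%R, +oo[) (f (x + a))%:E)%E.
Proof.
move=> cf f0.
have dE : ((fun x : R => x + a)^`())%classic = cst 1.
  by apply/funext => x; rewrite derive1E deriveD// derive_cst addr0 derive_id.
have cc x : {for x, continuous (fun y : R => y + a)}.
  by apply: cvgD; [exact: cvg_id|exact: cvg_cst].
have := @increasing_ge0_integration_by_substitutiony R (fun x => x + a) f 0.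
rewrite add0r => ->.
- by apply: eq_integral => u _; rewrite dE fctE /= mulr1.
- by move=> x y _ _; rewrite ltrD2r.
- by move=> x _; rewrite dE; exact: cst_continuous.
- by rewrite dE; exact: is_cvg_cst.
- by rewrite dE; exact: is_cvg_cst.
- split; first by move=> x _; apply: derivableD => //; exact: derivable_id.
  by apply: cvg_at_right_filter; exact: cc.
- exact: cvg_addrr.
- exact: continuous_subspaceT.
- by move=> x _; exact: f0.
Qed.

Lemma Rintegral_shift_y (f : R -> R) (a : R) : continuous f ->
  \int[mu]_(x in `[a, +oo[) f x = \int[mu]_(x in `[0, +oo[) f (x + a).
Proof.
move=> cf; rewrite /Rintegral; congr fine.
rewrite [LHS]integralE [RHS]integralE.
have posE D (g : R -> R) :
    (\int[mu]_(x in D) (EFin \o g)^\+ x = \int[mu]_(x in D) ((g^\+)%R x)%:E)%E.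
  by apply: eq_integral => u _; rewrite funeposE /funrpos EFin_max.
have negE D (g : R -> R) :
    (\int[mu]_(x in D) (EFin \o g)^\- x = \int[mu]_(x in D) ((g^\-)%R x)%:E)%E.
  by apply: eq_integral => u _; rewrite funenegE /funrneg EFin_max.
have H1 := ge0_shift a (continuous_funrpos cf) (funrpos_ge0 f).
have H2 := ge0_shift a (continuous_funrneg cf) (funrneg_ge0 f).
congr (_ - _)%E.
  by apply: etrans (posE _ f) _; apply: etrans H1 _; apply/esym/(posE _ (fun x => f (x + a))).
by apply: etrans (negE _ f) _; apply: etrans H2 _; apply/esym/(negE _ (fun x => f (x + a))).
Qed.

End ShiftHalfLine.

Section Laplace.
Context {R : realType} {X : completeNormedModType R[i]}.
Notation mu := (@lebesgue_measure R).
Notation bint F := (bochner_integral mu F).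

(** The complex exponential of [t%:C * z]. *)
Definition zexp (z : R[i]) (t : R) : R[i] := polar (complex.Re z * t) (complex.Im z * t).

Lemma zexpD z s t : zexp z (s + t) = zexp z s * zexp z t.
Proof. by rewrite /zexp !mulrDr polarD. Qed.

Lemma rnorm_zexp z t : rnorm (zexp z t) = expR (complex.Re z * t).
Proof. exact: rnorm_polar. Qed.

Let complex_scale_real z (t : R) : (complex.Re z * t) +i* (complex.Im z * t) = t%:C * z.
Proof. by case: z => a b; simpc; rewrite mulrC (mulrC b). Qed.

Lemma zexp_approx z (e : R) : 0 < e -> exists2 d : R, 0 < d & forall t : R, `|t| < d ->
  rnorm (zexp z t - 1 - t%:C * z) <= e * `|t|.
Proof.
move=> e0; pose k := `|complex.Re z| + `|complex.Im z| + 1.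
have k0 : 0 < k by rewrite ltr_wpDl// addr_ge0.
have [d d0 H] := polar_approx 0 0 (divr_gt0 e0 k0).
exists (d / k) => [|t]; first by rewrite divr_gt0.
rewrite ltr_pdivlMr// => td.
have rk : `|complex.Re z| <= k by rewrite /k -addrA lerDl addr_ge0.
have ik : `|complex.Im z| <= k by rewrite /k addrAC lerDr addr_ge0.
have /= := H (complex.Re z * t) (complex.Im z * t).
rewrite !add0r polar00 mulr1 !normrM => /(_ _ _).
rewrite (complex_scale_real z t).
move=> {}H; rewrite (le_trans (H _ _))//.
- by rewrite (le_lt_trans _ td)// mulrC ler_wpM2l.
- by rewrite (le_lt_trans _ td)// mulrC ler_wpM2l.
- rewrite -mulrDl mulrA ler_wpM2r// mulrAC ler_pdivrMr// ler_pM2l//.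
  by rewrite /k lerDl.
Qed.

Lemma zexp_near1 z (e : R) : 0 < e -> exists2 d : R, 0 < d & forall t : R, `|t| < d ->
  rnorm (zexp z t - 1) <= e.
Proof.
move=> e0; have [d d0 H] := zexp_approx z ltr01.
have k0 : 0 < 1 + rnorm z by rewrite ltr_pwDl ?rnorm_ge0.
exists (Num.min d (e / (1 + rnorm z))) => [|t]; first by rewrite lt_min d0 divr_gt0.
rewrite lt_min (ltr_pdivlMr _ _ k0) => /andP[/H Ht te].
rewrite -(subrK (t%:C * z) (zexp z t - 1)) (le_trans (ler_rnormD _ _))//.
rewrite (le_trans _ (ltW te))// mulrDr mulr1 lerD//; first by rewrite -[leRHS]mul1r.
by rewrite rnormM rnorm_real.
Qed.

Lemma continuous_zexp z : continuous (fun t : R => zexp z t : R[i]^o).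
Proof.
move=> t; apply/cvg_rnormP => e e0.
have k0 : 0 < 2 * rnorm (zexp z t) by rewrite mulr_gt0// rnorm_polar expR_gt0.
have [d d0 H] := zexp_near1 z (divr_gt0 e0 k0).
exists d => // u /=; rewrite distrC => /H Hu.
rewrite (_ : zexp z u - _ = (zexp z (u - t) - 1) * zexp z t); last first.
  by rewrite mulrBl mul1r -zexpD subrK.
rewrite rnormM.
rewrite (le_lt_trans (ler_wpM2r (rnorm_ge0 _) Hu))//.
rewrite invfM mulrA mulfVK; last by rewrite rnorm_polar gt_eqF ?expR_gt0.
by rewrite ltr_pdivrMr// ltr_pMr// ltr1n.
Qed.

Lemma edecay_mass_le (s : R) : 0 < s -> edecay_mass s <= 2 / s.
Proof. by move=> s0; rewrite /edecay_mass /Rintegral integral_edecay//= mulr2n -mulr2n. Qed.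

Variables (T : R -> {linear X -> X}) (M : R).
Hypotheses (hT : C0_semigroup T) (M0 : 0 <= M).
Hypothesis TM : forall t x, 0 <= t -> rnorm (T t x) <= M * rnorm x.

Lemma semigroup_right_near x (e : R) : 0 < e -> exists2 d : R, 0 < d &
  forall t, 0 <= t -> t < d -> rnorm (T t x - x) <= e.
Proof.
have [_ T0 _ Tc] := hT => e0.
have [d /= d0 H] := (cvg_rnormP _ _).1 (Tc x) _ e0.
exists d => // t; rewrite le_eqVlt => /predU1P[<- _|t0 td].
  by rewrite T0 subrr rnorm0 ltW.
apply/ltW/H => //=.
by rewrite sub0r normrN gtr0_norm.
Qed.

(** The values of [T] at negative times carry no information; the even extension in time is
    continuous on the whole line, which the integration lemmas require. *)
Lemma continuous_semigroup_abs x : continuous (fun t : R => T `|t| x).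
Proof.
have [_ T0 TD Tc] := hT.
move=> t; apply/cvg_rnormP => e e0.
have m0 : 0 < 1 + M by rewrite ltr_pwDl.
have [d d0 H] := semigroup_right_near x (divr_gt0 e0 (mulr_gt0 (ltr0n _ 2) m0)).
have key a h : 0 <= a -> 0 <= h -> h < d -> rnorm (T (a + h) x - T a x) < e.
  move=> a0 h0 hd; rewrite TD// -linearB (le_lt_trans (TM _ a0))//.
  rewrite (@le_lt_trans _ _ (M * (e / (2 * (1 + M)))))//; first by rewrite ler_wpM2l// H.
  rewrite (_ : M * _ = e * (M / (2 * (1 + M)))); last by field; rewrite gt_eqF.
  rewrite gtr_pMr// ltr_pdivrMr ?mulr_gt0//; lra.
exists d => // u /= ud.
have [tu|/ltW ut] := leP `|t| `|u|.
  rewrite -[X in T X](subrK `|t| `|u|) [X in T X]addrC; apply: key; rewrite ?subr_ge0//.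
  rewrite (le_lt_trans _ ud)// distrC -[leLHS]ger0_norm ?subr_ge0//; exact: ler_dist_dist.
rewrite rnormC -[X in T X x - _](subrK `|u| `|t|) [X in T X x - _]addrC; apply: key; rewrite ?subr_ge0//.
by rewrite (le_lt_trans _ ud)// -[leLHS]ger0_norm ?subr_ge0//; exact: ler_dist_dist.
Qed.

Variables (z : R[i]) (z_lt0 : complex.Re z < 0).

Let s := - complex.Re z.
Let s0 : 0 < s. Proof. by rewrite oppr_gt0. Qed.

Definition laplace_integrand x (t : R) : X := if t < 0 then 0 else zexp z t *: T t x.

(** For Re z < 0 this is minus the resolvent at z of the negative generator. *)
Definition laplace x : X := bint (laplace_integrand x).

Let G x (t : R) : X := zexp z `|t| *: T `|t| x.

Let continuousG x : continuous (G x).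
Proof.
move=> t; apply: (@cvgZ _ _ _ _ _ (fun t : R => zexp z `|t| : R[i]^o)); last exact: continuous_semigroup_abs.
apply: (@continuous_comp _ _ _ (fun t : R => `|t|) (fun t : R => zexp z t : R[i]^o)).
  exact: norm_continuous.
exact: continuous_zexp.
Qed.

Let rnormG x t : rnorm (G x t) <= M * rnorm x * edecay s t.
Proof.
rewrite rnormZ rnorm_zexp mulrC /edecay opprK; apply: ler_pM; rewrite ?rnorm_ge0 ?expR_ge0//.
exact: TM.
Qed.

Let integrandE x t : 0 <= t -> laplace_integrand x t = G x t.
Proof. by move=> t0; rewrite /laplace_integrand /G ltNge t0 ger0_norm. Qed.

Lemma laplace_dominated x : dominated_continuous (laplace_integrand x).
Proof.
split.
  move=> t t0; have [tneg|tpos] := ltP t 0.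
    rewrite /prop_for /continuous_at /laplace_integrand tneg.
    apply: cvg_near_cst; near=> u; rewrite ifT//; near: u; exact: lt_nbhsl.
  have {}tpos : 0 < t by rewrite lt_def t0.
  rewrite /prop_for /continuous_at integrandE ?(ltW tpos)//.
  apply: cvg_trans (@continuousG x t); apply: near_eq_cvg.
  near=> u; rewrite integrandE//; apply: ltW; near: u; exact: lt_nbhsr.
exists (fun t => M * rnorm x * edecay s t); split.
- by apply: measurable_funM => //; apply: continuous_measurable_fun; exact: continuous_edecay.
- by move=> t; rewrite !mulr_ge0 ?rnorm_ge0 ?edecay_ge0.
- exact: (integrableZl measurableT (M * rnorm x) (integrable_edecay s0)).
- move=> t _; rewrite /laplace_integrand; case: ltP => [_|t0].
    by rewrite rnorm0 !mulr_ge0 ?rnorm_ge0 ?edecay_ge0.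
  by have := rnormG x t; rewrite /G ger0_norm.
Unshelve. all: by end_near.
Qed.

Lemma rnorm_laplace x : rnorm (laplace x) <= M * (2 / s) * rnorm x.
Proof.
rewrite mulrAC (@le_trans _ _ (M * rnorm x * edecay_mass s))//; last first.
  by rewrite ler_wpM2l ?edecay_mass_le// mulr_ge0 ?rnorm_ge0.
rewrite /edecay_mass -RintegralZl//; last exact: integrable_edecay.
apply: rnorm_bint.
- exact: laplace_dominated.
- by move=> t; rewrite !mulr_ge0 ?rnorm_ge0 ?edecay_ge0.
- exact: (integrableZl measurableT (M * rnorm x) (integrable_edecay s0)).
- move=> t _; rewrite /laplace_integrand; case: ltP => [_|t0].
    by rewrite rnorm0 !mulr_ge0 ?rnorm_ge0 ?edecay_ge0.
  by have := rnormG x t; rewrite /G ger0_norm.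
Qed.

Lemma linear_laplace : linear laplace.
Proof.
move=> a x y; rewrite /laplace -bintZ; last exact: laplace_dominated.
rewrite -bintD; [|exact/dominated_continuousZ/laplace_dominated|exact: laplace_dominated].
congr bochner_integral; apply/funext => t; rewrite /laplace_integrand.
case: ifP => _; first by rewrite scaler0 addr0.
by rewrite linearP scalerDr !scalerA mulrC.
Qed.

Let rfunctional_laplace (l : X -> R) x : rfunctional l ->
  l (laplace x) = \int[mu]_(t in `[0, +oo[) l (G x t).
Proof.
move=> lP; rewrite (bint_functional (laplace_dominated x) lP).
rewrite [RHS]Rintegral_mkcond; congr (Rintegral _ _ _); apply/funext => t.
rewrite patchE /laplace_integrand; case: ifPn => t0.
  by rewrite (rfunctional0 lP) ifF// memNset//= in_itv/= andbT leNgt t0.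
by rewrite -leNgt in t0; rewrite ifT ?inE/= ?in_itv/= ?t0// /G ger0_norm.
Qed.

Let integrable_G (l : X -> R) x : rfunctional l ->
  mu.-integrable setT (EFin \o (fun t => l (G x t))).
Proof.
move=> lP; apply: integrable_functional lP.
apply: (@decaying_dominated _ _ (M * rnorm x) s).
by split => //; exact: rnormG.
Qed.

(** Applying [T tau] turns the integral over the half-line from 0 into exp (- z tau) times the one
    from [tau]; the difference is the integral over [0, tau]. *)
Lemma laplace_shift (l : X -> R) x (tau : R) : rfunctional l -> 0 < tau ->
  l (T tau (laplace x)) =
  l (zexp z (- tau) *: laplace x) -
  \int[mu]_(t in `[0, tau]) l (zexp z (- tau) *: (zexp z `|t| *: T `|t| x)).
Proof.
move=> lP tau0; have [Tc T0 TD _] := hT.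
have lP' := rfunctional_scale (zexp z (- tau)) lP.
pose g t := l (zexp z (- tau) *: G x t).
have cg : continuous g by move=> t; apply: (rfunctional_cvg lP'); exact: continuousG.
have ig : mu.-integrable setT (EFin \o g) := integrable_G x lP'.
have -> : l (T tau (laplace x)) = \int[mu]_(t in `[tau, +oo[) g t.
  have lPT := rfunctional_comp (fun x => TM x (ltW tau0)) lP.
  rewrite (Rintegral_shift_y _ cg); apply: etrans (rfunctional_laplace x lPT) _.
  apply: eq_Rintegral => t; rewrite inE /= in_itv/= andbT => t0.
  rewrite /g /G /= linearZ !ger0_norm ?addr_ge0 ?(ltW tau0)// scalerA -zexpD addrC addrK.
  by rewrite addrC TD// ltW.
rewrite (rfunctional_laplace x lP').
rewrite -[X in _ = _ - X]/(\int[mu]_(t in `[0, tau]) g t).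
have sub (i : interval R) : mu.-integrable [set` i] (EFin \o g).
  by apply: integrableS ig => //; exact: measurable_itv.
rewrite -(Rintegral_itv_obnd_cbnd (sub _)).
by rewrite -(@Rintegral_itvB _ g (BLeft 0) +oo%O tau (sub _)) ?bnd_simp//= ltW.
Qed.

(** By [laplace_shift], w - T t w is the sum of w - exp (- z t) w and an integral over [0, t] with
    integrand close to x. Divided by t they tend to z w and x; the errors are e / 4 for the former
    and e / 2 for the latter. *)
Lemma laplace_generator x : neg_generator T (laplace x, z *: laplace x + x).
Proof.
rewrite /neg_generator /=; set w := laplace x.
have [Tc T0 TD _] := hT.
have k0 : 0 < M * rnorm x + 1 by rewrite ltr_wpDl// mulr_ge0 ?rnorm_ge0.
have w0 : 0 < rnorm w + 1 by rewrite ltr_wpDl ?rnorm_ge0.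
apply/cvg_rnormP => e e0; have e3 : 0 < e / 4 by rewrite divr_gt0.
have [d1 d10 H1] := zexp_near1 z (divr_gt0 e3 k0).
have [d2 d20 H2] := semigroup_right_near x e3.
have [d3 d30 H3] := zexp_approx z (divr_gt0 e3 w0).
exists (Num.min d1 (Num.min d2 d3)); first by rewrite /= !lt_min d10 d20.
move=> t /=; rewrite sub0r normrN => + t0; rewrite gtr0_norm// !lt_min => /and3P[t1 t2 t3].
have near_cst r : 0 <= r <= t -> rnorm (zexp z (- t) *: (zexp z `|r| *: T `|r| x) - x) <= e / 4 + e / 4.
  move=> /andP[r0 rt]; rewrite ger0_norm// scalerA -zexpD.
  rewrite -(subrK (T r x) (_ *: _)) -addrA (le_trans (ler_rnormD _ _))//.
  rewrite lerD//; last by apply: H2 => //; exact: le_lt_trans t2.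
  rewrite -[X in rnorm (_ - X)]scale1r -scalerBl rnormZ.
  rewrite (@le_trans _ _ (e / 4 / (M * rnorm x + 1) * (M * rnorm x + 1)))//; last first.
    by rewrite divfK ?gt_eqF.
  apply: ler_pM; rewrite ?rnorm_ge0//; last by rewrite (le_trans (TM _ r0))// lerDl.
  apply: H1; rewrite (le_lt_trans _ t1)// -normrN opprD opprK.
  by rewrite ger0_norm ?subr_ge0// lerBlDr lerDl.
have main : rnorm (zexp z (- t) *: w - T t w - t%:C *: x) <= (e / 4 + e / 4) * t.
  apply: rnorm_le_functional => l lP l1.
  have [_ lZ _] := lP.
  rewrite !(rfunctionalB lP) (laplace_shift _ lP t0) -/w.
  set I := Rintegral _ _ _; set a := l (zexp z (- t) *: w).
  rewrite (_ : a - (a - I) - _ = I - l x * t); last by rewrite lZ; ring.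
  apply: le_trans (ler_norm _) _.
  have lP' := rfunctional_scale (zexp z (- t)) lP.
  have := @Rintegral_itv_near_cst _ (fun r => l (zexp z (- t) *: (zexp z `|r| *: T `|r| x))) (l x) (e / 4 + e / 4) 0 t (ltW t0).
  rewrite subr0; apply.
  - by move=> r _; apply: (rfunctional_cvg lP'); exact: continuousG.
  - by move=> r /near_cst; apply: le_trans; rewrite -(rfunctionalB lP).
have /H3 dz : `|- t| < d3 by rewrite normrN gtr0_norm.
have {}dz : rnorm (zexp z (- t) *: w - w + t%:C *: (z *: w)) <= e / 4 * t.
  rewrite scalerA -{2}[w]scale1r -scalerBl -scalerDl rnormZ.
  rewrite (_ : _ + _ = zexp z (- t) - 1 - (- t)%:C * z); last by rewrite real_complexN mulNr opprK.
  rewrite (@le_trans _ _ (e / 4 / (rnorm w + 1) * `|- t| * (rnorm w + 1)))//.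
    by apply: ler_pM; rewrite ?rnorm_ge0// lerDl.
  by rewrite normrN gtr0_norm// mulrAC divfK ?gt_eqF.
have tC : t%:C != 0 :> R[i] by rewrite (inj_eq (@complexI R)) gt_eqF.
rewrite (_ : _ - _ = (t^-1)%:C *: ((zexp z (- t) *: w - T t w - t%:C *: x) -
    (zexp z (- t) *: w - w + t%:C *: (z *: w)))); last first.
  rewrite real_complexV; apply: cfunctional_inj => c cD cN cZ; rewrite !(cD, cN, cZ).
  by field.
rewrite rnormZ rnorm_real gtr0_norm ?invr_gt0// mulrC ltr_pdivrMr//.
rewrite (le_lt_trans (ler_rnormB _ _))// (le_lt_trans (lerD main dz))// -mulrDl ltr_pM2r//; lra.
Qed.

End Laplace.

Arguments laplace_generator {R X T M} _ _ _ {z} _ _.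

Section LaplaceTransfer.
Context {R : realType} {X Y : completeNormedModType R[i]}.

(** The hypothesis compares one orbit of each semigroup. This is the form in which the dilation is
    used: [L] is [Q] composed with products of the [U] at fixed times. *)
Lemma laplace_transfer (T : R -> {linear X -> X}) (U : R -> {linear Y -> Y}) MT MU (z : R[i])
    (L : Y -> X) c x y :
  C0_semigroup T -> 0 <= MT -> (forall t x, 0 <= t -> rnorm (T t x) <= MT * rnorm x) ->
  C0_semigroup U -> 0 <= MU -> (forall t x, 0 <= t -> rnorm (U t x) <= MU * rnorm x) ->
  complex.Re z < 0 ->
  linear L -> (forall y, rnorm (L y) <= c * rnorm y) ->
  (forall t, 0 <= t -> L (U t y) = T t x) ->
  L (laplace U z y) = laplace T z x.
Proof.
move=> hT MT0 TM hU MU0 UM z0 lL Lc LU.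
have [L' L'E] := linear_packP lL.
have dU := laplace_dominated hU MU0 UM z0 y.
rewrite -L'E /laplace -(@bint_linear _ _ _ (laplace_integrand U z y) L' c dU); last first.
  by move=> u; rewrite L'E.
congr bochner_integral; apply/funext => t; rewrite /laplace_integrand.
by case: ltP => [_|t0]; rewrite ?linear0// linearZ/= L'E LU.
Qed.

End LaplaceTransfer.

Section GeneratorResolvent.
Context {R : realType} {X : completeNormedModType R[i]}.
Variables (T : R -> {linear X -> X}) (M : R).
Hypotheses (hT : C0_semigroup T) (M0 : 0 <= M).
Hypothesis TM : forall t x, 0 <= t -> rnorm (T t x) <= M * rnorm x.

Lemma neg_generator_commute (S : X -> X) c x y : linear S ->
  (forall x, rnorm (S x) <= c * rnorm x) ->
  (forall t x, 0 <= t -> S (T t x) = T t (S x)) ->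
  neg_generator T (x, y) -> neg_generator T (S x, S y).
Proof.
move=> lS Sc ST; rewrite /neg_generator /=.
have [S' S'E] := linear_packP lS.
have S'c u : rnorm (S' u) <= c * rnorm u by rewrite S'E.
move=> /(bounded_linear_cvg S'c); rewrite S'E; apply: cvg_trans; apply: near_eq_cvg.
near=> t; rewrite linearZ/= linearB/= !S'E ST//.
Unshelve. all: by end_near.
Qed.

Lemma neg_generator_fun x y y' : neg_generator T (x, y) -> neg_generator T (x, y') -> y = y'.
Proof. exact: cvg_unique. Qed.

Variables (z : R[i]) (z_lt0 : complex.Re z < 0).

Let lap := laplace T z.

Let lap_linear : linear lap. Proof. exact (linear_laplace hT M0 TM z_lt0). Qed.

Let lap_generator v : neg_generator T (lap v, z *: lap v + v).
Proof. exact (laplace_generator hT M0 TM z_lt0 v). Qed.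

Arguments lap_generator : clear implicits.

Let lap_generatorN v : neg_generator T (- lap v, - (z *: lap v + v)).
Proof.
refine (@neg_generator_commute (fun x => - x) 1 _ _ _ _ _ (lap_generator v)).
- by move=> a x y; rewrite opprD scalerN.
- by move=> x; rewrite rnormN mul1r.
- by move=> t x _; rewrite linearN.
Qed.

Arguments lap_generatorN : clear implicits.

Lemma laplace_commute (S : X -> X) c x : linear S ->
  (forall x, rnorm (S x) <= c * rnorm x) ->
  (forall t x, 0 <= t -> S (T t x) = T t (S x)) ->
  S (lap x) = lap (S x).
Proof.
move=> lS Sc ST.
by apply: (laplace_transfer hT M0 TM hT M0 TM z_lt0 lS Sc) => t; exact: ST.
Qed.

Lemma laplace_left x y : neg_generator T (x, y) -> lap y = z *: lap x + x.
Proof.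
move=> xy; refine (neg_generator_fun _ (lap_generator x)).
refine (neg_generator_commute lap_linear (rnorm_laplace hT M0 TM z_lt0) _ xy).
move=> t u t0; symmetry; apply: (@laplace_commute (T t) M).
- exact: linearP.
- by move=> v; exact: TM.
- have [_ _ TD _] := hT.
  by move=> r v r0; rewrite -!TD// addrC.
Qed.

Lemma resolvent_set_generator : resolvent_set (neg_generator T) z.
Proof.
have lN : linear (fun x => - lap x).
  by move=> a x y; rewrite lap_linear opprD scalerN.
have [S SE] := linear_packP lN; exists S; split.
- move=> x; apply: (@bounded_linear_cvg _ _ _ S (M * (2 / - complex.Re z))); last exact: cvg_id.
  by move=> u; rewrite SE rnormN; exact: rnorm_laplace.
- by move=> v; rewrite SE scalerN -opprD; exact: lap_generatorN.
- move=> x y xy; rewrite SE (linear_predB lap_linear) (linear_predZ lap_linear) (laplace_left xy).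
  by rewrite opprB addrAC subrr add0r.
Qed.

Lemma resolvent_generator v : resolvent (neg_generator T) z v = - lap v.
Proof.
have [_ H _] := resolventP resolvent_set_generator.
rewrite -(H _ _ (lap_generatorN v)); congr (resolvent _ _ _).
by rewrite scalerN opprK addrA addNr add0r.
Qed.

Lemma rnorm_resolvent_generator v :
  rnorm (resolvent (neg_generator T) z v) <= M * (2 / - complex.Re z) * rnorm v.
Proof. by rewrite resolvent_generator rnormN; exact: rnorm_laplace. Qed.

End GeneratorResolvent.

(** * Sectors in polar coordinates *)

Section SectorPolar.
Context {R : realType}.
Implicit Types (u a theta : R) (z : R[i]).

Lemma Arg_polar u a : - pi < a <= pi -> Arg (polar u a) = a.
Proof.
move=> /andP[a1 a2]; have eN : expR u != 0 by rewrite gt_eqF ?expR_gt0.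
rewrite /Arg rnorm_polar Re_polar Im_polar mulrAC mulfV// mul1r pmulr_rge0 ?expR_gt0//.
have [a0|a0] := leP 0 a; first by rewrite sin_ge0_pi ?a0// cosK// in_itv/= a0.
have na : 0 < - a < pi by rewrite oppr_gt0 a0 ltrNl.
rewrite ifF; first by rewrite -cosN cosK ?opprK// in_itv/=; lra.
by apply/negbTE; rewrite -ltNge -oppr_gt0 -sinN sin_gt0_pi.
Qed.

Lemma polar_Arg z : z != 0 -> z = polar (ln (rnorm z)) (Arg z).
Proof.
move=> z0; have n0 : 0 < rnorm z by rewrite lt_def rnorm_eq0 z0 rnorm_ge0.
have c1 : -1 <= complex.Re z / rnorm z <= 1.
  rewrite -ler_norml normrM normfV (ger0_norm (ltW n0)) ler_pdivrMr// mul1r.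
  exact: ler_Re_rnorm.
have nE : rnorm z ^+ 2 = complex.Re z ^+ 2 + complex.Im z ^+ 2.
  by rewrite /rnorm normc_def /= sqr_sqrtr// addr_ge0// sqr_ge0.
have sE : sin (acos (complex.Re z / rnorm z)) = `|complex.Im z| / rnorm z.
  rewrite sin_acos// -[RHS]ger0_norm ?divr_ge0 ?rnorm_ge0// -sqrtr_sqr; congr Num.sqrt.
  rewrite !exprMn exprVn real_normK ?num_real//.
  rewrite (_ : complex.Im z ^+ 2 = rnorm z ^+ 2 - complex.Re z ^+ 2); last by rewrite nE; ring.
  by field; rewrite gt_eqF.
rewrite /polar lnK// /Arg /cis; case: ifPn => im0.
  rewrite acosK// sE ger0_norm//; move: n0; case: z {z0 c1 nE sE im0} => x y /= n0.
  by simpc; congr (_ +i* _); field; rewrite gt_eqF.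
rewrite cosN sinN acosK// sE ltr0_norm ?ltNge//.
move: n0; case: z {z0 c1 nE sE im0} => x y /= n0.
by simpc; congr (_ +i* _); field; rewrite gt_eqF.
Qed.

Lemma sector_polar theta u a : `|a| < theta -> theta <= pi -> sector theta (polar u a).
Proof.
move=> at_ tp; split; first exact: polar_neq0.
rewrite Arg_polar//; move: at_; rewrite ltr_norml => /andP[a1 a2].
by apply/andP; split; [|apply/ltW]; lra.
Qed.

Lemma sector_polarP theta z : sector theta z ->
  exists u a, [/\ z = polar u a, `|a| < theta & u = ln (rnorm z)].
Proof. by move=> [z0 zt]; exists (ln (rnorm z)), (Arg z); split => //; exact: polar_Arg. Qed.

Lemma sector_le theta theta' z : theta <= theta' -> sector theta z -> sector theta' z.
Proof. by move=> tt [z0 zt]; split => //; exact: lt_le_trans tt. Qed.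

Lemma sector_gt0 theta (x : R) : 0 < theta -> theta <= pi -> 0 < x -> sector theta x%:C.
Proof.
move=> t0 tp x0; have -> : x%:C = polar (ln x) 0 by rewrite /polar lnK// /cis cos0 sin0 mulr1.
by apply: sector_polar => //; rewrite normr0.
Qed.

(** The inequality defines a closed cone containing the sector. Its failure is the test by which
    points are shown to lie off the closure of the sector. *)
Lemma closure_sector_Re theta z : 0 < theta < pi -> closure (sector theta) z ->
  cos theta * rnorm z <= complex.Re z.
Proof.
move=> /andP[t0 tp]; rewrite leNgt => zc; apply/negP => lt.
pose d := cos theta * rnorm z - complex.Re z.
have d0 : 0 < d by rewrite subr_gt0.
have d2 : 0 < (d / 2)%:C :> R[i] by rewrite ltcR divr_gt0.
have [w [[w0 wt] zw]] := zc _ (nbhsx_ballx (z : R[i]^o) _ d2).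
move: zw; rewrite /ball /= normE_rnorm ltcR => zw.
have wle : cos theta * rnorm w <= complex.Re w.
  rewrite [in leRHS](polar_Arg w0) Re_polar lnK ?posrE ?lt_def ?rnorm_eq0 ?w0 ?rnorm_ge0//.
  rewrite mulrC ler_wpM2l ?rnorm_ge0//.
  have -> : cos (Arg w) = cos `|Arg w|.
    by case: (ger0P (Arg w)) => _; rewrite ?cosN.
  by rewrite ltW// ltr_cos ?in_itv/= ?normr_ge0 ?(ltW t0) ?(ltW tp)//= ltW// (lt_trans wt).
have h1 := ler_Re_rnorm (z - w).
have h2 := ler_dist_rnorm z w.
move: h1; rewrite raddfB/= => h1.
have c1 := cos_le1 theta; have c2 := cos_geN1 theta.
have h3 : `|cos theta * (rnorm z - rnorm w)| <= rnorm (z - w).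
  rewrite normrM (le_trans _ h2)// -[leRHS]mul1r ler_wpM2r// ler_norml c1 andbT; lra.
move: h1 h3; rewrite !ler_norml => /andP[h1 _] /andP[_ h3].
move: h3; rewrite mulrBr => h3.
rewrite /d in zw; lra.
Qed.

Lemma closure_sectorN theta u a : 0 < theta < pi -> theta < `|a| <= pi ->
  ~ closure (sector theta) (polar u a).
Proof.
move=> /andP[t0 tp] /andP[ta ap] /closure_sector_Re; rewrite t0 tp => /(_ isT).
rewrite rnorm_polar Re_polar mulrC ler_pM2l ?expR_gt0//; apply/negP; rewrite -ltNge.
have -> : cos a = cos `|a|.
  by case: (ger0P a) => _; rewrite ?cosN.
by rewrite ltr_cos// in_itv/= ?normr_ge0 ?ap// ?(ltW t0) ?(ltW tp).
Qed.

Lemma closure_sector0 theta : 0 < theta <= pi -> closure (sector theta) (0 : R[i]^o).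
Proof.
move=> /andP[t0 tp] B /nbhs_ballP[e /= e0 eB].
have ee : e = (complex.Re e)%:C.
  by move: e0; rewrite ltcE => /andP[/eqP/= h _]; case: e h {eB} => a b /= ->.
have e0' : 0 < complex.Re e by rewrite -ltcR -ee.
exists ((complex.Re e / 2)%:C : R[i]^o); split.
  by apply: sector_gt0 => //; rewrite divr_gt0.
apply: eB; rewrite /ball /= sub0r normrN normE_rnorm rnorm_real [ltRHS]ee ltcR gtr0_norm ?divr_gt0//.
by rewrite ltr_pdivrMr// ltr_pMr// ltr1n.
Qed.

Lemma copen_closureN (S : set R[i]^o) : copen (fun z => ~ closure S z).
Proof.
move=> z zS.
have /nbhs_ballP[e /= e0 eB] : nbhs (z : R[i]^o) (~` closure S).
  by apply: open_nbhs_nbhs; split => //; apply: closed_openC; exact: closed_closure.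
have ee : e = (complex.Re e)%:C.
  by move: e0; rewrite ltcE => /andP[/eqP/= h _]; case: e h {eB} => a b /= ->.
have e0' : 0 < complex.Re e by rewrite -ltcR -ee.
exists (complex.Re e); first exact: e0'.
move=> w we; refine (eB (z + w) _).
by rewrite /ball /= opprD addrA subrr sub0r normrN normE_rnorm [ltRHS]ee ltcR.
Qed.

Lemma polarN u a : - polar u a = polar u (a + pi).
Proof. by rewrite /polar /cis cosDpi sinDpi -mulrN; congr (_ * _); simpc. Qed.

Lemma polarN' u a : - polar u a = polar u (a - pi).
Proof.
rewrite /polar /cis cosB sinB cospi sinpi -mulrN; congr (_ * _).
by simpc; congr (_ +i* _); ring.
Qed.

Lemma closure_sector_opp theta u a : 0 < theta < pi -> `|a| < pi - theta ->
  ~ closure (sector theta) (- polar u a).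
Proof.
move=> tp at_; have [a0|a0] := ltP a 0.
  rewrite ltr0_norm// in at_; rewrite polarN; apply: closure_sectorN => //.
  by rewrite ger0_norm; lra.
rewrite ger0_norm// in at_; rewrite polarN'; apply: closure_sectorN => //.
by have := pi_gt0 R; rewrite ler0_norm; lra.
Qed.

Lemma copen_opp (D : set R[i]) : copen D -> copen (fun z => D (- z)).
Proof.
move=> oD z /oD[d d0 H]; exists d => // w wd; rewrite opprD; apply: H.
by rewrite rnormN.
Qed.

End SectorPolar.

(** * Contour integrals of products of operator families *)

Section OperatorProducts.
Context {R : realType} {d : nat} {V : completeNormedModType R[i]}.
Notation mu := (@lebesgue_measure R).
Notation bint F := (bochner_integral mu F).
Notation point := 'rV[R[i]^o]_d.
Implicit Types (W : 'I_d -> R[i] -> V -> V) (nu theta : 'I_d -> R) (ks : seq 'I_d)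
  (c : point -> R[i]^o) (z : point).

Fixpoint opcomp W ks z (x : V) : V :=
  if ks is k :: ks' then W k (z 0 k) (opcomp W ks' z x) else x.

Definition ray_bounded (a : R) (W : R[i] -> V -> V) (B : R) :=
  [/\ 0 <= B, forall u, linear (W (polar u a)),
      forall u x, rnorm (W (polar u a) x) <= B * rnorm x &
      forall x, continuous (fun u => W (polar u a) x)].

Definition contour_bounded nu W := forall k b, exists B, ray_bounded (ray (nu k) b) (W k) B.

(** Holomorphy is stated in each variable separately, the form in which the one-variable contour
    shifts consume it. *)
Definition sector_decaying theta ks c (C s : R) :=
  [/\ 0 < s, 0 <= C,
      forall z k, polysector theta z -> cdiff (fun w => c (set_coord z k w)) (z 0 k) &
      forall z, polysector theta z ->
        rnorm (c z) <= C * \prod_(k <- ks) edecay s (ln (rnorm (z 0 k)))].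

Lemma compose_all_opcomp (Lambda : {set 'I_d}) W z x :
  compose_all (mem Lambda) (fun k => W k (z 0 k)) x = opcomp W (enum Lambda) z x.
Proof.
rewrite /compose_all -big_filter [index_enum _]unlock.
have -> : [seq k <- Finite.enum 'I_d | mem Lambda k] = enum Lambda by [].
by elim: (enum _) => [|k ks IH]; rewrite ?big_nil ?big_cons//= -IH.
Qed.

Lemma opcomp_set_coord W ks z k w x : k \notin ks ->
  opcomp W ks (set_coord z k w) x = opcomp W ks z x.
Proof.
elim: ks => [//|j ks IH]; rewrite inE negb_or => /andP[kj kks] /=.
by rewrite IH// set_coordE eq_sym (negbTE kj).
Qed.

Lemma eq_opcomp W W' ks z z' x :
  (forall k, k \in ks -> W k (z 0 k) =1 W' k (z' 0 k)) -> opcomp W ks z x = opcomp W' ks z' x.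
Proof.
elim: ks => [//|k ks IH] WW /=; rewrite IH ?WW ?inE ?eqxx// => j jks.
by apply: WW; rewrite inE jks orbT.
Qed.

Lemma linear_opcomp W ks z : (forall k, k \in ks -> linear (W k (z 0 k))) ->
  linear (opcomp W ks z).
Proof.
elim: ks => [//|k ks IH] lW a x y /=.
rewrite IH; last by move=> j jks; apply: lW; rewrite inE jks orbT.
by rewrite lW// inE eqxx.
Qed.

Lemma opcompZ W ks z (x : V) (a : R[i]) : (forall k, k \in ks -> linear (W k (z 0 k))) ->
  (\prod_(k <- ks) z 0 k) *: (a *: opcomp W ks z x) =
  a *: opcomp (fun k w x => w *: W k w x) ks z x.
Proof.
move=> lW; rewrite scalerA mulrC -scalerA; congr (_ *: _).
elim: ks lW => [|k ks IH] lW /=; first by rewrite big_nil scale1r.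
have lW' : forall j, j \in ks -> linear (W j (z 0 j)).
  by move=> j jks; apply: lW; rewrite inE jks orbT.
rewrite big_cons -scalerA -(linear_predZ (lW k _)) ?inE ?eqxx//.
by rewrite IH.
Qed.

Lemma polysector_on_contour theta nu A z0 z : (forall k, 0 < nu k < theta k) ->
  (forall k, theta k <= pi) ->
  polysector theta z0 -> on_contour nu A z0 z -> polysector theta z.
Proof.
move=> nt tp z0t zA k; have := zA k; case: ifP => _; last by move=> ->; exact: z0t.
move=> [u [b ->]]; apply: sector_polar => //.
by have /andP[n0 nk] := nt k; rewrite /ray; case: b; rewrite ?normrN gtr0_norm.
Qed.

Lemma contour_bounded_opcomp nu W ks : contour_bounded nu W ->
  exists2 B, 0 <= B & forall z x,
    (forall k, k \in ks -> exists u b, z 0 k = polar u (ray (nu k) b)) ->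
    rnorm (opcomp W ks z x) <= B * rnorm x.
Proof.
move=> cW; elim: ks => [|k ks [B B0 IH]]; first by exists 1 => // z x _; rewrite mul1r.
have [B1 [B10 _ H1 _]] := cW k true; have [B2 [B20 _ H2 _]] := cW k false.
exists ((B1 + B2) * B) => [|z x zk]; first by rewrite mulr_ge0// addr_ge0.
have {}IH : rnorm (opcomp W ks z x) <= B * rnorm x.
  by apply: IH => j jks; apply: zk; rewrite inE jks orbT.
rewrite -mulrA /= (@le_trans _ _ ((B1 + B2) * rnorm (opcomp W ks z x)))//; last first.
  by rewrite ler_wpM2l// addr_ge0.
have [u [b ->]] := zk k (mem_head _ _).
have n0 := rnorm_ge0 (opcomp W ks z x).
case: b; [rewrite (le_trans (H1 _ _))//|rewrite (le_trans (H2 _ _))//];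
  by rewrite ler_wpM2r// ?lerDl ?lerDr.
Qed.

Lemma continuous_opcomp nu W ks z k b x : contour_bounded nu W -> uniq ks ->
  (forall j, j \in ks -> exists u b, z 0 j = polar u (ray (nu j) b)) ->
  continuous (fun u => opcomp W ks (set_coord z k (polar u (ray (nu k) b))) x).
Proof.
move=> cW; elim: ks => [_ _ u|j ks IH /= /andP[jks uks] zk]; first exact: cvg_cst.
have zk' i : i \in ks -> exists u b, z 0 i = polar u (ray (nu i) b).
  by move=> iks; apply: zk; rewrite inE iks orbT.
have [jk|jk] := eqVneq j k.
  have kks : k \notin ks by rewrite -jk.
  rewrite [X in continuous X](_ : _ = fun u => W k (polar u (ray (nu k) b)) (opcomp W ks z x)); last first.
    by apply/funext => u /=; rewrite opcomp_set_coord// set_coordE jk eqxx.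
  by have [B [_ _ _]] := cW k b; apply.
move=> u; under eq_fun do rewrite set_coordE (negbTE jk).
have [v [b' ->]] := zk j (mem_head _ _).
have [B [_ lW WB _]] := cW j b'; have [L LE] := linear_packP (lW v).
have LB y : rnorm (L y) <= B * rnorm y by rewrite LE.
have <- : L = W j (polar v (ray (nu j) b')) :> (V -> V) by apply/funext => y; rewrite LE.
exact: (bounded_linear_cvg LB (IH uks zk' u)).
Qed.

Lemma sector_decaying_continuous theta ks c C s z k a : sector_decaying theta ks c C s ->
  polysector theta z -> `|a| < theta k -> theta k <= pi ->
  continuous (fun u => c (set_coord z k (polar u a))).
Proof.
move=> [_ _ cd _] zt at_ tp u.
apply: (@cdiff_continuous_polar _ _ (fun w => c (set_coord z k w)) u a).
have := cd (set_coord z k (polar u a)) k; rewrite set_coordE eqxx.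
under eq_fun do rewrite set_coord_id.
apply => j; rewrite set_coordE; case: eqP => [->|_]; first exact: sector_polar.
exact: zt.
Qed.

Lemma sector_decaying_behead theta k ks c C s : sector_decaying theta (k :: ks) c C s ->
  sector_decaying theta ks c C s.
Proof.
move=> [s0 C0 cd cle]; split => // z zt; rewrite (le_trans (cle z zt))// big_cons.
rewrite ler_wpM2l// -[leRHS]mul1r ler_wpM2r//.
  by apply: prodr_ge0 => j _; exact: edecay_ge0.
by apply: edecay_le1; exact: ltW.
Qed.

Lemma nice_opcomp theta nu ks c C s W z0 x : uniq ks -> (forall k, 0 < nu k < theta k) ->
  (forall k, theta k <= pi) -> polysector theta z0 ->
  sector_decaying theta ks c C s -> contour_bounded nu W ->
  exists C', nice nu [set k in ks] (fun z => c z *: opcomp W ks z x) z0 C' s.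
Proof.
move=> uks nt tp z0t hc cW; have [s0 C0 cd cle] := hc.
have [B B0 HB] := contour_bounded_opcomp ks cW.
have zks z : on_contour nu [set k in ks] z0 z ->
    forall k, k \in ks -> exists u b, z 0 k = polar u (ray (nu k) b).
  by move=> zA k kks; have := zA k; rewrite finset.in_set kks.
have x0 := rnorm_ge0 x.
exists (C * (B * rnorm x)); split => //.
- by rewrite !mulr_ge0.
- move=> z k b zA kA u.
  apply: (@cvgZ _ _ _ _ _ (fun u => c (set_coord z k (polar u (ray (nu k) b))))).
    apply: (sector_decaying_continuous hc) => //.
      exact: polysector_on_contour zA.
    by have /andP[n0 nk] := nt k; rewrite /ray; case: b; rewrite ?normrN gtr0_norm.
  by apply: continuous_opcomp => //; exact: zks.
- move=> z zA; rewrite rnormZ mulrAC; apply: ler_pM; rewrite ?rnorm_ge0//; last first.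
    by apply: HB; exact: zks.
  rewrite (le_trans (cle z _))//; first exact: polysector_on_contour zA.
  by rewrite ler_wpM2l// le_eqVlt; apply/orP; left; rewrite big_uniq//=;
    apply/eqP/eq_bigl => k; rewrite finset.in_set.
Qed.

(** Contour integrals against any decaying holomorphic function g on the sector agree. The relation
    covers both a change of angle with the same family and a change of family on the same
    contour. *)
Definition exchange (theta nu nu' : R) (W W' : R[i] -> V -> V) :=
  forall (g : R[i] -> R[i]^o) C s x, 0 < s ->
    (forall u a, `|a| < theta -> cdiff g (polar u a)) ->
    (forall u a, `|a| < theta -> rnorm (g (polar u a)) <= C * edecay s u) ->
  bint (fun u => g (polar u (ray nu true)) *: W (polar u (ray nu true)) x -
                 g (polar u (ray nu false)) *: W (polar u (ray nu false)) x) =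
  bint (fun u => g (polar u (ray nu' true)) *: W' (polar u (ray nu' true)) x -
                 g (polar u (ray nu' false)) *: W' (polar u (ray nu' false)) x).

Lemma contour_bounded_if nu nu' W W' (D : pred 'I_d) :
  contour_bounded nu W -> contour_bounded nu' W' ->
  contour_bounded (fun k => if D k then nu k else nu' k) (fun k => if D k then W k else W' k).
Proof. by move=> cW cW' k b; case: (D k). Qed.

Lemma log_integral_pull theta nu ks c C s W z0 x (L : V -> V) B :
  uniq ks -> (forall k, 0 < nu k < theta k) ->
  (forall k, theta k <= pi) -> polysector theta z0 ->
  sector_decaying theta ks c C s -> contour_bounded nu W ->
  linear L -> (forall x, rnorm (L x) <= B * rnorm x) ->
  log_integral nu ks (fun z => c z *: L (opcomp W ks z x)) z0 =
  L (log_integral nu ks (fun z => c z *: opcomp W ks z x) z0).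
Proof.
move=> uks nt tp z0t hc cW lL LB; have [L' L'E] := linear_packP lL.
have [C' nH] := nice_opcomp x uks nt tp z0t hc cW.
have L'B y : rnorm (L' y) <= B * rnorm y by rewrite L'E.
rewrite -L'E -(log_integral_map uks L'B nH); congr log_integral.
by apply/funext => z; rewrite linearZ/= L'E.
Qed.

Lemma ray_lt (nu theta : R) b : 0 < nu < theta -> `|ray nu b| < theta.
Proof. by case/andP => n0 nt; rewrite /ray; case: b; rewrite ?normrN gtr0_norm. Qed.

Lemma polysector_set_coord theta z k u a : polysector theta z -> `|a| < theta k ->
  theta k <= pi -> polysector theta (set_coord z k (polar u a)).
Proof.
move=> zt at_ tp j; rewrite set_coordE; case: eqP => [->|_]; last exact: zt.
exact: sector_polar.
Qed.

(** The coordinates are exchanged one at a time: the induction hypothesis treats the tail with the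
    head operator pulled out of the integral, then the head variable is moved to the innermost place
    and [exchange] is applied to the function of that variable alone. *)
Lemma log_integral_exchange theta nu nu' ks c C s W W' z0 x : uniq ks ->
  (forall k, 0 < nu k < theta k) -> (forall k, 0 < nu' k < theta k) ->
  (forall k, theta k <= pi) -> polysector theta z0 ->
  sector_decaying theta ks c C s -> contour_bounded nu W -> contour_bounded nu' W' ->
  (forall k, exchange (theta k) (nu k) (nu' k) (W k) (W' k)) ->
  log_integral nu ks (fun z => c z *: opcomp W ks z x) z0 =
  log_integral nu' ks (fun z => c z *: opcomp W' ks z x) z0.
Proof.
move=> + nt nt' tp + + cW cW' WW'.
elim: ks z0 => [//|k ks IH z0 ukks z0t hc].
have /= /andP[kks uks] := ukks.
have hc' := sector_decaying_behead hc.
(* The intermediate stage: the head coordinate still has the old angle and operator, the others have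
   the new ones. *)
pose nu1 j := if j == k then nu j else nu' j.
pose W1 j := if j == k then W j else W' j.
have nt1 j : 0 < nu1 j < theta j by rewrite /nu1; case: ifP.
have cW1 : contour_bounded nu1 W1 := contour_bounded_if (pred1 k) cW cW'.
have W1E j : j \in ks -> W1 j = W' j.
  by rewrite /W1; case: eqP => // -> kks'; rewrite kks' in kks.
have op1 z y : opcomp W1 ks z y = opcomp W' ks z y.
  by apply: eq_opcomp => j jks; rewrite W1E.
have [C1 n1] := nice_opcomp x ukks nt1 tp z0t hc cW1.
have [C2 n2] := nice_opcomp x ukks nt' tp z0t hc cW'.
transitivity (log_integral nu1 (k :: ks) (fun z => c z *: opcomp W1 (k :: ks) z x) z0).
  rewrite /= /ray_difference /nu1 eqxx; congr bochner_integral; apply/funext => u.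
  have tail b : log_integral nu ks (fun z => c z *: W k (z 0 k) (opcomp W ks z x))
      (set_coord z0 k (polar u (ray (nu k) b))) =
    log_integral (fun j => if j == k then nu j else nu' j) ks
      (fun z => c z *: W1 k (z 0 k) (opcomp W1 ks z x))
      (set_coord z0 k (polar u (ray (nu k) b))).
    set z1 := set_coord _ _ _.
    have z1t : polysector theta z1 by apply: polysector_set_coord => //; exact: ray_lt.
    have [B [_ lB WB _]] := cW k b.
    have fixk mu' (G : point -> V) : log_integral mu' ks (fun z => c z *: W k (z 0 k) (G z)) z1 =
        log_integral mu' ks (fun z => c z *: W k (polar u (ray (nu k) b)) (G z)) z1.
      apply: eq_log_integral => // z zA; have := zA k.
      by rewrite finset.in_set (negbTE kks) => ->; rewrite set_coordE eqxx.
    rewrite /W1 eqxx !fixk.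
    transitivity (W k (polar u (ray (nu k) b))
        (log_integral nu ks (fun z => c z *: opcomp W ks z x) z1)).
      exact: (log_integral_pull x uks nt tp z1t hc' cW (lB u) (WB u)).
    rewrite (IH z1 uks z1t hc').
    rewrite -(log_integral_pull x uks nt' tp z1t hc' cW' (lB u) (WB u)).
    apply: eq_log_integral => // [j jks|z _].
      by case: eqP => // jk; rewrite -jk jks in kks.
    by rewrite op1.
  by rewrite !tail.
apply: (log_integral_change ukks _ n1 n2) => [j jks|z zA].
  by rewrite /nu1; case: eqP => // jk; rewrite -jk jks in kks.
have zt : polysector theta z by apply: (polysector_on_contour nt1 tp z0t zA).
have cE j w : set_coord z k w 0 j = if j == k then w else z 0 j by rewrite set_coordE.
rewrite /ray_difference /nu1 eqxx.
have opE w : opcomp W1 (k :: ks) (set_coord z k w) x = W k w (opcomp W' ks z x).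
  by rewrite /= /W1 cE eqxx -/W1 opcomp_set_coord// op1.
have opE' w : opcomp W' (k :: ks) (set_coord z k w) x = W' k w (opcomp W' ks z x).
  by rewrite /= cE eqxx opcomp_set_coord.
under eq_fun do rewrite !opE; under [in RHS]eq_fun do rewrite !opE'.
have [s0 C0 cd cle] := hc.
apply: (WW' k (fun w => c (set_coord z k w)) C s) => // u a ak.
  have zz := polysector_set_coord u zt ak (tp k).
  have := cd _ k zz; rewrite set_coordE eqxx.
  by under eq_fun do rewrite set_coord_id.
have zz := polysector_set_coord u zt ak (tp k).
rewrite (le_trans (cle _ zz))// ler_wpM2l// big_cons set_coordE eqxx rnorm_polar expRK.
rewrite -[leRHS]mulr1 ler_wpM2l ?edecay_ge0//; apply: prodr_ile1 => j _.
by rewrite edecay_ge0/=; apply: edecay_le1; exact: ltW.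
Qed.

(** For a product of functions of one variable the iterated integral factors into the composition of
    the one-variable integrals, because a bounded operator may be pulled out of the inner
    integral. *)
Lemma log_integral_product theta nu ks (phi : 'I_d -> R[i] -> R[i]^o) W
    (L : 'I_d -> V -> V) z0 x : uniq ks ->
  (forall k, 0 < nu k < theta k) -> (forall k, theta k <= pi) -> polysector theta z0 ->
  (forall ks, uniq ks -> exists C s, sector_decaying theta ks (fun z => \prod_(k <- ks) phi k (z 0 k)) C s) ->
  contour_bounded nu W ->
  (forall k y, bint (fun u =>
    phi k (polar u (ray (nu k) true)) *: W k (polar u (ray (nu k) true)) y -
    phi k (polar u (ray (nu k) false)) *: W k (polar u (ray (nu k) false)) y) = L k y) ->
  log_integral nu ks (fun z => (\prod_(k <- ks) phi k (z 0 k)) *: opcomp W ks z x) z0 =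
  opcomp (fun k _ => L k) ks z0 x.
Proof.
move=> + nt tp + hphi cW WL; elim: ks z0 => [z0 _ _|k ks IH z0 ukks z0t].
  by rewrite /= big_nil scale1r.
have /= /andP[kks uks] := ukks; have [C [s hc]] := hphi ks uks.
rewrite -WL /ray_difference; congr bochner_integral; apply/funext => u.
suff E b : log_integral nu ks (fun z => (\prod_(k0 <- k :: ks) phi k0 (z 0 k0)) *: W k (z 0 k) (opcomp W ks z x))
    (set_coord z0 k (polar u (ray (nu k) b))) =
    phi k (polar u (ray (nu k) b)) *: W k (polar u (ray (nu k) b)) (opcomp (fun k _ => L k) ks z0 x).
  by rewrite !E.
set z1 := set_coord _ _ _; set w := polar _ _.
have z1t : polysector theta z1 by apply: polysector_set_coord => //; exact: ray_lt.
have [B [_ lB WB _]] := cW k b.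
transitivity (log_integral nu ks (fun z => (\prod_(k0 <- ks) phi k0 (z 0 k0)) *:
    (phi k w *: W k w (opcomp W ks z x))) z1).
  apply: eq_log_integral => // z zA; have := zA k.
  rewrite finset.in_set (negbTE kks) set_coordE eqxx big_cons => ->.
  by rewrite [RHS]scalerA [in RHS]mulrC.
rewrite (@log_integral_pull theta nu ks _ C s W z1 x (fun y => phi k w *: W k w y)
  (rnorm (phi k w) * B) uks nt tp z1t hc cW).
- rewrite IH//; congr (_ *: W k _ _).
  by apply: eq_opcomp.
- by move=> a y y'; rewrite lB scalerDr !scalerA mulrC.
- by move=> y; rewrite rnormZ -mulrA ler_wpM2l ?rnorm_ge0//; exact: WB.
Qed.

End OperatorProducts.

(** * Factorisation of the resolvent along a contour *)

Section Kernel.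
Context {R : realType} {V : completeNormedModType R[i]}.
Notation mu := (@lebesgue_measure R).
Notation bint F := (bochner_integral mu F).
Implicit Types (D : set R[i]) (W : R[i] -> V -> V).

Lemma op_holo_opp D W C : op_holo D W C -> op_holo (fun z => D (- z)) (fun z => W (- z)) C.
Proof.
move=> [C0 lW WC Wd]; split => // [z Dz|z x Dz|z x Dz]; [exact: lW|exact: WC|].
have [dh H] := Wd _ x Dz; exists (- dh) => e e0; have [d d0 Hd] := H _ e0.
exists d => // w wd; rewrite opprD scalerN -scaleNr -[rnorm w]rnormN; apply: Hd.
by rewrite rnormN.
Qed.

Lemma op_holo_sub D D' W C : D' `<=` D -> op_holo D W C -> op_holo D' W C.
Proof.
move=> DD [C0 lW WC Wd]; split => // [z Dz|z x Dz|z x Dz].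
- by apply: lW; exact: DD.
- by apply: WC; exact: DD.
- by apply: Wd; exact: DD.
Qed.

Lemma copenI D D' : copen D -> copen D' -> copen (D `&` D').
Proof.
move=> oD oD' z [/oD[d d0 H] /oD'[d' d'0 H']].
exists (Num.min d d') => [|w]; first by rewrite lt_min d0.
by rewrite lt_min => /andP[wd wd']; split; [exact: H|exact: H'].
Qed.

Lemma op_holo_ray_bounded D W C a : op_holo D W C -> (forall u, D (polar u a)) ->
  ray_bounded a W C.
Proof.
move=> [C0 lW WC Wd] Da; split => // [u|u x|x u]; [exact: lW|exact: WC|].
by apply: (@cdiff_continuous_polar _ _ (W^~ x)); exact: Wd.
Qed.

Lemma ray_bounded_decaying a W B theta (g : R[i] -> R[i]^o) C s x : 0 < s ->
  ray_bounded a W B -> `|a| < theta ->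
  (forall u a, `|a| < theta -> cdiff g (polar u a)) ->
  (forall u a, `|a| < theta -> rnorm (g (polar u a)) <= C * edecay s u) ->
  decaying (C * (B * rnorm x)) s (fun u => g (polar u a) *: W (polar u a) x).
Proof.
move=> s0 [B0 lW WB cW] at_ gd gle; split => // [u|u].
  apply: (@cvgZ _ _ _ _ _ (fun u => g (polar u a))); last exact: cW.
  by apply: (@cdiff_continuous_polar _ _ g); exact: gd.
by rewrite rnormZ mulrAC; apply: ler_pM; rewrite ?rnorm_ge0// gle.
Qed.

Lemma op_ray_shift_sym D W (C c s a1 a2 : R)
    (f : R[i] -> R[i]^o) (x : V) : copen D -> op_holo D W C -> 0 < s ->
  (forall u a, Num.min a1 a2 <= a <= Num.max a1 a2 -> D (polar u a)) ->
  (forall u a, Num.min a1 a2 <= a <= Num.max a1 a2 -> cdiff f (polar u a)) ->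
  (forall u a, Num.min a1 a2 <= a <= Num.max a1 a2 -> rnorm (f (polar u a)) <= c * edecay s u) ->
  bint (fun u => f (polar u a1) *: W (polar u a1) x) =
  bint (fun u => f (polar u a2) *: W (polar u a2) x).
Proof.
move=> oD oW s0; have [a12|/ltW a21] := leP a1 a2.
  by move=> Da fd fc; exact (@op_ray_shift _ _ D W C c s a1 a2 f x oD oW s0 a12 Da fd fc).
move=> Da fd fc; symmetry.
exact (@op_ray_shift _ _ D W C c s a2 a1 f x oD oW s0 a21 Da fd fc).
Qed.

(** The two rays are moved separately through the angles of modulus between [nu] and [nu'], a region
    that stays away from the spectrum around the positive axis. *)
Lemma exchange_shift D W (C theta nu nu' : R) : copen D -> op_holo D W C ->
  0 < nu < theta -> 0 < nu' < theta ->
  (forall u a, Num.min nu nu' <= `|a| <= Num.max nu nu' -> D (polar u a)) ->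
  exchange theta nu nu' W W.
Proof.
move=> oD oW /andP[n0 nt] /andP[n'0 n't] Da g c s x s0 gd gle.
have mt : Num.max nu nu' < theta by rewrite gt_max nt n't.
have m0 : 0 < Num.min nu nu' by rewrite lt_min n0 n'0.
have aux b a : Num.min (ray nu b) (ray nu' b) <= a <= Num.max (ray nu b) (ray nu' b) ->
    Num.min nu nu' <= `|a| <= Num.max nu nu'.
  case: b => /=; last first.
    by move=> /andP[a1 a2]; rewrite ger0_norm ?a1 ?a2// (le_trans (ltW m0)).
  rewrite -oppr_max -oppr_min lerNl [X in _ && X]lerNr => /andP[a1 a2].
  by rewrite ler0_norm ?a1 ?a2// -oppr_ge0 (le_trans (ltW m0)).
have dec n b : 0 < n < theta -> (forall u, D (polar u (ray n b))) -> exists K,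
    decaying K s (fun u => g (polar u (ray n b)) *: W (polar u (ray n b)) x).
  move=> nP Dn; eexists; apply: (ray_bounded_decaying x s0 (op_holo_ray_bounded oW Dn) _ gd gle).
  exact: ray_lt.
have abs_ray n b : 0 < n -> `|ray n b| = n.
  by move=> p0; rewrite /ray; case: b; rewrite ?normrN gtr0_norm.
have Dnu b u : D (polar u (ray nu b)).
  by apply: Da; rewrite abs_ray// ge_min le_max lexx.
have Dnu' b u : D (polar u (ray nu' b)).
  by apply: Da; rewrite abs_ray// ge_min le_max lexx !orbT.
have sh b : bint (fun u => g (polar u (ray nu b)) *: W (polar u (ray nu b)) x) =
    bint (fun u => g (polar u (ray nu' b)) *: W (polar u (ray nu' b)) x).
  apply: (@op_ray_shift_sym D W C c s _ _ g x oD oW s0) => u a /aux aP.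
  - exact: Da.
  - by apply: gd; have /andP[_] := aP => /le_lt_trans; apply.
  - by apply: gle; have /andP[_] := aP => /le_lt_trans; apply.
have nP : 0 < nu < theta by apply/andP.
have n'P : 0 < nu' < theta by apply/andP.
have [K1 d1] := dec nu true nP (Dnu true).
have [K2 d2] := dec nu false nP (Dnu false).
have [K3 d3] := dec nu' true n'P (Dnu' true).
have [K4 d4] := dec nu' false n'P (Dnu' false).
transitivity (bint (fun u => g (polar u (ray nu true)) *: W (polar u (ray nu true)) x) -
    bint (fun u => g (polar u (ray nu false)) *: W (polar u (ray nu false)) x)).
  exact: bintB (decaying_dominated d1) (decaying_dominated d2).
apply: etrans _ (esym (bintB (decaying_dominated d3) (decaying_dominated d4))).
by rewrite (sh true) (sh false).
Qed.

Let sub_swap (a b a' b' : V) : a - a' = b - b' -> a - b = a' - b'.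
Proof. by move=> /(canRL (subrK _)) ->; rewrite addrAC [b - b']addrC addrK addrC. Qed.

(** The difference [E] is holomorphic on the whole sector up to [nu], positive axis included, so one
    ray can be moved onto the other and the contour integral of the difference vanishes. *)
Lemma exchange_sub D W W' E (C B B' theta nu : R) : copen D -> op_holo D E C ->
  0 < nu < theta ->
  (forall b, ray_bounded (ray nu b) W B) -> (forall b, ray_bounded (ray nu b) W' B') ->
  (forall u a, `|a| <= nu -> D (polar u a)) ->
  (forall u b x, W (polar u (ray nu b)) x - W' (polar u (ray nu b)) x = E (polar u (ray nu b)) x) ->
  exchange theta nu nu W W'.
Proof.
move=> oD oE nP WB W'B Da WE g c s x s0 gd gle; have /andP[n0 nt] := nP.
have dW b := ray_bounded_decaying x s0 (WB b) (ray_lt b nP) gd gle.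
have dW' b := ray_bounded_decaying x s0 (W'B b) (ray_lt b nP) gd gle.
have sh : bint (fun u => g (polar u (- nu)) *: E (polar u (- nu)) x) =
    bint (fun u => g (polar u nu) *: E (polar u nu) x).
  have lt a : - nu <= a <= nu -> `|a| < theta by rewrite -ler_norml => /le_lt_trans; apply.
  apply: (@op_ray_shift _ _ D E C c s (- nu) nu g x oD oE s0) => [|u a aP|u a aP|u a aP].
  - by rewrite (@le_trans _ _ 0)// ?oppr_le0 ltW.
  - by apply: Da; rewrite ler_norml.
  - by apply: gd; exact: lt.
  - by apply: gle; exact: lt.
have diff b : bint (fun u => g (polar u (ray nu b)) *: W (polar u (ray nu b)) x) -
    bint (fun u => g (polar u (ray nu b)) *: W' (polar u (ray nu b)) x) =
    bint (fun u => g (polar u (ray nu b)) *: E (polar u (ray nu b)) x).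
  rewrite -(bintB (decaying_dominated (dW b)) (decaying_dominated (dW' b))).
  by congr bochner_integral; apply/funext => u; rewrite -WE scalerBr.
apply: etrans (bintB (decaying_dominated (dW true)) (decaying_dominated (dW false))) _.
apply: etrans _ (esym (bintB (decaying_dominated (dW' true)) (decaying_dominated (dW' false)))).
apply: sub_swap; apply: etrans (diff true) _; apply: etrans sh _.
exact: esym (diff false).
Qed.

End Kernel.

(** * Algebraic identities behind the factorisation *)

Section KernelAlgebra.
Context {R : realType} {V : normedModType R[i]}.
Variables (q r W : V -> V) (kappa : R[i]).
Hypotheses (lq : linear q) (lr : linear r) (lW : linear W).
Hypotheses (qr : forall x, q (r x) = r (q x)) (qW : forall x, q (W x) = W (q x))
  (rW : forall x, r (W x) = W (r x)).

Definition quadratic (q : V -> V) x := q x - q (q x).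

Definition kernel_remainder x :=
  let y := x + 4%:R *: q x - 4%:R *: q (q x) in - q (y - 2%:R *: q y).

(* W (1 - 2 q) = - q and 1 - 16 (q - q^2)^2 = (1 - 2 q)^2 (1 + 4 q - 4 q^2). *)
Lemma kernel_remainderE x : (forall x, W x + q x = 2%:R *: W (q x)) ->
  W x - 16%:R *: W (quadratic q (quadratic q x)) = kernel_remainder x.
Proof.
move=> Wq; rewrite /kernel_remainder /=; set y := x + _ - _; set v := y - _.
have -> : W x - 16%:R *: W (quadratic q (quadratic q x)) = W (v - 2%:R *: q v).
  rewrite -(linear_predZ lW) -(linear_predB lW); congr W.
  rewrite /v /y /quadratic !(linear_predN lq, linear_predD lq, linear_predZ lq).
  by apply: cfunctional_inj => c cD cN cZ; rewrite !(cD, cN, cZ); ring.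
rewrite (linear_predB lW) (linear_predZ lW) -Wq opprD addrA subrr add0r.
by rewrite -(linear_predN lq).
Qed.

Hypotheses (k0 : kappa != 0) (qrk : forall x, kappa *: r x - q x = (kappa - 1) *: q (r x)).

(** On scalars, with q = z / (z + a), r = p / (p + a) and z = kappa p, this is multiplication by (p
    + a) / (z + a). *)
Definition shifted x := x + (kappa^-1 - 1) *: q x.

Definition kernel_factor x := (16%:R * kappa ^+ 2) *: shifted (shifted (shifted (shifted (W x)))).

(* The resolvent identity gives r (1 + (kappa^-1 - 1) q) = kappa^-1 q; multiplying r - r^2 twice
   by this factor turns it into kappa^-1 (q - q^2). *)
Lemma kernel_factorE x :
  quadratic r (kernel_factor (quadratic r x)) = 16%:R *: W (quadratic q (quadratic q x)).
Proof.
have rS y : r (shifted y) = kappa^-1 *: q y.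
  rewrite /shifted (linear_predD lr) (linear_predZ lr) -qr.
  rewrite (_ : kappa^-1 - 1 = - (kappa^-1 * (kappa - 1))); last by field.
  rewrite scaleNr -scalerA -qrk.
  by apply: cfunctional_inj => c cD cN cZ; rewrite !(cD, cN, cZ); field.
have lS : linear shifted.
  move=> a y y'; rewrite /shifted lq.
  by apply: cfunctional_inj => c cD cN cZ; rewrite !(cD, cN, cZ); ring.
have qS y : q (shifted y) = shifted (q y).
  by rewrite /shifted (linear_predD lq) (linear_predZ lq).
have rS' y : r (shifted y) = shifted (r y).
  by rewrite /shifted (linear_predD lr) (linear_predZ lr) qr.
have WS y : shifted (W y) = W (shifted y).
  by rewrite /shifted (linear_predD lW) (linear_predZ lW) qW.
have rSS y : quadratic r (shifted (shifted y)) = kappa^-1 *: quadratic q y.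
  rewrite /quadratic rS (linear_predZ lr) -qr rS (linear_predZ lq) /shifted.
  rewrite (linear_predD lq) (linear_predZ lq).
  by apply: cfunctional_inj => c cD cN cZ; rewrite !(cD, cN, cZ); ring.
have lG : linear (quadratic q).
  move=> a y y'; rewrite /quadratic !lq.
  by apply: cfunctional_inj => c cD cN cZ; rewrite !(cD, cN, cZ); ring.
have lG' : linear (quadratic r).
  move=> a y y'; rewrite /quadratic !lr.
  by apply: cfunctional_inj => c cD cN cZ; rewrite !(cD, cN, cZ); ring.
have GW y : quadratic q (W y) = W (quadratic q y).
  by rewrite /quadratic !qW (linear_predB lW).
have GS y : quadratic r (shifted y) = shifted (quadratic r y).
  by rewrite /quadratic !rS' (linear_predB lS).
rewrite /kernel_factor (linear_predZ lG') rSS !WS -!GS rSS GW.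
rewrite (linear_predZ lG) (linear_predZ lW) !scalerA.
by congr (_ *: _); field.
Qed.

End KernelAlgebra.

(** Three quarters of the way from [omega] to [theta]: strictly above the mean of the two, which
    separates the contour from the spectrum by a fixed sector, and strictly below [theta], where f
    is defined. *)
Definition kernel_angle {R : realType} (omega theta : R) : R :=
  (omega + theta) / 2 + (theta - omega) / 4.

Section SectorialKernel.
Context {R : realType} {V : completeNormedModType R[i]}.
Variables (A : set (V * V)) (omega : R).
Hypotheses (omega_gt0 : 0 < omega) (omega_lt : omega < pi / 2).
Hypothesis hspec : spectrum A `<=` closure (sector omega).
Hypothesis hbound : forall theta, omega < theta < pi -> exists C : R,
  forall z, ~ closure (sector theta) z -> forall x, rnorm (z *: resolvent A z x) <= C * rnorm x.

Definition scaled_resolvent (z : R[i]) (x : V) : V := z *: resolvent A z x.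

Let Rw := scaled_resolvent.

Let q z := Rw (- z).

Let outside theta := [set z : R[i] | ~ closure (sector theta) z].

Let outside_resolvent theta : omega < theta -> outside theta `<=` resolvent_set A.
Proof.
move=> ot z zt; apply: contrapT => zr; apply: zt; have := hspec zr.
by apply: closure_subset => w; apply: sector_le; exact: ltW.
Qed.

Lemma op_holo_scaled_resolvent theta : omega < theta < pi ->
  exists C, op_holo (outside theta) Rw C.
Proof.
move=> /andP[ot tp]; have [|C HC] := hbound (theta := theta); first by rewrite ot.
exists `|C|; apply: op_holo_resolvent => //.
- exact: copen_closureN.
- exact: outside_resolvent.
- by apply; apply: closure_sector0; rewrite (lt_trans omega_gt0)//= ltW.
- by move=> z x /HC H; rewrite (le_trans (H x))// ler_wpM2r ?rnorm_ge0// ler_norm.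
Qed.

Lemma resolvent_commutes z w x : resolvent_set A z -> resolvent_set A w ->
  resolvent A z (resolvent A w x) = resolvent A w (resolvent A z x).
Proof.
move=> zr wr; have [->//|zw] := eqVneq z w.
have H1 := resolvent_identity x zr wr; have H2 := resolvent_identity x wr zr.
apply: (@scalerI _ _ (w - z)); first by rewrite subr_eq0 eq_sym.
by rewrite -H1 -[w - z]opprB scaleNr -H2 opprB.
Qed.

Let linear_Rw z : resolvent_set A z -> linear (Rw z).
Proof.
by move=> /resolventP[_ _ lR] a x y; rewrite /Rw /scaled_resolvent lR scalerDr !scalerA mulrC.
Qed.

Lemma scaled_resolvent_commutes z w x : resolvent_set A z -> resolvent_set A w ->
  scaled_resolvent z (scaled_resolvent w x) = scaled_resolvent w (scaled_resolvent z x).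
Proof.
move=> zr wr; have [_ _ lz] := resolventP zr; have [_ _ lw] := resolventP wr.
rewrite /scaled_resolvent (linear_predZ lz) (linear_predZ lw) resolvent_commutes//.
by rewrite !scalerA mulrC.
Qed.

Definition kernel z x := 16%:R *: Rw z (quadratic (q z) (quadratic (q z) x)).

(** On a scalar a this is e^u a / (e^u + a)^2, which vanishes both at 0 and at infinity. *)
Definition square_function (u : R) x := quadratic (q (polar u 0)) x.

Definition kernel_middle a z x := kernel_factor (q z) (Rw z) (cis a) x.

Variable theta : R.
Hypothesis theta_int : omega < theta < pi / 2.

Let D := outside ((omega + theta) / 2) `&` (fun z => outside theta (- z)).

Let theta_lt_pi : omega < theta < pi.
Proof. by have := pi_gt0 R; move/andP: theta_int => [-> ?] ?; rewrite /=; lra. Qed.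

Let mid_lt_pi : omega < (omega + theta) / 2 < pi.
Proof. by move/andP: theta_lt_pi => [? ?]; apply/andP; split; lra. Qed.

Let outside_polar t u a : omega < t < pi -> t < `|a| <= pi -> outside t (polar u a).
Proof. by move=> /andP[ot tp]; apply: closure_sectorN; rewrite (lt_trans omega_gt0). Qed.

Let outside_polarN t u a : omega < t < pi -> `|a| < pi - t -> outside t (- polar u a).
Proof. by move=> /andP[ot tp]; apply: closure_sector_opp; rewrite (lt_trans omega_gt0). Qed.

Lemma kernel_exchange_angle nu : omega < nu < theta -> forall nu', omega < nu' < theta ->
  exchange theta nu nu' Rw Rw.
Proof.
move=> /andP[on nt] nu' /andP[on' nt'].
(* An intermediate angle, whose sector contains the spectrum while its complement contains the rays
   at [nu], at [nu'] and in between. *)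
pose t := (omega + Num.min nu nu') / 2.
have om : omega < Num.min nu nu' by rewrite lt_min on.
have tm : t < Num.min nu nu' by rewrite /t; lra.
have mp : Num.max nu nu' < pi by rewrite gt_max !(lt_trans _ (andP theta_lt_pi).2).
have tP : omega < t < pi.
  have : Num.min nu nu' <= Num.max nu nu' by rewrite le_max ge_min lexx.
  by move=> ?; rewrite /t; apply/andP; split; lra.
have [C oC] := op_holo_scaled_resolvent tP.
have oD : copen (outside t) := @copen_closureN _ (sector t).
refine (exchange_shift oD oC _ _ _).
- by rewrite (lt_trans omega_gt0).
- by rewrite (lt_trans omega_gt0).
- move=> u a /andP[a1 a2]; apply: outside_polar => //.
  by rewrite (lt_le_trans tm)//= (le_trans a2)// ltW.
Qed.

Let op_holo_quadratic (D' : set R[i]) (p : R[i] -> V -> V) C : copen D' -> op_holo D' p C ->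
  exists C', op_holo D' (fun z => quadratic (p z)) C'.
Proof.
by move=> oD oq; eexists; apply: (op_holoB oD oq); exact (op_holo_comp oD oq oq).
Qed.

Let op_holo_kernel : exists C, op_holo D kernel C.
Proof.
have [C1 o1] := op_holo_scaled_resolvent mid_lt_pi.
have [C2 /op_holo_opp o2] := op_holo_scaled_resolvent theta_lt_pi.
have oD : copen D by apply: copenI; [|apply: copen_opp]; exact: copen_closureN.
have o1' : op_holo D Rw C1 by apply: op_holo_sub o1 => z [].
have o2' : op_holo D q C2 by apply: op_holo_sub o2 => z [].
have [C3 o3] := op_holo_quadratic oD o2'.
eexists; apply: (op_holoZ 16%:R oD); apply: (op_holo_comp oD o1').
exact (op_holo_comp oD o3 o3).
Qed.

Lemma ray_bounded_scaled_resolvent nu b : omega < nu < theta ->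
  exists B, ray_bounded (ray nu b) Rw B.
Proof.
move=> /andP[on nt]; have tP : omega < (omega + nu) / 2 < pi.
  by move/andP: theta_lt_pi => [? ?]; apply/andP; split; lra.
have [C oC] := op_holo_scaled_resolvent tP.
exists C; apply: (op_holo_ray_bounded oC) => u; apply: outside_polar => //.
have nu0 : 0 < nu by exact: lt_trans on.
rewrite (_ : `|_| = nu); last by rewrite /ray; case: b; rewrite ?normrN gtr0_norm.
by move/andP: theta_lt_pi => [? ?]; apply/andP; split; lra.
Qed.

Let nu0 := kernel_angle omega theta.

Let nu0P : omega < nu0 < theta.
Proof. by rewrite /nu0 /kernel_angle; move/andP: theta_int => [? ?]; apply/andP; split; lra. Qed.

Let nu0_gt0 : 0 < nu0.
Proof. by have /andP[+ _] := nu0P; apply: lt_trans. Qed.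

Let abs_ray b : `|ray nu0 b| = nu0.
Proof. by rewrite /ray; case: b; rewrite ?normrN gtr0_norm. Qed.

Let D_ray u b : D (polar u (ray nu0 b)).
Proof.
have /andP[? ?] := theta_int; have /andP[? ?] := nu0P; have ? := pi_gt0 R.
split; last by apply: outside_polarN => //; rewrite abs_ray; lra.
by apply: outside_polar => //; rewrite abs_ray /nu0 /kernel_angle; apply/andP; split; lra.
Qed.

Lemma kernel_ray_outside u b :
  ~ closure (sector ((omega + theta) / 2)) (polar u (ray nu0 b)) /\
  ~ closure (sector theta) (- polar u (ray nu0 b)).
Proof. exact: D_ray. Qed.

Lemma kernel_angle_itv : omega < nu0 < theta. Proof. exact: nu0P. Qed.

Lemma ray_bounded_kernel b : exists B, ray_bounded (ray nu0 b) kernel B.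
Proof.
by have [C oC] := op_holo_kernel; exists C; apply: (op_holo_ray_bounded oC) => u; exact: D_ray.
Qed.

Let ray_bounded_le a (W : R[i] -> V -> V) B B' : B <= B' -> ray_bounded a W B -> ray_bounded a W B'.
Proof.
move=> BB [B0 lW WB cW]; split => // [|u x]; first exact: le_trans BB.
by rewrite (le_trans (WB u x))// ler_wpM2r ?rnorm_ge0.
Qed.

Let scaled_resolventN z x : resolvent_set A z -> resolvent_set A (- z) ->
  Rw z x + q z x = 2%:R *: Rw z (q z x).
Proof.
move=> zr zr'; have [_ _ lz] := resolventP zr.
have := resolvent_identity x zr zr'; rewrite /q /Rw /scaled_resolvent.
rewrite (linear_predZ lz) scaleNr -scalerBr => ->.
by rewrite !scalerA; congr (_ *: _); ring.
Qed.

Lemma kernel_exchange : exchange theta nu0 nu0 Rw kernel.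
Proof.
have [C2 /op_holo_opp o2] := op_holo_scaled_resolvent theta_lt_pi.
have oD : copen (fun z : R[i] => outside theta (- z)).
  by apply: copen_opp; exact: copen_closureN.
have [C oE] : exists C, op_holo (fun z => outside theta (- z)) (fun z => kernel_remainder (q z)) C.
  have o3 := op_holo_comp oD o2 o2.
  have o4 := op_holoB oD (op_holoD (op_holo_id _) (op_holoZ 4%:R oD o2)) (op_holoZ 4%:R oD o3).
  have o5 := op_holoB oD o4 (op_holoZ 2%:R oD (op_holo_comp oD o2 o4)).
  have := op_holoZ (-1) oD (op_holo_comp oD o2 o5) => o6.
  eexists; move: o6; rewrite (_ : (fun z => _) = (fun z => kernel_remainder (q z))); first exact.
  by apply/funext => z; apply/funext => x; rewrite scaleN1r.
have [B1 rb1] := ray_bounded_scaled_resolvent true nu0P.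
have [B2 rb2] := ray_bounded_scaled_resolvent false nu0P.
have [B3 rb3] := ray_bounded_kernel true; have [B4 rb4] := ray_bounded_kernel false.
refine (@exchange_sub _ _ _ _ _ (fun z => kernel_remainder (q z)) C (Num.max B1 B2) (Num.max B3 B4)
  theta nu0 oD oE _ _ _ _ _).
- by rewrite nu0_gt0; case/andP: nu0P.
- by case; [apply: ray_bounded_le rb1|apply: ray_bounded_le rb2]; rewrite le_max lexx ?orbT.
- by case; [apply: ray_bounded_le rb3|apply: ray_bounded_le rb4]; rewrite le_max lexx ?orbT.
- move=> u a an; apply: outside_polarN => //; move/andP: theta_int => [? ?].
  by have /andP[? ?] := nu0P; lra.
- move=> u b x; have [D1 D2] := D_ray u b.
  have r1 : resolvent_set A (polar u (ray nu0 b)).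
    by apply: outside_resolvent D1; case/andP: mid_lt_pi.
  have r2 : resolvent_set A (- polar u (ray nu0 b)).
    by apply: outside_resolvent D2; case/andP: theta_lt_pi.
  apply: kernel_remainderE; [exact: linear_Rw|exact: linear_Rw|].
  by move=> y; exact: scaled_resolventN.
Qed.

(** An instance of [kernel_factorE] with [kappa = cis a], the quotient of the point on the ray by
    the point of the positive axis of the same modulus. The relation between [q] and [r] is the
    resolvent identity at their opposites. *)
Lemma kernelE u b x : kernel (polar u (ray nu0 b)) x =
  square_function u (kernel_middle (ray nu0 b) (polar u (ray nu0 b)) (square_function u x)).
Proof.
set a := ray nu0 b; set z := polar u a.
have [D1 D2] := D_ray u b.
have r1 : resolvent_set A z by apply: outside_resolvent D1; case/andP: mid_lt_pi.
have r2 : resolvent_set A (- z) by apply: outside_resolvent D2; case/andP: theta_lt_pi.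
have r3 : resolvent_set A (- polar u 0).
  apply: outside_resolvent (andP theta_lt_pi).1 _ _; apply: outside_polarN => //.
  by rewrite normr0 subr_gt0; case/andP: theta_lt_pi.
have zE : z = cis a * polar u 0.
  by rewrite /z /polar mulrCA -cisD addr0.
have p0 := polar_neq0 u 0; have c0 : cis a != 0 by rewrite -rnorm_eq0 rnorm_cis oner_eq0.
rewrite /square_function /kernel_middle /kernel kernel_factorE //.
- exact: linear_Rw.
- exact: linear_Rw.
- exact: linear_Rw.
- by move=> y; exact: scaled_resolvent_commutes.
- by move=> y; exact: scaled_resolvent_commutes.
- move=> y; have [_ _ lz] := resolventP r2.
  have := resolvent_identity y r2 r3; rewrite /q /Rw /scaled_resolvent (linear_predZ lz).
  move=> H; rewrite !scalerA.
  rewrite (_ : (cis a - 1) * - z * - polar u 0 = z * (- polar u 0 - - z)); last by rewrite zE; ring.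
  rewrite -[RHS]scalerA -H (_ : cis a * - polar u 0 = - z); last by rewrite zE mulrN.
  apply: cfunctional_inj => c cD cN cZ; rewrite !(cD, cN, cZ); ring.
Qed.

End SectorialKernel.

(** * Averaging over signs *)

Section SignAverage.
Context {R : realType} {V : normedModType R[i]}.

Definition sign (b : bool) : R := if b then -1 else 1.

Definition signed_sum n (x : nat -> V) (e : {ffun 'I_n -> bool}) : V :=
  \sum_(j < n) (sign (e j))%:C *: x j.

Definition sign_average n (x : nat -> V) : R :=
  (2^-1) ^+ n * \sum_(e : {ffun 'I_n -> bool}) rnorm (signed_sum x e) ^+ 2.

Lemma sign_average_ge0 n x : 0 <= sign_average n x.
Proof. by rewrite mulr_ge0 ?exprn_ge0 ?invr_ge0//; apply: sumr_ge0 => e _; exact: sqr_ge0. Qed.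

Lemma card_signs n : #|{ffun 'I_n -> bool}| = (2 ^ n)%N.
Proof. by rewrite card_ffun card_bool card_ord. Qed.

Lemma average_cst n (a : R) : (2^-1) ^+ n * \sum_(e : {ffun 'I_n -> bool}) a = a.
Proof.
rewrite sumr_const card_signs -[a *+ _]mulr_natr natrX mulrCA -exprMn mulVf//.
by rewrite expr1n mulr1.
Qed.

(** Orthogonality of signs: for distinct indices, flipping the sign at [j] is an involution that
    reverses the summand. *)
Lemma sum_sign n (j k : 'I_n) :
  \sum_(e : {ffun 'I_n -> bool}) sign (e j) * sign (e k) = if j == k then 2 ^+ n else 0.
Proof.
case: eqVneq => [->|jk].
  transitivity (\sum_(e : {ffun 'I_n -> bool}) (1 : R)).
    by apply: eq_bigr => e _; rewrite /sign; case: (e k); rewrite ?mulrNN mulr1.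
  by rewrite sumr_const card_signs natrX.
set s := \sum_e _; suff : s = - s by move=> /eqP; rewrite -addr_eq0 -mulr2n mulrn_eq0 => /eqP.
rewrite {1}/s.
pose flip (e : {ffun 'I_n -> bool}) := [ffun i => if i == j then ~~ e i else e i].
have flipK : involutive flip.
  by move=> e; apply/ffunP => i; rewrite !ffunE; case: eqP => // _; rewrite negbK.
rewrite (reindex_inj (inv_inj flipK)) /s -sumrN; apply: eq_bigr => e _.
rewrite !ffunE eqxx eq_sym (negbTE jk) /sign.
by case: (e j) => /=; rewrite ?mulN1r ?mul1r ?opprK.
Qed.

(** The difference of the two sides is the variance of [f]. *)
Lemma sqr_average n (f : {ffun 'I_n -> bool} -> R) :
  ((2^-1) ^+ n * \sum_e f e) ^+ 2 <= (2^-1) ^+ n * \sum_e f e ^+ 2.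
Proof.
set c := (2^-1) ^+ n; set m := c * \sum_e f e.
have c0 : 0 <= c by rewrite exprn_ge0// invr_ge0.
have c1 : c * \sum_(e : {ffun 'I_n -> bool}) 1 = 1.
  exact: average_cst.
rewrite -subr_ge0 (_ : _ - _ = c * \sum_e (f e - m) ^+ 2).
  by rewrite mulr_ge0//; apply: sumr_ge0 => e _; exact: sqr_ge0.
have -> : \sum_e (f e - m) ^+ 2 =
    \sum_e f e ^+ 2 - 2 * m * \sum_e f e + m ^+ 2 * \sum_(e : {ffun 'I_n -> bool}) 1.
  rewrite !mulr_sumr -sumrN -!big_split/=; apply: eq_bigr => e _; ring.
set a2 := \sum_e _; set a1 := \sum_e _; set a0 := \sum_e _.
transitivity (c * a2 - 2 * m * (c * a1) + m ^+ 2 * (c * a0)); last by ring.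
by rewrite c1 -/m; ring.
Qed.

(* sum_j G_j y_j is the average over signs e of (sum_j e_j G_j) (sum_k e_k y_k). *)
Lemma decoupling n (G : nat -> V -> V) (y : nat -> V) (K : R) : 0 <= K ->
  (forall j, linear (G j)) ->
  (forall (e : {ffun 'I_n -> bool}) v, rnorm (signed_sum (fun j => G j v) e) <= K * rnorm v) ->
  rnorm (\sum_(j < n) G j (y j)) <= K * Num.sqrt (sign_average n y).
Proof.
move=> K0 lG GK; set c : R := (2^-1) ^+ n.
have c0 : 0 <= c by rewrite exprn_ge0// invr_ge0.
have -> : \sum_(j < n) G j (y j) =
    c%:C *: \sum_(e : {ffun 'I_n -> bool}) signed_sum (fun j => G j (signed_sum y e)) e.
  have -> : \sum_(e : {ffun 'I_n -> bool}) signed_sum (fun j => G j (signed_sum y e)) e =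
      \sum_(j < n) \sum_(k < n) (\sum_(e : {ffun 'I_n -> bool}) sign (e j) * sign (e k))%:C *: G j (y k).
    rewrite /signed_sum exchange_big/=; apply: eq_bigr => j _.
    rewrite (eq_bigr (fun e : {ffun 'I_n -> bool} =>
      \sum_(k < n) (sign (e j) * sign (e k))%:C *: G j (y k))).
      rewrite exchange_big/=; apply: eq_bigr => k _.
      by rewrite -scaler_suml; congr (_ *: _); rewrite (rmorph_sum (real_complex R)).
    move=> e _; rewrite (linear_pred_sum (lG j)) scaler_sumr; apply: eq_bigr => k _.
    by rewrite (linear_predZ (lG j)) scale_realM.
  rewrite scaler_sumr; apply: eq_bigr => j _.
  have sgE k : (\sum_(e : {ffun 'I_n -> bool}) sign (e j) * sign (e k))%:C =
      (if j == k then 2 ^+ n else 0)%:C :> R[i] by congr (_%:C); exact: sum_sign.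
  rewrite (eq_bigr (fun k : 'I_n => if k == j then (2 ^+ n)%:C *: G j (y j) else 0)) => [|k _].
    by rewrite -big_mkcond big_pred1_eq -scale_realM /c -exprMn mulVf// expr1n scale1r.
  by rewrite sgE eq_sym; case: eqP => [->|_]; rewrite ?scale0r.
rewrite rnormZ rnorm_real ger0_norm//.
apply: (@le_trans _ _ (K * (c * \sum_e rnorm (signed_sum y e)))).
  rewrite mulrCA ler_wpM2l// (le_trans (ler_rnorm_sum _ _ _))// mulr_sumr.
  by apply: ler_sum => e _; exact: GK.
rewrite ler_wpM2l// -[leLHS]ger0_norm; last first.
  by rewrite mulr_ge0//; apply: sumr_ge0 => e _; exact: rnorm_ge0.
by rewrite -sqrtr_sqr; apply: ler_wsqrtr; exact: sqr_average.
Qed.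

(* R-boundedness of an indexed family, in terms of averages over signs. *)
Definition sign_bounded (I : Type) (W : I -> V -> V) (K : R) := 0 <= K /\
  forall n (i : nat -> I) (x : nat -> V),
    sign_average n (fun j => W (i j) (x j)) <= K * sign_average n x.

Lemma sign_bounded_comp (I : Type) (W W' : I -> V -> V) K K' :
  sign_bounded W K -> sign_bounded W' K' -> sign_bounded (fun i x => W i (W' i x)) (K * K').
Proof.
move=> [K0 WK] [K'0 WK']; split; first exact: mulr_ge0.
by move=> n i x; rewrite (le_trans (WK n i _))// -mulrA ler_wpM2l.
Qed.

Lemma sign_bounded_id (I : Type) : sign_bounded (fun (_ : I) x => x) 1.
Proof. by split => // n i x; rewrite mul1r. Qed.

Lemma sign_boundedZ (I : Type) (W : I -> V -> V) K (a : R[i]) : sign_bounded W K ->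
  sign_bounded (fun i x => a *: W i x) (rnorm a ^+ 2 * K).
Proof.
move=> [K0 WK]; split => [|n i x]; first by rewrite mulr_ge0// sqr_ge0.
rewrite -mulrA (@le_trans _ _ (rnorm a ^+ 2 * sign_average n (fun j => W (i j) (x j))))//.
  rewrite le_eqVlt; apply/orP; left; apply/eqP.
  rewrite /sign_average mulrCA; congr (_ * _); rewrite mulr_sumr; apply: eq_bigr => e _.
  rewrite -exprMn -rnormZ; congr (rnorm _ ^+ 2); rewrite /signed_sum scaler_sumr.
  by apply: eq_bigr => j _; rewrite !scalerA mulrC.
by rewrite ler_wpM2l ?sqr_ge0.
Qed.

Lemma sign_boundedD (I : Type) (W W' : I -> V -> V) K K' :
  sign_bounded W K -> sign_bounded W' K' ->
  sign_bounded (fun i x => W i x + W' i x) (2 * K + 2 * K').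
Proof.
move=> [K0 WK] [K'0 WK']; split => [|n i x]; first by rewrite addr_ge0 ?mulr_ge0.
apply: (@le_trans _ _ (2 * sign_average n (fun j => W (i j) (x j)) +
                      2 * sign_average n (fun j => W' (i j) (x j)))); last first.
  by rewrite [leRHS]mulrDl -(mulrA 2 K) -(mulrA 2 K') lerD// ler_wpM2l.
rewrite /sign_average !(mulrCA 2) -mulrDr ler_wpM2l ?exprn_ge0 ?invr_ge0//.
rewrite !mulr_sumr -big_split/=; apply: ler_sum => e _.
have -> : signed_sum (fun j => W (i j) (x j) + W' (i j) (x j)) e =
    signed_sum (fun j => W (i j) (x j)) e + signed_sum (fun j => W' (i j) (x j)) e.
  by rewrite -big_split; apply: eq_bigr => j _; rewrite scalerDr.
set a := signed_sum _ _; set b := signed_sum _ _.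
have := ler_rnormD a b; have := rnorm_ge0 a; have := rnorm_ge0 b; have := rnorm_ge0 (a + b).
move=> h1 h2 h3 h4; rewrite (@le_trans _ _ ((rnorm a + rnorm b) ^+ 2))//; first by rewrite lerXn2r// ?nnegrE ?addr_ge0.
rewrite -subr_ge0 (_ : _ - _ = (rnorm a - rnorm b) ^+ 2); [exact: sqr_ge0|ring].
Qed.

(** The bound on sums of the [G j] is used twice: with coefficients e_j a_j in the decoupling, and
    with coefficients e_j alone for the sign average of the vectors [G j x]. Between the two the
    family [M] acts termwise under the average. The root of [K] appears because [sign_bounded]
    compares squares. *)
Lemma square_function_estimate n (I : Type) (i : nat -> I) (a : nat -> R[i])
    (G : nat -> V -> V) (M : I -> V -> V) (alpha K1 K : R) (x : V) :
  0 <= K1 -> 0 <= alpha -> sign_bounded M K -> (forall j, linear (G j)) ->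
  (forall j, (j < n)%N -> rnorm (a j) <= alpha) ->
  (forall beta (c : nat -> R[i]) v, (forall j, (j < n)%N -> rnorm (c j) <= beta) -> 0 <= beta ->
     rnorm (\sum_(j < n) c j *: G j v) <= K1 * beta * rnorm v) ->
  rnorm (\sum_(j < n) a j *: G j (M (i j) (G j x))) <= K1 ^+ 2 * Num.sqrt K * alpha * rnorm x.
Proof.
move=> K10 a0 [K0 MK] lG aa GK.
have lG' j : linear (fun v => a j *: G j v).
  by move=> b u v; rewrite lG scalerDr !scalerA mulrC.
have sgn1 b : rnorm ((sign b)%:C) = 1 :> R.
  by rewrite rnorm_real /sign; case: b; rewrite ?normrN normr1.
apply: (le_trans (@decoupling n (fun j v => a j *: G j v) (fun j => M (i j) (G j x)) (K1 * alpha) _ lG' _)).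
- exact: mulr_ge0.
- move=> e v.
  (* Coefficients indexed by naturals, as [GK] expects; the default value 0 is taken only at indices
     that do not occur in the sum. *)
  pose c j := if insub j is Some k then (sign (e k))%:C * a j else 0.
  have cE (k : 'I_n) : c k = (sign (e k))%:C * a k by rewrite /c valK.
  rewrite /signed_sum (eq_bigr (fun j : 'I_n => c j *: G j v)) => [|j _]; last first.
    by rewrite cE scalerA.
  by apply: GK => // j jn; rewrite -[j]/(val (Ordinal jn)) cE rnormM sgn1 mul1r; exact: aa.
have av : sign_average n (fun j => G j x) <= (K1 * rnorm x) ^+ 2.
  have -> : (K1 * rnorm x) ^+ 2 = (2^-1) ^+ n * \sum_(e : {ffun 'I_n -> bool}) (K1 * rnorm x) ^+ 2.
    by rewrite average_cst.
  rewrite /sign_average ler_wpM2l ?exprn_ge0 ?invr_ge0//; apply: ler_sum => e _.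
  rewrite lerXn2r// ?nnegrE ?rnorm_ge0 ?mulr_ge0 ?rnorm_ge0//.
  pose c j : R[i] := if insub j is Some k then (sign (e k))%:C else 0.
  have cE (k : 'I_n) : c k = (sign (e k))%:C by rewrite /c valK.
  rewrite /signed_sum (eq_bigr (fun j : 'I_n => c j *: G j x)) => [|j _]; last by rewrite cE.
  rewrite -[K1]mulr1; apply: GK => // j jn.
  by rewrite -[j]/(val (Ordinal jn)) cE sgn1.
apply: (@le_trans _ _ (K1 * alpha * Num.sqrt (K * (K1 * rnorm x) ^+ 2))).
  rewrite ler_wpM2l ?mulr_ge0//; apply: ler_wsqrtr; rewrite (le_trans (MK n i _))//.
  by rewrite ler_wpM2l.
rewrite sqrtrM// sqrtr_sqr ger0_norm ?mulr_ge0 ?rnorm_ge0//.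
by rewrite le_eqVlt; apply/orP; left; apply/eqP; ring.
Qed.

End SignAverage.

Section Rademacher.
Context {R : realType} {dS : measure_display} {S : measurableType dS}.
Variables (P : probability S R) (r : nat -> {RV P >-> R}) (hr : independent_rademacher r).
Context {V : normedModType R[i]}.
Import HBNNSimple.

(** The event that the first n variables take the signs [e]. The default 0 concerns indices outside
    the intersection. *)
Let cell n (e : {ffun 'I_n -> bool}) : set S :=
  \bigcap_(j in [set` iota 0 n]) (r j @^-1` [set (if insub j is Some k then sign (e k) else 0)]).

Let measurable_cell n (e : {ffun 'I_n -> bool}) : measurable (cell e).
Proof.
apply: bigcap_measurableType => j _.
by rewrite -[X in measurable X]setTI; exact: measurable_funP.
Qed.

Let probability_cell n (e : {ffun 'I_n -> bool}) : P (cell e) = ((2^-1) ^+ n)%:E.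
Proof.
have [hr1 hr2] := hr; rewrite /cell (hr2 _ (fun j => [set (if insub j is Some k then sign (e k) else 0)])).
- rewrite big_seq (eq_bigr (fun=> (2^-1)%:E)) => [|j].
    rewrite -big_seq big_const_seq count_predT size_iota.
    by elim: n {e} => [|n IH] //=; rewrite IH -EFinM -exprS.
  rewrite mem_iota => /andP[_ jn]; rewrite add0n in jn; rewrite insubT /= /sign.
  by case: (e _); case: (hr1 j).
- exact: iota_uniq.
- by move=> j; exact: measurable_set1.
Qed.

(** Each variable is almost surely 1 or -1, since the two events have total probability 1. *)
Let ae_cell n : \forall t \ae P, exists e : {ffun 'I_n -> bool}, cell e t.
Proof.
have [hr1 _] := hr.
have one j : \forall t \ae P, r j t = 1 \/ r j t = -1.
  have mr (a : R) : measurable (r j @^-1` [set a]).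
    by rewrite -[X in measurable X]setTI; exact: measurable_funP.
  exists (~` (r j @^-1` [set 1] `|` r j @^-1` [set -1])); split.
  - by apply: measurableC; exact: measurableU.
  - rewrite [LHS]probability_setC; last exact: measurableU.
    rewrite measureU//; last first.
      apply/seteqP; split => t //= [-> ] /eqP; rewrite -subr_eq0 opprK.
      by rewrite (_ : 1 + 1 = 2%:R)// pnatr_eq0.
    have [h1 h2] := hr1 j; rewrite [X in (_ - (X + _))%E]h1 [X in (_ - (_ + X))%E]h2 -EFinD (_ : 2^-1 + 2^-1 = 1 :> R); last by field.
    by rewrite subrr.
  - by move=> t /= H1 H2; apply: H1; exact: H2.
have := ae_foralln one; apply: filterS => t H.
exists [ffun k : 'I_n => r k t == -1] => j; rewrite /= mem_iota add0n => /andP[_ jn].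
rewrite insubT /= ffunE /sign; case: eqP => // ne.
by have [] := H j.
Qed.

(** Almost everywhere the integrand equals the simple function [f] that is constant on the cells.
    The two integrals are compared through the definition of the integral as a supremum over simple
    functions. *)
Lemma rad_normE n (x : nat -> V) : rad_norm r n x = Num.sqrt (sign_average n x).
Proof.
rewrite /rad_norm; congr Num.sqrt.
pose v (e : {ffun 'I_n -> bool}) := rnorm (signed_sum x e) ^+ 2.
have v0 e : 0 <= v e by exact: sqr_ge0.
pose h t := rnorm (\sum_(j < n) (r j t)%:C *: x j) ^+ 2.
have h0 t : (0 <= (h t)%:E)%E by rewrite lee_fin sqr_ge0.
have hv e t : cell e t -> h t = v e.
  move=> et; rewrite /h /v /signed_sum; congr (rnorm _ ^+ 2); apply: eq_bigr => j _.
  by have := et j; rewrite /= mem_iota add0n leq0n ltn_ord valK => ->.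
have cell_inj e e' t : cell e t -> cell e' t -> e = e'.
  move=> et e't; apply/ffunP => j; have := et j; have := e't j.
  rewrite /= mem_iota add0n leq0n ltn_ord valK => /(_ isT) -> /(_ isT).
  rewrite /sign; case: (e j); case: (e' j) => // /eqP; rewrite -subr_eq0 ?opprK.
    by rewrite (_ : 1 + 1 = 2%:R)// pnatr_eq0.
  by rewrite -opprD oppr_eq0 (_ : 1 + 1 = 2%:R)// pnatr_eq0.
have [f fE] : exists f : {nnsfun S >-> R}, forall t,
    f t = \sum_(e : {ffun 'I_n -> bool}) v e * \1_(cell e) t.
  elim: (index_enum _) => [|e s [f fE]].
    by exists nnsfun0 => t; rewrite big_nil.
  exists (add_nnsfun (scale_nnsfun (indic_nnsfun R (measurable_cell e)) (v0 e)) f) => t.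
  by rewrite big_cons /= fE.
have fv e t : cell e t -> f t = v e.
  move=> et; rewrite fE (bigD1 e)//= big1 => [|e' /eqP e'e].
    by rewrite addr0 indicE mem_set// mulr1.
  by rewrite indicE memNset ?mulr0// => e't; apply: e'e; exact: cell_inj e't et.
have fint : (\int[P]_t (f t)%:E = (sign_average n x)%:E)%E.
  transitivity (\int[P]_t (\sum_(e : {ffun 'I_n -> bool}) (v e * \1_(cell e) t)%:E))%E.
    by apply: eq_integral => t _; rewrite fE sumEFin.
  rewrite ge0_integral_sum//.
  - rewrite /sign_average mulr_sumr -sumEFin; apply: eq_bigr => e _.
    rewrite (@integralZl_indic _ _ _ _ setT measurableT (fun=> cell e))//; last first.
      by move=> v_lt0; have := v0 e; rewrite leNgt v_lt0.
    transitivity ((v e)%:E * P (cell e))%E; last by rewrite probability_cell -EFinM mulrC.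
    by congr (_ * _)%E; rewrite integral_indic// setIT.
  - move=> e; apply/measurable_EFinP; apply: measurable_funM => //.
  - by move=> e t _; rewrite lee_fin mulr_ge0// indicE.
suff -> : (\int[P]_t (h t)%:E = (sign_average n x)%:E)%E by [].
(* A simple function below the integrand is almost everywhere at most [f]; conversely [f] itself
   lies below the integrand everywhere, being 0 off the cells. *)
rewrite -fint; apply/eqP; rewrite eq_le; apply/andP; split.
  rewrite [leLHS]ge0_integralTE//; apply: ge_ereal_sup => _ [g /= gh <-].
  rewrite -(integralT_nnsfun P g); apply: ae_ge0_le_integral => //.
  - by move=> t _; rewrite lee_fin.
  - by apply/measurable_EFinP.
  - by move=> t _; rewrite lee_fin.
  - by apply/measurable_EFinP.
  - apply: filterS (ae_cell n) => t [e et] _.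
    by rewrite (le_trans (gh t))// (hv _ _ et) (fv _ _ et).
rewrite [leRHS]ge0_integralTE// (integralT_nnsfun P f); apply: ereal_sup_ubound.
exists f => //= t; rewrite lee_fin.
have [[e et]|ne] := pselect (exists e : {ffun 'I_n -> bool}, cell e t); first by rewrite (hv _ _ et) (fv _ _ et).
rewrite fE big1 ?sqr_ge0// => e _; rewrite indicE memNset ?mulr0// => et; apply: ne; by exists e.
Qed.

Lemma R_bounded_sign_bounded (I : Type) (W : I -> V -> V) (F : set (V -> V)) :
  R_bounded r F -> (forall i, F (W i)) -> exists K, sign_bounded W K.
Proof.
move=> [K [K0 FK]] WF; exists (K ^+ 2); split => [|n i x]; first exact: sqr_ge0.
have := FK n (fun j => W (i j)) x (fun j _ => WF (i j)); rewrite !rad_normE => H.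
rewrite -[leLHS]sqr_sqrtr ?sign_average_ge0// -[sign_average n x in leRHS]sqr_sqrtr ?sign_average_ge0//.
by rewrite -exprMn lerXn2r// ?nnegrE ?mulr_ge0 ?sqrtr_ge0.
Qed.

Lemma R_bounded_norm (F : set (V -> V)) : R_bounded r F ->
  exists C, forall W, F W -> forall x, rnorm (W x) <= C * rnorm x.
Proof.
move=> [K [K0 FK]]; exists K => W FW x.
have av (y : V) : sign_average 1 (fun=> y) = rnorm y ^+ 2.
  rewrite /sign_average (eq_bigr (fun=> rnorm y ^+ 2)) => [|e _].
    exact: average_cst.
  rewrite /signed_sum big_ord1 rnormZ rnorm_real /sign.
  by case: (e _); rewrite ?normrN normr1 mul1r.
have := FK 1%N (fun=> W) (fun=> x) (fun j _ => FW).
by rewrite !rad_normE !av !sqrtr_sqr !ger0_norm ?rnorm_ge0.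
Qed.

End Rademacher.

(** * The square function kernel as a contour integral *)

Section ArctanIntegral.
Context {R : realType}.
Notation mu := (@lebesgue_measure R).

(** The form dx / (x^2 + rho^2) in the coordinate x = exp u; its integral is an arctangent and
    provides the factor pi in the residue computed below. *)
Definition lorentz (rho u : R) : R := expR u / (expR u ^+ 2 + rho ^+ 2).

Let den_gt0 (rho u : R) : 0 < expR u ^+ 2 + rho ^+ 2.
Proof. by rewrite ltr_wpDr ?sqr_ge0// exprn_gt0// expR_gt0. Qed.

Lemma continuous_lorentz rho : continuous (lorentz rho).
Proof.
move=> u; apply: cvgM; first exact: continuous_expR.
apply: cvgV; first by rewrite gt_eqF ?den_gt0.
by apply: cvgD; [apply: cvgM; exact: continuous_expR|exact: cvg_cst].
Qed.

Lemma integral_lorentz rho : 0 < rho ->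
  (\int[mu]_u (lorentz rho u)%:E = (pi / (2 * rho))%:E)%E.
Proof.
move=> rho0; rewrite -integral_log; last exact: continuous_lorentz.
have r0 : rho != 0 by rewrite gt_eqF.
pose F (x : R) := rho^-1 * atan (rho^-1 * x).
pose f (x : R) := (x ^+ 2 + rho ^+ 2)^-1.
have d0 (x : R) : 0 < x ^+ 2 + rho ^+ 2 by rewrite ltr_wpDl ?sqr_ge0// exprn_gt0.
have cf : continuous f.
  move=> x; apply: cvgV; first by rewrite gt_eqF.
  by apply: cvgD; [apply: cvgM; exact: cvg_id|exact: cvg_cst].
have dF (x : R) : is_derive x 1 F (f x).
  have h : is_derive x 1 (fun y : R => rho^-1 * y) rho^-1.
    by rewrite -[X in is_derive _ _ _ X](mulr1 rho^-1); apply: is_deriveZ.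
  have h2 : is_derive x 1 (atan \o (fun y : R => rho^-1 * y)) ((1 + (rho^-1 * x) ^+ 2)^-1 * rho^-1).
    exact: is_derive1_comp.
  rewrite (_ : f x = rho^-1 * ((1 + (rho^-1 * x) ^+ 2)^-1 * rho^-1)).
    by apply: is_deriveZ.
  have -> : 1 + (rho^-1 * x) ^+ 2 = (x ^+ 2 + rho ^+ 2) / rho ^+ 2 by field.
  by rewrite /f; field; rewrite r0 gt_eqF ?d0.
transitivity (\int[mu]_(x in `[0%R, +oo[) (f x)%:E)%E.
  rewrite -integral_itv_obnd_cbnd; last first.
    by apply/measurable_EFinP; apply: measurable_funTS; exact: continuous_measurable_fun.
  apply: eq_integral => t; rewrite inE /= in_itv/= andbT => t0; congr EFin.
  rewrite /lorentz lnK// /f; field; rewrite gt_eqF//= gt_eqF//.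
rewrite (@ge0_continuous_FTC2y _ f F 0 (pi / (2 * rho))).
- by rewrite /F mulr0 atan0 mulr0 sube0.
- by move=> x _; rewrite invr_ge0 ltW.
- exact: continuous_subspaceT.
- rewrite (_ : pi / (2 * rho) = rho^-1 * (pi / 2)); last by field.
  have H : rho^-1 * x @[x --> +oo] --> +oo by apply: gt0_cvgMry; rewrite ?invr_gt0//; exact: cvg_id.
  rewrite /F; apply: cvgMr.
  by move: H => /cvg_comp; apply; exact: cvgy_atan.
- by move=> x _; exact: ex_derive.
- apply: cvg_at_right_filter; apply: differentiable_continuous; apply/derivable1_diffP; exact: ex_derive.
- by move=> x _; rewrite derive1E; exact: derive_val.
Qed.

End ArctanIntegral.

Section PolarEstimates.
Context {R : realType}.
Implicit Types (u a nu : R).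

Lemma polar0 u : polar u 0 = (expR u)%:C.
Proof. by rewrite /polar /cis cos0 sin0 mulr1. Qed.

Lemma sqr_rnorm (z : R[i]) : rnorm z ^+ 2 = complex.Re z ^+ 2 + complex.Im z ^+ 2.
Proof. by rewrite {1}/rnorm normc_def /= sqr_sqrtr// addr_ge0// sqr_ge0. Qed.

Lemma rnorm_rational (p z : R[i]) :
  rnorm (- 2%:R * p ^+ 2 * z * (z - p)^-1 * (z + p)^-1) =
  2 * rnorm p ^+ 2 * rnorm z * (rnorm (z - p))^-1 * (rnorm (z + p))^-1.
Proof.
rewrite -rnormX 4!rnormM !rnormV rnormN (_ : 2%:R = 2%:C); last first.
  by rewrite (rmorph_nat (real_complex R) 2).
by rewrite rnorm_real ger0_norm.
Qed.

Lemma normr_ray nu b : 0 < nu -> `|ray nu b| = nu.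
Proof. by move=> n0; rewrite /ray; case: b; rewrite ?normrN gtr0_norm. Qed.

Lemma cos_abs a : cos `|a| = cos a.
Proof. by case: (ger0P a) => _; rewrite ?cosN. Qed.

Lemma ler_cos_pi a b : 0 <= a -> a <= b -> b <= pi -> cos b <= cos a.
Proof.
move=> a0; rewrite le_eqVlt => /predU1P[->//|ab] bp; rewrite ltW// ltr_cos//.
  by rewrite in_itv/= a0 (le_trans (ltW ab)).
by rewrite in_itv/= bp (le_trans a0)// ltW.
Qed.

Lemma rnorm_polarD_sqr u v a :
  rnorm (polar u a + polar v 0) ^+ 2 = expR u ^+ 2 + 2 * expR u * expR v * cos a + expR v ^+ 2.
Proof.
have ReD (z w : R[i]) : complex.Re (z + w) = complex.Re z + complex.Re w by case: z; case: w.
have ImD (z w : R[i]) : complex.Im (z + w) = complex.Im z + complex.Im w by case: z; case: w.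
rewrite sqr_rnorm ReD ImD !Re_polar !Im_polar cos0 sin0.
transitivity (expR u ^+ 2 * (cos a ^+ 2 + sin a ^+ 2) + 2 * expR u * expR v * cos a + expR v ^+ 2).
  by ring.
by rewrite cos2Dsin2 mulr1.
Qed.

(** This is cos^2 (nu / 2). *)
Definition opening nu : R := (1 + cos nu) / 2.

Lemma opening_gt0 nu : 0 <= nu < pi -> 0 < opening nu.
Proof.
move=> /andP[n0 np]; rewrite divr_gt0// -ltrBlDl sub0r -cospi.
by rewrite ltr_cos ?in_itv/= ?n0 ?lexx ?pi_ge0 ?(ltW np).
Qed.

Lemma opening_le1 nu : opening nu <= 1.
Proof. by rewrite /opening; have := cos_le1 nu; lra. Qed.

Lemma rnorm_polarD_ge nu u v a : 0 <= nu < pi -> `|a| <= nu ->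
  opening nu * (expR u + expR v) <= rnorm (polar u a + polar v 0).
Proof.
move=> np an; have k0 := opening_gt0 np; have k1 := opening_le1 nu.
have /andP[n0 npi] := np.
have e0 := expR_gt0 u; have e1 := expR_gt0 v.
have ca : cos nu <= cos a.
  by rewrite -(cos_abs a); apply: ler_cos_pi => //; exact: ltW.
rewrite -(@ler_pXn2r _ 2%N)// ?nnegrE ?rnorm_ge0//; last first.
  by rewrite mulr_ge0 ?addr_ge0 ?(ltW k0) ?(ltW e0) ?(ltW e1).
rewrite rnorm_polarD_sqr.
apply: (@le_trans _ _ (opening nu * (expR u + expR v) ^+ 2)).
  by rewrite exprMn ler_wpM2r ?sqr_ge0// expr2 ger_pMl.
apply: (@le_trans _ _ (expR u ^+ 2 + 2 * expR u * expR v * cos nu + expR v ^+ 2)).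
  rewrite -subr_ge0 /opening.
  rewrite (_ : _ - _ = (1 - cos nu) / 2 * (expR u - expR v) ^+ 2); last by field.
  by rewrite mulr_ge0 ?sqr_ge0// divr_ge0// subr_ge0 cos_le1.
by rewrite lerD2r lerD2l ler_wpM2l// !mulr_ge0// ltW.
Qed.

Lemma rnorm_polarB_ge u v a : pi / 2 <= `|a| <= pi ->
  expR u <= rnorm (polar u a - polar v 0) /\ expR v <= rnorm (polar u a - polar v 0).
Proof.
move=> /andP[a1 a2]; have e0 := expR_gt0 u; have e1 := expR_gt0 v.
have ca : cos a <= 0.
  rewrite -cos_abs -(cos_pihalf R); apply: ler_cos_pi => //.
  by rewrite divr_ge0// pi_ge0.
have E : rnorm (polar u a - polar v 0) ^+ 2 =
    expR u ^+ 2 + 2 * expR u * expR v * - cos a + expR v ^+ 2.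
  have -> : polar u a - polar v 0 = - (polar u (a + pi) + polar v 0).
    by rewrite -polarN opprD opprK.
  by rewrite rnormN rnorm_polarD_sqr cosDpi.
have m0 : 0 <= 2 * expR u * expR v * - cos a by rewrite !mulr_ge0 ?oppr_ge0// ltW.
by split; rewrite -ler_sqr ?nnegrE ?rnorm_ge0 ?(ltW (expR_gt0 _))// E;
  have := sqr_ge0 (expR u); have := sqr_ge0 (expR v); lra.
Qed.

Lemma le_edecay (h K u : R) : h <= K * expR u -> h <= K * expR (- u) -> h <= K * edecay 1 u.
Proof.
rewrite /edecay mulN1r; have [u0|u0] := ger0P u => //.
by rewrite opprK.
Qed.

(** The scalar function of which [square_function] at [v] is the operator version. *)
Definition kernel_symbol (v : R) (z : R[i]) : R[i]^o := z * polar v 0 / (z + polar v 0) ^+ 2.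

Lemma rnorm_kernel_symbol nu u v a : 0 <= nu < pi -> `|a| <= nu ->
  rnorm (kernel_symbol v (polar u a)) <=
    (opening nu ^+ 2)^-1 * (expR u * expR v / (expR u + expR v) ^+ 2).
Proof.
move=> np an; have k0 := opening_gt0 np; have e0 := expR_gt0 u; have e1 := expR_gt0 v.
have n0 := rnorm_polarD_ge u v np an.
have m0 : 0 < opening nu * (expR u + expR v) by rewrite mulr_gt0// addr_gt0.
rewrite /kernel_symbol rnormM rnormV rnormX rnormM !rnorm_polar.
rewrite (_ : _^-1 * (_ / _) = expR u * expR v / (opening nu * (expR u + expR v)) ^+ 2); last first.
  by field; rewrite !gt_eqF// addr_gt0.
rewrite ler_wpM2l ?mulr_ge0 ?(ltW e0) ?(ltW e1)// lef_pV2 ?posrE ?exprn_gt0//.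
  by rewrite lerXn2r// nnegrE ?rnorm_ge0// ltW.
exact: lt_le_trans n0.
Qed.

Lemma kernel_symbol_decay nu v : 0 <= nu < pi -> exists2 C, 0 <= C & forall u a, `|a| <= nu ->
  rnorm (kernel_symbol v (polar u a)) <= C * edecay 1 u.
Proof.
move=> np; have k0 := opening_gt0 np; have e1 := expR_gt0 v.
exists ((opening nu ^+ 2)^-1 * (expR v + (expR v)^-1)) => [|u a an].
  by rewrite mulr_ge0 ?invr_ge0 ?sqr_ge0// addr_ge0 ?invr_ge0 ltW.
apply: le_trans (rnorm_kernel_symbol _ _ np an) _.
rewrite -[leRHS]mulrA ler_wpM2l ?invr_ge0 ?sqr_ge0//.
have e0 := expR_gt0 u.
apply: le_edecay.
  rewrite ler_pdivrMr ?exprn_gt0 ?addr_gt0//.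
  rewrite -subr_ge0 (_ : _ - _ = expR u * ((expR v)^-1 * (expR u ^+ 2 + 2 * expR u * expR v)
    + expR v * (expR u + expR v) ^+ 2)); last by field; rewrite gt_eqF.
  by rewrite mulr_ge0 ?addr_ge0 ?mulr_ge0 ?invr_ge0 ?addr_ge0 ?mulr_ge0 ?sqr_ge0// ltW.
rewrite expRN ler_pdivrMr ?exprn_gt0 ?addr_gt0//.
rewrite -subr_ge0 (_ : _ - _ = (expR u)^-1 * (expR v * (2 * expR u * expR v + expR v ^+ 2)
    + (expR v)^-1 * (expR u + expR v) ^+ 2)); last by field; rewrite !gt_eqF.
by rewrite mulr_ge0 ?addr_ge0 ?mulr_ge0 ?invr_ge0 ?addr_ge0 ?mulr_ge0 ?sqr_ge0// ltW.
Qed.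

Lemma polarD_neq0 nu u v a : 0 <= nu < pi -> `|a| <= nu -> polar u a + polar v 0 != 0.
Proof.
move=> np an; rewrite -rnorm_eq0 gt_eqF// (lt_le_trans _ (rnorm_polarD_ge _ _ np an))//.
by rewrite mulr_gt0 ?opening_gt0// addr_gt0 ?expR_gt0.
Qed.

End PolarEstimates.

(** * The contour integral of the symbol against the resolvents of a generator *)

Section GeneratorContour.
Context {R : realType} {V : completeNormedModType R[i]}.
Notation mu := (@lebesgue_measure R).
Notation bint F := (bochner_integral mu F).
Variables (T : R -> {linear V -> V}) (M : R).
Hypotheses (hT : C0_semigroup T) (M0 : 0 <= M).
Hypothesis TM : forall t x, 0 <= t -> rnorm (T t x) <= M * rnorm x.

Let A := neg_generator T.
Let Rw := scaled_resolvent A.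
Let res := resolvent A.

(** A bounded semigroup gives only a bound of R(z) by 2 M / |Re z|; on this cone |Re z| is
    comparable to |z|, so z R(z) is bounded there. *)
Definition left_cone (c : R) := [set z : R[i] | complex.Re z < - (c * rnorm z)].

Lemma copen_left_cone c : 0 <= c -> copen (left_cone c).
Proof.
move=> c0 z zc; have c1 : 0 < 1 + c by rewrite ltr_pwDl.
exists ((- (c * rnorm z) - complex.Re z) / (1 + c)) => [|w].
  by rewrite divr_gt0// subr_gt0.
rewrite ltr_pdivlMr// => wd; rewrite /left_cone /=.
have -> : complex.Re (z + w) = complex.Re z + complex.Re w by case: (z) (w) => [? ?] [? ?].
have h1 := ler_Re_rnorm w; have h2 := ler_rnormD z w.
have h3 : c * rnorm (z + w) <= c * rnorm z + c * rnorm w by rewrite -mulrDr ler_wpM2l.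
have := ler_norm (complex.Re w); lra.
Qed.

Let left_cone_Re c z : 0 <= c -> left_cone c z -> complex.Re z < 0.
Proof. by move=> c0 /lt_le_trans; apply; rewrite oppr_le0 mulr_ge0 ?rnorm_ge0. Qed.

Lemma op_holo_generator c : 0 < c ->
  op_holo (left_cone c) Rw (M * (2 / c)).
Proof.
move=> c0; apply: op_holo_resolvent.
- exact/copen_left_cone/ltW.
- by rewrite mulr_ge0// divr_ge0// ltW.
- by move=> z /(left_cone_Re (ltW c0)) z0; exact (resolvent_set_generator hT M0 TM z0).
- by rewrite /left_cone /= rnorm0 mulr0 oppr0 ltxx.
- move=> z x zc; have z0 := left_cone_Re (ltW c0) zc.
  rewrite rnormZ (le_trans (ler_wpM2l (rnorm_ge0 z) (rnorm_resolvent_generator hT M0 TM z0 x)))//.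
  rewrite mulrA ler_wpM2r ?rnorm_ge0// mulrCA ler_wpM2l// mulrCA ler_wpM2l//.
  rewrite ler_pdivrMr ?oppr_gt0// ler_pdivlMl// lerNr; exact: ltW.
Qed.

Variable nu : R.
Hypothesis nuP : pi / 2 < nu < pi.

(** Half of the value - cos nu, so that the closed region of angles at least [nu] lies inside the
    open cone. *)
Let c := - cos nu / 2.

Let c_gt0 : 0 < c.
Proof.
have /andP[n1 n2] := nuP.
have p0 := pi_gt0 R.
have a1 : nu \in `[0, pi] by rewrite in_itv/=; apply/andP; split; lra.
have a2 : (pi / 2 : R) \in `[0, pi] by rewrite in_itv/=; apply/andP; split; lra.
by rewrite divr_gt0// oppr_gt0 -(cos_pihalf R) ltr_cos.
Qed.

Let in_cone u a : nu <= `|a| <= pi -> left_cone c (polar u a).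
Proof.
move=> /andP[a1 a2]; have /andP[n1 n2] := nuP.
change (complex.Re (polar u a) < - (c * rnorm (polar u a))).
rewrite rnorm_polar Re_polar -mulNr mulrC ltr_pM2r ?expR_gt0//.
apply: (@le_lt_trans _ _ (cos nu)).
  rewrite -(cos_abs a); apply: ler_cos_pi => //.
  by rewrite (le_trans _ (ltW n1))// divr_ge0// pi_ge0.
by have := c_gt0; rewrite /c; lra.
Qed.

Let Rset u a : nu <= `|a| <= pi -> resolvent_set A (polar u a).
Proof.
move=> aP; have z0 := left_cone_Re (ltW c_gt0) (in_cone u aP).
exact (resolvent_set_generator hT M0 TM z0).
Qed.

Lemma ray_bounded_generator b : exists B, ray_bounded (ray nu b) Rw B.
Proof.
have /andP[n1 n2] := nuP; have pi0 := pi_gt0 R.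
exists (M * (2 / c)); apply: (op_holo_ray_bounded (op_holo_generator c_gt0)) => u.
by apply: in_cone; rewrite normr_ray ?lexx ?(ltW n2)//; lra.
Qed.

Variable v : R.

Let p := polar v 0.
Let S := res (- p).

Let pset : resolvent_set A (- p).
Proof.
by rewrite /p polarN add0r; apply: Rset; rewrite ger0_norm ?pi_ge0// lexx andbT ltW//; case/andP: nuP.
Qed.

Let p_neq0 : p != 0. Proof. exact: polar_neq0. Qed.

(** On scalars - a / (p + a)^2, that is [square_function] divided by - p. Such a vector lies both in
    the domain and in the range of the operator, which gives decay at infinity and at 0. *)
Let rangev y := S y + p *: S (S y).

Let linear_res z : resolvent_set A z -> linear (res z).
Proof. by case/resolventP. Qed.

(* (z + p) R(z) S = S - R(z), the resolvent identity *)
Let resS z y : resolvent_set A z -> (z + p) *: res z (S y) = S y - res z y.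
Proof.
move=> zr; have := resolvent_identity y zr pset; rewrite -/S -/res => H.
by rewrite -[S y - _]opprB H -scaleNr; congr (_ *: _); ring.
Qed.

Let res_range z y : resolvent_set A z -> res z (rangev y) = S (S y) - z *: res z (S (S y)).
Proof.
move=> zr; have lz := linear_res zr; have := resS (S y) zr.
rewrite /rangev (linear_predD lz) (linear_predZ lz) scalerDl => /eqP.
rewrite eq_sym subr_eq => /eqP; move: (res z (S (S y))) (res z (S y)) => b d ->.
by apply: cfunctional_inj => f fD fN fZ; rewrite !(fD, fN, fZ); ring.
Qed.

Let res_domain z y : resolvent_set A z ->
  z *: res z (rangev y) - rangev y = - (p *: res z (rangev y) + res z (y + p *: S y)).
Proof.
move=> zr; have -> : rangev y = S (y + p *: S y).
  have lS : linear S := linear_res pset.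
  by rewrite /rangev (linear_predD lS) (linear_predZ lS).
have := resS (y + p *: S y) zr; rewrite scalerDl => /eqP; rewrite eq_sym subr_eq => /eqP H.
by rewrite {2}H; apply: cfunctional_inj => f fD fN fZ; rewrite !(fD, fN, fZ); ring.
Qed.

(** On the vector [rangev y] the family z R(z) tends to 0 at 0 and to the identity at infinity, like
    the scalar z / (z - p). The difference decays at both ends, and its pole p is off the left
    cone. *)
Let h1 y (z : R[i]) : V := (z * (z - p)^-1) *: rangev y - Rw z (rangev y).
Let h2 (z : R[i]) : R[i]^o := - 2%:R * p ^+ 2 * z * (z - p)^-1 * (z + p)^-1.
Let h3 (z : R[i]) : R[i]^o := p ^+ 2 * z * (z + p)^-1 * (z + p)^-1.

(** The three terms are suited to three displacements of the rays: [h1] is holomorphic around the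
    negative axis, [h3] around the positive axis, and the scalar [h2], with its poles at p and - p,
    between the rays and the imaginary axis. *)
Let symbol_split z y : resolvent_set A z -> z + p != 0 -> z - p != 0 ->
  kernel_symbol v z *: Rw z y = p *: h1 y z + h2 z *: rangev y - h3 z *: S y.
Proof.
move=> zr zp zp'; have lz := linear_res zr.
have E1 := resS y zr; have E2 := resS (S y) zr.
rewrite /h1 /h2 /h3 /kernel_symbol -/p /Rw /scaled_resolvent -/res.
rewrite {2}/rangev (linear_predD lz) (linear_predZ lz) /rangev.
have {}E1 : res z (S y) = (z + p)^-1 *: (S y - res z y).
  by rewrite -E1 scalerA mulVf// scale1r.
have {}E2 : res z (S (S y)) = (z + p)^-1 *: (S (S y) - res z (S y)).
  by rewrite -E2 scalerA mulVf// scale1r.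
rewrite E2 E1; apply: cfunctional_inj => f fD fN fZ; rewrite !(fD, fN, fZ).
by field; rewrite zp zp'.
Qed.

Let h1_cdiff y u a : nu <= `|a| <= pi -> cdiff (h1 y) (polar u a).
Proof.
move=> aP; have [_ _ _ Wd] := op_holo_generator c_gt0.
have aP' : pi / 2 <= `|a| <= pi.
  by have /andP[a1 ->] := aP; have /andP[n1 _] := nuP; rewrite (le_trans (ltW n1)).
have zp : polar u a + - p != 0.
  rewrite -rnorm_eq0 gt_eqF// (lt_le_trans (expR_gt0 u))//.
  by have [] := rnorm_polarB_ge u v aP'.
have H1 : cdiff (fun z : R[i] => (z : R[i]^o) *: ((z + - p)^-1 *: rangev y)) (polar u a).
  apply: cdiff_scale; first exact: cdiff_id.
  by apply: cdiff_scale; [exact: cdiff_inv|exact: cdiff_cst].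
have H2 : cdiff (fun z : R[i] => (-1 : R[i]^o) *: Rw z (rangev y)) (polar u a).
  by apply: cdiff_scale; [exact: cdiff_cst|apply: Wd; exact: in_cone].
rewrite (_ : h1 y = (fun z => z *: ((z + - p)^-1 *: rangev y) + -1 *: Rw z (rangev y))).
  exact: cdiffD H1 H2.
by apply/funext => z; rewrite /h1 scalerA scaleN1r.
Qed.

Let h1_bound y : exists C, forall u a, nu <= `|a| <= pi -> rnorm (h1 y (polar u a)) <= C * edecay 1 u.
Proof.
have [C0 _ WC _] := op_holo_generator c_gt0; set C := M * (2 / c) in C0 WC.
pose w := S (S y); pose x := y + p *: S y; pose g := rangev y.
exists (Num.max (rnorm g / expR v + rnorm w + C * rnorm w)
  (rnorm g * expR v + expR v * (C * rnorm g) + C * rnorm x)) => u a aP.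
have zr := Rset u aP; have zc := in_cone u aP.
have aP' : pi / 2 <= `|a| <= pi.
  by have /andP[a1 ->] := aP; have /andP[n1 _] := nuP; rewrite (le_trans (ltW n1)).
have [b1 b2] := rnorm_polarB_ge u v aP'.
have e0 := expR_gt0 u; have e1 := expR_gt0 v.
have zp : 0 < rnorm (polar u a - p) by exact: lt_le_trans b1.
have zp0 : polar u a - p != 0 by rewrite -rnorm_eq0 gt_eqF.
have i1 : (rnorm (polar u a - p))^-1 <= (expR u)^-1 by rewrite lef_pV2.
have i2 : (rnorm (polar u a - p))^-1 <= (expR v)^-1 by rewrite lef_pV2.
have res_le x' : rnorm (res (polar u a) x') <= expR (- u) * (C * rnorm x').
  have := WC _ x' zc; rewrite /Rw /scaled_resolvent rnormZ rnorm_polar => H.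
  by rewrite expRN ler_pdivlMl.
apply: le_edecay; last first.
  rewrite (@le_trans _ _ ((rnorm g * expR v + expR v * (C * rnorm g) + C * rnorm x) * expR (- u)))//; last first.
    by rewrite ler_wpM2r ?expR_ge0// le_max lexx orbT.
  have -> : h1 y (polar u a) = (p * (polar u a - p)^-1) *: g -
      (polar u a *: res (polar u a) g - g).
    rewrite /h1 -/g /Rw /scaled_resolvent -/res.
    by apply: cfunctional_inj => f fD fN fZ; rewrite !(fD, fN, fZ); field.
  rewrite res_domain// opprK -/g -/x.
  rewrite (le_trans (ler_rnormD _ _))// -addrA mulrDl lerD//.
    rewrite rnormZ rnormM rnormV rnorm_polar mulrC -mulrA ler_wpM2l ?rnorm_ge0//.
    by rewrite ler_wpM2l ?(ltW e1)// expRN.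
  rewrite (le_trans (ler_rnormD _ _))// mulrDl lerD//.
    rewrite rnormZ rnorm_polar -mulrA ler_wpM2l ?(ltW e1)// mulrC; exact: res_le.
  rewrite mulrC; exact: res_le.
rewrite (@le_trans _ _ ((rnorm g / expR v + rnorm w + C * rnorm w) * expR u))//; last first.
  by rewrite ler_wpM2r ?expR_ge0// le_max lexx.
have -> : h1 y (polar u a) = polar u a *: ((polar u a - p)^-1 *: g - (w - Rw (polar u a) w)).
  rewrite /h1 /Rw /scaled_resolvent -/res -/g /g res_range//.
  by rewrite [RHS]scalerBr scalerA.
rewrite rnormZ rnorm_polar mulrC ler_wpM2r ?(ltW e0)//.
rewrite (le_trans (ler_rnormB _ _))// -addrA lerD//.
  by rewrite rnormZ rnormV mulrC ler_wpM2l ?rnorm_ge0.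
by rewrite (le_trans (ler_rnormB _ _))// lerD// WC.
Qed.

Let nu_lt_pi : 0 <= nu < pi.
Proof. by have /andP[n1 ->] := nuP; rewrite andbT (le_trans _ (ltW n1))// divr_ge0// pi_ge0. Qed.

Let h2_bound : exists C, forall u a, pi / 2 <= `|a| <= nu ->
  rnorm (h2 (polar u a)) <= C * edecay 1 u.
Proof.
have k0 := opening_gt0 nu_lt_pi; set k := opening nu in k0.
exists (2 / k + 2 * expR v ^+ 2 / k) => u a /andP[a1 a2].
have [|b1 b2] := @rnorm_polarB_ge R u v a.
  by rewrite a1 (le_trans a2)// ltW//; case/andP: nu_lt_pi.
have b3 := rnorm_polarD_ge u v nu_lt_pi a2.
have e0 := expR_gt0 u; have e1 := expR_gt0 v; have i0 := expR_gt0 (- u).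
have m0 : 0 < rnorm (polar u a - p) by exact: lt_le_trans b1.
have m1 : 0 < k * (expR u + expR v) by rewrite mulr_gt0// addr_gt0.
have E : rnorm (h2 (polar u a)) <= 2 * expR v ^+ 2 * expR u * (rnorm (polar u a - p))^-1 *
    (k * (expR u + expR v))^-1.
  rewrite /h2 rnorm_rational !rnorm_polar.
  rewrite ler_wpM2l ?mulr_ge0 ?invr_ge0 ?(ltW e0) ?sqr_ge0 ?(ltW m0)// lef_pV2// posrE//.
  exact: lt_le_trans b3.
have i1 : (rnorm (polar u a - p))^-1 <= (expR u)^-1 by rewrite lef_pV2.
have i2 : (rnorm (polar u a - p))^-1 <= (expR v)^-1 by rewrite lef_pV2.
have m2 : 0 < k * expR u := mulr_gt0 k0 e0.
have m3 : 0 < k * expR v := mulr_gt0 k0 e1.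
have i3 : (k * (expR u + expR v))^-1 <= (k * expR u)^-1.
  by rewrite lef_pV2 ?posrE// ler_wpM2l ?(ltW k0)// lerDl ltW.
have i4 : (k * (expR u + expR v))^-1 <= (k * expR v)^-1.
  by rewrite lef_pV2 ?posrE// ler_wpM2l ?(ltW k0)// lerDr ltW.
have c0 : 0 <= 2 * expR v ^+ 2 * expR u by rewrite !mulr_ge0 ?sqr_ge0// ltW.
apply: le_edecay; apply: le_trans E _.
  apply: (@le_trans _ _ (2 * expR v ^+ 2 * expR u * (expR v)^-1 * (k * expR v)^-1)).
    by apply: ler_pM; rewrite ?mulr_ge0 ?invr_ge0 ?(ltW m0) ?(ltW m1)// ler_wpM2l.
  have -> : 2 * expR v ^+ 2 * expR u / expR v / (k * expR v) = 2 / k * expR u.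
    by field; rewrite !gt_eqF.
  by rewrite ler_wpM2r ?(ltW e0)// lerDl divr_ge0 ?mulr_ge0 ?sqr_ge0// ltW.
apply: (@le_trans _ _ (2 * expR v ^+ 2 * expR u * (expR u)^-1 * (k * expR u)^-1)).
  by apply: ler_pM; rewrite ?mulr_ge0 ?invr_ge0 ?(ltW m0) ?(ltW m1)// ler_wpM2l.
have -> : 2 * expR v ^+ 2 * expR u / expR u / (k * expR u) = 2 * expR v ^+ 2 / k * expR (- u).
  by rewrite expRN; field; rewrite !gt_eqF.
by rewrite ler_wpM2r ?(ltW i0)// lerDr divr_ge0// ltW.
Qed.

Let cdiff_scaled (q1 q2 b z : R[i]) : z + q1 != 0 -> z + q2 != 0 ->
  cdiff (fun z => b * z * (z + q1)^-1 * (z + q2)^-1 : R[i]^o) z.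
Proof.
move=> z1 z2.
have H : cdiff (fun w : R[i] => (b : R[i]^o) *: ((w : R[i]^o) *:
    ((w + q1)^-1 *: ((w + q2)^-1 : R[i]^o)))) z.
  apply: cdiff_scale; first exact: cdiff_cst.
  apply: cdiff_scale; first exact: cdiff_id.
  by apply: cdiff_scale; exact: cdiff_inv.
rewrite (_ : (fun z => _) = (fun w : R[i] => (b : R[i]^o) *: ((w : R[i]^o) *:
    ((w + q1)^-1 *: ((w + q2)^-1 : R[i]^o))))); first exact: H.
by apply/funext => w; rewrite /GRing.scale/= !mulrA.
Qed.

Let h2_cdiff u a : pi / 2 <= `|a| <= nu -> cdiff h2 (polar u a).
Proof.
move=> /andP[a1 a2]; apply: cdiff_scaled; last exact: polarD_neq0 nu_lt_pi a2.
have [|b1 b2] := @rnorm_polarB_ge R u v a.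
  by rewrite a1 (le_trans a2)// ltW//; case/andP: nu_lt_pi.
by rewrite -rnorm_eq0 gt_eqF// (lt_le_trans (expR_gt0 u)).
Qed.

Let h3_cdiff u a : `|a| <= nu -> cdiff h3 (polar u a).
Proof. by move=> an; apply: cdiff_scaled; exact: polarD_neq0 nu_lt_pi an. Qed.

Let h3_bound : exists C, forall u a, `|a| <= nu -> rnorm (h3 (polar u a)) <= C * edecay 1 u.
Proof.
have [C C0 HC] := kernel_symbol_decay v nu_lt_pi.
exists (expR v * C) => u a an; rewrite -mulrA.
have -> : h3 (polar u a) = p * kernel_symbol v (polar u a).
  rewrite /h3 /kernel_symbol -/p; field; exact: polarD_neq0 nu_lt_pi an.
by rewrite rnormM rnorm_polar ler_wpM2l ?expR_ge0// HC.
Qed.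

Let decayingP (h : R[i] -> V) a C : (forall u, cdiff h (polar u a)) ->
  (forall u, rnorm (h (polar u a)) <= C * edecay 1 u) ->
  decaying C 1 (fun u => h (polar u a)).
Proof. by move=> hd hC; split => // u; exact: cdiff_continuous_polar. Qed.

Let bint_lorentz rho (w : V) : 0 < rho ->
  bint (fun u => (lorentz rho u)%:C *: w) = (pi / (2 * rho))%:C *: w.
Proof.
move=> rho0.
have l0 u : 0 <= lorentz rho u.
  by rewrite /lorentz divr_ge0 ?expR_ge0// addr_ge0// sqr_ge0.
have il : mu.-integrable setT (EFin \o lorentz rho).
  apply/integrableP; split.
    by apply/measurable_EFinP; apply: continuous_measurable_fun; exact: continuous_lorentz.
  under eq_integral do rewrite /= ger0_norm//.
  by rewrite integral_lorentz// ltry.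
have dl : dominated_continuous (fun u => (lorentz rho u)%:C *: w).
  split.
    move=> u _; apply: (@cvgZr_tmp _ _ _ _ _ (fun u => (lorentz rho u)%:C : R[i]^o)).
    apply/cvg_rnormP => e e0; have /cvgrPdist_lt/(_ e e0) := @continuous_lorentz R rho u.
    by apply: filterS => t; rewrite -real_complexB rnorm_real distrC.
  exists (fun u => rnorm w * lorentz rho u); split.
  - by apply: measurable_funM => //; apply: continuous_measurable_fun; exact: continuous_lorentz.
  - by move=> t; rewrite mulr_ge0 ?rnorm_ge0.
  - exact: (integrableZl measurableT (rnorm w) il).
  - by move=> t _; rewrite rnormZr ger0_norm// mulrC.
apply: bint_eqP => // l lP; have [_ lZ _] := lP.
rewrite lZ; under [RHS]eq_Rintegral do rewrite lZ.
rewrite (_ : (fun x => lorentz rho x * l w) = (fun x => l w * lorentz rho x)); last first.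
  by apply/funext => x; rewrite mulrC.
rewrite RintegralZl//; rewrite [RHS]mulrC; congr (_ * _).
by rewrite /Rintegral integral_lorentz.
Qed.

Let lorentz_value y : (pi / (2 * expR v))%:C *: (- (4%:R * 'i * p ^+ 2) *: rangev y) =
  ((2 * pi)%:C * 'i) *: square_function A v y.
Proof.
rewrite /square_function /quadratic /scaled_resolvent.
have lS : linear S := linear_res pset.
rewrite -/p -[resolvent A (- p)]/S (linear_predZ lS) !scalerA /rangev.
rewrite real_complexM real_complexV !real_complexM -(polar0 v) -/p.
have -> : 2%:C = 2%:R :> R[i] by rewrite (rmorph_nat (real_complex R) 2).
by apply: cfunctional_inj => f fD fN fZ; rewrite !(fD, fN, fZ); field.
Qed.

(** On the imaginary axis the product of the two denominators is - (t^2 + p^2) on both rays, so the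
    difference of the values is a Lorentz function. *)
Let symbol_imag u : h2 (polar u (- (pi / 2))) - h2 (polar u (pi / 2)) =
  (lorentz (expR v) u)%:C * - (4%:R * 'i * p ^+ 2).
Proof.
have E1 : polar u (- (pi / 2)) = - 'i * (expR u)%:C.
  by rewrite /polar mulrC; congr (_ * _); rewrite /cis cosN sinN cos_pihalf sin_pihalf; simpc.
have E2 : polar u (pi / 2) = 'i * (expR u)%:C.
  by rewrite /polar mulrC; congr (_ * _); rewrite /cis cos_pihalf sin_pihalf; simpc.
rewrite E1 E2 /h2 /lorentz real_complexM real_complexV real_complexD !real_complexX -(polar0 v) -/p.
set t := (expR u)%:C.
have den : t ^+ 2 + p ^+ 2 != 0.
  rewrite /p polar0 -!real_complexX -real_complexD (inj_eq (@complexI R)) gt_eqF//.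
  by rewrite addr_gt0// exprn_gt0 ?expR_gt0.
have i2 : 'i ^+ 2 = -1 :> R[i] by rewrite sqr_i.
have m0 (w : R[i]) : w ^+ 2 = - t ^+ 2 -> w - p != 0 /\ w + p != 0.
  move=> wE; have : (w - p) * (w + p) != 0.
    by rewrite -subr_sqr wE -opprD oppr_eq0.
  by rewrite mulf_eq0 negb_or => /andP[].
have t1 : ('i * t) ^+ 2 = - t ^+ 2 by rewrite exprMn i2 mulN1r.
have t2 : (- 'i * t) ^+ 2 = - t ^+ 2 by rewrite exprMn sqrrN i2 mulN1r.
have [i1 i3] := m0 _ t1; have [i4 i5] := m0 _ t2.
have D1 : ('i * t - p) * ('i * t + p) = - (t ^+ 2 + p ^+ 2).
  by rewrite -subr_sqr exprMn i2; ring.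
have D2 : (- 'i * t - p) * (- 'i * t + p) = - (t ^+ 2 + p ^+ 2).
  by rewrite -subr_sqr exprMn sqrrN i2; ring.
rewrite -(mulrA _ ('i * t - p)^-1) -(mulrA _ (- 'i * t - p)^-1) -!invfM D1 D2.
by field.
Qed.

Let symbol_imag_scale u (g : V) :
  h2 (polar u (- (pi / 2))) *: g - h2 (polar u (pi / 2)) *: g =
  (lorentz (expR v) u)%:C *: (- (4%:R * 'i * p ^+ 2) *: g).
Proof. by rewrite -scalerBl symbol_imag scalerA. Qed.

Let congr3_sub (a a' b b' d d' : V) : a = a' -> b = b' -> d = d' -> a + b - d = a' + b' - d'.
Proof. by move=> -> -> ->. Qed.

Let add_sub_cancel (a b b' d : V) : (a + b - d) - (a + b' - d) = b - b'.
Proof. by apply: cfunctional_inj => f fD fN fZ; rewrite !(fD, fN, fZ); ring. Qed.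

(** The contributions of [h1] cancel by joining the two rays across the negative axis, where the
    angles - pi and pi coincide, and those of [h3] by joining them across the positive axis. The
    rays of [h2] are turned to the imaginary axis, and the integral of the Lorentz function yields
    the factor 2 pi i. *)
Lemma kernel_contour y :
  bint (fun u =>
    kernel_symbol v (polar u (ray nu true)) *: Rw (polar u (ray nu true)) y -
    kernel_symbol v (polar u (ray nu false)) *: Rw (polar u (ray nu false)) y) =
  ((2 * pi)%:C * 'i) *: square_function A v y.
Proof.
have /andP[n1 n2] := nuP; have pi0 := pi_gt0 R.
have nu0 : 0 < nu by apply: lt_trans n1; rewrite divr_gt0.
have pi2 : 0 < pi / 2 :> R by rewrite divr_gt0.
pose g := rangev y.
have [C1 H1] := h1_bound y; have [C2 H2] := h2_bound; have [C3 H3] := h3_bound.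
pose k2 z := h2 z *: g; pose k3 z := h3 z *: S y.
have absray b : `|ray nu b| = nu := normr_ray b nu0.
have d1 b : decaying C1 1 (fun u => h1 y (polar u (ray nu b))).
  by apply: decayingP => u; [apply: h1_cdiff|apply: H1]; rewrite absray lexx ltW.
have k2d u a : pi / 2 <= `|a| <= nu -> cdiff k2 (polar u a).
  by move=> aP; apply: cdiff_scale; [exact: h2_cdiff|exact: cdiff_cst].
have k2b u a : pi / 2 <= `|a| <= nu -> rnorm (k2 (polar u a)) <= C2 * rnorm g * edecay 1 u.
  by move=> aP; rewrite /k2 rnormZ mulrAC ler_wpM2r ?rnorm_ge0// H2.
have k3d u a : `|a| <= nu -> cdiff k3 (polar u a).
  by move=> aP; apply: cdiff_scale; [exact: h3_cdiff|exact: cdiff_cst].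
have k3b u a : `|a| <= nu -> rnorm (k3 (polar u a)) <= C3 * rnorm (S y) * edecay 1 u.
  by move=> aP; rewrite /k3 rnormZ mulrAC ler_wpM2r ?rnorm_ge0// H3.
have d2 b : decaying (C2 * rnorm g) 1 (fun u => k2 (polar u (ray nu b))).
  by apply: decayingP => u; [apply: k2d|apply: k2b]; rewrite absray lexx ltW.
have d3 b : decaying (C3 * rnorm (S y)) 1 (fun u => k3 (polar u (ray nu b))).
  by apply: decayingP => u; [apply: k3d|apply: k3b]; rewrite absray.
have dd b := dominated_continuousB (dominated_continuousD
  (dominated_continuousZ p (decaying_dominated (d1 b))) (decaying_dominated (d2 b)))
  (decaying_dominated (d3 b)).
have split b : (fun u => kernel_symbol v (polar u (ray nu b)) *: Rw (polar u (ray nu b)) y) =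
    (fun u => p *: h1 y (polar u (ray nu b)) + k2 (polar u (ray nu b)) - k3 (polar u (ray nu b))).
  apply/funext => u; apply: symbol_split.
  - by apply: Rset; rewrite absray lexx ltW.
  - by apply: (polarD_neq0 u v nu_lt_pi); rewrite absray.
  - have [|b1 _] := @rnorm_polarB_ge R u v (ray nu b); first by rewrite absray !ltW.
    by rewrite -rnorm_eq0 gt_eqF// (lt_le_trans (expR_gt0 u)).
have total b : bint (fun u => kernel_symbol v (polar u (ray nu b)) *: Rw (polar u (ray nu b)) y) =
    p *: bint (fun u => h1 y (polar u (ray nu b))) + bint (fun u => k2 (polar u (ray nu b))) -
    bint (fun u => k3 (polar u (ray nu b))).
  rewrite split.
  apply: etrans (bintB (dominated_continuousD
    (dominated_continuousZ p (decaying_dominated (d1 b))) (decaying_dominated (d2 b)))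
    (decaying_dominated (d3 b))) _; congr (_ - _).
  apply: etrans (bintD (dominated_continuousZ p (decaying_dominated (d1 b)))
    (decaying_dominated (d2 b))) _; congr (_ + _).
  exact: bintZ (decaying_dominated (d1 b)).
have nn1 : - pi < - nu by rewrite ltrN2.
have nn2 : - nu < - (pi / 2) by rewrite ltrN2.
have e1 : bint (fun u => h1 y (polar u (ray nu true))) = bint (fun u => h1 y (polar u (ray nu false))).
  transitivity (bint (fun u => h1 y (polar u (- pi)))).
    symmetry; refine (@strip_invariance _ _ (h1 y) (- pi) (- nu) C1 1 ltr01 nn1 _ _) => u a aP.
    - by apply: h1_cdiff; have /andP[? ?] := aP; rewrite ler0_norm; lra.
    - by apply: H1; have /andP[? ?] := aP; rewrite ler0_norm; lra.
  transitivity (bint (fun u => h1 y (polar u pi))).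
    by congr bochner_integral; apply/funext => u; rewrite /polar /cis cosN sinN sinpi oppr0.
  symmetry; refine (@strip_invariance _ _ (h1 y) nu pi C1 1 ltr01 n2 _ _) => u a aP.
  - by apply: h1_cdiff; have /andP[? ?] := aP; rewrite ger0_norm; lra.
  - by apply: H1; have /andP[? ?] := aP; rewrite ger0_norm; lra.
have e3' : bint (fun u => k3 (polar u (- nu))) = bint (fun u => k3 (polar u nu)).
  have nn : - nu < nu := lt_trans (etrans (oppr_lt0 nu) nu0) nu0.
  refine (@strip_invariance _ _ k3 (- nu) nu (C3 * rnorm (S y)) 1 ltr01 nn _ _) => u a aP.
    by apply: k3d; rewrite ler_norml; exact: aP.
  by apply: k3b; rewrite ler_norml; exact: aP.
have e3 : bint (fun u => k3 (polar u (ray nu true))) = bint (fun u => k3 (polar u (ray nu false))) := e3'.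
have e2 b : bint (fun u => k2 (polar u (ray nu b))) = bint (fun u => k2 (polar u (ray (pi / 2) b))).
  case: b.
    refine (@strip_invariance _ _ k2 (- nu) (- (pi / 2)) (C2 * rnorm g) 1 ltr01 nn2 _ _) => u a aP.
    - by apply: k2d; have /andP[? ?] := aP; rewrite ler0_norm; lra.
    - by apply: k2b; have /andP[? ?] := aP; rewrite ler0_norm; lra.
  symmetry; refine (@strip_invariance _ _ k2 (pi / 2) nu (C2 * rnorm g) 1 ltr01 n1 _ _) => u a aP.
  - by apply: k2d; have /andP[? ?] := aP; rewrite ger0_norm; lra.
  - by apply: k2b; have /andP[? ?] := aP; rewrite ger0_norm; lra.
have dpi b : decaying (C2 * rnorm g) 1 (fun u => k2 (polar u (ray (pi / 2) b))).
  have E := normr_ray b pi2.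
  by apply: decayingP => u; [apply: k2d|apply: k2b]; rewrite E lexx ltW.
have dom b : dominated_continuous
    (fun u => kernel_symbol v (polar u (ray nu b)) *: Rw (polar u (ray nu b)) y).
  by rewrite split; exact: dd.
apply: etrans (bintB (dom true) (dom false)) _.
pose K b := bint (fun u => k2 (polar u (ray (pi / 2) b))).
set I1 := bint (fun u => h1 y (polar u (ray nu false))) in e1.
set I3 := bint (fun u => k3 (polar u (ray nu false))) in e3.
have t1 := etrans (total true) (congr3_sub (congr1 ( *:%R p) e1) (e2 true) e3).
have t2 := etrans (total false) (congr3_sub (erefl (p *: I1)) (e2 false) (erefl I3)).
apply: etrans (congr2 (fun x x' => x - x') t1 t2) _.
apply: etrans (add_sub_cancel _ (K true) (K false) _) _.
apply: etrans (esym (bintB (decaying_dominated (dpi true)) (decaying_dominated (dpi false)))) _.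
rewrite (_ : (fun u => _) = (fun u => (lorentz (expR v) u)%:C *: (- (4%:R * 'i * p ^+ 2) *: g))).
  exact: etrans (bint_lorentz _ (expR_gt0 v)) (lorentz_value y).
apply/funext => u; exact (symbol_imag_scale u g).
Qed.

End GeneratorContour.

(** * The functional calculus as an iterated integral in logarithmic coordinates *)

Section HolomorphicDecay.
Context {R : realType} {d : nat}.
Notation point := 'rV[R[i]^o]_d.
Implicit Types (z : point) (k : 'I_d).

Lemma set_coord_same z k : set_coord z k (z 0 k) = z.
Proof. by apply/rowP => j; rewrite set_coordE; case: eqP => // ->. Qed.

Lemma set_coord_shift z k w : set_coord z k (z 0 k + w) = w *: delta_mx 0 k + z.
Proof.
apply/rowP => j; rewrite set_coordE !mxE eqxx /=.
case: eqP => [->|_]; last by rewrite mulr0 add0r.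
by rewrite mulr1 addrC.
Qed.

Lemma differentiable_cdiff (f : point -> R[i]^o) z k : differentiable f z ->
  cdiff (fun w => f (set_coord z k w)) (z 0 k).
Proof.
move=> /(@diff_derivable _ _ _ f z (delta_mx 0 k)); rewrite /derivable => /cvg_ex[/= l fl].
exists l => e e0.
have /cvg_rnormP/(_ e e0) := fl.
move=> /nbhs_ballP[r /= r0 rB].
have rr : r = (complex.Re r)%:C.
  by move: r0; rewrite ltcE => /andP[/eqP/= h _]; case: r h {rB} => a b /= ->.
have r0' : 0 < complex.Re r by rewrite -ltcR -rr.
exists (complex.Re r); first exact: r0'.
move=> w wr; rewrite set_coord_shift set_coord_same.
have [->|w0] := eqVneq w 0.
  by rewrite !scale0r add0r !subrr rnorm0 mulr0.
have /= := rB w _ w0; rewrite /ball /= sub0r normrN normE_rnorm [X in _ < X]rr ltcR => /(_ wr) H.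
rewrite (_ : _ - _ = w *: (w^-1 *: (f (w *: delta_mx 0 k + z) - f z) - l)); last first.
  by rewrite scalerBr scalerA mulfV// scale1r.
by rewrite rnormZ mulrC ler_wpM2r ?rnorm_ge0// ltW.
Qed.

Lemma edecay_mono (s s' u : R) : s <= s' -> edecay s' u <= edecay s u.
Proof. by move=> ss; rewrite ler_expR !mulNr lerN2 ler_wpM2r. Qed.

(** After taking logarithms this is 2 ln (1 + x) >= ln x + |ln x|, which follows from ln (1 + x)
    being at least 0 and at least ln x. *)
Lemma powR_decay (s x : R) : 0 < s -> 0 < x ->
  x `^ s / (1 + x) `^ (2 * s) <= edecay s (ln x).
Proof.
move=> s0 x0; have x1 : 0 < 1 + x by rewrite addr_gt0.
rewrite /powR !gt_eqF// -expRN -expRD ler_expR mulNr.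
have h1 : 0 <= ln (1 + x) by rewrite ln_ge0// lerDl ltW.
have h2 : ln x <= ln (1 + x) by rewrite ler_ln ?posrE// lerDr.
rewrite -subr_ge0 (_ : _ - _ = s * (2 * ln (1 + x) - ln x - `|ln x|)); last by ring.
apply: mulr_ge0; first exact: ltW.
by have [h|h] := ger0P (ln x); lra.
Qed.

Lemma common_lower_bound (sk : 'I_d -> R) (ks : seq 'I_d) :
  (forall k, k \in ks -> 0 < sk k) -> exists2 s, 0 < s & forall k, k \in ks -> s <= sk k.
Proof.
elim: ks => [_|k ks IH kP]; first by exists 1.
have [|s s0 sP] := IH; first by move=> j jks; apply: kP; rewrite inE jks orbT.
exists (Num.min s (sk k)) => [|j]; first by rewrite lt_min s0 kP// mem_head.
by rewrite inE ge_min => /predU1P[->|/sP ->//]; rewrite lexx orbT.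
Qed.

Lemma Hinf0_sector_decaying theta (Lambda : {set 'I_d}) (f : point -> R[i]^o) :
  Hinf0 theta Lambda f -> exists C s, sector_decaying theta (enum Lambda) f C s.
Proof.
move=> [fd _ _ [C [sk [C0 sk0 fC]]]].
have [k|s s0 sP] := @common_lower_bound sk (enum Lambda); first by rewrite mem_enum => /sk0.
exists C, s; split => // [z k zt|z zt]; first by apply: differentiable_cdiff; exact: fd.
rewrite (le_trans (fC z zt))// ler_wpM2l// big_enum/=; apply: ler_prod => k kL.
have z0 : 0 < rnorm (z 0 k) by rewrite lt_def rnorm_eq0 rnorm_ge0; have [-> _] := zt k.
rewrite divr_ge0 ?powR_ge0//= (le_trans (powR_decay (sk0 _ kL) z0))//.
by apply: edecay_mono; apply: sP; rewrite mem_enum.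
Qed.

Lemma polysector1 theta : (forall k, 0 < theta k <= pi) -> polysector theta (const_mx 1 : point).
Proof.
move=> tp k; rewrite mxE; have /andP[t0 t1] := tp k.
exact: (sector_gt0 t0 t1 ltr01).
Qed.

Context {V : completeNormedModType R[i]}.

(** The weight z_k coming from dz_k in logarithmic coordinates is absorbed by the k-th resolvent,
    which becomes a scaled resolvent. Only these are bounded along the rays. *)
Lemma fcalcE theta nu (A : 'I_d -> set (V * V)) (Lambda : {set 'I_d})
    (f : point -> R[i]^o) (x : V) : Hinf0 theta Lambda f ->
  (forall k, 0 < nu k < theta k) -> (forall k, theta k <= pi) ->
  contour_bounded nu (fun k => scaled_resolvent (A k)) ->
  fcalc A nu Lambda f x = ((2 * pi)%:C * 'i)^-1 ^+ #|Lambda| *: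
    log_integral nu (enum Lambda) (fun z => f z *:
      opcomp (fun k => scaled_resolvent (A k)) (enum Lambda) z x) (const_mx 1).
Proof.
move=> fH nt tp cA; have [C [s hc]] := Hinf0_sector_decaying fH.
have ut : uniq (enum Lambda) by exact: enum_uniq.
have z1 : polysector theta (const_mx 1 : point).
  by apply: polysector1 => k; rewrite tp andbT; have /andP[a b] := nt k; exact: lt_trans a b.
have [C' nH] := nice_opcomp x ut nt tp z1 hc cA.
have E z : on_contour nu [set k in enum Lambda] (const_mx 1) z ->
    (\prod_(k <- enum Lambda) z 0 k) *: (f z *:
      compose_all (mem Lambda) (fun k => resolvent (A k) (z 0 k)) x) =
    f z *: opcomp (fun k => scaled_resolvent (A k)) (enum Lambda) z x.
  move=> zA; rewrite (compose_all_opcomp Lambda (fun k => resolvent (A k))).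
  rewrite opcompZ// => k kL; have := zA k; rewrite finset.in_set kL => -[u [b ->]].
  have [B [_ lB _ _]] := cA k b; move=> a y y'.
  apply: (@scalerI _ _ (polar u (ray (nu k) b))); first exact: polar_neq0.
  by have := lB u a y y'; rewrite /scaled_resolvent scalerDr !scalerA mulrC.
rewrite /fcalc; congr (_ *: _).
rewrite (@multi_contour_integralE _ _ _ _ _ _ _ C' s ut); last exact: nice_eq nH E.
by apply: eq_log_integral.
Qed.

End HolomorphicDecay.

(** * Test functions *)

Section TestFunctions.
Context {R : realType} {d : nat}.
Notation point := 'rV[R[i]^o]_d.
Implicit Types (ks : seq 'I_d) (p z : point) (k : 'I_d).

Definition test_symbol ks p z : R[i]^o :=
  \prod_(k <- ks) kernel_symbol (ln (rnorm (p 0 k))) (z 0 k).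

(** The first factor comes from the pointwise bound of the symbol in the sector, the second from a
    telescoping sum over unit steps. *)
Definition shell_bound (nu : R) : R := (opening nu ^+ 2)^-1 / (1 - expR (-1)).

Let ratio (u v : R) := expR v / (expR u + expR v).

Let ratio_itv (u v : R) : 0 <= ratio u v <= 1.
Proof.
rewrite divr_ge0 ?addr_ge0 ?expR_ge0//= ler_pdivrMr ?addr_gt0 ?expR_gt0// mul1r.
by rewrite lerDr expR_ge0.
Qed.

Let e1 : 0 < 1 - expR (-1) :> R. Proof. by rewrite subr_gt0 expR_lt1 oppr_lt0. Qed.

(** The left-hand side is the derivative of [ratio u] at v. Up to a constant it is at most the
    increment of [ratio u] over the preceding unit step, so sums over shells telescope, and [ratio]
    takes values in [0, 1]. *)
Let ratio_step (u v : R) : expR u * expR v / (expR u + expR v) ^+ 2 <=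
  (1 - expR (-1))^-1 * (ratio u v - ratio u (v - 1)).
Proof.
rewrite ler_pdivlMl// /ratio expRD.
have x0 := expR_gt0 u; have y0 := expR_gt0 v; have w0 := expR_gt0 (-1 : R).
move: x0 y0 w0 e1; move: (expR u) (expR v) (expR (-1)) => x y w x0 y0 w0 w1.
have a0 : 0 < x + y by rewrite addr_gt0. 
have b0 : 0 < x + y * w by rewrite addr_gt0// mulr_gt0.
rewrite -subr_ge0 (_ : _ - _ = (1 - w) ^+ 2 * x * y ^+ 2 / ((x + y) ^+ 2 * (x + y * w))); last first.
  by field; rewrite !gt_eqF.
by apply: divr_ge0; [rewrite mulr_ge0 ?sqr_ge0// mulr_ge0 ?sqr_ge0// ltW|rewrite mulr_ge0 ?sqr_ge0// ltW].
Qed.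

Lemma kernel_symbol_shells (nu c u a : R) n : 0 <= nu < pi -> `|a| <= nu ->
  \sum_(i <- iota 0 n) rnorm (kernel_symbol (c + i%:R) (polar u a)) <= shell_bound nu.
Proof.
move=> np an; have k0 := opening_gt0 np; have k2 : 0 <= (opening nu ^+ 2)^-1.
  by rewrite invr_ge0 sqr_ge0.
apply: (@le_trans _ _ ((opening nu ^+ 2)^-1 *
    ((1 - expR (-1))^-1 * (ratio u (c + n%:R - 1) - ratio u (c - 1))))); last first.
  rewrite /shell_bound ler_wpM2l// -[leRHS]mulr1 ler_wpM2l ?invr_ge0 ?(ltW e1)//.
  by have /andP[_ h1] := ratio_itv u (c + n%:R - 1); have /andP[h2 _] := ratio_itv u (c - 1); lra.
elim: n => [|n IH]; first by rewrite big_nil addr0 subrr !mulr0.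
rewrite -addn1 iotaD big_cat big_seq1 add0n natrD.
apply: le_trans (lerD IH (rnorm_kernel_symbol _ _ np an)) _.
rewrite -mulrDr ler_wpM2l//.
have := ratio_step u (c + n%:R); rewrite (_ : c + (n%:R + 1) - 1 = c + n%:R); last by ring.
by rewrite !mulrBr; lra.
Qed.

Lemma test_symbol_set_coord ks p z k w : k \notin ks ->
  test_symbol ks (set_coord p k w) z = test_symbol ks p z.
Proof.
move=> kks; rewrite /test_symbol !big_seq; apply: eq_bigr => j jks.
by rewrite set_coordE; case: eqP => // jk; rewrite -jk jks in kks.
Qed.

Lemma test_symbol_shells (eta nu : 'I_d -> R) N t b ks (z0 z : point) :
  (forall k, 0 <= eta k < pi) -> uniq ks -> polysector eta z ->
  \sum_(p <- shell_points nu N t b ks z0) rnorm (test_symbol ks p z) <=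
  \prod_(k <- ks) shell_bound (eta k).
Proof.
move=> ep + zt; elim: ks z0 => [z0 _|k ks IH z0 /= /andP[kks uks]].
  by rewrite /= big_seq1 /test_symbol !big_nil rnorm1.
have B0 : 0 <= \prod_(k <- ks) shell_bound (eta k).
  apply: prodr_ge0 => j _; rewrite /shell_bound divr_ge0 ?invr_ge0 ?sqr_ge0//; exact: ltW.
have [u [a [zE ak _]]] := sector_polarP (zt k).
rewrite big_flatten big_map big_cons.
apply: (@le_trans _ _ (\sum_(i <- iota 0 (N k).*2)
    rnorm (kernel_symbol (- (N k)%:R + t k + i%:R) (z 0 k)) * \prod_(k <- ks) shell_bound (eta k))).
  apply: ler_sum => i _; rewrite shell_points_set_coord// big_map.
  set w := polar _ _.
  apply: (@le_trans _ _ (rnorm (kernel_symbol (- (N k)%:R + t k + i%:R) (z 0 k)) *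
      \sum_(p <- shell_points nu N t b ks z0) rnorm (test_symbol ks p z))).
    rewrite mulr_sumr; apply: ler_sum => p _.
    rewrite /test_symbol big_cons -!/(test_symbol _ _ _) test_symbol_set_coord//.
    by rewrite set_coordE eqxx rnormM rnorm_polar expRK addrAC.
  by rewrite ler_wpM2l ?rnorm_ge0// IH.
rewrite -mulr_suml ler_wpM2r// zE; apply: kernel_symbol_shells => //; exact: ltW.
Qed.

Lemma differentiable_kernel_symbol v z k : z 0 k + polar v 0 != 0 ->
  differentiable (fun z : point => kernel_symbol v (z 0 k)) z.
Proof.
move=> z0; have dc : differentiable (fun z : point => z 0 k : R[i]^o) z.
  exact: differentiable_coord.
have d1 : differentiable (fun z : point => z 0 k + polar v 0 : R[i]^o) z.
  exact: (differentiableD dc (differentiable_cst (polar v 0 : R[i]^o) z)).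
have d2 := differentiableV d1 z0.
have d3 := differentiableM (differentiableM dc (differentiable_cst (polar v 0 : R[i]^o) z))
  (differentiableM d2 d2).
rewrite (_ : (fun z => _) = ((fun z : point => z 0 k : R[i]^o) * cst (polar v 0 : R[i]^o)) *
  ((fun z : point => (z 0 k + polar v 0)^-1 : R[i]^o) * (fun z : point => (z 0 k + polar v 0)^-1 : R[i]^o))).
  exact: d3.
by apply/funext => w; rewrite /kernel_symbol expr2 invfM.
Qed.

Lemma differentiable_test_symbol (eta : 'I_d -> R) ks p z : (forall k, 0 <= eta k < pi) ->
  polysector eta z -> differentiable (test_symbol ks p) z.
Proof.
move=> ep zt; elim: ks => [|k ks IH].
  rewrite (_ : test_symbol _ _ = cst (1 : R[i]^o)); first exact: differentiable_cst.
  by apply/funext => w; rewrite /test_symbol big_nil.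
rewrite (_ : test_symbol _ _ = (fun z : point => kernel_symbol (ln (rnorm (p 0 k))) (z 0 k)) * test_symbol ks p).
  refine (differentiableM _ IH); apply: differentiable_kernel_symbol.
  have [u [a [-> ak _]]] := sector_polarP (zt k).
  exact: (polarD_neq0 _ _ (ep k) (ltW ak)).
by apply/funext => w; rewrite /test_symbol big_cons.
Qed.

Lemma test_symbol_decay (eta : 'I_d -> R) ks p : (forall k, 0 <= eta k < pi) ->
  exists2 C, 0 <= C & forall z, polysector eta z ->
    rnorm (test_symbol ks p z) <= C * \prod_(k <- ks) edecay 1 (ln (rnorm (z 0 k))).
Proof.
move=> ep; elim: ks => [|k ks [C C0 IH]].
  by exists 1 => // z _; rewrite /test_symbol !big_nil rnorm1 mulr1.
have [C1 C10 H1] := kernel_symbol_decay (ln (rnorm (p 0 k))) (ep k).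
exists (C1 * C) => [|z zt]; first exact: mulr_ge0.
rewrite /test_symbol !big_cons rnormM -/(test_symbol _ _ _) mulrACA.
apply: ler_pM; rewrite ?rnorm_ge0//; last exact: IH.
have [u [a [-> ak _]]] := sector_polarP (zt k).
by rewrite rnorm_polar expRK; apply: H1; exact: ltW.
Qed.

Lemma sector_decaying_test (eta : 'I_d -> R) ks p : (forall k, 0 <= eta k < pi) ->
  exists C s, sector_decaying eta ks (test_symbol ks p) C s.
Proof.
move=> ep; have [C C0 HC] := test_symbol_decay ks p ep.
exists C, 1; split => // z k zt.
by apply: differentiable_cdiff; exact: differentiable_test_symbol ep zt.
Qed.

(** The converse of [powR_decay] for exponent 1, needed to place the test symbols in [Hinf0]. The
    constant 4 comes from 1 + x <= 2 max (1, x). *)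
Lemma edecay1_le (x : R) : 0 < x -> edecay 1 (ln x) <= 4%:R * (x `^ 1 / (1 + x) `^ (2 * 1)).
Proof.
move=> x0; have x1 : 0 < 1 + x by rewrite addr_gt0.
rewrite powRr1 ?(ltW x0)// mulr1 (powR_mulrn 2) ?(ltW x1)// mulrA ler_pdivlMr ?exprn_gt0//.
rewrite /edecay mulN1r; have [l0|l0] := ger0P (ln x).
  have xge1 : 1 <= x by rewrite -(lnK x0) -expR0 ler_expR.
  rewrite expRN lnK// ler_pdivrMl// -subr_ge0.
  rewrite (_ : _ - _ = (x - 1) * (3 * x + 1)); last by ring.
  by rewrite mulr_ge0 ?subr_ge0//; lra.
have xle1 : x <= 1 by rewrite -(lnK x0) -expR0 ler_expR ltW.
rewrite opprK lnK// mulrC ler_wpM2r ?(ltW x0)//.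
rewrite (_ : 4%:R = 2 ^+ 2 :> R); last by ring.
by rewrite lerXn2r ?nnegrE ?(ltW x1)//; lra.
Qed.

Lemma Hinf0_zero (theta : 'I_d -> R) (Lambda : {set 'I_d}) : Hinf0 theta Lambda (fun=> 0).
Proof.
split => //.
  by exists 0 => z _; rewrite rnorm0.
by exists 0, (fun=> 1); split => // z _; rewrite rnorm0 mul0r.
Qed.

Definition test_function (Lambda : {set 'I_d}) n (c : nat -> R[i]) (P : nat -> point) (z : point) : R[i]^o :=
  \sum_(j < n) c j * test_symbol (enum Lambda) (P j) z.

Lemma Hinf0_test_function (eta : 'I_d -> R) (Lambda : {set 'I_d}) n c P :
  (forall k, 0 <= eta k < pi) -> Hinf0 eta Lambda (test_function Lambda n c P).
Proof.
move=> ep; rewrite /test_function.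
have [C C0 HC] : exists2 C, 0 <= C & forall z, polysector eta z ->
    rnorm (\sum_(j < n) c j * test_symbol (enum Lambda) (P j) z) <=
    C * \prod_(k <- enum Lambda) edecay 1 (ln (rnorm (z 0 k))).
  elim: n => [|n [C C0 IH]].
    by exists 0 => // z _; rewrite big_ord0 rnorm0 mul0r.
  have [C1 C10 H1] := test_symbol_decay (enum Lambda) (P n) ep.
  exists (C + rnorm (c n) * C1) => [|z zt]; first by rewrite addr_ge0 ?mulr_ge0 ?rnorm_ge0.
  rewrite big_ord_recr/= (le_trans (ler_rnormD _ _))// mulrDl lerD ?IH//.
  by rewrite rnormM -mulrA ler_wpM2l ?rnorm_ge0// H1.
split.
- move=> z zt; elim: n {C C0 HC} => [|n IH].
    rewrite (_ : (fun z => _) = cst (0 : R[i]^o)); first exact: differentiable_cst.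
    by apply/funext => w; rewrite big_ord0.
  rewrite (_ : (fun z => _) = (fun z : point => \sum_(j < n) c j * test_symbol (enum Lambda) (P j) z : R[i]^o) +
    (cst (c n : R[i]^o) * test_symbol (enum Lambda) (P n))).
    refine (differentiableD IH (differentiableM _ _)); first exact: differentiable_cst.
    exact: differentiable_test_symbol ep zt.
  by apply/funext => w; rewrite big_ord_recr.
- exists C => z zt; rewrite (le_trans (HC z zt))// -[leRHS]mulr1 ler_wpM2l//.
  apply: prodr_ile1 => k _; rewrite edecay_ge0/=; exact: edecay_le1.
- move=> z w _ _ zw; apply: eq_bigr => j _; congr (_ * _).
  by rewrite /test_symbol !big_seq; apply: eq_bigr => k; rewrite mem_enum => /zw ->.
- exists (C * 4 ^+ #|Lambda|), (fun=> 1); split => // [|z zt].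
    by rewrite mulr_ge0// exprn_ge0.
  rewrite (le_trans (HC z zt))// -mulrA ler_wpM2l// big_enum/= -prodr_const -big_split/=.
  apply: ler_prod => k kL; rewrite edecay_ge0/=; apply: edecay1_le.
  by rewrite lt_def rnorm_eq0 rnorm_ge0; have [-> _] := zt k.
Qed.

End TestFunctions.

(** * Square functions for semigroups with a joint functional calculus *)

Section SquareFunctionBound.
Context {R : realType} {d : nat} {V : completeNormedModType R[i]}.
Notation point := 'rV[R[i]^o]_d.
Notation mu := (@lebesgue_measure R).
Notation bint F := (bochner_integral mu F).

Definition square_product (A : 'I_d -> set (V * V)) ks (p : point) : V -> V :=
  opcomp (fun k w => square_function (A k) (ln (rnorm w))) ks p.

Lemma opcomp_scale (L : 'I_d -> V -> V) (a : R[i]) ks z x : (forall k, linear (L k)) ->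
  opcomp (fun k _ y => a *: L k y) ks z x = a ^+ size ks *: opcomp (fun k _ => L k) ks z x.
Proof.
move=> lL; elim: ks => [|k ks IH] /=; first by rewrite expr0 scale1r.
by rewrite IH (linear_predZ (lL k)) scalerA exprS.
Qed.

Lemma nice_zero nu (A : {set 'I_d}) (z : point) : nice nu A (fun=> 0 : V) z 0 1.
Proof. by split => // [z' k b _ _ u|z' _]; [exact: cvg_cst|rewrite rnorm0 mul0r]. Qed.

Variables (T : 'I_d -> R -> {linear V -> V}) (M : R).
Hypotheses (hT : forall k, C0_semigroup (T k)) (M0 : 0 <= M).
Hypothesis TM : forall k t x, 0 <= t -> rnorm (T k t x) <= M * rnorm x.

Let A k := neg_generator (T k).

Lemma linear_square_function k v : linear (square_function (A k) v).
Proof.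
have r : resolvent_set (A k) (- polar v 0).
  apply: (resolvent_set_generator (hT k) M0 (@TM k)).
  by rewrite polar0 -real_complexN /= oppr_lt0 expR_gt0.
have [_ _ lR] := resolventP r.
have lw : linear (scaled_resolvent (A k) (- polar v 0)).
  by move=> a x y; rewrite /scaled_resolvent lR scalerDr !scalerA mulrC.
move=> a x y; rewrite /square_function /quadratic !lw.
by apply: cfunctional_inj => f fD fN fZ; rewrite !(fD, fN, fZ); ring.
Qed.

Variables (eta : 'I_d -> R) (K : R).
Hypothesis etaP : forall k, pi / 2 < eta k < pi.
Hypotheses (K0 : 0 <= K) (hK : Hinf_estimate A (fun=> pi / 2) eta K).

Let nu k := (pi / 2 + eta k) / 2.

Let nuP k : pi / 2 < nu k < pi.
Proof. by have /andP[? ?] := etaP k; rewrite /nu; apply/andP; split; lra. Qed.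

Let nu_eta k : pi / 2 < nu k < eta k.
Proof. by have /andP[? ?] := etaP k; rewrite /nu; apply/andP; split; lra. Qed.

Let nu_gt0 k : 0 < nu k < eta k.
Proof. by have /andP[? ->] := nu_eta k; have := pi_gt0 R; rewrite andbT; lra. Qed.

Let eta_le k : eta k <= pi. Proof. by apply: ltW; case/andP: (etaP k). Qed.

Let eta_ge0 k : 0 <= eta k < pi.
Proof. by have /andP[? ->] := etaP k; have := pi_gt0 R; rewrite andbT; lra. Qed.

Let contour_boundedA : contour_bounded nu (fun k => scaled_resolvent (A k)).
Proof. by move=> k b; exact (ray_bounded_generator (hT k) M0 (@TM k) (nuP k) b). Qed.

Let one_polysector : polysector eta (const_mx 1 : point).
Proof. by apply: polysector1 => k; rewrite eta_le andbT; have /andP[a b] := nu_gt0 k; exact: lt_trans a b. Qed.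

Let fcalc0 (Lambda : {set 'I_d}) x : fcalc A nu Lambda (fun=> 0) x = 0.
Proof.
have H0 := Hinf0_zero eta Lambda.
rewrite (fcalcE x H0 nu_gt0 eta_le contour_boundedA).
have := @log_integral_sum _ _ _ nu (enum Lambda) unit [::] (fun _ _ => 0) (const_mx 1) (fun=> 0) (fun=> 1)
  (enum_uniq _) (fun _ => nice_zero nu _ _).
rewrite big_nil => H.
have {}H : log_integral nu (enum Lambda) (fun=> 0 : V) (const_mx 1) = 0.
  by apply: etrans H _; rewrite big_nil.
rewrite (_ : log_integral _ _ _ _ = 0) ?scaler0//; apply: etrans _ H.
by congr log_integral; apply/funext => z; rewrite scale0r.
Qed.

(** The function is a combination of products of symbols, so each iterated integral factors; the
    factors 2 pi i of [kernel_contour] cancel the normalisation of the calculus. *)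
Lemma fcalc_test_function (Lambda : {set 'I_d}) n c (P : nat -> point) y :
  fcalc A nu Lambda (test_function Lambda n c P) y =
  \sum_(j < n) c j *: square_product A (enum Lambda) (P j) y.
Proof.
have uL : uniq (enum Lambda) := enum_uniq _.
rewrite (fcalcE y (Hinf0_test_function Lambda n c P eta_ge0) nu_gt0 eta_le contour_boundedA).
set ks := enum Lambda in uL *.
pose Rw k := scaled_resolvent (A k).
have nT p : exists C s, nice nu [set k in ks] (fun z => test_symbol ks p z *: opcomp Rw ks z y) (const_mx 1) C s.
  have [C [s hc]] := sector_decaying_test ks p eta_ge0.
  have [C' nH] := nice_opcomp y uL nu_gt0 eta_le one_polysector hc contour_boundedA.
  by exists C', s.
have sum_eq : log_integral nu ks (fun z => test_function Lambda n c P z *: opcomp Rw ks z y) (const_mx 1) =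
    \sum_(j < n) c j *: log_integral nu ks (fun z => test_symbol ks (P j) z *: opcomp Rw ks z y) (const_mx 1).
  have [C /choice[s nP]] := choice (fun j => nT (P j)).
  transitivity (log_integral nu ks (fun z => \sum_(j <- index_enum 'I_n)
      c j *: (test_symbol ks (P j) z *: opcomp Rw ks z y)) (const_mx 1)).
    congr log_integral; apply/funext => z; rewrite /test_function scaler_suml.
    by apply: eq_bigr => j _; rewrite scalerA.
  apply: etrans (@log_integral_sum _ _ _ nu ks 'I_n _
    (fun j z => c j *: (test_symbol ks (P j) z *: opcomp Rw ks z y)) (const_mx 1)
    (fun j => rnorm (c j) * C j) (fun j => s j) uL (fun j => niceZ (c j) (nP j))) _.
  by apply: eq_bigr => j _; exact: (log_integralZ (c j) uL (nP j)).
rewrite sum_eq scaler_sumr; apply: eq_bigr => j _.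
have value : log_integral nu ks (fun z => test_symbol ks (P j) z *: opcomp Rw ks z y) (const_mx 1) =
    ((2 * pi)%:C * 'i) ^+ #|Lambda| *: square_product A ks (P j) y.
  pose v k := ln (rnorm (P j 0 k)).
  pose L k := square_function (A k) (v k).
  transitivity (opcomp (fun k _ y => ((2 * pi)%:C * 'i) *: L k y) ks (const_mx 1) y).
    apply: (@log_integral_product _ _ _ eta nu ks (fun k => kernel_symbol (v k)) Rw
      (fun k y => ((2 * pi)%:C * 'i) *: L k y) (const_mx 1) y uL nu_gt0 eta_le one_polysector _ contour_boundedA).
      by move=> ks' _; exact: (sector_decaying_test ks' (P j) eta_ge0).
    by move=> k y'; exact (kernel_contour (hT k) M0 (@TM k) (nuP k) (v k) y').
  rewrite (opcomp_scale _ ks _ y (fun k => linear_square_function k (v k))) -cardE; congr (_ *: _).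
  by apply: eq_opcomp.
rewrite value !scalerA; congr (_ *: _).
rewrite mulrA mulrAC -exprMn mulVf ?expr1n ?mul1r//.
rewrite mulf_neq0//; first by rewrite (inj_eq (@complexI R)) mulf_neq0// gt_eqF// pi_gt0.
by rewrite -rnorm_eq0 rnormi oner_eq0.
Qed.

(** The sum is the calculus applied to a test function whose supremum is at most [beta * Cs],
    whatever the coefficients of modulus at most [beta]. This freedom in the coefficients is what
    the averaging over signs exploits. *)
Lemma square_product_bound (Lambda : {set 'I_d}) n c (P : nat -> point) (beta Cs : R) y :
  0 <= beta -> (forall j, (j < n)%N -> rnorm (c j) <= beta) ->
  (forall z, polysector eta z ->
    \sum_(j < n) rnorm (test_symbol (enum Lambda) (P j) z) <= Cs) ->
  rnorm (\sum_(j < n) c j *: square_product A (enum Lambda) (P j) y) <=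
    K * (beta * Cs) * rnorm y.
Proof.
move=> b0 cb PC; rewrite -fcalc_test_function.
pose g := test_function Lambda n c P.
(* The test function as an element of the direct sum: its only nonzero component is the one of index
   [Lambda]. *)
pose F (L : {set 'I_d}) : point -> R[i]^o := if L == Lambda then g else fun=> 0.
have gF : Hinf01 eta g F.
  split => [L|z zt].
    rewrite /F; case: eqP => [->|_]; first exact: Hinf0_test_function.
    exact: Hinf0_zero.
  rewrite (bigD1 Lambda)//= big1 => [|L LL]; first by rewrite addr0 /F eqxx.
  by rewrite /F (negbTE LL).
have := hK gF nu_eta y.
rewrite (bigD1 Lambda)//= big1 => [|L LL]; last by rewrite /F (negbTE LL); exact: fcalc0.
rewrite addr0 /F eqxx => /le_trans; apply.
rewrite ler_wpM2r ?rnorm_ge0// ler_wpM2l// /supnorm.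
apply: ge_sup; first by exists (rnorm (g (const_mx 1))), (const_mx 1).
move=> _ [z zt <-]; rewrite (le_trans (ler_rnorm_sum _ _ _))//.
apply: (@le_trans _ _ (\sum_(j < n) beta * rnorm (test_symbol (enum Lambda) (P j) z))).
  by apply: ler_sum => j _; rewrite rnormM ler_wpM2r ?rnorm_ge0// cb.
by rewrite -mulr_sumr ler_wpM2l// PC.
Qed.

End SquareFunctionBound.

(** * Transfer of square functions to the dilation *)

Section LinearCombination.
Context {R : realType} {V W : lmodType R[i]}.

Lemma linear_combination (L : V -> W) (a b : R[i]) u w : linear L ->
  L (a *: u - b *: w) = a *: L u - b *: L w.
Proof. by move=> lL; rewrite (linear_predB lL) !(linear_predZ lL). Qed.

Lemma eq_combination (a b : R[i]) (u u' w w' : V) : u = u' -> w = w' ->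
  a *: u - b *: w = a *: u' - b *: w'.
Proof. by move=> -> ->. Qed.

End LinearCombination.

Section SemigroupProducts.
Context {R : realType} {d : nat} {V : completeNormedModType R[i]}.
Variables (T : 'I_d -> R -> {linear V -> V}) (M : R).
Hypotheses (hT : forall k, C0_semigroup (T k)) (M0 : 0 <= M).
Hypothesis TM : forall k t x, 0 <= t -> rnorm (T k t x) <= M * rnorm x.
Hypothesis hcomm : commuting_semigroups T.
Implicit Types (l : seq 'I_d) (t : 'I_d -> R).

Definition semigroup_product l t x := foldr (fun k y => T k (t k) y) x l.

Lemma compose_all_semigroup t x :
  compose_all xpredT (fun k => T k (t k)) x = semigroup_product (index_enum 'I_d) t x.
Proof.
rewrite /compose_all; elim: (index_enum _) => [|k l IH]; first by rewrite big_nil.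
by rewrite big_cons /= -IH.
Qed.

Lemma semigroup_product_comm l t k s x : (forall j, 0 <= t j) -> 0 <= s ->
  T k s (semigroup_product l t x) = semigroup_product l t (T k s x).
Proof. by move=> t0 s0; elim: l => [//|j l IH] /=; rewrite hcomm// IH. Qed.

Lemma eq_semigroup_product l t t' x : {in l, t =1 t'} ->
  semigroup_product l t x = semigroup_product l t' x.
Proof.
elim: l => [//|k l IH] tt /=; rewrite tt ?mem_head// IH// => j jl.
by apply: tt; rewrite inE jl orbT.
Qed.

(** An extra time in one coordinate is absorbed by the product, so that the dilation identity can be
    applied at shifted times. *)
Lemma semigroup_product_add l t k s x : uniq l -> k \in l -> (forall j, 0 <= t j) -> 0 <= s ->
  semigroup_product l (fun j => t j + (if j == k then s else 0)) x =
  T k s (semigroup_product l t x).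
Proof.
move=> + + t0 s0; elim: l => [//|j l IH] /= /andP[jl ul].
have [_ _ TD _] := hT k; rewrite inE.
have [jk|jk /= kl] := eqVneq j k.
  subst j => _; rewrite (addrC (t k)) TD//; congr (T k s (T k (t k) _)).
  apply: eq_semigroup_product => i il.
  by case: eqP => [ik|_]; [rewrite -ik il in jl|rewrite addr0].
by rewrite addr0 IH// hcomm.
Qed.

Lemma semigroup_product0 l x : semigroup_product l (fun=> 0) x = x.
Proof. by elim: l => [//|k l IH] /=; rewrite IH; have [_ -> _ _] := hT k. Qed.

Lemma linear_semigroup_product l t : linear (semigroup_product l t).
Proof. by move=> a x y; elim: l => [//|k l IH] /=; rewrite IH linearP. Qed.

Lemma semigroup_product_bounded l t : (forall j, 0 <= t j) ->
  exists2 c, 0 <= c & forall x, rnorm (semigroup_product l t x) <= c * rnorm x.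
Proof.
move=> t0; elim: l => [|k l [c c0 IH]]; first by exists 1 => // x; rewrite mul1r.
exists (M * c) => [|x]; first exact: mulr_ge0.
by rewrite -mulrA /= (le_trans (TM _ _ (t0 k)))// ler_wpM2l.
Qed.

Lemma scaled_resolvent_laplace k v x :
  scaled_resolvent (neg_generator (T k)) (- polar v 0) x =
  polar v 0 *: laplace (T k) (- polar v 0) x.
Proof.
have z0 : complex.Re (- polar v 0 : R[i]) < 0.
  by rewrite polar0 -real_complexN /= oppr_lt0 expR_gt0.
rewrite /scaled_resolvent (resolvent_generator (hT k) M0 (@TM k) z0).
by rewrite scalerN scaleNr opprK.
Qed.

Lemma square_function_laplace k v x : square_function (neg_generator (T k)) v x =
  polar v 0 *: laplace (T k) (- polar v 0) x -
  polar v 0 ^+ 2 *: laplace (T k) (- polar v 0) (laplace (T k) (- polar v 0) x).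
Proof.
have z0 : complex.Re (- polar v 0 : R[i]) < 0.
  by rewrite polar0 -real_complexN /= oppr_lt0 expR_gt0.
rewrite /square_function /quadratic !scaled_resolvent_laplace.
by rewrite (linear_predZ (linear_laplace (hT k) M0 (@TM k) z0)) scalerA expr2.
Qed.

Lemma square_function_commute k v (S : V -> V) c x : linear S ->
  (forall x, rnorm (S x) <= c * rnorm x) ->
  (forall (s : R) y, 0 <= s -> S (T k s y) = T k s (S y)) ->
  S (square_function (neg_generator (T k)) v x) = square_function (neg_generator (T k)) v (S x).
Proof.
move=> lS Sc ST.
have z0 : complex.Re (- polar v 0 : R[i]) < 0.
  by rewrite polar0 -real_complexN /= oppr_lt0 expR_gt0.
have lc y := laplace_commute (hT k) M0 (@TM k) z0 y lS Sc ST.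
apply: etrans (congr1 S (square_function_laplace k v x)) _.
apply: etrans (linear_combination _ _ _ _ lS) _.
apply: etrans _ (esym (square_function_laplace k v (S x))).
by apply: eq_combination; [exact: lc|apply: etrans (lc _) _; congr laplace; exact: lc].
Qed.

End SemigroupProducts.

Section Transfer.
Context {R : realType} {d : nat} {X Y : completeNormedModType R[i]}.
Notation point := 'rV[R[i]^o]_d.
Variables (T : 'I_d -> R -> {linear X -> X}) (U : 'I_d -> R -> {linear Y -> Y}) (MT MU : R).
Hypotheses (hT : forall k, C0_semigroup (T k)) (MT0 : 0 <= MT).
Hypothesis TM : forall k t x, 0 <= t -> rnorm (T k t x) <= MT * rnorm x.
Hypothesis hTcomm : commuting_semigroups T.
Hypotheses (hU : forall k, C0_semigroup (U k)) (MU0 : 0 <= MU).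
Hypothesis UM : forall k t x, 0 <= t -> rnorm (U k t x) <= MU * rnorm x.
Hypothesis hUcomm : commuting_semigroups U.

(** The square function contains a Laplace transform and its iterate. For the iterate, the orbits of
    the transforms have to be compared: this follows from the first transfer applied to [L] composed
    with [U k t], since the transform commutes with the semigroup. *)
Lemma square_function_transfer k v (L : Y -> X) c x y : linear L ->
  (forall y, rnorm (L y) <= c * rnorm y) ->
  (forall t, 0 <= t -> L (U k t y) = T k t x) ->
  L (square_function (neg_generator (U k)) v y) = square_function (neg_generator (T k)) v x.
Proof.
move=> lL Lc LU.
have z0 : complex.Re (- polar v 0 : R[i]) < 0.
  by rewrite polar0 -real_complexN /= oppr_lt0 expR_gt0.
have [_ _ UD _] := hU k; have [_ _ TD _] := hT k.
have lap1 L' c' x' : linear L' -> (forall y, rnorm (L' y) <= c' * rnorm y) ->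
    (forall t, 0 <= t -> L' (U k t y) = T k t x') ->
    L' (laplace (U k) (- polar v 0) y) = laplace (T k) (- polar v 0) x'.
  exact (@laplace_transfer _ _ _ (T k) (U k) MT MU (- polar v 0) L' c' x' y
    (hT k) MT0 (@TM k) (hU k) MU0 (@UM k) z0).
apply: etrans (congr1 L (square_function_laplace hU MU0 UM k v y)) _.
apply: etrans (linear_combination _ _ _ _ lL) _.
apply: etrans _ (esym (square_function_laplace hT MT0 TM k v x)).
apply: eq_combination; first exact (lap1 L c x lL Lc LU).
apply: (@laplace_transfer _ _ _ (T k) (U k) MT MU (- polar v 0) L c _ _
    (hT k) MT0 (@TM k) (hU k) MU0 (@UM k) z0 lL Lc) => t t0.
have lLU : linear (fun y => L (U k t y)) by move=> a u w; rewrite linearP lL.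
have LUc w : rnorm (L (U k t w)) <= `|c| * MU * rnorm w.
  rewrite -mulrA (le_trans (Lc _))//.
  rewrite (@le_trans _ _ (`|c| * rnorm (U k t w)))//; first by rewrite ler_wpM2r ?rnorm_ge0 ?ler_norm.
  by rewrite ler_wpM2l// UM.
have LUU s : 0 <= s -> L (U k t (U k s y)) = T k s (T k t x).
  by move=> s0; rewrite -UD// LU ?addr_ge0// addrC TD.
rewrite (lap1 _ _ _ lLU LUc LUU); symmetry.
apply: (laplace_commute (hT k) MT0 (@TM k) z0 _ (c := MT)).
- exact: linearP.
- by move=> u; exact: TM.
- by move=> s u s0; rewrite -!TD// addrC.
Qed.

Variables (J : {linear X -> Y}) (Q : {linear Y -> X}) (cQ : R).
Hypothesis QM : forall y, rnorm (Q y) <= cQ * rnorm y.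
Hypothesis hb : forall t : 'I_d -> R, (forall k, 0 <= t k) -> forall x,
  compose_all xpredT (fun k => T k (t k)) x =
  Q (compose_all xpredT (fun k => U k (t k)) (J x)).

(** A Laplace transform in one coordinate integrates over the time of that coordinate. The induction
    is therefore carried out for the identity preceded on both sides by products of semigroups at
    arbitrary times, and these are set to 0 at the end. *)
Lemma square_product_transfer ks (p : point) x :
  square_product (fun k => neg_generator (T k)) ks p x =
  Q (square_product (fun k => neg_generator (U k)) ks p (J x)).
Proof.
pose l := index_enum 'I_d.
suff main t : (forall k, 0 <= t k) ->
    Q (semigroup_product U l t (square_product (fun k => neg_generator (U k)) ks p (J x))) =
    semigroup_product T l t (square_product (fun k => neg_generator (T k)) ks p x).
  by have := main (fun=> 0) (fun=> lexx 0); rewrite !semigroup_product0.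
elim: ks t => [|k ks IH] t t0.
  by have := hb t0 x; rewrite !compose_all_semigroup => ->.
have lQ : linear (fun y => Q (semigroup_product U l t y)).
  by move=> a y y'; rewrite linear_semigroup_product linearP.
have [c c0 Uc] := semigroup_product_bounded MU0 UM l t0.
have [c' c'0 Tc] := semigroup_product_bounded MT0 TM l t0.
rewrite /square_product /= -!/(square_product _ _ _ _).
set w := square_product _ ks p (J x); set w' := square_product _ ks p x.
rewrite (@square_function_transfer k _ (fun y => Q (semigroup_product U l t y)) (`|cQ| * c)
  (semigroup_product T l t w')) //.
- symmetry; apply: (square_function_commute hT MT0 TM _ _ (c := c')) => //.
    exact: linear_semigroup_product.
  by move=> s u s0; rewrite semigroup_product_comm.
- move=> y; rewrite -mulrA (le_trans (QM _))//.
  rewrite (@le_trans _ _ (`|cQ| * rnorm (semigroup_product U l t y)))//.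
    by rewrite ler_wpM2r ?rnorm_ge0 ?ler_norm.
  by rewrite ler_wpM2l.
- move=> s s0; rewrite -semigroup_product_comm// -semigroup_product_add ?index_enum_uniq ?mem_index_enum//.
  rewrite IH; last by move=> j; rewrite addr_ge0//; case: ifP.
  by rewrite semigroup_product_add ?index_enum_uniq ?mem_index_enum.
Qed.

End Transfer.

(** * The components of a function are controlled by its supremum *)

Section Components.
Context {R : realType} {d : nat}.
Notation point := 'rV[R[i]^o]_d.
Implicit Types (Lambda : {set 'I_d}) (z : point) (theta : 'I_d -> R)
  (f : point -> R[i]^o) (F : {set 'I_d} -> point -> R[i]^o).

Lemma le_supnorm theta f F z : Hinf01 theta f F -> polysector theta z ->
  rnorm (f z) <= supnorm theta f.
Proof.
move=> [hF fF] zt; apply: ub_le_sup; last by exists z.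
have /choice[B HB] : forall Lambda, exists B : R, forall z, polysector theta z -> rnorm (F Lambda z) <= B.
  by move=> Lambda; have [_ [B HB] _ _] := hF Lambda; exists B.
exists (\sum_(Lambda : {set 'I_d}) B Lambda) => _ [w wt <-].
rewrite fF// (le_trans (ler_rnorm_sum _ _ _))//; apply: ler_sum => Lambda _; exact: HB.
Qed.

(** Positive dilations preserve sectors, so the point stays in the polysector while its coordinates
    outside [Lambda] tend to 0. *)
Definition shrink Lambda (n : nat) z : point :=
  \row_j (if j \in Lambda then z 0 j else (expR (- n%:R))%:C * z 0 j).

Lemma polysector_shrink theta Lambda n z : (forall k, theta k <= pi) ->
  polysector theta z -> polysector theta (shrink Lambda n z).
Proof.
move=> tp zt k; rewrite mxE; case: ifP => _; first exact: zt.
have [u [a [-> ak _]]] := sector_polarP (zt k).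
rewrite -polar0 -polarD add0r; exact: sector_polar.
Qed.

Lemma shrink_eq theta Lambda Lambda' F f n z : (forall k, theta k <= pi) -> Hinf01 theta f F ->
  Lambda' \subset Lambda -> polysector theta z -> F Lambda' (shrink Lambda n z) = F Lambda' z.
Proof.
move=> tp [hF _] LL zt; have [_ _ H _] := hF Lambda'.
apply: H => // [|k kL]; first exact: polysector_shrink.
by rewrite mxE (fintype.subsetP LL _ kL).
Qed.

Lemma shrink_decay theta Lambda Lambda' F f z : (forall k, theta k <= pi) -> Hinf01 theta f F ->
  ~~ (Lambda' \subset Lambda) -> polysector theta z ->
  rnorm (F Lambda' (shrink Lambda n z)) @[n --> \oo] --> 0.
Proof.
move=> tp [hF _] /subsetPn[k kL' kL] zt.
have [C [s [s0 C0 _ FC]]] := Hinf0_sector_decaying (hF Lambda').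
have zk0 : 0 < rnorm (z 0 k) by rewrite lt_def rnorm_eq0 rnorm_ge0; have [-> _] := zt k.
pose K := C * expR (s * `|ln (rnorm (z 0 k))|).
have bound n : rnorm (F Lambda' (shrink Lambda n z)) <= K * edecay s n%:R.
  have st := polysector_shrink Lambda n tp zt.
  rewrite (le_trans (FC _ st))// /K -mulrA ler_wpM2l//.
  rewrite big_enum (bigD1 k)//= -[leRHS]mulr1; apply: ler_pM; rewrite ?edecay_ge0//.
  - by apply: prodr_ge0 => j _; exact: edecay_ge0.
  - rewrite mxE (negbTE kL) rnormM rnorm_real ger0_norm ?expR_ge0//.
    rewrite lnM ?posrE ?expR_gt0// expRK /edecay -expRD ler_expR.
    rewrite !mulNr -mulrBr -mulrN ler_wpM2l ?(ltW s0)// lerNl opprB.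
    rewrite (ger0_norm (ler0n _ n)) lerBlDr.
    have := ler_normB (- n%:R + ln (rnorm (z 0 k))) (ln (rnorm (z 0 k))).
    by rewrite addrK normrN (ger0_norm (ler0n _ n)).
  - apply: prodr_ile1 => j _; rewrite edecay_ge0/=; apply: edecay_le1; exact: ltW.
apply: (@squeeze_cvgr _ _ _ _ (cst 0) (fun n => K * edecay s n%:R)).
- by apply: nearW => n; rewrite rnorm_ge0 bound.
- exact: cvg_cst.
- by rewrite -(mulr0 K); apply: cvgMr; exact: cvg_edecay.
Qed.

Lemma sum_subset_bound theta Lambda F f z : (forall k, theta k <= pi) -> Hinf01 theta f F ->
  polysector theta z ->
  rnorm (\sum_(L : {set 'I_d} | L \subset Lambda) F L z) <= supnorm theta f.
Proof.
move=> tp fF zt; pose b n := \sum_(L : {set 'I_d} | ~~ (L \subset Lambda)) rnorm (F L (shrink Lambda n z)).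
have bound n : rnorm (\sum_(L : {set 'I_d} | L \subset Lambda) F L z) <= supnorm theta f + b n.
  have st := polysector_shrink Lambda n tp zt.
  have [_ /(_ _ st)] := fF.
  rewrite (bigID (fun L : {set 'I_d} => L \subset Lambda))/= => /(canLR (addrK _)) E.
  rewrite (eq_bigr (fun L => F L (shrink Lambda n z))) => [|L LL]; last first.
    by rewrite (shrink_eq n tp fF LL zt).
  rewrite -E (le_trans (ler_rnormB _ _))// lerD//; first exact: le_supnorm fF st.
  exact: ler_rnorm_sum.
have b0 : b n @[n --> \oo] --> 0.
  have tail (l : seq {set 'I_d}) :
      (fun n => \sum_(L <- l | ~~ (L \subset Lambda)) rnorm (F L (shrink Lambda n z))) @ \oo --> (0 : R).
    elim: l => [|L l IH].
      by under eq_fun do rewrite big_nil; exact: cvg_cst.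
    have [LL|LL] := boolP (L \subset Lambda).
      by under eq_fun do rewrite big_cons LL.
    under eq_fun do rewrite big_cons LL.
    have /(_ eventually_filter) := cvgD (shrink_decay tp fF LL zt) IH.
    by rewrite addr0.
  exact: tail.
apply/ler_addgt0Pr => e e0; have /cvgrPdist_lt/(_ e e0) [n _ /(_ n (leqnn n))] := b0.
rewrite sub0r normrN => bn; rewrite (le_trans (bound n))// lerD2l.
by rewrite (le_trans (ler_norm _))// ltW.
Qed.

(* The partial sums over the subsets of Lambda are limits of f, as the coordinates outside Lambda
   tend to 0; the components are then isolated by induction on the cardinal of Lambda. *)
Lemma component_bound : exists2 c : R, 0 <= c & forall theta f F Lambda z,
  (forall k, theta k <= pi) -> Hinf01 theta f F -> polysector theta z ->
  rnorm (F Lambda z) <= c * supnorm theta f.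
Proof.
suff H m : exists2 c : R, 0 <= c & forall theta f F Lambda z, (#|Lambda| < m)%N ->
    (forall k, theta k <= pi) -> Hinf01 theta f F -> polysector theta z ->
    rnorm (F Lambda z) <= c * supnorm theta f.
  have [c c0 Hc] := H d.+1; exists c => // theta f F Lambda z.
  by apply: Hc; rewrite ltnS -[leqRHS](card_ord d) max_card.
elim: m => [|m [c c0 IH]]; first by exists 0.
exists (1 + #|{set 'I_d}|%:R * c) => [|theta f F Lambda z Lm tp fF zt].
  by rewrite addr_ge0// mulr_ge0.
have S0 : 0 <= supnorm theta f := le_trans (rnorm_ge0 _) (le_supnorm fF zt).
have := sum_subset_bound Lambda tp fF zt.
rewrite (bigD1 Lambda)//=; set a := F Lambda z; set r := \sum_(L | _) _ => H.
rewrite -(addrK r a) (le_trans (ler_rnormB _ _))// mulrDl mul1r lerD//.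
rewrite (le_trans (ler_rnorm_sum _ _ _))//.
apply: (@le_trans _ _ (\sum_(L : {set 'I_d} | (L \subset Lambda) && (L != Lambda)) c * supnorm theta f)).
  apply: ler_sum => L /andP[LL LN]; apply: IH => //.
  have lt : (#|L| < #|Lambda|)%N by rewrite fintype.proper_card// finset.properEneq LN LL.
  exact: leq_trans lt Lm.
rewrite sumr_const -[leLHS]mulr_natl mulrA ler_wpM2r// ler_wpM2r//.
by rewrite ler_nat max_card.
Qed.

End Components.

(** * The joint functional calculus of the original operators *)

Section SignBoundedFamilies.
Context {R : realType} {V : completeNormedModType R[i]}.

Lemma sign_bounded_le (I : Type) (W : I -> V -> V) K K' : K <= K' ->
  sign_bounded W K -> sign_bounded W K'.
Proof.
move=> KK [K0 WK]; split=> [|n i x]; first exact: le_trans KK.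
by rewrite (le_trans (WK n i x))// ler_wpM2r ?sign_average_ge0.
Qed.

Lemma sign_bounded_reindex (I I' : Type) (h : I' -> I) (W : I -> V -> V) K :
  sign_bounded W K -> sign_bounded (fun j => W (h j)) K.
Proof. by move=> [K0 WK]; split => // n i x; exact: (WK n (fun j => h (i j)) x). Qed.

(** The factor is a polynomial in the two families with coefficients depending only on [kappa], so
    its bound is uniform as long as [kappa] is fixed. *)
Lemma sign_bounded_kernel_factor (I : Type) (q W : I -> V -> V) K K' (kappa : R[i]) :
  sign_bounded q K -> sign_bounded W K' ->
  exists K'', sign_bounded (fun i => kernel_factor (q i) (W i) kappa) K''.
Proof.
move=> qK WK; have [L sL] : exists L, sign_bounded (fun i => shifted (q i) kappa) L.
  by eexists; apply: sign_boundedD (sign_bounded_id I) (sign_boundedZ _ qK).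
by eexists; apply: sign_boundedZ; do 4! (apply: (sign_bounded_comp sL)); exact: WK.
Qed.

Lemma sign_bounded_opcomp d ks (G : 'I_d -> R -> V -> V) (K : 'I_d -> R) :
  (forall k, sign_bounded (G k) (K k)) ->
  sign_bounded (fun p : 'rV[R[i]^o]_d => opcomp (fun k w => G k (ln (rnorm w))) ks p)
    (\prod_(k <- ks) K k).
Proof.
move=> GK; elim: ks => [|k ks IH]; first by rewrite big_nil; exact: sign_bounded_id.
rewrite big_cons.
have GK' := sign_bounded_reindex (fun p : 'rV[R[i]^o]_d => ln (rnorm (p 0 k))) (GK k).
exact (sign_bounded_comp GK' IH).
Qed.

End SignBoundedFamilies.

Section Commutation.
Context {R : realType} {V : completeNormedModType R[i]}.
Implicit Types (g q W : V -> V).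

Lemma linear_quadratic q : linear q -> linear (quadratic q).
Proof.
move=> lq a x y; rewrite /quadratic !lq.
by apply: cfunctional_inj => c cD cN cZ; rewrite !(cD, cN, cZ); ring.
Qed.

Lemma linear_shifted q kappa : linear q -> linear (shifted q kappa).
Proof.
move=> lq a x y; rewrite /shifted !lq.
by apply: cfunctional_inj => c cD cN cZ; rewrite !(cD, cN, cZ); ring.
Qed.

Lemma linear_kernel_factor q W kappa : linear q -> linear W -> linear (kernel_factor q W kappa).
Proof.
move=> lq lW a x y; rewrite /kernel_factor lW !(linear_shifted _ lq) scalerDr !scalerA.
by rewrite mulrC.
Qed.

Lemma quadratic_commute g q x : linear g -> (forall x, g (q x) = q (g x)) ->
  g (quadratic q x) = quadratic q (g x).
Proof. by move=> lg gq; rewrite /quadratic (linear_predB lg) !gq. Qed.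

Lemma kernel_factor_commute g q W kappa x : linear g -> (forall x, g (q x) = q (g x)) ->
  (forall x, g (W x) = W (g x)) -> g (kernel_factor q W kappa x) = kernel_factor q W kappa (g x).
Proof.
move=> lg gq gW; have gs y : g (shifted q kappa y) = shifted q kappa (g y).
  by rewrite /shifted (linear_predD lg) (linear_predZ lg) gq.
by rewrite /kernel_factor (linear_predZ lg) !gs gW.
Qed.

Lemma opcomp_commute d (G : 'I_d -> R[i] -> V -> V) ks (p : 'rV[R[i]^o]_d) g x :
  (forall k y, k \in ks -> g (G k (p 0 k) y) = G k (p 0 k) (g y)) ->
  g (opcomp G ks p x) = opcomp G ks p (g x).
Proof.
elim: ks => [//|k ks IH] gG /=; rewrite gG ?mem_head// IH// => j y jks.
by apply: gG; rewrite inE jks orbT.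
Qed.

(** Commutation across different coordinates turns a product of sandwiches into a sandwich of
    products, the shape required by the square function estimate. *)
Lemma opcomp_sandwich d (W S M : 'I_d -> R[i] -> V -> V) ks (p : 'rV[R[i]^o]_d) x : uniq ks ->
  (forall k y, k \in ks -> W k (p 0 k) y = S k (p 0 k) (M k (p 0 k) (S k (p 0 k) y))) ->
  (forall j k y, j \in ks -> k \in ks ->
    S j (p 0 j) (S k (p 0 k) y) = S k (p 0 k) (S j (p 0 j) y)) ->
  (forall j k y, j \in ks -> k \in ks -> j != k ->
    S j (p 0 j) (M k (p 0 k) y) = M k (p 0 k) (S j (p 0 j) y)) ->
  opcomp W ks p x = opcomp S ks p (opcomp M ks p (opcomp S ks p x)).
Proof.
elim: ks => [//|k ks IH] /= /andP[kks uks] WE SS SM.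
have tl j : j \in ks -> j \in k :: ks by rewrite inE => ->; rewrite orbT.
have ne j : j \in ks -> j != k by apply: contraTneq => ->.
rewrite WE ?mem_head// IH//; last 3 first.
- by move=> j y /tl; exact: WE.
- by move=> i j y /tl ii /tl; exact: SS.
- by move=> i j y /tl ii /tl; exact: SM.
have hk := mem_head k ks.
have e1 y : S k (p 0 k) (opcomp S ks p y) = opcomp S ks p (S k (p 0 k) y).
  by apply: opcomp_commute => j v jks; exact: SS hk (tl _ jks).
have e2 y : S k (p 0 k) (opcomp M ks p y) = opcomp M ks p (S k (p 0 k) y).
  by apply: opcomp_commute => j v jks; apply: SM hk (tl _ jks) _; rewrite eq_sym ne.
have e3 y : M k (p 0 k) (opcomp S ks p y) = opcomp S ks p (M k (p 0 k) y).
  by apply: opcomp_commute => j v jks; rewrite (SM j k)// ?tl ?ne.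
by rewrite e1 e2 e3.
Qed.

Lemma resolvent_bounded (A : set (V * V)) z : resolvent_set A z ->
  exists2 c, 0 < c & forall x, rnorm (resolvent A z x) <= c * rnorm x.
Proof.
move=> zr; have [zA zl _] := resolventP zr; have [S [cS AS _]] := zr.
have [c c0 Sc] := continuous_linear_bounded cS; exists c => // x.
suff -> : resolvent A z x = S x by [].
by have := zl _ _ (AS x); rewrite opprB addrC subrK.
Qed.

Lemma linear_scaled_resolvent (A : set (V * V)) z : resolvent_set A z ->
  linear (scaled_resolvent A z).
Proof.
by move=> /resolventP[_ _ lR] a x y; rewrite /scaled_resolvent lR scalerDr !scalerA mulrC.
Qed.

End Commutation.

Section GeneratorCommutation.
Context {R : realType} {d : nat} {V : completeNormedModType R[i]}.
Variables (T : 'I_d -> R -> {linear V -> V}) (M : R).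
Hypothesis TM : forall k t x, 0 <= t -> rnorm (T k t x) <= M * rnorm x.
Hypothesis hcomm : commuting_semigroups T.

(** Commutation is passed on in two stages: [T k] preserves the graph of the generator of [T j],
    hence commutes with its resolvent; this resolvent then preserves the graph of the generator of
    [T k], hence commutes with the other resolvent. *)
Lemma generator_resolvents_commute j k z w x :
  resolvent_set (neg_generator (T j)) z -> resolvent_set (neg_generator (T k)) w ->
  scaled_resolvent (neg_generator (T j)) z (scaled_resolvent (neg_generator (T k)) w x) =
  scaled_resolvent (neg_generator (T k)) w (scaled_resolvent (neg_generator (T j)) z x).
Proof.
move=> zr wr; have [_ _ lz] := resolventP zr; have [_ _ lw] := resolventP wr.
have [c _ Rc] := resolvent_bounded zr.
have RT t y : 0 <= t ->
    resolvent (neg_generator (T j)) z (T k t y) = T k t (resolvent (neg_generator (T j)) z y).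
  move=> t0; apply: (resolvent_commute (S := T k t)) => //; first exact: linearP.
  move=> u v; apply: (neg_generator_commute (c := M)) => //; first exact: linearP.
    by move=> u'; exact: TM.
  by move=> s u' s0; rewrite hcomm.
rewrite /scaled_resolvent (linear_predZ lz) (linear_predZ lw).
rewrite (resolvent_commute (S := resolvent (neg_generator (T j)) z))//.
  by rewrite !scalerA mulrC.
by move=> u v; exact: (neg_generator_commute lz Rc RT).
Qed.

End GeneratorCommutation.

(** * The estimate on a single component space *)

Section MainEstimate.
Context {R : realType} {dS : measure_display} {S : measurableType dS}.
Variables (P : probability S R) (r : nat -> {RV P >-> R}) (hr : independent_rademacher r).
Context {d : nat} {V : completeNormedModType R[i]}.
Notation point := 'rV[R[i]^o]_d.
Variables (A : 'I_d -> set (V * V)) (omega theta : 'I_d -> R).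
Hypothesis omega_gt0 : forall k, 0 < omega k.
Hypothesis hspec : forall k, spectrum (A k) `<=` closure (sector (omega k)).
Hypothesis hR : forall k t, omega k < t < pi -> R_bounded r
  [set W : V -> V | exists2 z, ~ closure (sector t) z & W = fun x => z *: resolvent (A k) z x].
Hypothesis theta_int : forall k, omega k < theta k < pi / 2.
Hypothesis hcomm : forall j k z w x, resolvent_set (A j) z -> resolvent_set (A k) w ->
  scaled_resolvent (A j) z (scaled_resolvent (A k) w x) =
  scaled_resolvent (A k) w (scaled_resolvent (A j) z x).

Let nu0 k := kernel_angle (omega k) (theta k).

Let theta_lt_pi k : omega k < theta k < pi.
Proof. by have := pi_gt0 R; move/andP: (theta_int k) => [-> ?] ?; rewrite /=; lra. Qed.

Let mid_lt_pi k : omega k < (omega k + theta k) / 2 < pi.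
Proof. by move/andP: (theta_lt_pi k) => [? ?]; apply/andP; split; lra. Qed.

Let hbound k t : omega k < t < pi -> exists C : R,
  forall z, ~ closure (sector t) z -> forall x, rnorm (z *: resolvent (A k) z x) <= C * rnorm x.
Proof.
by move=> /hR /(R_bounded_norm hr)[C HC]; exists C => z zt; apply: (HC (fun x => _)); exists z.
Qed.

Let outside_resolvent k t z : omega k < t -> ~ closure (sector t) z -> resolvent_set (A k) z.
Proof.
move=> ot zt; apply: contrapT => zr; apply: zt; have := hspec zr.
by apply: closure_subset => w; apply: sector_le; exact: ltW.
Qed.

Let resolvent_ray k u b : resolvent_set (A k) (polar u (ray (nu0 k) b)) /\
  resolvent_set (A k) (- polar u (ray (nu0 k) b)).
Proof.
have [D1 D2] := kernel_ray_outside (omega_gt0 k) (theta_int k) u b.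
by split; [apply: outside_resolvent D1; case/andP: (mid_lt_pi k)|
           apply: outside_resolvent D2; case/andP: (theta_lt_pi k)].
Qed.

Let resolvent_axis k u : resolvent_set (A k) (- polar u 0).
Proof.
have /andP[t1 t2] := theta_lt_pi k.
apply: (outside_resolvent t1); apply: closure_sector_opp.
  by rewrite (lt_trans (omega_gt0 k) t1).
by rewrite normr0 subr_gt0.
Qed.

Let middle (b : 'I_d -> bool) k (v : R) :=
  kernel_middle (A k) (ray (nu0 k) (b k)) (polar v (ray (nu0 k) (b k))).

(** On each ray the middle factor is a fixed polynomial in the scaled resolvents at z and - z, both
    taken from R-bounded sets since these points stay off the corresponding sectors; [kappa] depends
    on the ray only. The maximum covers both rays. *)
Let sign_bounded_middle k : exists K, forall b, sign_bounded (middle b k) K.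
Proof.
have H c : exists K, sign_bounded (fun v : R =>
    kernel_middle (A k) (ray (nu0 k) c) (polar v (ray (nu0 k) c))) K.
  have D v := kernel_ray_outside (omega_gt0 k) (theta_int k) v c.
  have [K1 H1] := R_bounded_sign_bounded hr (hR (mid_lt_pi k))
    (W := fun v => scaled_resolvent (A k) (polar v (ray (nu0 k) c)))
    (fun v => ex_intro2 _ _ (polar v (ray (nu0 k) c)) (D v).1 erefl).
  have [K2 H2] := R_bounded_sign_bounded hr (hR (theta_lt_pi k))
    (W := fun v => scaled_resolvent (A k) (- polar v (ray (nu0 k) c)))
    (fun v => ex_intro2 _ _ (- polar v (ray (nu0 k) c)) (D v).2 erefl).
  exact (sign_bounded_kernel_factor _ H2 H1).
have [K1 H1] := H true; have [K2 H2] := H false.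
exists (Num.max K1 K2) => b; rewrite /middle; case: (b k).
  by apply: sign_bounded_le H1; rewrite le_max lexx.
by apply: sign_bounded_le H2; rewrite le_max lexx orbT.
Qed.

Let middle_commute j k b v w x : square_function (A j) v (middle b k w x) =
  middle b k w (square_function (A j) v x).
Proof.
have [r1 r2] := resolvent_ray k w (b k).
symmetry; apply: quadratic_commute.
  exact: linear_kernel_factor (linear_scaled_resolvent r2) (linear_scaled_resolvent r1).
move=> y; symmetry; apply: kernel_factor_commute.
- exact: linear_scaled_resolvent.
- by move=> y'; exact: hcomm.
- by move=> y'; exact: hcomm.
Qed.

Let square_function_comm j k v w x : square_function (A j) v (square_function (A k) w x) =
  square_function (A k) w (square_function (A j) v x).
Proof.
apply: quadratic_commute; first exact: linear_quadratic (linear_scaled_resolvent _).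
move=> y; symmetry; apply: quadratic_commute; first exact: linear_scaled_resolvent.
by move=> y'; exact: hcomm.
Qed.

Lemma kernel_sandwich b ks (p : point) x : uniq ks ->
  (forall k, k \in ks -> exists u, p 0 k = polar u (ray (nu0 k) (b k))) ->
  opcomp (fun k => kernel (A k)) ks p x =
  square_product A ks p (opcomp (fun k w => middle b k (ln (rnorm w))) ks p
    (square_product A ks p x)).
Proof.
move=> uks pks; apply: opcomp_sandwich => //.
move=> k y /pks[u ->]; rewrite rnorm_polar expRK.
exact: (kernelE (omega_gt0 k) (@hspec k) (theta_int k) u (b k) y).
Qed.

Lemma shell_pointsP nu N t b ks (z p : point) : p \in shell_points nu N t b ks z -> forall k,
  (k \in ks -> exists u, p 0 k = polar u (ray (nu k) (b k))) /\ (k \notin ks -> p 0 k = z 0 k).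
Proof.
elim: ks z => [z|j ks IH z] /=; first by rewrite inE => /eqP ->.
move=> /flattenP[s /mapP[i _ ->] /IH H] k; have [H1 H2] := H k; rewrite inE.
have [kks|kks] := boolP (k \in ks); first by rewrite orbT; split=> // _; exact: H1.
have := H2 kks; rewrite set_coordE orbF.
by case: eqP => [->|kj] E; split => // _; exists (- (N j)%:R + i%:R + t j).
Qed.

Variables (Lambda : {set 'I_d}) (eta : 'I_d -> R) (Ka : R).
Hypotheses (Ka0 : 0 <= Ka) (etaP : forall k, 0 < eta k < pi).
Hypothesis hG : forall n (c : nat -> R[i]) (p : nat -> point) (beta Cs : R) y,
  0 <= beta -> (forall j, (j < n)%N -> rnorm (c j) <= beta) ->
  (forall z, polysector eta z ->
    \sum_(j < n) rnorm (test_symbol (enum Lambda) (p j) z) <= Cs) ->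
  rnorm (\sum_(j < n) c j *: square_product A (enum Lambda) (p j) y) <=
    Ka * (beta * Cs) * rnorm y.

(** The constant involves neither [f] nor [nu]: the contour is moved to the fixed angles [nu0]
    before anything is estimated. The bound [alpha] of f is kept apart from a supremum, because the
    lemma is applied to components of a function. *)
Lemma fcalc_bound : exists2 C : R, 0 <= C & forall (f : point -> R[i]^o) alpha nu x,
  Hinf0 theta Lambda f -> 0 <= alpha ->
  (forall z, polysector theta z -> rnorm (f z) <= alpha) ->
  (forall k, omega k < nu k < theta k) ->
  rnorm (fcalc A nu Lambda f x) <= C * alpha * rnorm x.
Proof.
have /choice[K HK] := sign_bounded_middle.
set ks := enum Lambda; have uks : uniq ks := enum_uniq _.
(* This bounds the sum of the moduli of the test symbols over any grid, independently of the number
   of shells; with [hG] it makes [K1] the constant of the square functions. *)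
pose Cs := \prod_(k <- ks) shell_bound (eta k).
have Cs0 : 0 <= Cs.
  apply: prodr_ge0 => k _; apply: divr_ge0; first by rewrite invr_ge0 sqr_ge0.
  by rewrite subr_ge0 -[leRHS]expR0 ler_expR lerN10.
pose K1 := Ka * Cs; pose K2 := \prod_(k <- ks) K k.
pose Z := ((2 * pi)%:C * 'i)^-1 ^+ #|Lambda| : R[i].
exists (rnorm Z * (2 ^+ size ks * (K1 ^+ 2 * Num.sqrt K2))).
  by rewrite mulr_ge0 ?rnorm_ge0// mulr_ge0 ?exprn_ge0// mulr_ge0 ?sqrtr_ge0 ?sqr_ge0.
move=> f alpha nu x fH a0 fa nuP.
have th0 k : 0 < theta k by have /andP[+ _] := theta_lt_pi k; apply: lt_trans.
have thp k : theta k <= pi by have /andP[_ /ltW] := theta_lt_pi k.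
have nu_theta k : 0 < nu k < theta k.
  by have /andP[n1 ->] := nuP k; rewrite (lt_trans (omega_gt0 k) n1).
have nu0_int k := kernel_angle_itv (theta_int k).
have nu0_theta k : 0 < nu0 k < theta k.
  by have /andP[n1 n2] := nu0_int k; rewrite n2 (lt_trans (omega_gt0 k) n1).
have cR mu' : (forall k, omega k < mu' k < theta k) ->
    contour_bounded mu' (fun k => scaled_resolvent (A k)).
  move=> muP k b; exact (ray_bounded_scaled_resolvent (omega_gt0 k) (@hspec k) (@hbound k)
    (theta_int k) b (muP k)).
have cK : contour_bounded nu0 (fun k => kernel (A k)).
  move=> k b; exact (ray_bounded_kernel (omega_gt0 k) (@hspec k) (@hbound k) (theta_int k) b).
have z1 : polysector theta (const_mx 1 : point).
  by apply: polysector1 => k; rewrite th0 thp.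
have [C [s hc]] := Hinf0_sector_decaying fH.
have E1 : log_integral nu ks (fun z => f z *: opcomp (fun k => scaled_resolvent (A k)) ks z x) (const_mx 1) =
    log_integral nu0 ks (fun z => f z *: opcomp (fun k => scaled_resolvent (A k)) ks z x) (const_mx 1).
  refine (log_integral_exchange x uks nu_theta nu0_theta thp z1 hc (cR _ nuP) (cR _ nu0_int) _).
  move=> k; exact (kernel_exchange_angle (omega_gt0 k) (@hspec k) (@hbound k) (theta_int k)
    (nuP k) (nu0_int k)).
have E2 : log_integral nu0 ks (fun z => f z *: opcomp (fun k => scaled_resolvent (A k)) ks z x) (const_mx 1) =
    log_integral nu0 ks (fun z => f z *: opcomp (fun k => kernel (A k)) ks z x) (const_mx 1).
  refine (log_integral_exchange x uks nu0_theta nu0_theta thp z1 hc (cR _ nu0_int) cK _).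
  move=> k; exact (kernel_exchange (omega_gt0 k) (@hspec k) (@hbound k) (theta_int k)).
rewrite (fcalcE x fH nu_theta thp (cR _ nuP)) -/ks -/Z rnormZ E1 E2.
set K3 := K1 ^+ 2 * Num.sqrt K2.
rewrite [leRHS](_ : _ = rnorm Z * (2 ^+ size ks * (K3 * alpha * rnorm x))); last by rewrite !mulrA.
rewrite ler_wpM2l ?rnorm_ge0//.
have [C' nH] := nice_opcomp x uks nu0_theta thp z1 hc cK.
apply: (rnorm_log_integral_shells uks nH) => N t b t01.
set sp := shell_points _ _ _ _ _ _.
have spP p : p \in sp -> forall k, k \in ks -> exists u, p 0 k = polar u (ray (nu0 k) (b k)).
  by move=> /shell_pointsP pP k; have [] := pP k.
have spt p : p \in sp -> polysector theta p.
  move=> /shell_pointsP pP k; have [H1 H2] := pP k.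
  have [kks|kks] := boolP (k \in ks); last by rewrite H2//; exact: z1.
  by have [u ->] := H1 kks; apply: sector_polar => //; exact: ray_lt.
rewrite (big_nth (const_mx 1)) big_mkord.
pose p j := nth (const_mx 1) sp j.
have pin j : (j < size sp)%N -> p j \in sp by exact: mem_nth.
(* At every grid point the kernel is written as middle factor between two square functions, so that
   the values of f become the coefficients of the square function estimate. *)
rewrite (eq_bigr (fun j : 'I_(size sp) => f (p j) *: square_product A ks (p j)
    (opcomp (fun k w => middle b k (ln (rnorm w))) ks (p j) (square_product A ks (p j) x)))); last first.
  move=> j _; congr (_ *: _); apply: kernel_sandwich => //; apply: spP; exact: pin.
have lS j : linear (square_product A ks (p j)).
  apply: linear_opcomp => k _; apply: linear_quadratic; exact: linear_scaled_resolvent.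
have MK := sign_bounded_opcomp ks (fun k => HK k b).
have Gb beta (c : nat -> R[i]) v : (forall j, (j < size sp)%N -> rnorm (c j) <= beta) ->
    0 <= beta ->
    rnorm (\sum_(j < size sp) c j *: square_product A ks (p j) v) <= K1 * beta * rnorm v.
  move=> cb b0; rewrite /K1 -(mulrA Ka) (mulrC Cs); apply: hG => // z zt.
  have := @test_symbol_shells R d eta nu0 N t b ks (const_mx 1) z.
  move=> /(_ _ uks zt) H; apply: le_trans (H _); last by move=> k; have /andP[/ltW -> ->] := etaP k.
  by rewrite [leRHS](big_nth (const_mx 1)) big_mkord.
exact (@square_function_estimate R V (size sp) point p (fun j => f (p j))
  (fun j => square_product A ks (p j)) _ alpha K1 K2 x (mulr_ge0 Ka0 Cs0) a0 MK lS
  (fun j jn => fa _ (spt _ (pin j jn))) Gb).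
Qed.

End MainEstimate.

Lemma uniform_bound {R : realType} {V : completeNormedModType R[i]} d (T : 'I_d -> R -> V -> V) :
  (forall k, exists M : R, forall t x, 0 <= t -> rnorm (T k t x) <= M * rnorm x) ->
  exists2 M : R, 0 <= M & forall k t x, 0 <= t -> rnorm (T k t x) <= M * rnorm x.
Proof.
move=> /choice[M TM]; exists (\sum_k `|M k|) => [|k t x t0]; first exact: sumr_ge0.
rewrite (le_trans (TM k t x t0))// ler_wpM2r ?rnorm_ge0// (bigD1 k)//=.
by rewrite (le_trans (ler_norm _))// lerDl sumr_ge0.
Qed.

Lemma C0_group_semigroup {R : realType} {V : completeNormedModType R[i]}
    (U : R -> {linear V -> V}) : bounded_C0_group U -> C0_semigroup U.
Proof.
move=> [cU U0 UD Uc _]; split => // x.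
exact: cvg_within_filter (Uc x).
Qed.

Theorem theorem5p5
  (R : realType)
  (dS : measure_display) (S : measurableType dS) (P : probability S R)
  (r : nat -> {RV P >-> R}) (hr : independent_rademacher r)
  (X : completeNormedModType R[i]) (d : nat) (hd : (1 <= d)%N)
  (T : 'I_d -> R -> {linear X -> X})
  (hT : forall k, bounded_analytic_semigroup (T k))
  (hTcomm : commuting_semigroups T)
  (omega : 'I_d -> R) (homega : forall k, omega k < pi / 2)
  (hA : forall k, R_sectorial_of_type r (omega k) (neg_generator (T k)))
  (Y : completeNormedModType R[i])
  (J : {linear X -> Y}) (hJ : continuous J)
  (Q : {linear Y -> X}) (hQ : continuous Q)
  (U : 'I_d -> R -> {linear Y -> Y})
  (hU : forall k, bounded_C0_group (U k))
  (hUcomm : commuting_groups U)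
  (theta : 'I_d -> R) (htheta : forall k, pi / 2 <= theta k < pi)
  (ha : admits_Hinf_limit (fun k => neg_generator (U k)) (fun=> pi / 2) theta)
  (hb : forall t : 'I_d -> R, (forall k, 0 <= t k) ->
     forall x, compose_all xpredT (fun k => T k (t k)) x =
               Q (compose_all xpredT (fun k => U k (t k)) (J x))) :
  forall theta' : 'I_d -> R,
    (forall k, omega k < theta' k < pi / 2) ->
    admits_Hinf (fun k => neg_generator (T k)) omega theta'.
Proof.
move=> theta' theta'P; have pi0 := pi_gt0 R.
have [K [K0 HK]] := ha.
(* Where [theta k] is the limit angle pi / 2, any angle of the open interval from pi / 2 to pi may
   be substituted; 3 pi / 4 is one choice. *)
pose eta k := if theta k == pi / 2 then 3 * pi / 4 else theta k.
have etaP k : pi / 2 < eta k < pi.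
  have /andP[t1 t2] := htheta k; rewrite /eta; case: eqP => [_|/eqP tn].
    by apply/andP; split; lra.
  by rewrite lt_neqAle eq_sym tn t1 t2.
have hB : Hinf_estimate (fun k => neg_generator (U k)) (fun=> pi / 2) eta K.
  apply: HK => k; first by move=> /eqP tk; have := etaP k; rewrite /eta tk.
  by rewrite /eta; case: eqP => [->|//]; rewrite ltxx.
have [cJ cJ0 JM] := continuous_linear_bounded hJ.
have [cQ cQ0 QM] := continuous_linear_bounded hQ.
have hT0 k : C0_semigroup (T k) by have [[]] := hT k.
have hU0 k : C0_semigroup (U k) := C0_group_semigroup (hU k).
have [MT MT0 TM] : exists2 M : R, 0 <= M &
    forall k t x, 0 <= t -> rnorm (T k t x) <= M * rnorm x.
  by apply: (uniform_bound (T := fun k t => T k t)) => k; have [[]] := hT k.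
have [MU MU0 UM] : exists2 M : R, 0 <= M &
    forall k t x, 0 <= t -> rnorm (U k t x) <= M * rnorm x.
  apply: (uniform_bound (T := fun k t => U k t)) => k.
  by have [_ _ _ _ [M UM]] := hU k; exists M => t x _; exact: UM.
have hUc : commuting_semigroups U by move=> i j s t x _ _; exact: hUcomm.
pose A k := neg_generator (T k).
have omega_gt0 k : 0 < omega k by have [/andP[]] := hA k.
have hspec k : spectrum (A k) `<=` closure (sector (omega k)) by have [] := hA k.
have hR k t : omega k < t < pi -> R_bounded r
    [set W : X -> X | exists2 z, ~ closure (sector t) z & W = fun x => z *: resolvent (A k) z x].
  by have [_ _ _ H] := hA k => kt; exact (H t kt).
have hcomm j k z w x := @generator_resolvents_commute R d X T MT TM hTcomm j k z w x.
have eta1 : polysector eta (const_mx 1 : 'rV[R[i]^o]_d).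
  by apply: polysector1 => k; have /andP[? ?] := etaP k; apply/andP; split; lra.
have hG (Lambda : {set 'I_d}) n (c : nat -> R[i]) (p : nat -> 'rV[R[i]^o]_d) (beta Cs : R) y :
    0 <= beta -> (forall j, (j < n)%N -> rnorm (c j) <= beta) ->
    (forall z, polysector eta z ->
      \sum_(j < n) rnorm (test_symbol (enum Lambda) (p j) z) <= Cs) ->
    rnorm (\sum_(j < n) c j *: square_product A (enum Lambda) (p j) y) <=
      cQ * K * cJ * (beta * Cs) * rnorm y.
  move=> b0 cb HCs.
  have Cs0 : 0 <= Cs.
    by apply: le_trans (HCs _ eta1); apply: sumr_ge0 => j _; exact: rnorm_ge0.
  (* Transfer to [Y]: the sum of square functions of the [A_k] is compressed from that of the
     groups, whence the constants of [Q] and [J] on both sides of [K]. *)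
  have -> : \sum_(j < n) c j *: square_product A (enum Lambda) (p j) y =
      Q (\sum_(j < n) c j *: square_product (fun k => neg_generator (U k)) (enum Lambda) (p j) (J y)).
    rewrite linear_sum; apply: eq_bigr => j _; rewrite linearZ/=; congr (_ *: _).
    exact: (square_product_transfer hT0 MT0 TM hTcomm hU0 MU0 UM hUc QM hb).
  have B := square_product_bound hU0 MU0 UM etaP (ltW K0) hB (J y) b0 cb HCs.
  rewrite (le_trans (QM _))// -!(mulrA cQ) ler_wpM2l ?(ltW cQ0)//.
  rewrite (le_trans B)// -!(mulrA K) ler_wpM2l ?(ltW K0)//.
  rewrite -(mulrA cJ) [leRHS]mulrCA ler_wpM2l ?mulr_ge0//; exact: JM.
have Ka0 : 0 <= cQ * K * cJ by rewrite !mulr_ge0 ?ltW.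
have etaP' k : 0 < eta k < pi by have /andP[? ?] := etaP k; apply/andP; split; lra.
have /choice[C HC] : forall Lambda : {set 'I_d}, exists C : R, 0 <= C /\
    forall (f : 'rV[R[i]^o]_d -> R[i]^o) alpha nu x,
    Hinf0 theta' Lambda f -> 0 <= alpha ->
    (forall z, polysector theta' z -> rnorm (f z) <= alpha) ->
    (forall k, omega k < nu k < theta' k) ->
    rnorm (fcalc A nu Lambda f x) <= C * alpha * rnorm x.
  move=> Lambda; have [C C0 H] := fcalc_bound hr omega_gt0 hspec hR theta'P hcomm Ka0 etaP' (hG Lambda).
  by exists C.
have [c c0 Hc] := @component_bound R d.
have theta'pi k : 0 < theta' k <= pi.
  have /andP[? ?] := theta'P k; have ? := omega_gt0 k; apply/andP; split; lra.
have theta'1 : polysector theta' (const_mx 1 : 'rV[R[i]^o]_d) by exact: polysector1.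
(* [C Lambda] bounds the calculus on the component space and [c] the component by the supremum of f;
   the summand 1 makes the constant positive. *)
exists (1 + \sum_(Lambda : {set 'I_d}) C Lambda * c); split.
  rewrite ltr_pwDl ?ltr01// sumr_ge0// => Lambda _.
  by rewrite mulr_ge0//; have [] := HC Lambda.
move=> f F nu fF nuP x.
have S0 : 0 <= supnorm theta' f := le_trans (rnorm_ge0 _) (le_supnorm fF theta'1).
have bd (Lambda : {set 'I_d}) :
    rnorm (fcalc A nu Lambda (F Lambda) x) <= C Lambda * c * (supnorm theta' f * rnorm x).
  have [C0 H] := HC Lambda; rewrite !mulrA -(mulrA (C Lambda)).
  apply: H => //; [by have [] := fF|exact: mulr_ge0|].
  by move=> z zt; apply: Hc => // k; have /andP[] := theta'pi k.
rewrite (le_trans (ler_rnorm_sum _ _ _))// (le_trans (ler_sum _ (fun L _ => bd L)))//.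
rewrite -mulr_suml -mulrA ler_wpM2r ?mulr_ge0 ?rnorm_ge0//.
by rewrite lerDr ler01.
Qed.
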